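(* Let $M\subset\mathbb{R}^3$ be a quasiperiodic, immersed minimal surface of Riemann type. Then the linear space of bounded Jacobi functions on $M$ is finite dimensional.
   Context: Here $i=\sqrt{-1}$ and $\mathbb{C}/\langle i\rangle$ is the cylinder with conformal coordinate $z$. A meromorphic function $g\colon\mathbb{C}/\langle i\rangle\to\mathbb{C}\cup\{\infty\}$ is quasiperiodic if: (1) there is $C>0$ such that any two distinct points of $g^{-1}(\{0,\infty\})$ are at distance at least $C$, and for every $p\in g^{-1}(\{0,\infty\})$ there is at least one point of $g^{-1}(\{0,\infty\})-\{p\}$ at distance less than $1/C$ from $p$; (2) for every divergent sequence $\{z_k\}_k\subset\mathbb{C}/\langle i\rangle$, a subsequence of $g_k(z)=g(z+z_k)$ converges uniformly on compact subsets of $\mathbb{C}/\langle i\rangle$ to a non-constant meromorphic function. $\mathcal{W}$ is the set of quasiperiodic meromorphic functions $g$ on $\mathbb{C}/\langle i\rangle$ whose divisor of zeros and poles has the form $(g)=\prod_{j\in\mathbb{Z}}p_j^2q_j^{-2}$ (double zeros at the $p_j$ and double poles at the $q_j$). $\mathcal{M}_{\mathrm{imm}}\subset\mathcal{W}$ is the set of $g\in\mathcal{W}$ with $\mathrm{Res}_{p_j}(dz/g)=0$ and $\mathrm{Res}_{q_j}(g\,dz)=0$ for all $j$, and $\overline{\int_\gamma g\,dz}=\int_\gamma\frac{dz}{g}$, where $\gamma$ is a closed curve avoiding $g^{-1}(\{0,\infty\})$ that represents the generator $\{is\mid s\in[0,1]\}$ of the homology of $\mathbb{C}/\langle i\rangle$.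 A quasiperiodic, immersed minimal surface of Riemann type is a minimal surface $M\subset\mathbb{R}^3$ that admits a Weierstrass pair $(g,dz)$ on $(\mathbb{C}/\langle i\rangle)-g^{-1}(\{0,\infty\})$ with $g\in\mathcal{M}_{\mathrm{imm}}$, i.e. $M$ is parametrized, up to translation, by $$X(p)=\Re\int_{p_0}^p\left(\tfrac12\left(\tfrac1g-g\right),\tfrac i2\left(\tfrac1g+g\right),1\right)dz.$$ A Jacobi function on $M$ is a function $v\colon M\to\mathbb{R}$ with $\Delta v-2Kv=0$, where $\Delta$ is the Laplacian and $K$ the Gaussian curvature of the metric induced on $M$ by $\mathbb{R}^3$; in the coordinate $z$ this reads $v_{z\overline z}+2\frac{|g'|^2}{(1+|g|^2)^2}v=0$ on $(\mathbb{C}/\langle i\rangle)-g^{-1}(\{0,\infty\})$. *)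

(* Defs.v *)
From Stdlib Require Import Reals ZArith List.
From Coquelicot Require Import Coquelicot.
Open Scope R_scope.

(** Points of C/<i> are represented by complex numbers modulo [cyl_eq], and
    maps on (an open subset of) C/<i> by i-periodic maps on C. *)

Definition cyl_eq (z w : C) : Prop := exists n : Z, z = (w + IZR n * Ci)%C.

Definition cyl_dist (z w : C) : R :=
  real (Glb_Rbar (fun d => exists n : Z, d = Cmod (z - w - IZR n * Ci))).

(** A subset of C/<i> is relatively compact iff Re is bounded on it, so this
    says that the sequence leaves every compact set. *)
Definition cyl_divergent (z : nat -> C) : Prop :=
  is_lim_seq (fun k => Rabs (Re (z k))) p_infty.

Inductive sphere : Type :=
| Fin (c : C)
| Infty.

(** The value at [Infty] is a dummy. *)
Definition toC (s : sphere) : C :=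
  match s with Fin c => c | Infty => 0%C end.

Definition sph_inv (s : sphere) : sphere :=
  match s with
  | Fin c => if Ceq_dec c 0 then Infty else Fin (/ c)
  | Infty => Fin 0
  end.

Definition chordal (s t : sphere) : R :=
  match s, t with
  | Fin z, Fin w =>
      2 * Cmod (z - w) / (sqrt (1 + Cmod z ^ 2) * sqrt (1 + Cmod w ^ 2))
  | Fin z, Infty | Infty, Fin z => 2 / sqrt (1 + Cmod z ^ 2)
  | Infty, Infty => 0
  end.

Definition holomorphic_at (f : C -> C) (z : C) : Prop :=
  locally z (fun w => ex_derive (K := C_AbsRing) (V := C_NormedModule) f w).

Definition finite_holomorphic_at (g : C -> sphere) (z : C) : Prop :=
  locally z (fun w => g w <> Infty) /\ holomorphic_at (fun w => toC (g w)) z.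

Definition meromorphic_cyl (g : C -> sphere) : Prop :=
  (forall z, g (z + Ci)%C = g z) /\
  (forall z, finite_holomorphic_at g z \/
             finite_holomorphic_at (fun w => sph_inv (g w)) z) /\
  (exists z, g z <> Infty).

Definition nonconstant (g : C -> sphere) : Prop := exists z w, g z <> g w.

Definition zero_of_order (n : nat) (g : C -> sphere) (p : C) : Prop :=
  exists h : C -> C,
    holomorphic_at h p /\ h p <> 0%C /\
    locally p (fun z => g z = Fin (Cpow (z - p) n * h z)).

Definition pole_of_order (n : nat) (g : C -> sphere) (p : C) : Prop :=
  zero_of_order n (fun z => sph_inv (g z)) p.

Definition zero_or_pole (g : C -> sphere) (z : C) : Prop :=
  g z = Fin 0 \/ g z = Infty.

Definition regular (g : C -> sphere) (z : C) : Prop := ~ zero_or_pole g z.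

Definition uniformly_spread (g : C -> sphere) : Prop :=
  exists c : R, 0 < c /\
    (forall p q, zero_or_pole g p -> zero_or_pole g q -> ~ cyl_eq p q ->
       c <= cyl_dist p q) /\
    (forall p, zero_or_pole g p ->
       exists q, zero_or_pole g q /\ ~ cyl_eq p q /\ cyl_dist p q < 1 / c).

(** Uniform convergence, for the spherical metric, on the compact exhaustion
    |Re z| <= r of C/<i>. *)
Definition cvg_compact_cyl (f : nat -> C -> sphere) (h : C -> sphere) : Prop :=
  forall r eps : R, 0 < eps ->
    exists N : nat, forall k : nat, (N <= k)%nat ->
      forall z, Rabs (Re z) <= r -> chordal (f k z) (h z) < eps.

Definition quasiperiodic (g : C -> sphere) : Prop :=
  meromorphic_cyl g /\
  uniformly_spread g /\
  (forall z_ : nat -> C, cyl_divergent z_ ->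
     exists (s : nat -> nat) (h : C -> sphere),
       (forall k, (s k < s (S k))%nat) /\
       meromorphic_cyl h /\ nonconstant h /\
       cvg_compact_cyl (fun k z => g (z + z_ (s k))%C) h).

(** The divisor of zeros and poles is prod_(j in Z) p_j^2 q_j^(-2). *)
Definition double_divisor (g : C -> sphere) : Prop :=
  exists p q : Z -> C,
    (forall j k, cyl_eq (p j) (p k) -> j = k) /\
    (forall j k, cyl_eq (q j) (q k) -> j = k) /\
    (forall z, g z = Fin 0 <-> exists j, cyl_eq z (p j)) /\
    (forall z, g z = Infty <-> exists j, cyl_eq z (q j)) /\
    (forall j, zero_of_order 2 g (p j)) /\
    (forall j, pole_of_order 2 g (q j)).

Definition in_W (g : C -> sphere) : Prop := quasiperiodic g /\ double_divisor g.

Definition path_deriv (gamma : R -> C) (t : R) : C :=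
  (Derive (fun s => Re (gamma s)) t, Derive (fun s => Im (gamma s)) t).

Definition C1_path (gamma : R -> C) : Prop :=
  forall t, 0 <= t <= 1 ->
    ex_derive (fun s => Re (gamma s)) t /\
    ex_derive (fun s => Im (gamma s)) t /\
    continuous (path_deriv gamma) t.

Definition path_in (U : C -> Prop) (gamma : R -> C) : Prop :=
  forall t, 0 <= t <= 1 -> U (gamma t).

Definition line_int (f : C -> C) (gamma : R -> C) : C :=
  RInt (V := C_R_CompleteNormedModule)
    (fun t => (f (gamma t) * path_deriv gamma t)%C) 0 1.

Definition circle (p : C) (r : R) (t : R) : C :=
  Cplus p (r * cos (2 * PI * t), r * sin (2 * PI * t)).

(** [rho] is the residue at [p] of [f dz], for [f] holomorphic on a punctured
    neighbourhood of [p]. *)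
Definition is_residue (f : C -> C) (p rho : C) : Prop :=
  exists r0 : R, 0 < r0 /\
    forall r, 0 < r < r0 -> (line_int f (circle p r) = 2 * PI * Ci * rho)%C.

(** The closed curve in C/<i> is given by its lift [gamma] to C: it represents
    the generator {is | 0 <= s <= 1} iff [gamma 1 = gamma 0 + i].  Its choice is
    irrelevant because all residues vanish. *)
Definition M_imm (g : C -> sphere) : Prop :=
  in_W g /\
  (forall p, g p = Fin 0 -> is_residue (fun z => / toC (g z))%C p 0) /\
  (forall q, g q = Infty -> is_residue (fun z => toC (g z)) q 0) /\
  (exists gamma : R -> C,
     C1_path gamma /\ path_in (regular g) gamma /\
     gamma 1 = (gamma 0 + Ci)%C /\
     Cconj (line_int (fun z => toC (g z)) gamma) =
     line_int (fun z => / toC (g z))%C gamma).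

Definition R3 : Type := (R * R * R)%type.

Definition c1 (u : R3) : R := fst (fst u).
Definition c2 (u : R3) : R := snd (fst u).
Definition c3 (u : R3) : R := snd u.

Definition dot (u v : R3) : R := c1 u * c1 v + c2 u * c2 v + c3 u * c3 v.

Definition pdx (f : C -> R) (z : C) : R := Derive (fun t => f (t, Im z)) (Re z).
Definition pdy (f : C -> R) (z : C) : R := Derive (fun t => f (Re z, t)) (Im z).

Definition pdx3 (X : C -> R3) (z : C) : R3 :=
  (pdx (fun w => c1 (X w)) z, pdx (fun w => c2 (X w)) z, pdx (fun w => c3 (X w)) z).
Definition pdy3 (X : C -> R3) (z : C) : R3 :=
  (pdy (fun w => c1 (X w)) z, pdy (fun w => c2 (X w)) z, pdy (fun w => c3 (X w)) z).

Fixpoint class_Ck (k : nat) (U : C -> Prop) (f : C -> R) : Prop :=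
  match k with
  | O => forall z, U z -> continuous f z
  | S k' =>
      (forall z, U z ->
         continuous f z /\
         ex_derive (fun t => f (t, Im z)) (Re z) /\
         ex_derive (fun t => f (Re z, t)) (Im z)) /\
      class_Ck k' U (pdx f) /\ class_Ck k' U (pdy f)
  end.

(** First fundamental form E dx^2 + 2 F dx dy + G dy^2 of [X], i.e. the metric
    induced by R^3, in the coordinate z = x + i y. *)
Definition EE (X : C -> R3) (z : C) : R := dot (pdx3 X z) (pdx3 X z).
Definition FF (X : C -> R3) (z : C) : R := dot (pdx3 X z) (pdy3 X z).
Definition GG (X : C -> R3) (z : C) : R := dot (pdy3 X z) (pdy3 X z).

Definition area_density (X : C -> R3) (z : C) : R :=
  sqrt (EE X z * GG X z - FF X z ^ 2).

(** Laplace-Beltrami operator of the induced metric. *)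
Definition laplacian (X : C -> R3) (v : C -> R) (z : C) : R :=
  / area_density X z *
  (pdx (fun w => (GG X w * pdx v w - FF X w * pdy v w) / area_density X w) z +
   pdy (fun w => (EE X w * pdy v w - FF X w * pdx v w) / area_density X w) z).

Definition det3 (a1 a2 a3 b1 b2 b3 d1 d2 d3 : R) : R :=
  a1 * (b2 * d3 - b3 * d2) - a2 * (b1 * d3 - b3 * d1) + a3 * (b1 * d2 - b2 * d1).

(** Gaussian curvature of the induced metric, by Brioschi's formula. *)
Definition gauss_curvature (X : C -> R3) (z : C) : R :=
  let E := EE X in let F := FF X in let G := GG X in
  (det3
     (- / 2 * pdy (pdy E) z + pdy (pdx F) z - / 2 * pdx (pdx G) z)
     (/ 2 * pdx E z)
     (pdx F z - / 2 * pdy E z)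
     (pdy F z - / 2 * pdx G z) (E z) (F z)
     (/ 2 * pdy G z)          (F z) (G z) -
   det3
     0              (/ 2 * pdy E z) (/ 2 * pdx G z)
     (/ 2 * pdy E z) (E z)          (F z)
     (/ 2 * pdx G z) (F z)          (G z))
  / (E z * G z - F z ^ 2) ^ 2.

Definition weierstrass1 (g : C -> sphere) (z : C) : C :=
  (/ 2 * (/ toC (g z) - toC (g z)))%C.
Definition weierstrass2 (g : C -> sphere) (z : C) : C :=
  (Ci / 2 * (/ toC (g z) + toC (g z)))%C.
Definition weierstrass3 (_ : C) : C := 1%C.

(** [X] parametrizes the surface with Weierstrass pair (g, dz), up to
    translation; the additive constant is fixed by [X] at one point. *)
Definition weierstrass_param (g : C -> sphere) (X : C -> R3) : Prop :=
  (forall z, regular g z -> X (z + Ci)%C = X z) /\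
  (forall gamma, C1_path gamma -> path_in (regular g) gamma ->
     c1 (X (gamma 1)) = c1 (X (gamma 0)) + Re (line_int (weierstrass1 g) gamma) /\
     c2 (X (gamma 1)) = c2 (X (gamma 0)) + Re (line_int (weierstrass2 g) gamma) /\
     c3 (X (gamma 1)) = c3 (X (gamma 0)) + Re (line_int weierstrass3 gamma)).

Definition qp_immersed_Riemann_type (g : C -> sphere) (X : C -> R3) : Prop :=
  M_imm g /\ weierstrass_param g X.

(** Functions on the surface are i-periodic functions on the open set [U] of
    C over which it is parametrized; values outside [U] are irrelevant. *)

Definition jacobi (U : C -> Prop) (X : C -> R3) (v : C -> R) : Prop :=
  (forall z, U z -> v (z + Ci)%C = v z) /\
  class_Ck 2 U v /\
  (forall z, U z -> laplacian X v z - 2 * gauss_curvature X z * v z = 0).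

Definition bounded_on (U : C -> Prop) (v : C -> R) : Prop :=
  exists B : R, forall z, U z -> Rabs (v z) <= B.

Definition bounded_jacobi (U : C -> Prop) (X : C -> R3) (v : C -> R) : Prop :=
  jacobi U X v /\ bounded_on U v.

(** [S], a linear space of functions on [U] (two functions being identified
    when they agree on [U]), is spanned by finitely many of its elements. *)
Definition finite_dimensional (U : C -> Prop) (S : (C -> R) -> Prop) : Prop :=
  exists (n : nat) (e : nat -> C -> R),
    (forall k, (k < n)%nat -> S (e k)) /\
    (forall v, S v ->
       exists a : nat -> R, forall z, U z ->
         v z = fold_right Rplus 0 (map (fun k => a k * e k z) (seq 0 n))).

(* Main.v *)
Require Import Defs.
From Stdlib Require Import Reals Lra Lia Psatz ZArith Arith List Classical ClassicalEpsilon FunctionalExtensionality.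
From Coquelicot Require Import Coquelicot.
Open Scope R_scope.

(** The surface carries the metric [cosh(l)^2 |dz|^2], where [l = log |g|], and in
    the coordinate [z = x + i y] the Jacobi equation is [v_xx + v_yy + q v = 0]
    off the zeros and poles of [g], with [q = 2 |grad l|^2 / cosh(l)^2]
    ([jacobi_equation_iff]). Two facts about [g] matter. The potential [q] is
    bounded, by quasiperiodicity: along a sequence where it blew up, the
    translates of [g] would converge and Cauchy's estimate, for [g] or [1 / g],
    would bound it ([potential_bounded]). And [l] is harmonic with isolated
    logarithmic singularities ([tempered_singular]).

    Expand a bounded solution on the circles [x = const] of length one in
    Fourier modes, with coefficients [V_j(x)]. Although the circles through a
    zero or a pole are incomplete, every [V_j] is of class [C^2] on the whole
    line and satisfies [V_j'' = freq_j^2 V_j - f_j] there, with [f_j] the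
    coefficient of [q v] ([mode_equation]). This is the removability of points
    for bounded solutions: they have capacity zero. Concretely, [v] is
    multiplied by the cutoff [bump (eps l)], which vanishes near the
    singularities and whose gradient, as [l] is logarithmic, tends to zero in
    [L^2] when [eps] does; the terms that the cutoff adds to the equation then
    vanish in the limit.

    Let [N] be at least the bound of [q], fix a circle [x = x0] without singularity
    and let [v] be a bounded solution whose modes of frequency at most
    [2 pi N] vanish at [x0] together with their derivatives. Measure [v] by the
    supremum of the ratio of its [L^2] norm on the circle over [x] to
    [cosh(mu (x - x0))], where [mu = 2 pi (N + 1/2)] is the middle of a spectral
    gap. The low modes solve an initial value problem with zero data, and
    their rate of growth is below [mu] ([low_modes]); the high modes are
    bounded and a maximum principle applies to them, their rates being above
    [mu] ([high_modes]). In both cases a source of size [Q] yields a solution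
    of size at most [Q / (4 N)], so the norm of [v] is at most half of itself
    ([contraction]) and [v] vanishes ([solution_zero]).

    So finitely many linear functionals, the low Fourier data at [x0], separate
    the bounded Jacobi functions ([finitely_determined]), and a space with that
    property has finite dimension ([finite_dimensional_of_functionals]).

    The function theory that this needs is derived from integration over
    rectangles and circles (Goursat's theorem, Cauchy's formula and estimate),
    and the completeness of the Fourier modes from the kernel of
    de la Vallee-Poussin. *)

(** * Goursat's theorem for closed real forms *)

(** Quartering: otherwise a nested sequence of quarters on which [P] fails
    shrinks to a point, and [P] holds on all small rectangles around it. It
    serves for Goursat's theorem and as compactness of rectangles. *)
Lemma bisection_rectangles :
  forall (P : R -> R -> R -> R -> Prop) (a b c d : R),
  a <= b -> c <= d ->
  (forall a b c d, a <= b -> c <= d ->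
     P a ((a + b) / 2) c ((c + d) / 2) -> P ((a + b) / 2) b c ((c + d) / 2) ->
     P a ((a + b) / 2) ((c + d) / 2) d -> P ((a + b) / 2) b ((c + d) / 2) d ->
     P a b c d) ->
  (forall x y, a <= x <= b -> c <= y <= d -> exists delta, 0 < delta /\
     forall a' b' c' d', a <= a' -> b' <= b -> c <= c' -> d' <= d ->
       a' <= x <= b' -> c' <= y <= d' ->
       b' - a' < delta -> d' - c' < delta -> P a' b' c' d') ->
  P a b c d.
Proof.
  intros P a0 b0 c0 d0 Hab Hcd Hsplit Hloc.
  apply NNPP; intro Hnot.
  set (T := (R * R * R * R)%type).
  set (good := fun r : T => let '(a, b, c, d) := r in
     a <= b /\ c <= d /\ ~ P a b c d).
  set (half := fun r s : T => let '(a, b, c, d) := r in let '(a', b', c', d') := s in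
     a <= a' /\ b' <= b /\ c <= c' /\ d' <= d /\
     b' - a' = (b - a) / 2 /\ d' - c' = (d - c) / 2).
  assert (Hstep : forall r, exists s, good r -> good s /\ half r s).
  { intros [[[a b] c] d].
    destruct (classic (good (a, b, c, d))) as [Hg|Hg];
      [| exists (a, b, c, d); tauto].
    destruct Hg as (H1 & H2 & H3).
    destruct (classic (P a ((a + b) / 2) c ((c + d) / 2))) as [Q1|Q1];
      [| exists (a, (a + b) / 2, c, (c + d) / 2); intros _; simpl; intuition lra].
    destruct (classic (P ((a + b) / 2) b c ((c + d) / 2))) as [Q2|Q2];
      [| exists ((a + b) / 2, b, c, (c + d) / 2); intros _; simpl; intuition lra].
    destruct (classic (P a ((a + b) / 2) ((c + d) / 2) d)) as [Q3|Q3];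
      [| exists (a, (a + b) / 2, (c + d) / 2, d); intros _; simpl; intuition lra].
    destruct (classic (P ((a + b) / 2) b ((c + d) / 2) d)) as [Q4|Q4];
      [| exists ((a + b) / 2, b, (c + d) / 2, d); intros _; simpl; intuition lra].
    exfalso; apply H3, Hsplit; assumption. }
  destruct (choice _ Hstep) as [nxt Hnxt].
  set (r := fun n => Nat.iter n nxt (a0, b0, c0, d0)).
  assert (Hgood : forall n, good (r n)).
  { induction n; [simpl; tauto|]. simpl. apply (Hnxt (r n)); assumption. }
  assert (Hhalf : forall n, half (r n) (r (S n))).
  { intros n. apply (Hnxt (r n)); auto. }
  set (A := fun n => fst (fst (fst (r n)))).
  set (B := fun n => snd (fst (fst (r n)))).
  set (C' := fun n => snd (fst (r n))).
  set (D := fun n => snd (r n)).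
  assert (Hr : forall n, r n = (A n, B n, C' n, D n)).
  { intros n; unfold A, B, C', D; destruct (r n) as [[[? ?] ?] ?]; reflexivity. }
  assert (HS : forall n, A n <= A (S n) /\ B (S n) <= B n /\ C' n <= C' (S n) /\
     D (S n) <= D n /\ B (S n) - A (S n) = (B n - A n) / 2 /\
     D (S n) - C' (S n) = (D n - C' n) / 2).
  { intros n. generalize (Hhalf n). rewrite !Hr. simpl. tauto. }
  assert (HG : forall n, A n <= B n /\ C' n <= D n /\ ~ P (A n) (B n) (C' n) (D n)).
  { intros n. generalize (Hgood n). rewrite !Hr. simpl. tauto. }
  assert (Hmono : forall n k, A n <= A (n + k)%nat /\ B (n + k)%nat <= B n /\
     C' n <= C' (n + k)%nat /\ D (n + k)%nat <= D n).
  { intros n k; induction k.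
    - rewrite Nat.add_0_r; lra.
    - rewrite Nat.add_succ_r. generalize (HS (n + k)%nat); lra. }
  assert (Hcross : forall n m, A n <= B m /\ C' n <= D m).
  { intros n m. generalize (Hmono n m) (Hmono m n) (HG (n + m)%nat).
    rewrite (Nat.add_comm m n); lra. }
  assert (Hlim : forall u w : nat -> R, (forall n m, u n <= w m) ->
     exists x, forall n, u n <= x <= w n).
  { intros u w H.
    destruct (completeness (fun x => exists n, x = u n)) as [x [Hx1 Hx2]].
    - exists (w O). intros y [n ->]; auto.
    - exists (u O); exists O; reflexivity.
    - exists x; intros n; split; [apply Hx1; exists n; auto|].
      apply Hx2; intros y [k ->]; auto. }
  destruct (Hlim A B) as [x Hx]; [intros; apply Hcross|].
  destruct (Hlim C' D) as [y Hy]; [intros; apply Hcross|].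
  destruct (Hloc x y (Hx O) (Hy O)) as (delta & Hd & Hdelta).
  assert (Hsize : forall n, B n - A n = (b0 - a0) * / 2 ^ n /\
                            D n - C' n = (d0 - c0) * / 2 ^ n).
  { induction n as [|n IH].
    - unfold A, B, C', D; simpl; lra.
    - destruct (HS n) as (_ & _ & _ & _ & E1 & E2). destruct IH as [I1 I2].
      rewrite E1, E2, I1, I2. simpl. split; field; apply pow_nonzero; lra. }
  assert (Hsmall : exists n, (b0 - a0 + (d0 - c0)) * / 2 ^ n < delta).
  { assert (Hl : is_lim_seq (fun n => (b0 - a0 + (d0 - c0)) * (/ 2) ^ n) 0).
    { replace (Finite 0) with (Rbar_mult (b0 - a0 + (d0 - c0)) 0)
        by (simpl; f_equal; ring).
      apply is_lim_seq_scal_l. apply is_lim_seq_geom. rewrite Rabs_pos_eq; lra. }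
    apply is_lim_seq_spec in Hl. destruct (Hl (mkposreal delta Hd)) as [N HN].
    exists N. specialize (HN N (Nat.le_refl _)). simpl in HN.
    rewrite Rminus_0_r in HN. rewrite <- pow_inv.
    apply Rle_lt_trans with (2 := HN), Rle_abs. }
  destruct Hsmall as [n Hn].
  assert (Hp : 0 < / 2 ^ n) by (apply Rinv_0_lt_compat, pow_lt; lra).
  apply (HG n). apply Hdelta; try apply (Hmono O n); auto;
    destruct (Hsize n) as [E1 E2]; [rewrite E1 | rewrite E2]; nra.
Qed.

Definition boundary_int (p q : R -> R -> R) (a b c d : R) : R :=
  RInt (fun x => p x c) a b + RInt (fun y => q b y) c d
  - RInt (fun x => p x d) a b - RInt (fun y => q a y) c d.

Lemma ex_RInt_cont (f : R -> R) (a b : R) :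
  a <= b -> (forall x, a <= x <= b -> continuous f x) -> ex_RInt f a b.
Proof.
  intros Hab H. apply (ex_RInt_continuous (V := R_CompleteNormedModule)).
  rewrite Rmin_left, Rmax_right by exact Hab. exact H.
Qed.

Lemma RInt_split (f : R -> R) (a m b : R) :
  a <= m <= b -> ex_RInt f a b ->
  RInt f a b = RInt f a m + RInt f m b.
Proof.
  intros H Hf. symmetry. apply (RInt_Chasles (V := R_CompleteNormedModule)).
  - apply ex_RInt_Chasles_1 with b; auto.
  - apply ex_RInt_Chasles_2 with a; auto.
Qed.

Lemma RInt_affine (al be a b : R) :
  is_RInt (fun x => al + be * x) a b (al * (b - a) + be * (b ^ 2 - a ^ 2) / 2).
Proof.
  replace (al * (b - a) + be * (b ^ 2 - a ^ 2) / 2) with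
    (minus (al * b + be * b ^ 2 / 2) (al * a + be * a ^ 2 / 2))
    by (unfold minus, plus, opp; simpl; field).
  apply (is_RInt_derive (V := R_CompleteNormedModule)
           (fun x => al * x + be * x ^ 2 / 2)).
  - intros x _. auto_derive; auto; field.
  - intros x _. apply (ex_derive_continuous (V := R_NormedModule)). auto_derive; auto.
Qed.

Lemma RInt_near_affine (f : R -> R) (al be e a b : R) :
  a <= b -> ex_RInt f a b ->
  (forall x, a <= x <= b -> Rabs (f x - (al + be * x)) <= e) ->
  Rabs (RInt f a b - (al * (b - a) + be * (b ^ 2 - a ^ 2) / 2)) <= e * (b - a).
Proof.
  intros Hab Hf H.
  assert (Hm : is_RInt (fun x => f x - (al + be * x)) a b
     (RInt f a b - (al * (b - a) + be * (b ^ 2 - a ^ 2) / 2))).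
  { apply (is_RInt_minus f (fun x => al + be * x)).
    - apply (RInt_correct f); auto.
    - apply RInt_affine. }
  rewrite (Rmult_comm e).
  replace (RInt f a b - (al * (b - a) + be * (b ^ 2 - a ^ 2) / 2))
    with (RInt (fun x => f x - (al + be * x)) a b) by (apply is_RInt_unique; exact Hm).
  apply abs_RInt_le_const; auto.
  eexists; exact Hm.
Qed.

Lemma continuous_eps (f : R -> R) (x : R) :
  (forall eps, 0 < eps -> exists delta, 0 < delta /\
     forall y, Rabs (y - x) < delta -> Rabs (f y - f x) < eps) ->
  continuous f x.
Proof.
  intros H. apply filterlim_locally. intros [e He].
  destruct (H e He) as (d & Hd & Hd').
  exists (mkposreal d Hd). intros y Hy. apply Hd'. exact Hy.
Qed.

Lemma continuous_section_x (f : R -> R -> R) (x y : R) :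
  continuity_2d_pt f x y -> continuous (fun t => f t y) x.
Proof.
  intros H. apply continuous_eps. intros e He.
  destruct (H (mkposreal e He)) as [[d Hd] Hd'].
  exists d; split; auto. intros t Ht. apply Hd'; auto.
  rewrite Rminus_diag, Rabs_R0. exact Hd.
Qed.

Lemma continuous_section_y (f : R -> R -> R) (x y : R) :
  continuity_2d_pt f x y -> continuous (fun t => f x t) y.
Proof.
  intros H. apply continuous_eps. intros e He.
  destruct (H (mkposreal e He)) as [[d Hd] Hd'].
  exists d; split; auto. intros t Ht. apply Hd'; auto.
  rewrite Rminus_diag, Rabs_R0. exact Hd.
Qed.

(** Differentiability with closed linear part, rather than class [C^1], so as to
    cover [f dz] for [f] complex differentiable at every point. *)
Definition closed_form_at (p q : R -> R -> R) (x y : R) : Prop :=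
  exists px m qy, differentiable_pt_lim p x y px m /\ differentiable_pt_lim q x y m qy.

Lemma closed_form_continuous (p q : R -> R -> R) (x y : R) :
  closed_form_at p q x y -> continuity_2d_pt p x y /\ continuity_2d_pt q x y.
Proof.
  intros (px & m & qy & Hp & Hq).
  split; apply differentiable_continuity_pt; eexists; eexists; eassumption.
Qed.

(** The bound [eps * diameter^2] on the boundary integral passes from the four
    quarters to the whole, as the integrals over inner edges cancel; near a point
    it holds because the integral of the closed linear part is zero. *)
Lemma goursat_rectangle (p q : R -> R -> R) (a b c d : R) :
  a <= b -> c <= d ->
  (forall x y, a <= x <= b -> c <= y <= d -> closed_form_at p q x y) ->
  boundary_int p q a b c d = 0.
Proof.
  intros Hab Hcd Hcl.
  assert (Hpx : forall y a' b', a <= a' -> a' <= b' -> b' <= b -> c <= y <= d ->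
            ex_RInt (fun x => p x y) a' b').
  { intros y a' b' ? ? ? ?. apply ex_RInt_cont; [lra|]. intros x Hx.
    apply continuous_section_x, (closed_form_continuous p q), Hcl; lra. }
  assert (Hqy : forall x c' d', c <= c' -> c' <= d' -> d' <= d -> a <= x <= b ->
            ex_RInt (fun y => q x y) c' d').
  { intros x c' d' ? ? ? ?. apply ex_RInt_cont; [lra|]. intros y Hy.
    apply continuous_section_y, (closed_form_continuous p q), Hcl; lra. }
  assert (Hmain : forall eps, 0 < eps ->
     Rabs (boundary_int p q a b c d) <= eps * Rmax (b - a) (d - c) ^ 2).
  { intros eps Heps.
    set (P := fun a' b' c' d' => a <= a' -> b' <= b -> c <= c' -> d' <= d ->
      Rabs (boundary_int p q a' b' c' d') <= eps * Rmax (b' - a') (d' - c') ^ 2).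
    enough (P a b c d) as HP by (apply HP; lra).
    apply bisection_rectangles; auto.
    - intros a' b' c' d' Hab' Hcd' P1 P2 P3 P4 Ha Hb Hc Hd.
      specialize (P1 ltac:(lra) ltac:(lra) ltac:(lra) ltac:(lra)).
      specialize (P2 ltac:(lra) ltac:(lra) ltac:(lra) ltac:(lra)).
      specialize (P3 ltac:(lra) ltac:(lra) ltac:(lra) ltac:(lra)).
      specialize (P4 ltac:(lra) ltac:(lra) ltac:(lra) ltac:(lra)).
      set (m := (a' + b') / 2) in *. set (n := (c' + d') / 2) in *.
      assert (E : boundary_int p q a' b' c' d' =
        boundary_int p q a' m c' n + boundary_int p q m b' c' n +
        boundary_int p q a' m n d' + boundary_int p q m b' n d').
      { unfold boundary_int.
        rewrite (RInt_split (fun x => p x c') a' m b') by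
          (try apply Hpx; unfold m; lra).
        rewrite (RInt_split (fun x => p x d') a' m b') by
          (try apply Hpx; unfold m; lra).
        rewrite (RInt_split (fun y => q a' y) c' n d') by
          (try apply Hqy; unfold n; lra).
        rewrite (RInt_split (fun y => q b' y) c' n d') by
          (try apply Hqy; unfold n; lra).
        ring. }
      rewrite E.
      assert (Em : forall u v u' v', u' = u / 2 -> v' = v / 2 ->
                 Rmax u' v' = Rmax u v / 2).
      { intros u v u' v' -> ->. unfold Rmax.
        destruct (Rle_dec (u / 2) (v / 2)), (Rle_dec u v); lra. }
      rewrite (Em (b' - a') (d' - c')) in P1 by (unfold m, n; field).
      rewrite (Em (b' - a') (d' - c')) in P2 by (unfold m, n; field).
      rewrite (Em (b' - a') (d' - c')) in P3 by (unfold m, n; field).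
      rewrite (Em (b' - a') (d' - c')) in P4 by (unfold m, n; field).
      set (M := Rmax (b' - a') (d' - c')) in *.
      replace (eps * M ^ 2) with (eps * (M / 2) ^ 2 + eps * (M / 2) ^ 2 +
         eps * (M / 2) ^ 2 + eps * (M / 2) ^ 2) by field.
      apply Rle_trans with (1 := Rabs_triang _ _); apply Rplus_le_compat; auto.
      apply Rle_trans with (1 := Rabs_triang _ _); apply Rplus_le_compat; auto.
      apply Rle_trans with (1 := Rabs_triang _ _); apply Rplus_le_compat; auto.
    - intros x y Hx Hy.
      destruct (Hcl x y Hx Hy) as (px & m & qy & Hp & Hq).
      assert (He4 : 0 < eps / 4) by lra.
      destruct (Hp (mkposreal _ He4)) as [[d1 Hd1] H1].
      destruct (Hq (mkposreal _ He4)) as [[d2 Hd2] H2]. simpl in H1, H2.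
      exists (Rmin d1 d2); split; [apply Rmin_pos; auto|].
      intros a' b' c' d' Ha Hb Hc Hd Hxi Hyi Hs1 Hs2 _ _ _ _.
      assert (Hm1 := Rmin_l d1 d2). assert (Hm2 := Rmin_r d1 d2).
      set (M := Rmax (b' - a') (d' - c')).
      assert (HM1 : b' - a' <= M) by apply Rmax_l.
      assert (HM2 : d' - c' <= M) by apply Rmax_r.
      assert (Hnear : forall u v, a' <= u <= b' -> c' <= v <= d' ->
        Rabs (u - x) < Rmin d1 d2 /\ Rabs (v - y) < Rmin d1 d2 /\
        Rmax (Rabs (u - x)) (Rabs (v - y)) <= M).
      { intros u v Hu Hv.
        assert (Rabs (u - x) <= b' - a') by (apply Rabs_le; lra).
        assert (Rabs (v - y) <= d' - c') by (apply Rabs_le; lra).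
        repeat split; try lra. apply Rmax_lub; lra. }
      assert (Hlp : forall u v, a' <= u <= b' -> c' <= v <= d' ->
        Rabs (p u v - ((p x y - px * x + m * (v - y)) + px * u)) <= eps / 4 * M).
      { intros u v Hu Hv. destruct (Hnear u v Hu Hv) as (N1 & N2 & N3).
        assert (H := H1 u v ltac:(lra) ltac:(lra)).
        replace (p u v - ((p x y - px * x + m * (v - y)) + px * u))
          with (p u v - p x y - (px * (u - x) + m * (v - y))) by ring.
        nra. }
      assert (Hlq : forall u v, a' <= u <= b' -> c' <= v <= d' ->
        Rabs (q u v - ((q x y - qy * y + m * (u - x)) + qy * v)) <= eps / 4 * M).
      { intros u v Hu Hv. destruct (Hnear u v Hu Hv) as (N1 & N2 & N3).
        assert (H := H2 u v ltac:(lra) ltac:(lra)).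
        replace (q u v - ((q x y - qy * y + m * (u - x)) + qy * v))
          with (q u v - q x y - (m * (u - x) + qy * (v - y))) by ring.
        nra. }
      assert (B1 := RInt_near_affine (fun u => p u c') _ px (eps / 4 * M) a' b'
        ltac:(lra) (Hpx c' a' b' ltac:(lra) ltac:(lra) ltac:(lra) ltac:(lra))
        (fun u Hu => Hlp u c' Hu ltac:(lra))).
      assert (B2 := RInt_near_affine (fun v => q b' v) _ qy (eps / 4 * M) c' d'
        ltac:(lra) (Hqy b' c' d' ltac:(lra) ltac:(lra) ltac:(lra) ltac:(lra))
        (fun v Hv => Hlq b' v ltac:(lra) Hv)).
      assert (B3 := RInt_near_affine (fun u => p u d') _ px (eps / 4 * M) a' b'
        ltac:(lra) (Hpx d' a' b' ltac:(lra) ltac:(lra) ltac:(lra) ltac:(lra))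
        (fun u Hu => Hlp u d' Hu ltac:(lra))).
      assert (B4 := RInt_near_affine (fun v => q a' v) _ qy (eps / 4 * M) c' d'
        ltac:(lra) (Hqy a' c' d' ltac:(lra) ltac:(lra) ltac:(lra) ltac:(lra))
        (fun v Hv => Hlq a' v ltac:(lra) Hv)).
      unfold boundary_int.
      assert (HMM : eps / 4 * M * (b' - a') <= eps / 4 * M ^ 2 /\
                    eps / 4 * M * (d' - c') <= eps / 4 * M ^ 2).
      { assert (0 <= eps / 4 * M) by (apply Rmult_le_pos; lra).
        replace (M ^ 2) with (M * M) by ring. split; nra. }
      apply Rabs_le_between in B1. apply Rabs_le_between in B2.
      apply Rabs_le_between in B3. apply Rabs_le_between in B4.
      apply Rabs_le_between. nra. }
  destruct (Req_dec (boundary_int p q a b c d) 0) as [|Hne]; auto.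
  exfalso. apply Rabs_pos_lt in Hne.
  set (K := Rmax (b - a) (d - c) ^ 2) in *.
  assert (HK : 0 <= K) by apply pow2_ge_0.
  specialize (Hmain (Rabs (boundary_int p q a b c d) / (2 * (K + 1)))).
  assert (H : 0 < Rabs (boundary_int p q a b c d) / (2 * (K + 1)))
    by (apply Rdiv_lt_0_compat; lra).
  specialize (Hmain H).
  set (r := Rabs (boundary_int p q a b c d)) in *.
  assert (r / (2 * (K + 1)) * K <= r / 2); [|lra].
  replace (r / 2) with (r / (2 * (K + 1)) * (K + 1)) by (field; lra).
  apply Rmult_le_compat_l; lra.
Qed.

Definition box (x0 y0 r : R) (x y : R) : Prop := Rabs (x - x0) < r /\ Rabs (y - y0) < r.

Lemma Rabs_between_lt (x a b z r : R) :
  Rabs (a - z) < r -> Rabs (b - z) < r -> Rmin a b <= x <= Rmax a b -> Rabs (x - z) < r.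
Proof.
  intros H1 H2 H3. apply Rabs_lt_between in H1. apply Rabs_lt_between in H2.
  apply Rabs_lt_between. revert H3. unfold Rmin, Rmax.
  destruct (Rle_dec a b); lra.
Qed.

Lemma ex_RInt_cont_abs (f : R -> R) (a b : R) :
  (forall x, Rmin a b <= x <= Rmax a b -> continuous f x) -> ex_RInt f a b.
Proof. exact (ex_RInt_continuous (V := R_CompleteNormedModule) f a b). Qed.

Lemma RInt_swapR (f : R -> R) (a b : R) : ex_RInt f a b -> RInt f b a = - RInt f a b.
Proof.
  intros H. symmetry. apply (opp_RInt_swap (V := R_CompleteNormedModule)); auto.
Qed.

Lemma RInt_ChaslesR (f : R -> R) (a b c : R) :
  ex_RInt f a b -> ex_RInt f b c -> RInt f a c = RInt f a b + RInt f b c.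
Proof. intros. symmetry. apply (RInt_Chasles (V := R_CompleteNormedModule)); auto. Qed.

Lemma goursat_box (p q : R -> R -> R) (x0 y0 r a b c d : R) :
  (forall x y, box x0 y0 r x y -> closed_form_at p q x y) ->
  box x0 y0 r a c -> box x0 y0 r b d -> boundary_int p q a b c d = 0.
Proof.
  intros Hcl [Ha Hc] [Hb Hd].
  assert (Hx : forall u v y, Rabs (u - x0) < r -> Rabs (v - x0) < r -> Rabs (y - y0) < r ->
     ex_RInt (fun x => p x y) u v).
  { intros u v y Hu Hv Hy. apply ex_RInt_cont_abs. intros x Hx.
    apply continuous_section_x, (closed_form_continuous p q), Hcl.
    split; auto. apply Rabs_between_lt with u v; auto. }
  assert (Hy : forall u v x, Rabs (u - y0) < r -> Rabs (v - y0) < r -> Rabs (x - x0) < r ->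
     ex_RInt (fun y => q x y) u v).
  { intros u v x Hu Hv Hx'. apply ex_RInt_cont_abs. intros y Hy.
    apply continuous_section_y, (closed_form_continuous p q), Hcl.
    split; auto. apply Rabs_between_lt with u v; auto. }
  assert (Hle : forall a b c d, Rabs (a - x0) < r -> Rabs (b - x0) < r ->
     Rabs (c - y0) < r -> Rabs (d - y0) < r -> a <= b -> c <= d ->
     boundary_int p q a b c d = 0).
  { intros a' b' c' d' A B C0 D Hab Hcd. apply goursat_rectangle; auto.
    intros x y Hx' Hy'. apply Hcl; split.
    - apply Rabs_between_lt with a' b'; auto. rewrite Rmin_left, Rmax_right; auto.
    - apply Rabs_between_lt with c' d'; auto. rewrite Rmin_left, Rmax_right; auto. }
  destruct (Rle_dec a b) as [Hab|Hab], (Rle_dec c d) as [Hcd|Hcd].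
  - auto.
  - rewrite <- Ropp_0, <- (Hle a b d c) by (auto; lra). unfold boundary_int.
    rewrite (RInt_swapR (fun y => q b y) d c), (RInt_swapR (fun y => q a y) d c); auto. ring.
  - rewrite <- Ropp_0, <- (Hle b a c d) by (auto; lra). unfold boundary_int.
    rewrite (RInt_swapR (fun x => p x c) b a), (RInt_swapR (fun x => p x d) b a); auto. ring.
  - rewrite <- (Hle b a d c) by (auto; lra). unfold boundary_int.
    rewrite (RInt_swapR (fun y => q b y) d c), (RInt_swapR (fun y => q a y) d c),
      (RInt_swapR (fun x => p x c) b a), (RInt_swapR (fun x => p x d) b a); auto. ring.
Qed.

Lemma RInt_near_const (f : R -> R) (a b k e : R) :
  (forall x, Rmin a b <= x <= Rmax a b -> continuous f x /\ Rabs (f x - k) <= e) ->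
  Rabs (RInt f a b - k * (b - a)) <= e * Rabs (b - a).
Proof.
  intros H.
  assert (Hf : ex_RInt f a b) by (apply ex_RInt_cont_abs; apply H).
  assert (Hm : is_RInt (fun x => f x - k) a b (RInt f a b - k * (b - a))).
  { apply (is_RInt_minus f (fun x => k)); [apply (RInt_correct f); auto|].
    rewrite (Rmult_comm k). apply (is_RInt_const (V := R_NormedModule)). }
  rewrite (Rmult_comm e).
  apply (norm_RInt_le_const_abs (V := R_NormedModule)) with (2 := Hm).
  intros x Hx. apply H; auto.
Qed.

(** The primitive is the integral along a path of two edges; Goursat's theorem
    lets the order of the edges be exchanged. *)
Lemma primitive_in_box (p q : R -> R -> R) (x0 y0 r : R) :
  (forall x y, box x0 y0 r x y -> closed_form_at p q x y) ->
  exists phi : R -> R -> R, forall x y, box x0 y0 r x y ->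
    differentiable_pt_lim phi x y (p x y) (q x y).
Proof.
  intros Hcl.
  destruct (Rlt_dec 0 r) as [Hr|Hr].
  2:{ exists (fun _ _ => 0). intros x y [Hx _]. generalize (Rabs_pos (x - x0)). lra. }
  set (phi := fun x y => RInt (fun t => p t y0) x0 x + RInt (fun t => q x t) y0 y).
  exists phi. intros x y [Hx Hy].
  assert (H0 : Rabs (x0 - x0) < r /\ Rabs (y0 - y0) < r)
    by (rewrite !Rminus_diag, Rabs_R0; auto).
  assert (Hpc : forall u v, Rabs (u - x0) < r -> Rabs (v - y0) < r ->
     continuity_2d_pt p u v /\ continuity_2d_pt q u v).
  { intros u v Hu Hv. apply closed_form_continuous, Hcl; split; auto. }
  assert (HIx : forall u v y, Rabs (u - x0) < r -> Rabs (v - x0) < r -> Rabs (y - y0) < r ->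
     ex_RInt (fun x => p x y) u v).
  { intros u v y' Hu Hv Hy'. apply ex_RInt_cont_abs. intros x' Hx'.
    apply continuous_section_x, Hpc; auto. apply Rabs_between_lt with u v; auto. }
  assert (HIy : forall u v x, Rabs (u - y0) < r -> Rabs (v - y0) < r -> Rabs (x - x0) < r ->
     ex_RInt (fun y => q x y) u v).
  { intros u v x' Hu Hv Hx'. apply ex_RInt_cont_abs. intros y' Hy'.
    apply continuous_section_y, Hpc; auto. apply Rabs_between_lt with u v; auto. }
  intros [eps Heps].
  assert (He2 : 0 < eps / 2) by lra.
  destruct (proj1 (Hpc x y Hx Hy) (mkposreal _ He2)) as [[d1 Hd1] H1].
  destruct (proj2 (Hpc x y Hx Hy) (mkposreal _ He2)) as [[d2 Hd2] H2].
  simpl in H1, H2.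
  assert (Hd : 0 < Rmin (Rmin d1 d2) (Rmin (r - Rabs (x - x0)) (r - Rabs (y - y0)))).
  { repeat apply Rmin_pos; lra. }
  exists (mkposreal _ Hd). simpl. intros u v Hu Hv.
  assert (M1 := Rmin_l (Rmin d1 d2) (Rmin (r - Rabs (x - x0)) (r - Rabs (y - y0)))).
  assert (M2 := Rmin_r (Rmin d1 d2) (Rmin (r - Rabs (x - x0)) (r - Rabs (y - y0)))).
  assert (M3 := Rmin_l d1 d2). assert (M4 := Rmin_r d1 d2).
  assert (M5 := Rmin_l (r - Rabs (x - x0)) (r - Rabs (y - y0))).
  assert (M6 := Rmin_r (r - Rabs (x - x0)) (r - Rabs (y - y0))).
  assert (Hu0 : Rabs (u - x0) < r).
  { replace (u - x0) with ((u - x) + (x - x0)) by ring.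
    apply Rle_lt_trans with (1 := Rabs_triang _ _); lra. }
  assert (Hv0 : Rabs (v - y0) < r).
  { replace (v - y0) with ((v - y) + (y - y0)) by ring.
    apply Rle_lt_trans with (1 := Rabs_triang _ _); lra. }
  assert (E : phi u v - phi x y = RInt (fun t => p t v) x u + RInt (fun t => q x t) y v).
  { unfold phi.
    rewrite (RInt_ChaslesR (fun t => p t y0) x0 x u) by (apply HIx; tauto).
    assert (G := goursat_box p q x0 y0 r x u y0 v Hcl (conj Hx (proj2 H0)) (conj Hu0 Hv0)).
    unfold boundary_int in G.
    rewrite (RInt_ChaslesR (fun t => q x t) y0 y v) in G;
      [lra | apply HIy; tauto | apply HIy; tauto]. }
  rewrite E.
  assert (B1 : Rabs (RInt (fun t => p t v) x u - p x y * (u - x)) <= eps / 2 * Rabs (u - x)).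
  { apply RInt_near_const. intros t Ht.
    assert (Ht' : Rabs (t - x0) < r) by (apply Rabs_between_lt with x u; auto).
    split; [apply continuous_section_x, Hpc; auto|].
    apply Rlt_le, H1; [|lra].
    apply Rabs_between_lt with x u; auto; [rewrite Rminus_diag, Rabs_R0; auto | lra]. }
  assert (B2 : Rabs (RInt (fun t => q x t) y v - q x y * (v - y)) <= eps / 2 * Rabs (v - y)).
  { apply RInt_near_const. intros t Ht.
    assert (Ht' : Rabs (t - y0) < r) by (apply Rabs_between_lt with y v; auto).
    split; [apply continuous_section_y, Hpc; auto|].
    apply Rlt_le, H2; [rewrite Rminus_diag, Rabs_R0; auto|].
    apply Rabs_between_lt with y v; auto; [rewrite Rminus_diag, Rabs_R0; auto | lra]. }
  replace (RInt (fun t => p t v) x u + RInt (fun t => q x t) y v -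
    (p x y * (u - x) + q x y * (v - y))) with
    ((RInt (fun t => p t v) x u - p x y * (u - x)) +
     (RInt (fun t => q x t) y v - q x y * (v - y))) by ring.
  apply Rle_trans with (1 := Rabs_triang _ _).
  assert (N1 := Rmax_l (Rabs (u - x)) (Rabs (v - y))).
  assert (N2 := Rmax_r (Rabs (u - x)) (Rabs (v - y))).
  nra.
Qed.

(** * Holomorphic functions: primitives, Cauchy's formula, smoothness *)

Notation cderiv f z l :=
  (is_derive (K := C_AbsRing) (V := C_NormedModule) f (z : C) (l : C)).

Lemma cderiv_eps (f : C -> C) (z l : C) :
  cderiv f z l <->
  (forall eps, 0 < eps -> exists delta, 0 < delta /\ forall w, Cmod (w - z) < delta ->
     Cmod (f w - f z - (w - z) * l) <= eps * Cmod (w - z)).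
Proof.
  split.
  - intros [_ H] eps He.
    destruct (H z (fun P HP => HP) (mkposreal eps He)) as [[d Hd] Hd'].
    exists d; split; [exact Hd|]. intros w Hw. exact (Hd' w Hw).
  - intros H. split.
    + apply (is_linear_scal_l (K := C_AbsRing) (V := C_NormedModule)).
    + intros x Hx eps.
      apply (is_filter_lim_locally_unique (K := C_AbsRing) (V := AbsRing_NormedModule C_AbsRing)) in Hx.
      subst x. destruct (H eps (cond_pos eps)) as (d & Hd & Hd').
      exists (mkposreal d Hd). intros w Hw. exact (Hd' w Hw).
Qed.

Lemma Re_le_Cmod (z : C) : Rabs (Re z) <= Cmod z.
Proof. exact (Rle_trans _ _ _ (Rmax_l _ _) (Rmax_Cmod z)). Qed.

Lemma Im_le_Cmod (z : C) : Rabs (Im z) <= Cmod z.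
Proof. exact (Rle_trans _ _ _ (Rmax_r _ _) (Rmax_Cmod z)). Qed.

Lemma Cmod_le_Rabs (z : C) : Cmod z <= Rabs (Re z) + Rabs (Im z).
Proof.
  unfold Cmod. change (fst z) with (Re z). change (snd z) with (Im z).
  apply Rsqr_incr_0_var.
  2:{ generalize (Rabs_pos (Re z)) (Rabs_pos (Im z)); lra. }
  rewrite Rsqr_sqrt by nra. rewrite Rsqr_plus, <- !Rsqr_abs.
  generalize (Rabs_pos (Re z)) (Rabs_pos (Im z)); unfold Rsqr; nra.
Qed.

Lemma Cmod_le_max (z : C) : Cmod z <= 2 * Rmax (Rabs (Re z)) (Rabs (Im z)).
Proof.
  generalize (Cmod_le_Rabs z) (Rmax_l (Rabs (Re z)) (Rabs (Im z)))
    (Rmax_r (Rabs (Re z)) (Rabs (Im z))); lra.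
Qed.

(** The Cauchy-Riemann equations. *)
Lemma cderiv_real (f : C -> C) (z l : C) :
  cderiv f z l <->
  differentiable_pt_lim (fun x y => Re (f (x, y))) (Re z) (Im z) (Re l) (- Im l) /\
  differentiable_pt_lim (fun x y => Im (f (x, y))) (Re z) (Im z) (Im l) (Re l).
Proof.
  assert (Hpair : (Re z, Im z) = z) by (destruct z; reflexivity).
  rewrite cderiv_eps; split.
  - intros H; split; intros [eps Heps]; simpl;
      (assert (He2 : 0 < eps / 2) by lra; destruct (H _ He2) as (d & Hd & Hd');
      assert (Hd2 : 0 < d / 2) by lra;
      exists (mkposreal _ Hd2); simpl; intros u v Hu Hv;
      assert (Hm := Cmod_le_max ((u, v) - z));
      change (Re ((u, v) - z)) with (u - Re z) in Hm;
      change (Im ((u, v) - z)) with (v - Im z) in Hm;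
      assert (Hw : Cmod ((u, v) - z) < d);
      [apply Rle_lt_trans with (1 := Hm);
       assert (Rmax (Rabs (u - Re z)) (Rabs (v - Im z)) < d / 2) by (apply Rmax_lub_lt; auto);
       lra |];
      assert (B := Hd' _ Hw); rewrite Hpair).
    + replace (Re (f (u, v)) - Re (f z) - (Re l * (u - Re z) + - Im l * (v - Im z)))
        with (Re (f (u, v) - f z - ((u, v) - z) * l))
        by (simpl; unfold Re, Im; ring).
      apply Rle_trans with (1 := Re_le_Cmod _). nra.
    + replace (Im (f (u, v)) - Im (f z) - (Im l * (u - Re z) + Re l * (v - Im z)))
        with (Im (f (u, v) - f z - ((u, v) - z) * l))
        by (simpl; unfold Re, Im; ring).
      apply Rle_trans with (1 := Im_le_Cmod _). nra.
  - intros [H1 H2] eps Heps. assert (He2 : 0 < eps / 2) by lra.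
    destruct (H1 (mkposreal _ He2)) as [[d1 Hd1] B1].
    destruct (H2 (mkposreal _ He2)) as [[d2 Hd2] B2]. simpl in B1, B2.
    rewrite Hpair in B1, B2.
    exists (Rmin d1 d2); split; [apply Rmin_pos; auto|]. intros w Hw.
    assert (M1 := Rmin_l d1 d2). assert (M2 := Rmin_r d1 d2).
    assert (R1 := Re_le_Cmod (w - z)). assert (R2 := Im_le_Cmod (w - z)).
    change (Re (w - z)) with (Re w - Re z) in R1.
    change (Im (w - z)) with (Im w - Im z) in R2.
    specialize (B1 (Re w) (Im w) ltac:(lra) ltac:(lra)).
    specialize (B2 (Re w) (Im w) ltac:(lra) ltac:(lra)).
    replace (Re w, Im w) with w in B1, B2 by (destruct w; reflexivity).
    apply Rle_trans with (1 := Cmod_le_Rabs _).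
    replace (Re (f w - f z - (w - z) * l)) with
      (Re (f w) - Re (f z) - (Re l * (Re w - Re z) + - Im l * (Im w - Im z)))
      by (simpl; unfold Re, Im; ring).
    replace (Im (f w - f z - (w - z) * l)) with
      (Im (f w) - Im (f z) - (Im l * (Re w - Re z) + Re l * (Im w - Im z)))
      by (simpl; unfold Re, Im; ring).
    assert (Rmax (Rabs (Re w - Re z)) (Rabs (Im w - Im z)) <= Cmod (w - z))
      by (apply Rmax_lub; auto).
    nra.
Qed.

Definition cbox (z0 : C) (r : R) (z : C) : Prop := box (Re z0) (Im z0) r (Re z) (Im z).

Lemma cprimitive_in_box (f : C -> C) (z0 : C) (r : R) :
  (forall z, cbox z0 r z -> exists l, cderiv f z l) ->
  exists F : C -> C, forall z, cbox z0 r z -> cderiv F z (f z).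
Proof.
  intros Hf.
  assert (Hf' : forall x y, box (Re z0) (Im z0) r x y -> exists l,
     differentiable_pt_lim (fun x y => Re (f (x, y))) x y (Re l) (- Im l) /\
     differentiable_pt_lim (fun x y => Im (f (x, y))) x y (Im l) (Re l)).
  { intros x y H. destruct (Hf (x, y) H) as [l Hl]. exists l.
    apply cderiv_real in Hl. exact Hl. }
  destruct (primitive_in_box (fun x y => Re (f (x, y))) (fun x y => - Im (f (x, y)))
     (Re z0) (Im z0) r) as [phi Hphi].
  { intros x y H. destruct (Hf' x y H) as (l & H1 & H2).
    exists (Re l), (- Im l), (- Re l). split; auto.
    intros eps. destruct (H2 eps) as [d Hd]. exists d. intros u v Hu Hv.
    specialize (Hd u v Hu Hv). rewrite <- Rabs_Ropp in Hd.
    replace (- Im (f (u, v)) - - Im (f (x, y)) - (- Im l * (u - x) + - Re l * (v - y)))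
      with (- (Im (f (u, v)) - Im (f (x, y)) - (Im l * (u - x) + Re l * (v - y)))) by ring.
    exact Hd. }
  destruct (primitive_in_box (fun x y => Im (f (x, y))) (fun x y => Re (f (x, y)))
     (Re z0) (Im z0) r) as [psi Hpsi].
  { intros x y H. destruct (Hf' x y H) as (l & H1 & H2).
    exists (Im l), (Re l), (- Im l). split; auto. }
  exists (fun z => (phi (Re z) (Im z), psi (Re z) (Im z))).
  intros z Hz. apply cderiv_real. destruct z as [x y].
  split; simpl; [apply (Hphi x y Hz) | apply (Hpsi x y Hz)].
Qed.

Lemma cderiv_ext_loc (f g : C -> C) (z l : C) (d : R) :
  0 < d -> (forall w, Cmod (w - z) < d -> f w = g w) -> cderiv f z l -> cderiv g z l.
Proof.
  intros Hd Hfg. rewrite !cderiv_eps. intros H eps He.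
  destruct (H eps He) as (d' & Hd' & B).
  exists (Rmin d d'); split; [apply Rmin_pos; auto|]. intros w Hw.
  assert (M1 := Rmin_l d d'). assert (M2 := Rmin_r d d').
  rewrite <- !Hfg; [apply B; lra | | lra].
  replace (z - z)%C with (RtoC 0) by (apply injective_projections; simpl; ring).
  rewrite Cmod_0; auto.
Qed.

Lemma cderiv_unique (f : C -> C) (z l l' : C) : cderiv f z l -> cderiv f z l' -> l = l'.
Proof.
  rewrite !cderiv_real. intros [H1 H2] [H3 H4].
  apply differentiable_pt_lim_unique in H1, H2, H3, H4.
  apply injective_projections.
  - transitivity (Re l); [reflexivity|]. rewrite <- (proj1 H1), (proj1 H3). reflexivity.
  - transitivity (Im l); [reflexivity|]. rewrite <- (proj1 H2), (proj1 H4). reflexivity.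
Qed.

Lemma cderiv_cont (f : C -> C) (z l : C) :
  cderiv f z l -> forall eps, 0 < eps -> exists d, 0 < d /\
    forall w, Cmod (w - z) < d -> Cmod (f w - f z) < eps.
Proof.
  rewrite cderiv_eps. intros H eps He.
  destruct (H 1 Rlt_0_1) as (d & Hd & B).
  assert (Hl := Cmod_ge_0 l).
  assert (He' : 0 < eps / (Cmod l + 1)) by (apply Rdiv_lt_0_compat; lra).
  exists (Rmin d (eps / (Cmod l + 1))); split; [apply Rmin_pos; auto|]. intros w Hw.
  assert (M1 := Rmin_l d (eps / (Cmod l + 1))).
  assert (M2 := Rmin_r d (eps / (Cmod l + 1))).
  specialize (B w ltac:(lra)).
  replace (f w - f z)%C with ((f w - f z - (w - z) * l) + (w - z) * l)%C by ring.
  apply Rle_lt_trans with (1 := Cmod_triangle _ _). rewrite Cmod_mult.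
  apply Rle_lt_trans with (Cmod (w - z) * (Cmod l + 1)); [lra|].
  replace eps with (eps / (Cmod l + 1) * (Cmod l + 1)) by (field; lra).
  apply Rmult_lt_compat_r; lra.
Qed.

Lemma Cmod_sub_sym (a b : C) : Cmod (a - b) = Cmod (b - a).
Proof. rewrite <- Cmod_opp. f_equal. ring. Qed.

Lemma cderiv_const (c z : C) : cderiv (fun _ => c) z 0%C.
Proof.
  apply cderiv_eps. intros eps He. exists 1; split; [lra|]. intros w _.
  replace (c - c - (w - z) * 0)%C with (RtoC 0) by ring. rewrite Cmod_0.
  apply Rmult_le_pos; [lra | apply Cmod_ge_0].
Qed.

Lemma cderiv_id (z : C) : cderiv (fun w => w) z 1%C.
Proof.
  apply cderiv_eps. intros eps He. exists 1; split; [lra|]. intros w _.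
  replace (w - z - (w - z) * 1)%C with (RtoC 0) by ring. rewrite Cmod_0.
  apply Rmult_le_pos; [lra | apply Cmod_ge_0].
Qed.

Lemma cderiv_plus (f g : C -> C) (z l m : C) :
  cderiv f z l -> cderiv g z m -> cderiv (fun w => f w + g w)%C z (l + m)%C.
Proof. exact (is_derive_plus (K := C_AbsRing) (V := C_NormedModule) f g z l m). Qed.

Lemma cderiv_mult (f g : C -> C) (z l m : C) :
  cderiv f z l -> cderiv g z m -> cderiv (fun w => f w * g w)%C z (l * g z + f z * m)%C.
Proof.
  rewrite !cderiv_eps. intros Hf Hg.
  assert (Hgc := cderiv_cont g z m (proj2 (cderiv_eps g z m) Hg)).
  intros eps He.
  assert (L := Cmod_ge_0 l). assert (G := Cmod_ge_0 (g z)). assert (F := Cmod_ge_0 (f z)).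
  set (K := Cmod l + Cmod (g z) + Cmod (f z) + 1).
  assert (HK : 0 < K) by (unfold K; lra).
  assert (HeK : 0 < eps / (3 * K)) by (apply Rdiv_lt_0_compat; lra).
  destruct (Hf _ HeK) as (d1 & Hd1 & B1).
  destruct (Hg _ HeK) as (d2 & Hd2 & B2).
  destruct (Hgc (Rmin 1 (eps / (3 * K)))) as (d3 & Hd3 & B3); [apply Rmin_pos; lra|].
  exists (Rmin d1 (Rmin d2 d3)); split; [repeat apply Rmin_pos; auto|]. intros w Hw.
  assert (M1 := Rmin_l d1 (Rmin d2 d3)). assert (M2 := Rmin_r d1 (Rmin d2 d3)).
  assert (M3 := Rmin_l d2 d3). assert (M4 := Rmin_r d2 d3).
  specialize (B1 w ltac:(lra)). specialize (B2 w ltac:(lra)). specialize (B3 w ltac:(lra)).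
  assert (N1 := Rmin_l 1 (eps / (3 * K))). assert (N2 := Rmin_r 1 (eps / (3 * K))).
  replace (f w * g w - f z * g z - (w - z) * (l * g z + f z * m))%C with
    ((f w - f z - (w - z) * l) * g w + (w - z) * l * (g w - g z) +
     f z * (g w - g z - (w - z) * m))%C by ring.
  apply Rle_trans with (1 := Cmod_triangle _ _).
  apply Rle_trans with (Cmod ((f w - f z - (w - z) * l) * g w) +
     Cmod ((w - z) * l * (g w - g z)) + Cmod (f z * (g w - g z - (w - z) * m))).
  { apply Rplus_le_compat_r, Cmod_triangle. }
  rewrite !Cmod_mult.
  assert (Hgw : Cmod (g w) <= K).
  { replace (g w) with (g z + (g w - g z))%C by ring.
    apply Rle_trans with (1 := Cmod_triangle _ _). unfold K; lra. }
  assert (W := Cmod_ge_0 (w - z)).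
  assert (E : eps * Cmod (w - z) = 3 * (eps / (3 * K) * Cmod (w - z) * K)) by (field; lra).
  rewrite E.
  set (e := eps / (3 * K)) in *.
  assert (T1 : Cmod (f w - f z - (w - z) * l) * Cmod (g w) <= e * Cmod (w - z) * K).
  { apply Rmult_le_compat; auto using Cmod_ge_0. }
  assert (T2 : Cmod (w - z) * Cmod l * Cmod (g w - g z) <= e * Cmod (w - z) * K).
  { replace (e * Cmod (w - z) * K) with (Cmod (w - z) * K * e) by ring.
    apply Rmult_le_compat; auto using Cmod_ge_0; try lra.
    - apply Rmult_le_pos; lra.
    - apply Rmult_le_compat_l; auto. unfold K; lra. }
  assert (T3 : Cmod (f z) * Cmod (g w - g z - (w - z) * m) <= e * Cmod (w - z) * K).
  { rewrite Rmult_comm. apply Rmult_le_compat; auto using Cmod_ge_0. unfold K; lra. }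
  lra.
Qed.

Lemma cderiv_inv (f : C -> C) (z l : C) :
  f z <> 0%C -> cderiv f z l -> cderiv (fun w => / f w)%C z (- l / (f z * f z))%C.
Proof.
  intros Hz Hf.
  assert (Hzp : 0 < Cmod (f z)) by (apply Cmod_gt_0; auto).
  (* It suffices to invert the identity: the general case is the chain rule. *)
  assert (Hinv : forall a : C, a <> 0%C -> cderiv Cinv a (- / (a * a))%C).
  { clear f z l Hz Hf Hzp. intros a Ha. apply cderiv_eps. intros eps He.
    assert (Hap : 0 < Cmod a) by (apply Cmod_gt_0; auto).
    set (d := eps * (Cmod a ^ 3 / 2)).
    assert (Hd : 0 < d).
    { apply Rmult_lt_0_compat; auto. apply Rdiv_lt_0_compat; [apply pow_lt; auto | lra]. }
    exists (Rmin (Cmod a / 2) d); split; [apply Rmin_pos; lra|]. intros w Hw.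
    assert (M1 := Rmin_l (Cmod a / 2) d). assert (M2 := Rmin_r (Cmod a / 2) d).
    assert (Hwa : Cmod a / 2 <= Cmod w).
    { assert (T := Cmod_triangle w (a - w)). replace (w + (a - w))%C with a in T by ring.
      rewrite Cmod_sub_sym in T. lra. }
    assert (Hw0 : w <> 0%C) by (intros ->; rewrite Cmod_0 in Hwa; lra).
    replace (/ w - / a - (w - a) * - / (a * a))%C with
      ((w - a) * ((w - a) * / (a * a * w)))%C by (field; auto).
    rewrite Cmod_mult, (Rmult_comm eps).
    apply Rmult_le_compat_l; [apply Cmod_ge_0|].
    rewrite Cmod_mult, Cmod_inv by (repeat apply Cmult_neq_0; auto).
    rewrite !Cmod_mult.
    assert (P : 0 < Cmod a * Cmod a * (Cmod a / 2)) by (repeat apply Rmult_lt_0_compat; lra).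
    assert (/ (Cmod a * Cmod a * Cmod w) <= / (Cmod a * Cmod a * (Cmod a / 2))).
    { apply Rinv_le_contravar; auto. apply Rmult_le_compat_l; auto. nra. }
    apply Rle_trans with (d * / (Cmod a * Cmod a * (Cmod a / 2))).
    { apply Rmult_le_compat; auto using Cmod_ge_0; try lra.
      apply Rlt_le, Rinv_0_lt_compat. repeat apply Rmult_lt_0_compat; lra. }
    unfold d. right. field. lra. }
  assert (H := is_derive_comp (K := C_AbsRing) (V := C_NormedModule) Cinv f z
     (- / (f z * f z))%C l (Hinv _ Hz)).
  assert (E : (- l / (f z * f z))%C = scal (K := C_AbsRing) (V := C_NormedModule) l (- / (f z * f z))%C).
  { change (- l / (f z * f z) = l * - / (f z * f z))%C. field. auto. }
  rewrite E. apply H. split; [apply is_linear_scal_l | exact (proj2 Hf)].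
Qed.

(** * Integrals along circles *)

(** A complex integral taken componentwise, so that the calculus of real
    integrals applies to it. *)
Definition cint (f : R -> C) : C :=
  (RInt (fun t => Re (f t)) 0 1, RInt (fun t => Im (f t)) 0 1).

Definition ccont (f : R -> C) : Prop :=
  forall t, continuous (fun s => Re (f s)) t /\ continuous (fun s => Im (f s)) t.

Lemma continuous_plusR (f g : R -> R) (t : R) :
  continuous f t -> continuous g t -> continuous (fun s => f s + g s) t.
Proof. intros; apply (continuous_plus (V := R_NormedModule)); auto. Qed.

Lemma continuous_multR (f g : R -> R) (t : R) :
  continuous f t -> continuous g t -> continuous (fun s => f s * g s) t.
Proof. intros; apply (continuous_mult (K := R_AbsRing)); auto. Qed.

Lemma continuous_oppR (f : R -> R) (t : R) :
  continuous f t -> continuous (fun s => - f s) t.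
Proof. intros; apply (continuous_opp (V := R_NormedModule)); auto. Qed.

Lemma continuous_invR (f : R -> R) (t : R) :
  continuous f t -> f t <> 0 -> continuous (fun s => / f s) t.
Proof.
  intros H H0. apply (continuous_comp f Rinv); auto.
  apply (ex_derive_continuous (V := R_NormedModule)). auto_derive; auto.
Qed.

Lemma continuous_extR (f g : R -> R) (t : R) :
  (forall s, f s = g s) -> continuous f t -> continuous g t.
Proof. exact (continuous_ext f g t). Qed.

Lemma ccont_plus (f g : R -> C) : ccont f -> ccont g -> ccont (fun t => f t + g t)%C.
Proof.
  intros Hf Hg t; destruct (Hf t), (Hg t); split; simpl; apply continuous_plusR; auto.
Qed.

Lemma ccont_mult (f g : R -> C) : ccont f -> ccont g -> ccont (fun t => f t * g t)%C.
Proof.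
  intros Hf Hg t; destruct (Hf t), (Hg t); split; simpl.
  - apply continuous_plusR; [|apply continuous_oppR]; apply continuous_multR; auto.
  - apply continuous_plusR; apply continuous_multR; auto.
Qed.

Lemma ccont_const (c : C) : ccont (fun _ => c).
Proof. intros t; split; apply continuous_const. Qed.

Lemma ccont_inv (f : R -> C) : ccont f -> (forall t, f t <> 0%C) -> ccont (fun t => / f t)%C.
Proof.
  intros Hf H0 t. destruct (Hf t) as [H1 H2].
  assert (Hm : continuous (fun s => / (Re (f s) ^ 2 + Im (f s) ^ 2)) t).
  { apply continuous_invR.
    - apply continuous_extR with (fun s => Re (f s) * Re (f s) + Im (f s) * Im (f s));
        [intros s; ring|].
      apply continuous_plusR; apply continuous_multR; assumption.
    - intros E. apply (H0 t). apply injective_projections; simpl;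
        unfold Re, Im in E; nra. }
  split; simpl; apply continuous_multR; auto. apply continuous_oppR; auto.
Qed.

Lemma ccont_pow (f : R -> C) (n : nat) : ccont f -> ccont (fun t => f t ^ n)%C.
Proof.
  intros Hf; induction n; simpl; [apply ccont_const | apply ccont_mult; auto].
Qed.

Lemma RInt_plusR (f g : R -> R) (a b : R) : ex_RInt f a b -> ex_RInt g a b ->
  RInt (fun t => f t + g t) a b = RInt f a b + RInt g a b.
Proof. exact (RInt_plus (V := R_CompleteNormedModule) f g a b). Qed.

Lemma RInt_minusR (f g : R -> R) (a b : R) : ex_RInt f a b -> ex_RInt g a b ->
  RInt (fun t => f t - g t) a b = RInt f a b - RInt g a b.
Proof. exact (RInt_minus (V := R_CompleteNormedModule) f g a b). Qed.

Lemma RInt_scalR (f : R -> R) (k a b : R) : ex_RInt f a b ->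
  RInt (fun t => k * f t) a b = k * RInt f a b.
Proof. exact (RInt_scal (V := R_CompleteNormedModule) f a b k). Qed.

Lemma ex_RInt_cont_all (f : R -> R) (a b : R) : (forall t, continuous f t) -> ex_RInt f a b.
Proof. intros H; apply ex_RInt_cont_abs; auto. Qed.

Lemma ex_RInt_scalR (f : R -> R) (k a b : R) : ex_RInt f a b -> ex_RInt (fun t => k * f t) a b.
Proof. exact (ex_RInt_scal (V := R_NormedModule) f a b k). Qed.

Lemma ccont_ex_RInt (f : R -> C) : ccont f ->
  ex_RInt (fun t => Re (f t)) 0 1 /\ ex_RInt (fun t => Im (f t)) 0 1.
Proof. intros H; split; apply ex_RInt_cont_all; apply H. Qed.

Lemma cint_ext (f g : R -> C) : (forall t, f t = g t) -> cint f = cint g.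
Proof.
  intros H. unfold cint. f_equal; apply RInt_ext; intros; rewrite H; auto.
Qed.

Lemma cint_plus (f g : R -> C) : ccont f -> ccont g ->
  cint (fun t => f t + g t)%C = (cint f + cint g)%C.
Proof.
  intros Hf Hg. destruct (ccont_ex_RInt f Hf), (ccont_ex_RInt g Hg).
  apply injective_projections; simpl; apply RInt_plusR; auto.
Qed.

Lemma cint_scal (c : C) (f : R -> C) : ccont f ->
  cint (fun t => c * f t)%C = (c * cint f)%C.
Proof.
  intros Hf. destruct (ccont_ex_RInt f Hf) as [H1 H2].
  apply injective_projections; simpl.
  - rewrite (RInt_minusR (fun t => fst c * Re (f t)) (fun t => snd c * Im (f t)))
      by (apply ex_RInt_scalR; auto).
    rewrite !RInt_scalR; auto.
  - rewrite (RInt_plusR (fun t => fst c * Im (f t)) (fun t => snd c * Re (f t)))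
      by (apply ex_RInt_scalR; auto).
    rewrite !RInt_scalR; auto.
Qed.

(** The factor [2] comes from bounding the two components separately. *)
Lemma cint_bound (f : R -> C) (M : R) : ccont f ->
  (forall t, 0 <= t <= 1 -> Cmod (f t) <= M) -> Cmod (cint f) <= 2 * M.
Proof.
  intros Hf HM. destruct (ccont_ex_RInt f Hf) as [H1 H2].
  apply Rle_trans with (1 := Cmod_le_Rabs _). simpl.
  assert (B1 : Rabs (RInt (fun t => Re (f t)) 0 1) <= (1 - 0) * M).
  { apply abs_RInt_le_const; auto; [lra|]. intros t Ht.
    apply Rle_trans with (1 := Re_le_Cmod _); auto. }
  assert (B2 : Rabs (RInt (fun t => Im (f t)) 0 1) <= (1 - 0) * M).
  { apply abs_RInt_le_const; auto; [lra|]. intros t Ht.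
    apply Rle_trans with (1 := Im_le_Cmod _); auto. }
  lra.
Qed.

(** The velocity of [circle p r]. *)
Definition dcircle (r t : R) : C :=
  (- (2 * PI * r) * sin (2 * PI * t), 2 * PI * r * cos (2 * PI * t)).

Lemma circle_derive (p : C) (r t : R) :
  derivable_pt_lim (fun s => Re (circle p r s)) t (Re (dcircle r t)) /\
  derivable_pt_lim (fun s => Im (circle p r s)) t (Im (dcircle r t)).
Proof.
  split; apply is_derive_Reals; unfold circle, dcircle, Re, Im; simpl;
    auto_derive; auto; ring.
Qed.

Lemma ccont_circle (p : C) (r : R) : ccont (circle p r).
Proof.
  intros t; destruct (circle_derive p r t) as [H1 H2]; split;
    apply (ex_derive_continuous (V := R_NormedModule)); eexists;
    apply is_derive_Reals; eassumption.
Qed.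

Lemma ccont_dcircle (r : R) : ccont (dcircle r).
Proof.
  intros t; split; unfold dcircle, Re, Im; simpl;
    apply (ex_derive_continuous (V := R_NormedModule)); auto_derive; auto.
Qed.

Lemma Cmod_polar (r a : R) : 0 <= r -> Cmod (r * cos a, r * sin a) = r.
Proof.
  intros H. unfold Cmod. simpl.
  replace (r * cos a * (r * cos a * 1) + r * sin a * (r * sin a * 1))
    with (Rsqr r * (Rsqr (sin a) + Rsqr (cos a))) by (unfold Rsqr; ring).
  rewrite sin2_cos2, Rmult_1_r. apply sqrt_Rsqr; auto.
Qed.

Lemma circle_dist (p : C) (r t : R) : 0 <= r -> Cmod (circle p r t - p) = r.
Proof.
  intros H. rewrite <- (Cmod_polar r (2 * PI * t) H) at 2. f_equal.
  apply injective_projections; simpl; ring.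
Qed.

Lemma dcircle_eq (p : C) (r t : R) :
  dcircle r t = (RtoC (2 * PI) * Ci * (circle p r t - p))%C.
Proof. apply injective_projections; simpl; ring. Qed.

Lemma Cmod_dcircle (r t : R) : 0 <= r -> Cmod (dcircle r t) = 2 * PI * r.
Proof.
  intros H. rewrite (dcircle_eq 0 r t), !Cmod_mult, circle_dist, Cmod_R by auto.
  replace (Cmod Ci) with 1.
  - rewrite Rabs_pos_eq; [ring|]. generalize PI_RGT_0; lra.
  - transitivity (sqrt 1); [symmetry; apply sqrt_1 | unfold Cmod; simpl; f_equal; ring].
Qed.

Lemma comp_circle_derive (H h : C -> C) (p : C) (r t : R) :
  cderiv H (circle p r t) (h (circle p r t)) ->
  derivable_pt_lim (fun s => Re (H (circle p r s))) t (Re (h (circle p r t) * dcircle r t)%C) /\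
  derivable_pt_lim (fun s => Im (H (circle p r s))) t (Im (h (circle p r t) * dcircle r t)%C).
Proof.
  intros HH. apply cderiv_real in HH. destruct HH as [H1 H2].
  destruct (circle_derive p r t) as [C1 C2].
  assert (E : forall s, (Re (circle p r s), Im (circle p r s)) = circle p r s)
    by (intros; destruct (circle p r s); reflexivity).
  split.
  - replace (fun s => Re (H (circle p r s))) with
      (fun s => Re (H (Re (circle p r s), Im (circle p r s))))
      by (apply functional_extensionality; intros; rewrite E; auto).
    replace (Re (h (circle p r t) * dcircle r t)%C) with
      (Re (h (circle p r t)) * Re (dcircle r t) + - Im (h (circle p r t)) * Im (dcircle r t))
      by (simpl; unfold Re, Im; ring).
    apply (derivable_pt_lim_comp_2d (fun x y => Re (H (x, y)))); auto.
  - replace (fun s => Im (H (circle p r s))) with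
      (fun s => Im (H (Re (circle p r s), Im (circle p r s))))
      by (apply functional_extensionality; intros; rewrite E; auto).
    replace (Im (h (circle p r t) * dcircle r t)%C) with
      (Im (h (circle p r t)) * Re (dcircle r t) + Re (h (circle p r t)) * Im (dcircle r t))
      by (simpl; unfold Re, Im; ring).
    apply (derivable_pt_lim_comp_2d (fun x y => Im (H (x, y)))); auto.
Qed.

Lemma ccont_comp_circle (H h : C -> C) (p : C) (r : R) :
  (forall t, cderiv H (circle p r t) (h (circle p r t))) -> ccont (fun t => H (circle p r t)).
Proof.
  intros HH t. destruct (comp_circle_derive H h p r t (HH t)) as [H1 H2].
  split; apply (ex_derive_continuous (V := R_NormedModule)); eexists;
    apply is_derive_Reals; eassumption.
Qed.

Lemma RInt_ftc (f df : R -> R) (a b : R) :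
  (forall t, is_derive f t (df t)) -> (forall t, continuous df t) ->
  RInt df a b = f b - f a.
Proof.
  intros H1 H2. apply is_RInt_unique.
  apply (is_RInt_derive (V := R_CompleteNormedModule) f df); auto.
Qed.

Lemma circle_closed (p : C) (r : R) : circle p r 1 = circle p r 0.
Proof.
  unfold circle. rewrite Rmult_1_r, Rmult_0_r, cos_2PI, sin_2PI, cos_0, sin_0. reflexivity.
Qed.

Lemma circle_int_exact (H h : C -> C) (p : C) (r : R) :
  (forall t, cderiv H (circle p r t) (h (circle p r t))) ->
  ccont (fun t => h (circle p r t)) ->
  cint (fun t => h (circle p r t) * dcircle r t)%C = 0%C.
Proof.
  intros HH Hc.
  assert (Hcc := ccont_mult _ _ Hc (ccont_dcircle r)).
  apply injective_projections; simpl.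
  - rewrite (RInt_ftc (fun t => Re (H (circle p r t)))
      (fun t => Re (h (circle p r t) * dcircle r t)%C)).
    + rewrite circle_closed. ring.
    + intros t; apply is_derive_Reals, comp_circle_derive; auto.
    + apply Hcc.
  - rewrite (RInt_ftc (fun t => Im (H (circle p r t)))
      (fun t => Im (h (circle p r t) * dcircle r t)%C)).
    + rewrite circle_closed. ring.
    + intros t; apply is_derive_Reals, comp_circle_derive; auto.
    + apply Hcc.
Qed.

(** Second order Taylor estimate for [A |-> A ^ n] along [1 / (c - z)]:
    [A = 1 / (c - z)] and [B = 1 / (c - z - h)] satisfy [B - A = h A B]. *)
Lemma inv_pow_increment (n : nat) (M : R) : 0 <= M ->
  exists K, 0 <= K /\ forall A B h : C, Cmod A <= M -> Cmod B <= M -> (B - A = h * A * B)%C ->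
    Cmod (B ^ n - A ^ n - INR n * h * A ^ S n)%C <= K * Cmod h ^ 2.
Proof.
  intros HM. induction n as [|n [K [HK IH]]].
  - exists 0; split; [lra|]. intros A B h _ _ _.
    replace (B ^ 0 - A ^ 0 - INR 0 * h * A ^ 1)%C with (RtoC 0) by (simpl; ring).
    rewrite Cmod_0, Rmult_0_l. lra.
  - exists (M * K + INR n * (M ^ S (S n) * M) + M ^ S (S n) * M).
    assert (P1 : 0 <= M ^ S (S n)) by (apply pow_le; auto).
    assert (P2 := pos_INR n).
    split.
    { assert (P3 : 0 <= M ^ S (S n) * M) by (apply Rmult_le_pos; auto).
      assert (P4 : 0 <= INR n * (M ^ S (S n) * M)) by (apply Rmult_le_pos; auto).
      assert (P5 : 0 <= M * K) by (apply Rmult_le_pos; auto). lra. }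
    intros A B h HA HB E.
    assert (E2 : (B ^ S n - A ^ S n - INR (S n) * h * A ^ S (S n) =
      B * (B ^ n - A ^ n - INR n * h * A ^ S n) +
      (INR n * (h * h * (A ^ S (S n) * B)) + h * h * (A ^ S (S n) * B)))%C).
    { rewrite S_INR, RtoC_plus.
      transitivity (B * (B ^ n - A ^ n - INR n * h * A ^ S n) +
        (INR n * h * A ^ S n * (B - A) + A ^ n * ((B - A) - h * A * A)))%C.
      - rewrite !Cpow_S. ring.
      - assert (E3 : ((B - A) - h * A * A = h * A * (h * A * B))%C).
        { transitivity (h * A * (B - A))%C; [|rewrite E; reflexivity].
          rewrite E at 1. ring. }
        rewrite E3, E, !Cpow_S. ring. }
    rewrite E2.
    assert (HAB : Cmod (A ^ S (S n) * B)%C <= M ^ S (S n) * M).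
    { rewrite Cmod_mult, Cmod_pow. apply Rmult_le_compat; auto using Cmod_ge_0.
      - apply pow_le, Cmod_ge_0.
      - apply pow_incr; split; auto using Cmod_ge_0. }
    assert (Hhh : Cmod (h * h * (A ^ S (S n) * B))%C <= M ^ S (S n) * M * Cmod h ^ 2).
    { rewrite !(Cmod_mult (h * h)), Cmod_mult.
      replace (Cmod h * Cmod h) with (Cmod h ^ 2) by ring.
      rewrite Rmult_comm. apply Rmult_le_compat_r; [apply pow2_ge_0|auto]. }
    apply Rle_trans with (1 := Cmod_triangle _ _).
    apply Rle_trans with (M * (K * Cmod h ^ 2) +
      (INR n * (M ^ S (S n) * M * Cmod h ^ 2) + M ^ S (S n) * M * Cmod h ^ 2)); [|right; ring].
    apply Rplus_le_compat.
    + rewrite Cmod_mult. apply Rmult_le_compat; auto using Cmod_ge_0.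
    + apply Rle_trans with (1 := Cmod_triangle _ _). apply Rplus_le_compat; auto.
      rewrite Cmod_mult, Cmod_R, (Rabs_pos_eq (INR n)) by auto.
      apply Rmult_le_compat_l; auto.
Qed.

(** The Cauchy integral of order [n] of the weight [om] along a circle. *)
Definition cauchy_int (om : R -> C) (p : C) (r : R) (n : nat) (z : C) : C :=
  cint (fun t => om t * (/ (circle p r t - z)) ^ n)%C.

Lemma circle_far (p : C) (r : R) (z : C) (t : R) : 0 <= r ->
  r - Cmod (z - p) <= Cmod (circle p r t - z).
Proof.
  intros Hr. assert (T := Cmod_triangle (circle p r t - z) (z - p)).
  replace (circle p r t - z + (z - p))%C with (circle p r t - p)%C in T by ring.
  rewrite circle_dist in T by auto. lra.
Qed.

Lemma circle_ne (p : C) (r : R) (z : C) (t : R) : 0 <= r -> Cmod (z - p) < r ->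
  (circle p r t - z)%C <> 0%C.
Proof.
  intros Hr Hz E. assert (F := circle_far p r z t Hr). rewrite E, Cmod_0 in F. lra.
Qed.

Lemma ccont_cauchy (om : R -> C) (p : C) (r : R) (n : nat) (z : C) :
  0 <= r -> Cmod (z - p) < r -> ccont om ->
  ccont (fun t => om t * (/ (circle p r t - z)) ^ n)%C.
Proof.
  intros Hr Hz Hom. apply ccont_mult; auto. apply ccont_pow, ccont_inv.
  - apply ccont_plus; [apply ccont_circle | apply ccont_const].
  - intros t; apply circle_ne; auto.
Qed.

Lemma ccont_bounded (om : R -> C) : ccont om ->
  exists W, 0 <= W /\ forall t, 0 <= t <= 1 -> Cmod (om t) <= W.
Proof.
  intros H.
  assert (Hb : forall f : R -> R, (forall t, continuous f t) ->
    exists W, 0 <= W /\ forall t, 0 <= t <= 1 -> Rabs (f t) <= W).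
  { intros f Hf.
    destruct (continuity_ab_maj (fun t => Rabs (f t)) 0 1) as [m Hm]; [lra| |].
    - intros t _. apply continuity_pt_filterlim.
      apply (continuous_comp f Rabs); [apply Hf | apply continuous_Rabs].
    - exists (Rabs (f m)); split; [apply Rabs_pos|]. intros t Ht. apply Hm; auto. }
  destruct (Hb (fun t => Re (om t))) as (W1 & P1 & B1); [apply H|].
  destruct (Hb (fun t => Im (om t))) as (W2 & P2 & B2); [apply H|].
  exists (W1 + W2); split; [lra|]. intros t Ht.
  apply Rle_trans with (1 := Cmod_le_Rabs _). specialize (B1 t Ht). specialize (B2 t Ht). lra.
Qed.

(** Differentiation under the integral sign: the quadratic remainder of
    [inv_pow_increment] is uniform on the circle. *)
Lemma cauchy_int_derive (om : R -> C) (p : C) (r : R) (n : nat) (z : C) :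
  0 <= r -> Cmod (z - p) < r -> ccont om ->
  cderiv (cauchy_int om p r n) z (INR n * cauchy_int om p r (S n) z)%C.
Proof.
  intros Hr Hz Hom. apply cderiv_eps. intros eps He.
  set (d := (r - Cmod (z - p)) / 2).
  assert (Hd : 0 < d) by (unfold d; lra).
  destruct (ccont_bounded om Hom) as (W & HW & BW).
  destruct (inv_pow_increment n (/ d)) as (K & HK & BK).
  { apply Rlt_le, Rinv_0_lt_compat; auto. }
  assert (Hq : 0 < eps / (2 * (W * K) + 1)).
  { apply Rdiv_lt_0_compat; auto. assert (0 <= W * K) by (apply Rmult_le_pos; auto). lra. }
  exists (Rmin d (eps / (2 * (W * K) + 1))); split; [apply Rmin_pos; auto|].
  intros w Hw.
  assert (M1 := Rmin_l d (eps / (2 * (W * K) + 1))).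
  assert (M2 := Rmin_r d (eps / (2 * (W * K) + 1))).
  assert (Hwp : Cmod (w - p) < r).
  { replace (w - p)%C with ((w - z) + (z - p))%C by ring.
    apply Rle_lt_trans with (1 := Cmod_triangle _ _). unfold d in *. lra. }
  assert (E : (cauchy_int om p r n w - cauchy_int om p r n z -
     (w - z) * (INR n * cauchy_int om p r (S n) z))%C =
     cint (fun t => om t * ((/ (circle p r t - w)) ^ n - (/ (circle p r t - z)) ^ n
        - INR n * (w - z) * (/ (circle p r t - z)) ^ S n))%C).
  { unfold cauchy_int.
    transitivity (cint (fun t => om t * (/ (circle p r t - w)) ^ n) +
      ((-1) * cint (fun t => om t * (/ (circle p r t - z)) ^ n) +
       (- (INR n * (w - z))) * cint (fun t => om t * (/ (circle p r t - z)) ^ S n)))%C; [ring|].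
    rewrite <- !cint_scal by (apply ccont_cauchy; auto).
    assert (S1 := ccont_mult _ _ (ccont_const (-1)) (ccont_cauchy om p r n z Hr Hz Hom)).
    assert (S2 := ccont_mult _ _ (ccont_const (- (INR n * (w - z)))) (ccont_cauchy om p r (S n) z Hr Hz Hom)).
    rewrite <- cint_plus by auto.
    rewrite <- cint_plus; [| apply ccont_cauchy; auto | apply ccont_plus; auto].
    apply cint_ext. intros t. ring. }
  rewrite E.
  set (h := (w - z)%C) in *.
  apply Rle_trans with (2 * (W * (K * Cmod h ^ 2))).
  - apply cint_bound.
    + apply ccont_mult; auto.
      assert (S1 := ccont_cauchy _ p r n w Hr Hwp (ccont_const 1)).
      assert (S2 := ccont_mult _ _ (ccont_const (-1)) (ccont_cauchy _ p r n z Hr Hz (ccont_const 1))).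
      assert (S3 := ccont_cauchy _ p r (S n) z Hr Hz (ccont_const (- (INR n * h)))).
      assert (S4 := ccont_plus _ _ (ccont_plus _ _ S1 S2) S3).
      intros t. generalize (S4 t).
      replace (fun s : R => (/ (circle p r s - w)) ^ n - (/ (circle p r s - z)) ^ n -
        INR n * h * (/ (circle p r s - z)) ^ S n)%C with
       (fun t0 : R => 1 * (/ (circle p r t0 - w)) ^ n +
        (-1) * (1 * (/ (circle p r t0 - z)) ^ n) +
        - (INR n * h) * (/ (circle p r t0 - z)) ^ S n)%C.
      * intros [G1 G2]; split; [eapply continuous_ext; [|exact G1] | eapply continuous_ext; [|exact G2]];
          intros s; simpl; f_equal; ring.
      * apply functional_extensionality; intros; ring.
    + intros t Ht. rewrite Cmod_mult. apply Rmult_le_compat; auto using Cmod_ge_0.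
      assert (F1 := circle_far p r z t Hr). assert (F2 := circle_far p r w t Hr).
      assert (T : Cmod (w - p) <= Cmod h + Cmod (z - p)).
      { replace (w - p)%C with (h + (z - p))%C by (unfold h; ring). apply Cmod_triangle. }
      assert (Z1 := circle_ne p r z t Hr Hz). assert (Z2 := circle_ne p r w t Hr Hwp).
      apply BK.
      * rewrite Cmod_inv by auto. apply Rinv_le_contravar; auto. unfold d in *; lra.
      * rewrite Cmod_inv by auto. apply Rinv_le_contravar; auto. unfold d in *; lra.
      * unfold h. field. auto.
  - assert (0 <= Cmod h) by apply Cmod_ge_0.
    assert (0 <= W * K) by (apply Rmult_le_pos; auto).
    replace (2 * (W * (K * Cmod h ^ 2))) with (2 * (W * K) * Cmod h * Cmod h) by ring.
    apply Rmult_le_compat_r; auto.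
    apply Rle_trans with ((2 * (W * K) + 1) * (eps / (2 * (W * K) + 1))).
    + apply Rmult_le_compat; lra.
    + right. field. lra.
Qed.

Lemma cbox_of_Cmod (z0 z : C) (r : R) : Cmod (z - z0) < r -> cbox z0 r z.
Proof.
  intros H. assert (H1 := Re_le_Cmod (z - z0)). assert (H2 := Im_le_Cmod (z - z0)).
  split; [apply Rle_lt_trans with (2 := H); exact H1 | apply Rle_lt_trans with (2 := H); exact H2].
Qed.

Lemma Cmod_of_cbox (z0 z : C) (r : R) : cbox z0 r z -> Cmod (z - z0) < 2 * r.
Proof.
  intros [H1 H2]. apply Rle_lt_trans with (1 := Cmod_le_Rabs _).
  change (Re (z - z0)) with (Re z - Re z0). change (Im (z - z0)) with (Im z - Im z0). lra.
Qed.

Definition seg (z w : C) (s : R) : C := (z + RtoC s * (w - z))%C.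

Lemma comp_seg_derive (G g : C -> C) (z w : C) (s : R) :
  cderiv G (seg z w s) (g (seg z w s)) ->
  derivable_pt_lim (fun t => Re (G (seg z w t))) s (Re (g (seg z w s) * (w - z))%C) /\
  derivable_pt_lim (fun t => Im (G (seg z w t))) s (Im (g (seg z w s) * (w - z))%C).
Proof.
  intros HH. apply cderiv_real in HH. destruct HH as [H1 H2].
  assert (C1 : derivable_pt_lim (fun t => Re (seg z w t)) s (Re (w - z)%C)).
  { apply is_derive_Reals. unfold seg, Re; simpl. auto_derive; auto; ring. }
  assert (C2 : derivable_pt_lim (fun t => Im (seg z w t)) s (Im (w - z)%C)).
  { apply is_derive_Reals. unfold seg, Im; simpl. auto_derive; auto; ring. }
  assert (E : forall t, (Re (seg z w t), Im (seg z w t)) = seg z w t)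
    by (intros; destruct (seg z w t); reflexivity).
  split.
  - replace (fun t => Re (G (seg z w t))) with
      (fun t => Re (G (Re (seg z w t), Im (seg z w t))))
      by (apply functional_extensionality; intros; rewrite E; auto).
    replace (Re (g (seg z w s) * (w - z))%C) with
      (Re (g (seg z w s)) * Re (w - z)%C + - Im (g (seg z w s)) * Im (w - z)%C)
      by (simpl; unfold Re, Im; ring).
    apply (derivable_pt_lim_comp_2d (fun x y => Re (G (x, y)))); auto.
  - replace (fun t => Im (G (seg z w t))) with
      (fun t => Im (G (Re (seg z w t), Im (seg z w t))))
      by (apply functional_extensionality; intros; rewrite E; auto).
    replace (Im (g (seg z w s) * (w - z))%C) with
      (Im (g (seg z w s)) * Re (w - z)%C + Re (g (seg z w s)) * Im (w - z)%C)
      by (simpl; unfold Re, Im; ring).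
    apply (derivable_pt_lim_comp_2d (fun x y => Im (G (x, y)))); auto.
Qed.

Lemma seg_0 (z w : C) : seg z w 0 = z.
Proof. unfold seg. ring. Qed.

Lemma seg_1 (z w : C) : seg z w 1 = w.
Proof. unfold seg. ring. Qed.

Lemma seg_dist (z w : C) (s : R) : 0 <= s <= 1 -> Cmod (seg z w s - z) <= Cmod (w - z).
Proof.
  intros Hs. replace (seg z w s - z)%C with (RtoC s * (w - z))%C by (unfold seg; ring).
  rewrite Cmod_mult, Cmod_R, Rabs_pos_eq by lra.
  assert (0 <= Cmod (w - z)) by apply Cmod_ge_0. nra.
Qed.

(** The factor [2] comes from applying the mean value theorem to the two
    components separately. *)
Lemma cmean_value (G g : C -> C) (z w : C) (K : R) :
  (forall s, 0 <= s <= 1 -> cderiv G (seg z w s) (g (seg z w s)) /\ Cmod (g (seg z w s)) <= K) ->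
  Cmod (G w - G z) <= 2 * (K * Cmod (w - z)).
Proof.
  intros H.
  assert (Hb : forall u du : R -> R,
    (forall s, 0 <= s <= 1 -> derivable_pt_lim u s (du s) /\ Rabs (du s) <= K * Cmod (w - z)) ->
    Rabs (u 1 - u 0) <= K * Cmod (w - z)).
  { intros u du Hu.
    destruct (MVT_gen u 0 1 du) as (c & Hc & E).
    - intros s Hs. rewrite Rmin_left, Rmax_right in Hs by lra. apply is_derive_Reals, Hu; lra.
    - intros s Hs. rewrite Rmin_left, Rmax_right in Hs by lra.
      apply derivable_continuous_pt. exists (du s). apply Hu; lra.
    - rewrite Rmin_left, Rmax_right in Hc by lra. rewrite E, Rminus_0_r, Rmult_1_r.
      apply Hu; auto. }
  assert (B1 := Hb (fun t => Re (G (seg z w t))) (fun s => Re (g (seg z w s) * (w - z))%C)).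
  assert (B2 := Hb (fun t => Im (G (seg z w t))) (fun s => Im (g (seg z w s) * (w - z))%C)).
  cbv beta in B1, B2. rewrite seg_0, seg_1 in B1, B2.
  apply Rle_trans with (1 := Cmod_le_Rabs _).
  change (Re (G w - G z)) with (Re (G w) - Re (G z)).
  change (Im (G w - G z)) with (Im (G w) - Im (G z)).
  assert (P : forall s, 0 <= s <= 1 -> Cmod (g (seg z w s) * (w - z)) <= K * Cmod (w - z)).
  { intros s Hs. rewrite Cmod_mult. apply Rmult_le_compat_r; [apply Cmod_ge_0 | apply H; auto]. }
  enough (Rabs (Re (G w) - Re (G z)) <= K * Cmod (w - z) /\
          Rabs (Im (G w) - Im (G z)) <= K * Cmod (w - z)) by lra.
  split.
  - apply B1. intros s Hs. split; [apply comp_seg_derive, H; auto|].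
    apply Rle_trans with (2 := P s Hs). apply Re_le_Cmod.
  - apply B2. intros s Hs. split; [apply comp_seg_derive, H; auto|].
    apply Rle_trans with (2 := P s Hs). apply Im_le_Cmod.
Qed.

Lemma cderiv_scal (k : C) (f : C -> C) (z l : C) :
  cderiv f z l -> cderiv (fun w => k * f w)%C z (k * l)%C.
Proof.
  intros H. replace (k * l)%C with (0 * f z + k * l)%C by ring.
  apply (cderiv_mult (fun _ => k)); auto. apply cderiv_const.
Qed.

(** * Cauchy's formula and the smoothness of holomorphic functions *)

Definition diff_quot (F f : C -> C) (z w : C) : C :=
  if Ceq_dec w z then f z else ((F w - F z) / (w - z))%C.

Lemma cderiv_sub_const (F : C -> C) (z w l : C) :
  cderiv F w l -> cderiv (fun x => F x - F z)%C w l.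
Proof.
  intros H. replace l with (l + 0)%C by ring.
  apply cderiv_plus; auto. apply cderiv_const.
Qed.

(** The difference quotient of a primitive [F] of [f] is differentiable also
    at its removable point [z]: as [f] is differentiable at [z], [F] has there
    a Taylor expansion of order two. *)
Lemma diff_quot_derivable (F f : C -> C) (z0 : C) (r : R) (z : C) :
  cbox z0 r z ->
  (forall w, cbox z0 r w -> cderiv F w (f w)) ->
  (forall w, cbox z0 r w -> exists l, cderiv f w l) ->
  forall w, cbox z0 r w -> exists l, cderiv (diff_quot F f z) w l.
Proof.
  intros Hz HF Hf w Hw.
  destruct (Ceq_dec w z) as [->|Hne].
  - destruct (Hf z Hz) as [m Hm]. exists (m / 2)%C.
    assert (Hbox : exists d0, 0 < d0 /\ forall w, Cmod (w - z) < d0 -> cbox z0 r w).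
    { destruct Hz as [Z1 Z2]. exists (Rmin (r - Rabs (Re z - Re z0)) (r - Rabs (Im z - Im z0))).
      split; [apply Rmin_pos; lra|]. intros x Hx.
      assert (M1 := Rmin_l (r - Rabs (Re z - Re z0)) (r - Rabs (Im z - Im z0))).
      assert (M2 := Rmin_r (r - Rabs (Re z - Re z0)) (r - Rabs (Im z - Im z0))).
      destruct (cbox_of_Cmod z x _ Hx) as [X1 X2].
      split.
      - replace (Re x - Re z0) with ((Re x - Re z) + (Re z - Re z0)) by ring.
        apply Rle_lt_trans with (1 := Rabs_triang _ _). lra.
      - replace (Im x - Im z0) with ((Im x - Im z) + (Im z - Im z0)) by ring.
        apply Rle_lt_trans with (1 := Rabs_triang _ _). lra. }
    destruct Hbox as (d0 & Hd0 & Hbox).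
    apply cderiv_eps. intros eps He.
    assert (He2 : 0 < eps / 2) by lra.
    destruct (proj1 (cderiv_eps f z m) Hm _ He2) as (d1 & Hd1 & B1).
    exists (Rmin d0 d1); split; [apply Rmin_pos; auto|]. intros x Hx.
    assert (M1 := Rmin_l d0 d1). assert (M2 := Rmin_r d0 d1).
    unfold diff_quot. destruct (Ceq_dec z z) as [_|N]; [|congruence].
    destruct (Ceq_dec x z) as [->|Nx].
    + replace (f z - f z - (z - z) * (m / 2))%C with (RtoC 0) by ring.
      rewrite Cmod_0. apply Rmult_le_pos; [lra | apply Cmod_ge_0].
    + assert (Hxz : (x - z)%C <> 0%C).
      { intros E. apply Nx. replace x with ((x - z) + z)%C by ring. rewrite E. ring. }
      set (G := fun w => (F w + ((- f z) * (w - z) + (- m / 2) * ((w - z) * (w - z))))%C).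
      set (g := fun w => (f w + ((- f z) + (- m / 2) * ((w - z) + (w - z))))%C).
      assert (MV := cmean_value G g z x (eps / 2 * Cmod (x - z))).
      assert (HG : Cmod (G x - G z) <= 2 * (eps / 2 * Cmod (x - z) * Cmod (x - z))).
      { apply MV. intros s Hs. assert (Hsd := seg_dist z x s Hs).
        set (y := seg z x s) in *. split.
        - unfold G, g. apply cderiv_plus; [apply HF, Hbox; lra|].
          assert (Hi : cderiv (fun w => w - z)%C y 1%C).
          { replace (RtoC 1) with (1 + 0)%C by ring.
            apply (cderiv_plus (fun w => w) (fun _ => - z)%C); [apply cderiv_id | apply cderiv_const]. }
          replace (- f z + - m / 2 * (y - z + (y - z)))%C with
            ((- f z) * 1 + (- m / 2) * (1 * (y - z) + (y - z) * 1))%C by ring.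
          apply cderiv_plus; apply cderiv_scal; [exact Hi|].
          exact (cderiv_mult (fun w => w - z)%C (fun w => w - z)%C y 1 1 Hi Hi).
        - unfold g. replace (f y + (- f z + - m / 2 * (y - z + (y - z))))%C with
            (f y - f z - (y - z) * m)%C by field.
          apply Rle_trans with (1 := B1 y ltac:(lra)).
          apply Rmult_le_compat_l; lra. }
      replace ((F x - F z) / (x - z) - f z - (x - z) * (m / 2))%C with
        ((G x - G z) / (x - z))%C by (unfold G; field; auto).
      rewrite Cmod_div by auto.
      assert (P : 0 < Cmod (x - z)) by (apply Cmod_gt_0; auto).
      apply Rmult_le_reg_r with (Cmod (x - z)); auto.
      unfold Rdiv. rewrite Rmult_assoc, Rinv_l, Rmult_1_r by lra.
      apply Rle_trans with (1 := HG). right. field.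
  - assert (Hwz : (w - z)%C <> 0%C).
    { intros E. apply Hne. replace w with ((w - z) + z)%C by ring. rewrite E. ring. }
    eexists. apply (cderiv_ext_loc (fun x => (F x - F z) * / (x - z))%C) with (d := Cmod (w - z)).
    + apply Cmod_gt_0; auto.
    + intros x Hx. unfold diff_quot. destruct (Ceq_dec x z) as [->|_]; [|reflexivity].
      rewrite Cmod_sub_sym in Hx. lra.
    + apply cderiv_mult.
      * apply cderiv_sub_const. apply HF; auto.
      * apply (cderiv_inv (fun x => x - z)%C); auto.
        apply (cderiv_sub_const (fun x => x)). apply cderiv_id.
Qed.

Lemma RInt_constR (k a b : R) : RInt (fun _ => k) a b = (b - a) * k.
Proof. exact (RInt_const (V := R_CompleteNormedModule) a b k). Qed.

Lemma circle_in_cbox (p : C) (r r0 t : R) : 0 <= r < r0 -> cbox p r0 (circle p r t).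
Proof. intros H. apply cbox_of_Cmod. rewrite circle_dist; lra. Qed.

(** [z |-> int dw / (w - z)] has zero derivative inside the circle, since
    [1 / (w - z) ^ 2] has a primitive; its value is thus that at the centre. *)
Lemma winding_number_disc (p z : C) (r : R) : 0 < r -> Cmod (z - p) < r ->
  cauchy_int (dcircle r) p r 1 z = (RtoC (2 * PI) * Ci)%C.
Proof.
  intros Hr Hz.
  assert (H0 : cauchy_int (dcircle r) p r 1 p = (RtoC (2 * PI) * Ci)%C).
  { unfold cauchy_int. rewrite (cint_ext _ (fun _ => RtoC (2 * PI) * Ci)%C).
    - unfold cint. cbv beta. rewrite (RInt_constR (Re (RtoC (2 * PI) * Ci)%C)),
        (RInt_constR (Im (RtoC (2 * PI) * Ci)%C)).
      apply injective_projections; simpl; ring.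
    - intros t. rewrite (dcircle_eq p). rewrite Cpow_1_r || simpl.
      assert (N : (circle p r t - p)%C <> 0%C).
      { intros E. assert (D := circle_dist p r t). rewrite E, Cmod_0 in D. lra. }
      field. auto. }
  rewrite <- H0.
  enough (Cmod (cauchy_int (dcircle r) p r 1 z - cauchy_int (dcircle r) p r 1 p) <= 0) as E.
  { assert (E' := Cmod_ge_0 (cauchy_int (dcircle r) p r 1 z - cauchy_int (dcircle r) p r 1 p)).
    assert (E2 : (cauchy_int (dcircle r) p r 1 z - cauchy_int (dcircle r) p r 1 p)%C = 0%C)
      by (apply Cmod_eq_0; lra).
    transitivity (cauchy_int (dcircle r) p r 1 z - cauchy_int (dcircle r) p r 1 p
       + cauchy_int (dcircle r) p r 1 p)%C; [ring|]. rewrite E2. ring. }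
  replace 0 with (2 * (0 * Cmod (z - p))) by ring.
  apply (cmean_value _ (fun w => INR 1 * cauchy_int (dcircle r) p r 2 w)%C).
  intros s Hs. assert (Hsd := seg_dist p z s Hs). set (w := seg p z s) in *.
  assert (Hw : Cmod (w - p) < r) by lra.
  split; [apply cauchy_int_derive; auto using ccont_dcircle; lra|].
  assert (E : cauchy_int (dcircle r) p r 2 w = 0%C).
  { unfold cauchy_int.
    rewrite (cint_ext _ (fun t => (fun c => (/ (c - w)) ^ 2)%C (circle p r t) * dcircle r t)%C)
      by (intros; ring).
    apply (circle_int_exact (fun c => (-1) * / (c - w))%C (fun c => (/ (c - w)) ^ 2)%C).
    - intros t. assert (N := circle_ne p r w t (Rlt_le _ _ Hr) Hw).
      replace ((/ (circle p r t - w)) ^ 2)%C with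
        ((-1) * (- (1) / ((circle p r t - w) * (circle p r t - w))))%C
        by (simpl; field; auto).
      apply cderiv_scal.
      apply (cderiv_inv (fun c => c - w)%C); auto.
      apply (cderiv_sub_const (fun x => x)), cderiv_id.
    - apply ccont_pow, ccont_inv.
      + apply ccont_plus; [apply ccont_circle | apply ccont_const].
      + intros t. apply circle_ne; auto; lra. }
  rewrite E, Cmult_0_r, Cmod_0. lra.
Qed.

Lemma two_pi_i_neq_0 : (RtoC (2 * PI) * Ci)%C <> 0%C.
Proof.
  intros E. apply (f_equal Im) in E. simpl in E. generalize PI_RGT_0; lra.
Qed.

(** The difference quotient of [F] at [z] has a primitive, hence integral zero
    along the circle; what remains of the Cauchy integral is [F z] times the
    winding number. The hypothesis that [F] has a differentiable derivative makes
    the quotient differentiable at [z]. *)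
Lemma cauchy_formula (F f : C -> C) (z0 : C) (r r0 : R) :
  0 < r < r0 ->
  (forall w, cbox z0 r0 w -> cderiv F w (f w)) ->
  (forall w, cbox z0 r0 w -> exists l, cderiv f w l) ->
  forall z, Cmod (z - z0) < r ->
  F z = (/ (RtoC (2 * PI) * Ci) *
         cauchy_int (fun t => F (circle z0 r t) * dcircle r t) z0 r 1 z)%C.
Proof.
  intros Hr HF Hf z Hz.
  assert (Hbz : cbox z0 r0 z) by (apply cbox_of_Cmod; lra).
  destruct (cprimitive_in_box (diff_quot F f z) z0 r0) as [H HH].
  { apply diff_quot_derivable; auto. }
  assert (Hcirc : forall t, cbox z0 r0 (circle z0 r t)) by (intros; apply circle_in_cbox; lra).
  assert (Hne : forall t, (circle z0 r t - z)%C <> 0%C) by (intros; apply circle_ne; auto; lra).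
  assert (HdF : ccont (fun t => F (circle z0 r t))) by (apply (ccont_comp_circle F f); auto).
  assert (Hi : ccont (fun t => / (circle z0 r t - z))%C).
  { apply ccont_inv; auto. apply ccont_plus; [apply ccont_circle | apply ccont_const]. }
  assert (Hq : forall t, diff_quot F f z (circle z0 r t) =
     ((F (circle z0 r t) + - F z) * / (circle z0 r t - z))%C).
  { intros t. unfold diff_quot. destruct (Ceq_dec (circle z0 r t) z) as [E|_]; [|reflexivity].
    exfalso. apply (Hne t). rewrite E. ring. }
  assert (E := circle_int_exact H (diff_quot F f z) z0 r (fun t => HH _ (Hcirc t))).
  assert (Hc : ccont (fun t => diff_quot F f z (circle z0 r t))).
  { assert (Hc' := ccont_mult _ _ (ccont_plus _ _ HdF (ccont_const (- F z)%C)) Hi).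
    intros t. destruct (Hc' t) as [G1 G2].
    split; [eapply continuous_extR; [|exact G1] | eapply continuous_extR; [|exact G2]];
      intros s; simpl; rewrite Hq; reflexivity. }
  specialize (E Hc).
  assert (E2 : cint (fun t => diff_quot F f z (circle z0 r t) * dcircle r t)%C =
    (cauchy_int (fun t => F (circle z0 r t) * dcircle r t) z0 r 1 z +
     (- F z) * cauchy_int (dcircle r) z0 r 1 z)%C).
  { unfold cauchy_int.
    assert (Hz' : 0 <= r) by lra.
    rewrite <- cint_scal by (apply ccont_cauchy; auto using ccont_dcircle).
    rewrite <- cint_plus.
    - apply cint_ext. intros t. rewrite Hq. ring.
    - apply ccont_cauchy; auto. apply ccont_mult; auto using ccont_dcircle.
    - apply (ccont_mult (fun _ => (- F z)%C)); [apply ccont_const|].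
      apply ccont_cauchy; auto using ccont_dcircle. }
  rewrite E2, winding_number_disc in E by (auto; lra).
  assert (E3 : cauchy_int (fun t => F (circle z0 r t) * dcircle r t)%C z0 r 1 z =
     (F z * (RtoC (2 * PI) * Ci))%C).
  { transitivity (cauchy_int (fun t => F (circle z0 r t) * dcircle r t) z0 r 1 z +
      - F z * (RtoC (2 * PI) * Ci) + F z * (RtoC (2 * PI) * Ci))%C; [ring|]. rewrite E. ring. }
  rewrite E3. rewrite (Cmult_comm (F z)), Cmult_assoc, Cinv_l by apply two_pi_i_neq_0. ring.
Qed.

(** [f] has a primitive [F]; by Cauchy's formula [F] is a Cauchy integral, which
    can be differentiated any number of times, and [f] is its derivative. *)
Lemma holomorphic_derivative (f : C -> C) (z0 : C) (r0 : R) :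
  0 < r0 ->
  (forall w, cbox z0 r0 w -> exists l, cderiv f w l) ->
  exists f1 : C -> C, forall w, Cmod (w - z0) < r0 / 2 ->
    cderiv f w (f1 w) /\ exists l, cderiv f1 w l.
Proof.
  intros Hr Hf.
  destruct (cprimitive_in_box f z0 r0 Hf) as [F HF].
  set (r := r0 / 2).
  set (k := (/ (RtoC (2 * PI) * Ci))%C).
  set (om := fun t => (F (circle z0 r t) * dcircle r t)%C).
  assert (Hom : ccont om).
  { apply ccont_mult; [|apply ccont_dcircle]. apply (ccont_comp_circle F f).
    intros t; apply HF, circle_in_cbox. unfold r; lra. }
  assert (HFC : forall w, Cmod (w - z0) < r -> F w = (k * cauchy_int om z0 r 1 w)%C).
  { apply (cauchy_formula F f z0 r r0); auto. unfold r; lra. }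
  assert (Hnear : forall w, Cmod (w - z0) < r -> 0 < r - Cmod (w - z0) /\
    forall x, Cmod (x - w) < r - Cmod (w - z0) -> Cmod (x - z0) < r).
  { intros w Hw. split; [lra|]. intros x Hx.
    replace (x - z0)%C with ((x - w) + (w - z0))%C by ring.
    apply Rle_lt_trans with (1 := Cmod_triangle _ _). lra. }
  assert (Hd : forall n w, Cmod (w - z0) < r ->
    cderiv (fun w => k * cauchy_int om z0 r n w)%C w (k * (INR n * cauchy_int om z0 r (S n) w))%C).
  { intros n w Hw. apply cderiv_scal, cauchy_int_derive; auto. unfold r; lra. }
  assert (Hf1 : forall w, Cmod (w - z0) < r -> f w = (k * cauchy_int om z0 r 2 w)%C).
  { intros w Hw. apply (cderiv_unique F w).
    - apply HF, cbox_of_Cmod. unfold r in Hw; lra.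
    - destruct (Hnear w Hw) as [Hp Hx].
      apply (cderiv_ext_loc (fun w => k * cauchy_int om z0 r 1 w)%C F w _ _ Hp).
      + intros x Hx'. symmetry. apply HFC; auto.
      + replace (k * cauchy_int om z0 r 2 w)%C with (k * (INR 1 * cauchy_int om z0 r 2 w))%C
          by (simpl; ring).
        apply Hd; auto. }
  exists (fun w => k * (INR 2 * cauchy_int om z0 r 3 w))%C. intros w Hw. split.
  - destruct (Hnear w Hw) as [Hp Hx].
    apply (cderiv_ext_loc (fun w => k * cauchy_int om z0 r 2 w)%C f w _ _ Hp).
    + intros x Hx'. symmetry. apply Hf1; auto.
    + apply (Hd 2%nat); auto.
  - exists (k * (INR 2 * (INR 3 * cauchy_int om z0 r 4 w)))%C.
    apply cderiv_scal, cderiv_scal, cauchy_int_derive; auto. unfold r; lra.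
Qed.

Lemma cauchy_estimate (f : C -> C) (z0 l : C) (r0 M : R) :
  0 < r0 ->
  (forall w, cbox z0 r0 w -> exists l, cderiv f w l) ->
  (forall w, cbox z0 r0 w -> Cmod (f w) <= M) ->
  cderiv f z0 l -> Cmod l <= 16 * M / r0.
Proof.
  intros Hr Hf HM Hl.
  destruct (holomorphic_derivative f z0 r0 Hr Hf) as [f1 Hf1].
  set (r1 := r0 / 4). set (r := r0 / 8).
  assert (Hbox : forall w, cbox z0 r1 w -> Cmod (w - z0) < r0 / 2).
  { intros w Hw. apply Cmod_of_cbox in Hw. unfold r1 in Hw; lra. }
  set (k := (/ (RtoC (2 * PI) * Ci))%C).
  set (om := fun t => (f (circle z0 r t) * dcircle r t)%C).
  assert (Hcb : forall t, cbox z0 r1 (circle z0 r t)).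
  { intros t. apply circle_in_cbox. unfold r, r1; lra. }
  assert (Hom : ccont om).
  { apply ccont_mult; [|apply ccont_dcircle]. apply (ccont_comp_circle f f1).
    intros t; apply Hf1, Hbox, Hcb. }
  assert (HFC : forall w, Cmod (w - z0) < r -> f w = (k * cauchy_int om z0 r 1 w)%C).
  { apply (cauchy_formula f f1 z0 r r1).
    - unfold r, r1; lra.
    - intros w Hw; apply Hf1, Hbox; auto.
    - intros w Hw; apply Hf1, Hbox; auto. }
  assert (Hr' : 0 < r) by (unfold r; lra).
  assert (Hz : Cmod (z0 - z0) < r).
  { replace (z0 - z0)%C with (RtoC 0) by ring. rewrite Cmod_0; auto. }
  assert (E : l = (k * (INR 1 * cauchy_int om z0 r 2 z0))%C).
  { apply (cderiv_unique f z0); auto.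
    apply (cderiv_ext_loc (fun w => k * cauchy_int om z0 r 1 w)%C f z0 _ r); auto.
    - intros w Hw. symmetry; auto.
    - apply cderiv_scal, cauchy_int_derive; auto. lra. }
  assert (HPI := PI_RGT_0).
  assert (Hci : Cmod Ci = 1).
  { transitivity (sqrt 1); [unfold Cmod; simpl; f_equal; ring | apply sqrt_1]. }
  rewrite E. simpl INR. rewrite Cmult_1_l. unfold k.
  rewrite Cmod_mult, Cmod_inv by apply two_pi_i_neq_0.
  rewrite Cmod_mult, Cmod_R, Hci, Rabs_pos_eq by lra.
  assert (B : Cmod (cauchy_int om z0 r 2 z0) <= 2 * (M * (2 * PI * r) * (/ r) ^ 2)).
  { apply cint_bound.
    - apply ccont_cauchy; auto; lra.
    - intros t Ht. unfold om. rewrite !Cmod_mult, Cmod_dcircle by lra.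
      assert (N : (circle z0 r t - z0)%C <> 0%C) by (apply circle_ne; auto; lra).
      rewrite Cmod_pow, Cmod_inv, circle_dist by (auto; lra).
      apply Rmult_le_compat_r; [apply pow2_ge_0|].
      apply Rmult_le_compat_r; [nra|].
      apply HM. destruct (Hcb t); split; unfold r1 in *; lra. }
  apply Rle_trans with (/ (2 * PI * 1) * (2 * (M * (2 * PI * r) * (/ r) ^ 2))).
  - apply Rmult_le_compat_l; auto. apply Rlt_le, Rinv_0_lt_compat; lra.
  - right. unfold r. field. lra.
Qed.

(** * The logarithm of the modulus of [g] *)

Lemma locally_cbox (z : C) (P : C -> Prop) :
  locally z P <-> exists r, 0 < r /\ forall w, cbox z r w -> P w.
Proof.
  split.
  - intros [[r Hr] H]. exists r; split; [exact Hr|]. intros w [H1 H2]. apply H. split; [exact H1 | exact H2].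
  - intros (r & Hr & H). exists (mkposreal r Hr). intros w [H1 H2]. apply H. split; [exact H1 | exact H2].
Qed.

Lemma cbox_mono (z w : C) (r r' : R) : r <= r' -> cbox z r w -> cbox z r' w.
Proof. intros H [H1 H2]; split; lra. Qed.

Lemma cbox_center (z : C) (r : R) : 0 < r -> cbox z r z.
Proof. intros H; split; rewrite Rminus_diag, Rabs_R0; auto. Qed.

Lemma cbox_nested (z w : C) (r : R) : cbox z r w ->
  exists r', 0 < r' /\ forall x, cbox w r' x -> cbox z r x.
Proof.
  intros [H1 H2]. exists (Rmin (r - Rabs (Re w - Re z)) (r - Rabs (Im w - Im z))).
  split; [apply Rmin_pos; lra|]. intros x [X1 X2].
  assert (M1 := Rmin_l (r - Rabs (Re w - Re z)) (r - Rabs (Im w - Im z))).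
  assert (M2 := Rmin_r (r - Rabs (Re w - Re z)) (r - Rabs (Im w - Im z))).
  split.
  - replace (Re x - Re z) with ((Re x - Re w) + (Re w - Re z)) by ring.
    apply Rle_lt_trans with (1 := Rabs_triang _ _). lra.
  - replace (Im x - Im z) with ((Im x - Im w) + (Im w - Im z)) by ring.
    apply Rle_lt_trans with (1 := Rabs_triang _ _). lra.
Qed.

Lemma holomorphic_at_cbox (f : C -> C) (z : C) :
  holomorphic_at f z <->
  exists r, 0 < r /\ forall w, cbox z r w -> exists l, cderiv f w l.
Proof. apply locally_cbox. Qed.

(** [L = f' / f], which exists without a choice of logarithm. *)
Lemma log_derivative (f : C -> C) (z0 : C) (r0 : R) : 0 < r0 ->
  (forall w, cbox z0 r0 w -> f w <> 0%C /\ exists l, cderiv f w l) ->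
  exists r L L1, 0 < r <= r0 /\ forall w, cbox z0 r w ->
    cderiv f w (L w * f w)%C /\ cderiv L w (L1 w) /\ exists l, cderiv L1 w l.
Proof.
  intros Hr Hf.
  destruct (holomorphic_derivative f z0 r0 Hr (fun w Hw => proj2 (Hf w Hw))) as [f1 Hf1].
  assert (Hsmall : forall r w, cbox z0 (r / 4) w -> Cmod (w - z0) < r / 2).
  { intros r w Hw. apply Cmod_of_cbox in Hw. lra. }
  set (L := fun w => (f1 w * / f w)%C).
  assert (HL : forall w, cbox z0 (r0 / 4) w -> exists l, cderiv L w l).
  { intros w Hw. destruct (Hf1 w (Hsmall _ _ Hw)) as [H1 [l H2]].
    eexists. apply cderiv_mult; [exact H2|]. apply cderiv_inv; [|exact H1].
    apply Hf. apply cbox_mono with (2 := Hw). lra. }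
  destruct (holomorphic_derivative L z0 (r0 / 4) ltac:(lra) HL) as [L1 HL1].
  exists (r0 / 4 / 4), L, L1. split; [lra|]. intros w Hw.
  assert (Hw4 : cbox z0 (r0 / 4) w) by (apply cbox_mono with (2 := Hw); lra).
  destruct (HL1 w (Hsmall _ _ Hw)) as [H1 H2]. split; [|split; auto].
  replace (L w * f w)%C with (f1 w).
  - apply Hf1, Hsmall; auto.
  - unfold L. field. apply Hf. apply cbox_mono with (2 := Hw4). lra.
Qed.

Lemma regular_nonzero (g : C -> sphere) (z : C) : regular g z -> g z = Fin (toC (g z)) /\ toC (g z) <> 0%C.
Proof.
  intros H. unfold regular, zero_or_pole in H. destruct (g z) as [c|] eqn:E; simpl.
  - split; auto. intros ->. apply H; auto.
  - exfalso; apply H; auto.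
Qed.

Lemma nonzero_regular (g : C -> sphere) (z c : C) : g z = Fin c -> c <> 0%C -> regular g z.
Proof. intros E H [E'|E']; rewrite E in E'; congruence. Qed.

(** Where only [1 / g] is known to be holomorphic, [g] is the inverse of a
    function without zero. *)
Lemma regular_local (g : C -> sphere) (z0 : C) : meromorphic_cyl g -> regular g z0 ->
  exists r, 0 < r /\ forall w, cbox z0 r w ->
    regular g w /\ exists l, cderiv (fun w => toC (g w)) w l.
Proof.
  intros (_ & Hm & _) Hreg. destruct (regular_nonzero g z0 Hreg) as [Hg0 Hg1].
  assert (Hnz : forall (f : C -> C) r, 0 < r -> f z0 <> 0%C ->
    (forall w, cbox z0 r w -> exists l, cderiv f w l) ->
    exists r', 0 < r' <= r /\ forall w, cbox z0 r' w -> f w <> 0%C).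
  { intros f r Hr Hf0 Hf. destruct (Hf z0 (cbox_center z0 r Hr)) as [l Hl].
    assert (P : 0 < Cmod (f z0)) by (apply Cmod_gt_0; auto).
    destruct (cderiv_cont f z0 l Hl _ P) as (d & Hd & B).
    exists (Rmin r (d / 2)). split; [split; [apply Rmin_pos; lra | apply Rmin_l]|].
    intros w Hw E. specialize (B w).
    assert (Hwd : Cmod (w - z0) < d).
    { apply Cmod_of_cbox in Hw. generalize (Rmin_r r (d / 2)); lra. }
    specialize (B Hwd). rewrite E in B. rewrite Cmod_sub_sym in B.
    replace (f z0 - 0)%C with (f z0) in B by ring. lra. }
  destruct (Hm z0) as [[H1 H2]|[H1 H2]].
  - apply locally_cbox in H1. destruct H1 as (r1 & Hr1 & H1).
    apply holomorphic_at_cbox in H2. destruct H2 as (r2 & Hr2 & H2).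
    destruct (Hnz (fun w => toC (g w)) r2 Hr2 Hg1 H2) as (r3 & Hr3 & H3).
    exists (Rmin r1 r3). split; [apply Rmin_pos; lra|]. intros w Hw.
    assert (W1 : cbox z0 r1 w) by (apply cbox_mono with (2 := Hw), Rmin_l).
    assert (W3 : cbox z0 r3 w) by (apply cbox_mono with (2 := Hw), Rmin_r).
    split.
    + specialize (H1 w W1). specialize (H3 w W3).
      destruct (g w) as [c|] eqn:E; [|congruence].
      apply nonzero_regular with c; auto.
    + apply H2. apply cbox_mono with (2 := W3). lra.
  - apply locally_cbox in H1. destruct H1 as (r1 & Hr1 & H1).
    apply holomorphic_at_cbox in H2. destruct H2 as (r2 & Hr2 & H2).
    destruct (Hnz (fun w => toC (sph_inv (g w))) r2 Hr2) as (r3 & Hr3 & H3); auto.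
    { rewrite Hg0. simpl. destruct (Ceq_dec (toC (g z0)) 0) as [E|_]; [congruence|].
      simpl. intros E.
      assert (E2 : (toC (g z0) * / toC (g z0))%C = 1%C) by (apply Cinv_r; auto).
      rewrite E, Cmult_0_r in E2. apply RtoC_inj in E2. lra. }
    exists (Rmin r1 r3). split; [apply Rmin_pos; lra|].
    assert (HW : forall w, cbox z0 (Rmin r1 r3) w -> regular g w /\
       toC (g w) = (/ toC (sph_inv (g w)))%C).
    { intros w Hw.
      assert (W1 : cbox z0 r1 w) by (apply cbox_mono with (2 := Hw), Rmin_l).
      assert (W3 : cbox z0 r3 w) by (apply cbox_mono with (2 := Hw), Rmin_r).
      specialize (H1 w W1). specialize (H3 w W3).
      destruct (g w) as [c|] eqn:E; simpl in *; [|congruence].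
      destruct (Ceq_dec c 0) as [E0|N0]; [congruence|]. simpl.
      split; [apply nonzero_regular with c; auto|].
      field. auto. }
    intros w Hw. split; [apply HW; auto|].
    assert (W3 : cbox z0 r3 w) by (apply cbox_mono with (2 := Hw), Rmin_r).
    destruct (H2 w) as [l Hl]; [apply cbox_mono with (2 := W3); lra|].
    destruct (cbox_nested _ _ _ Hw) as (r' & Hr' & Hnest).
    eexists. apply (cderiv_ext_loc (fun w => / toC (sph_inv (g w)))%C) with (d := r'); auto.
    + intros x Hx. symmetry. apply HW, Hnest, cbox_of_Cmod; auto.
    + apply cderiv_inv; [|exact Hl]. apply H3; auto.
Qed.

Lemma differentiable_partial_x (f : R -> R -> R) (x y a b : R) :
  differentiable_pt_lim f x y a b -> is_derive (fun t => f t y) x a.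
Proof.
  intros H. apply is_derive_Reals.
  replace a with (a * 1 + b * 0) by ring.
  apply (derivable_pt_lim_comp_2d f (fun t => t) (fun _ => y) x a b 1 0 H).
  - apply derivable_pt_lim_id.
  - apply derivable_pt_lim_const.
Qed.

Lemma differentiable_partial_y (f : R -> R -> R) (x y a b : R) :
  differentiable_pt_lim f x y a b -> is_derive (fun t => f x t) y b.
Proof.
  intros H. apply is_derive_Reals.
  replace b with (a * 0 + b * 1) by ring.
  apply (derivable_pt_lim_comp_2d f (fun _ => x) (fun t => t) y a b 0 1 H).
  - apply derivable_pt_lim_const.
  - apply derivable_pt_lim_id.
Qed.

Lemma cderiv_partials (f : C -> C) (x y : R) (l : C) : cderiv f (x, y) l ->
  is_derive (fun t => Re (f (t, y))) x (Re l) /\ is_derive (fun t => Im (f (t, y))) x (Im l) /\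
  is_derive (fun t => Re (f (x, t))) y (- Im l) /\ is_derive (fun t => Im (f (x, t))) y (Re l).
Proof.
  intros H. apply cderiv_real in H. destruct H as [H1 H2].
  split; [|split; [|split]].
  - exact (differentiable_partial_x _ _ _ _ _ H1).
  - exact (differentiable_partial_x _ _ _ _ _ H2).
  - exact (differentiable_partial_y _ _ _ _ _ H1).
  - exact (differentiable_partial_y _ _ _ _ _ H2).
Qed.

Lemma cderiv_continuity_2d (f : C -> C) (x y : R) (l : C) : cderiv f (x, y) l ->
  continuity_2d_pt (fun u v => Re (f (u, v))) x y /\
  continuity_2d_pt (fun u v => Im (f (u, v))) x y.
Proof.
  intros H. apply cderiv_real in H. destruct H as [H1 H2].
  split; apply differentiable_continuity_pt; eexists; eexists; eassumption.
Qed.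

Lemma Cmod_sqr (z : C) : Cmod z ^ 2 = Re z ^ 2 + Im z ^ 2.
Proof.
  unfold Cmod. rewrite pow2_sqrt; [reflexivity|].
  unfold Re, Im. nra.
Qed.

Lemma ln_Cmod_half (z : C) : z <> 0%C -> ln (Cmod z) = / 2 * ln (Re z ^ 2 + Im z ^ 2).
Proof.
  intros H. rewrite <- Cmod_sqr. assert (P := proj1 (Cmod_gt_0 z) H).
  replace (Cmod z ^ 2) with (Cmod z * Cmod z) by ring.
  rewrite ln_mult by auto. field.
Qed.

Lemma is_derive_ext_near (f g : R -> R) (x l d : R) : 0 < d ->
  (forall t, Rabs (t - x) < d -> f t = g t) -> is_derive f x l -> is_derive g x l.
Proof.
  intros Hd H. apply is_derive_ext_loc. exists (mkposreal d Hd). intros t Ht. apply H. exact Ht.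
Qed.

(** The real part of [(log f)' = f' / f]. *)
Lemma ln_Cmod_derive (f : R -> C) (t : R) (p : C) :
  f t <> 0%C ->
  is_derive (fun s => Re (f s)) t (Re (p * f t)%C) ->
  is_derive (fun s => Im (f s)) t (Im (p * f t)%C) ->
  is_derive (fun s => ln (Cmod (f s))) t (Re p).
Proof.
  intros H0 H1 H2.
  assert (Hp : 0 < Re (f t) ^ 2 + Im (f t) ^ 2).
  { rewrite <- Cmod_sqr. apply pow_lt, Cmod_gt_0; auto. }
  assert (Hloc : exists d, 0 < d /\ forall s, Rabs (s - t) < d -> f s <> 0%C).
  { assert (Hc : continuous (fun s => Re (f s) ^ 2 + Im (f s) ^ 2) t).
    { apply (ex_derive_continuous (V := R_NormedModule)).
      apply (ex_derive_plus (V := R_NormedModule) (fun s => Re (f s) ^ 2) (fun s => Im (f s) ^ 2));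
        apply ex_derive_pow; eexists; eassumption. }
    apply filterlim_locally with (eps := mkposreal _ Hp) in Hc.
    destruct Hc as [d Hd]. exists d; split; [apply cond_pos|].
    intros s Hs E. specialize (Hd s Hs). unfold ball in Hd; simpl in Hd.
    unfold AbsRing_ball, abs, minus, plus, opp in Hd; simpl in Hd.
    rewrite E in Hd. simpl in Hd. apply Rabs_def2 in Hd. simpl in *. lra. }
  destruct Hloc as (d & Hd & Hne).
  apply (is_derive_ext_near (fun s => / 2 * ln (Re (f s) ^ 2 + Im (f s) ^ 2))) with d; auto.
  { intros s Hs. symmetry. apply ln_Cmod_half; auto. }
  evar_last.
  - apply is_derive_scal. apply (is_derive_comp ln (fun s => Re (f s) ^ 2 + Im (f s) ^ 2)).
    + apply is_derive_Reals. apply derivable_pt_lim_ln; auto.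
    + apply (is_derive_plus (V := R_NormedModule) (fun s => Re (f s) ^ 2) (fun s => Im (f s) ^ 2));
        apply is_derive_pow; eassumption.
  - simpl. unfold plus, scal, mult; simpl. unfold mult; simpl. unfold Re, Im in *. simpl in *.
    field. simpl in Hp. lra.
Qed.

Definition ell (g : C -> sphere) (x y : R) : R := ln (Cmod (toC (g (x, y)))).
Definition ell_x (g : C -> sphere) (x y : R) : R := Derive (fun t => ell g t y) x.
Definition ell_y (g : C -> sphere) (x y : R) : R := Derive (fun t => ell g x t) y.
Definition ell_xx (g : C -> sphere) (x y : R) : R := Derive (fun t => ell_x g t y) x.

Lemma regular_log_derivative (g : C -> sphere) (z0 : C) : meromorphic_cyl g -> regular g z0 ->
  exists r L L1, 0 < r /\ forall w, cbox z0 r w ->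
    regular g w /\ cderiv (fun w => toC (g w)) w (L w * toC (g w))%C /\
    cderiv L w (L1 w) /\ exists l, cderiv L1 w l.
Proof.
  intros Hm Hr. destruct (regular_local g z0 Hm Hr) as (r0 & Hr0 & H0).
  destruct (log_derivative (fun w => toC (g w)) z0 r0 Hr0) as (r & L & L1 & Hr1 & H1).
  { intros w Hw. destruct (H0 w Hw) as [R1 R2]. split; auto. apply regular_nonzero; auto. }
  exists r, L, L1. split; [lra|]. intros w Hw. split; [|apply H1; auto].
  apply H0, cbox_mono with (2 := Hw). lra.
Qed.

Lemma Im_as_Re (l : C) : - Im l = Re (Ci * l)%C.
Proof. unfold Re, Im; simpl; ring. Qed.

Lemma ell_derive (g : C -> sphere) (x y : R) (p : C) :
  toC (g (x, y)) <> 0%C -> cderiv (fun w => toC (g w)) (x, y) (p * toC (g (x, y)))%C ->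
  is_derive (fun t => ell g t y) x (Re p) /\ is_derive (fun t => ell g x t) y (- Im p).
Proof.
  intros H0 H. destruct (cderiv_partials _ _ _ _ H) as (D1 & D2 & D3 & D4). split.
  - apply (ln_Cmod_derive (fun t => toC (g (t, y)))); auto.
  - rewrite Im_as_Re. apply (ln_Cmod_derive (fun t => toC (g (x, t)))); auto.
    + replace (Re (Ci * p * toC (g (x, y)))%C) with (- Im (p * toC (g (x, y)))%C)
        by (unfold Re, Im; simpl; ring). exact D3.
    + replace (Im (Ci * p * toC (g (x, y)))%C) with (Re (p * toC (g (x, y)))%C)
        by (unfold Re, Im; simpl; ring). exact D4.
Qed.

Lemma cbox_line_x (z0 : C) (r x y : R) : cbox z0 r (x, y) ->
  exists d, 0 < d /\ forall t, Rabs (t - x) < d -> cbox z0 r (t, y).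
Proof.
  intros H. destruct (cbox_nested _ _ _ H) as (d & Hd & B). exists d; split; [exact Hd|].
  intros t Ht. apply B. split; simpl; auto. rewrite Rminus_diag, Rabs_R0; auto.
Qed.

Lemma cbox_line_y (z0 : C) (r x y : R) : cbox z0 r (x, y) ->
  exists d, 0 < d /\ forall t, Rabs (t - y) < d -> cbox z0 r (x, t).
Proof.
  intros H. destruct (cbox_nested _ _ _ H) as (d & Hd & B). exists d; split; [exact Hd|].
  intros t Ht. apply B. split; simpl; auto. rewrite Rminus_diag, Rabs_R0; auto.
Qed.

Lemma continuity_2d_near (f h : R -> R -> R) (z0 : C) (r x y : R) : cbox z0 r (x, y) ->
  (forall u v, cbox z0 r (u, v) -> f u v = h u v) ->
  continuity_2d_pt f x y -> continuity_2d_pt h x y.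
Proof.
  intros Hb He Hf. apply continuity_2d_pt_ext_loc with f; auto.
  destruct (cbox_nested _ _ _ Hb) as (d & Hd & B). exists (mkposreal d Hd).
  intros u v Hu Hv. apply He, B. split; auto.
Qed.

(** [ell_x = Re L] and [ell_y = - Im L] with [L = g' / g] holomorphic; the
    Cauchy-Riemann equations for [L] make [ell] harmonic. *)
Lemma ell_harmonic (g : C -> sphere) (x y : R) : meromorphic_cyl g -> regular g (x, y) ->
  (is_derive (fun t => ell g t y) x (ell_x g x y) /\
   is_derive (fun t => ell g x t) y (ell_y g x y) /\
   is_derive (fun t => ell_x g t y) x (ell_xx g x y) /\
   is_derive (fun t => ell_y g x t) y (- ell_xx g x y)) /\
  (continuity_2d_pt (ell g) x y /\ continuity_2d_pt (ell_x g) x y /\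
   continuity_2d_pt (ell_y g) x y /\ continuity_2d_pt (ell_xx g) x y).
Proof.
  intros Hm Hreg.
  destruct (regular_log_derivative g (x, y) Hm Hreg) as (r & L & L1 & Hr & H).
  assert (Hc := cbox_center (x, y) r Hr).
  assert (Hd : forall u v, cbox (x, y) r (u, v) ->
    is_derive (fun t => ell g t v) u (Re (L (u, v))) /\
    is_derive (fun t => ell g u t) v (- Im (L (u, v)))).
  { intros u v Huv. destruct (H _ Huv) as (R1 & R2 & _). apply ell_derive; auto.
    apply regular_nonzero; auto. }
  assert (Hx : forall u v, cbox (x, y) r (u, v) -> ell_x g u v = Re (L (u, v)))
    by (intros u v Huv; apply is_derive_unique, Hd; auto).
  assert (Hy : forall u v, cbox (x, y) r (u, v) -> ell_y g u v = - Im (L (u, v)))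
    by (intros u v Huv; apply is_derive_unique, Hd; auto).
  assert (Hxx : forall u v, cbox (x, y) r (u, v) ->
     is_derive (fun t => ell_x g t v) u (Re (L1 (u, v)))).
  { intros u v Huv. destruct (H _ Huv) as (_ & _ & R3 & _).
    destruct (cbox_line_x _ _ _ _ Huv) as (d & Hd' & B).
    apply (is_derive_ext_near (fun t => Re (L (t, v)))) with d; auto.
    - intros t Ht. symmetry; auto.
    - apply (cderiv_partials _ _ _ _ R3). }
  assert (Hxx' : forall u v, cbox (x, y) r (u, v) -> ell_xx g u v = Re (L1 (u, v)))
    by (intros u v Huv; apply is_derive_unique, Hxx; auto).
  destruct (H _ Hc) as (R1 & R2 & R3 & [l R4]).
  split; [split; [|split; [|split]] | split; [|split; [|split]]].
  - rewrite Hx by auto. apply Hd; auto.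
  - rewrite Hy by auto. apply Hd; auto.
  - rewrite Hxx' by auto. apply Hxx; auto.
  - rewrite Hxx' by auto. destruct (cbox_line_y _ _ _ _ Hc) as (d & Hd' & B).
    apply (is_derive_ext_near (fun t => - Im (L (x, t)))) with d; auto.
    + intros t Ht. symmetry; auto.
    + apply (is_derive_opp (V := R_NormedModule) (fun t => Im (L (x, t)))).
      apply (cderiv_partials _ _ _ _ R3).
  - destruct (cderiv_continuity_2d _ _ _ _ R2) as [C1 C2].
    assert (Hn : forall u v, cbox (x, y) r (u, v) ->
       0 < Re (toC (g (u, v))) ^ 2 + Im (toC (g (u, v))) ^ 2).
    { intros u v Huv. rewrite <- Cmod_sqr. apply pow_lt, Cmod_gt_0.
      apply regular_nonzero, H; auto. }
    apply (continuity_2d_near (fun u v => / 2 * ln (Re (toC (g (u, v))) * Re (toC (g (u, v)))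
       + Im (toC (g (u, v))) * Im (toC (g (u, v)))))) with (1 := Hc).
    { intros u v Huv. unfold ell. rewrite ln_Cmod_half; [f_equal; f_equal; ring|].
      apply regular_nonzero, H; auto. }
    apply continuity_2d_pt_mult; [apply continuity_2d_pt_const|].
    apply continuity_1d_2d_pt_comp.
    + apply derivable_continuous_pt. eexists. apply derivable_pt_lim_ln.
      specialize (Hn x y Hc). simpl in Hn. lra.
    + apply continuity_2d_pt_plus; apply continuity_2d_pt_mult; auto.
  - apply (continuity_2d_near (fun u v => Re (L (u, v)))) with (1 := Hc).
    + intros; symmetry; auto.
    + apply (cderiv_continuity_2d _ _ _ _ R3).
  - apply (continuity_2d_near (fun u v => - Im (L (u, v)))) with (1 := Hc).
    + intros; symmetry; auto.
    + apply continuity_2d_pt_opp. apply (cderiv_continuity_2d _ _ _ _ R3).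
  - apply (continuity_2d_near (fun u v => Re (L1 (u, v)))) with (1 := Hc).
    + intros; symmetry; auto.
    + apply (cderiv_continuity_2d _ _ _ _ R4).
Qed.

(** * The induced metric and the Jacobi equation in the coordinate [z] *)

Lemma Re_RInt_C (f : R -> C) (a b : R) :
  ex_RInt (fun t => Re (f t)) a b -> ex_RInt (fun t => Im (f t)) a b ->
  Re (RInt (V := C_R_CompleteNormedModule) f a b) = RInt (fun t => Re (f t)) a b.
Proof.
  intros H1 H2.
  rewrite (is_RInt_unique (V := C_R_CompleteNormedModule) f a b
    (RInt (fun t => Re (f t)) a b, RInt (fun t => Im (f t)) a b)).
  - reflexivity.
  - apply (is_RInt_fct_extend_pair (U := R_NormedModule) (V := R_NormedModule)).
    + exact (RInt_correct (fun t => Re (f t)) a b H1).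
    + exact (RInt_correct (fun t => Im (f t)) a b H2).
Qed.

Lemma seg_path_deriv (z w : C) (t : R) :
  is_derive (fun s => Re (seg z w s)) t (Re (w - z)%C) /\
  is_derive (fun s => Im (seg z w s)) t (Im (w - z)%C) /\
  path_deriv (seg z w) t = (w - z)%C.
Proof.
  assert (C1 : is_derive (fun t => Re (seg z w t)) t (Re (w - z)%C)).
  { unfold seg, Re; simpl. auto_derive; auto; ring. }
  assert (C2 : is_derive (fun t => Im (seg z w t)) t (Im (w - z)%C)).
  { unfold seg, Im; simpl. auto_derive; auto; ring. }
  split; [exact C1|split; [exact C2|]].
  transitivity (Re (w - z)%C, Im (w - z)%C).
  - unfold path_deriv. f_equal; apply is_derive_unique; assumption.
  - destruct (w - z)%C; reflexivity.
Qed.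

Lemma seg_C1_path (z w : C) : C1_path (seg z w).
Proof.
  intros t _. destruct (seg_path_deriv z w t) as (H1 & H2 & _).
  split; [eexists; exact H1|split; [eexists; exact H2|]].
  apply (continuous_ext (fun _ => (w - z)%C)); [|apply continuous_const].
  intros s. symmetry. apply seg_path_deriv.
Qed.

Lemma seg_in_cbox (z w : C) (d s : R) : 0 < d -> cbox z d w -> 0 <= s <= 1 -> cbox z d (seg z w s).
Proof.
  intros Hd [H1 H2] Hs. unfold seg. split; simpl.
  - replace (fst z + (s * (fst w + - fst z) - 0 * (snd w + - snd z)) - Re z)
      with (s * (Re w - Re z)) by (unfold Re; ring).
    rewrite Rabs_mult, (Rabs_pos_eq s) by lra.
    generalize (Rabs_pos (Re w - Re z)); nra.
  - replace (snd z + (s * (snd w + - snd z) + 0 * (fst w + - fst z)) - Im z)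
      with (s * (Im w - Im z)) by (unfold Im; ring).
    rewrite Rabs_mult, (Rabs_pos_eq s) by lra.
    generalize (Rabs_pos (Im w - Im z)); nra.
Qed.

(** Near [z0] the increments of [h] along segments agree with those of the real
    part of a primitive of [phi]. *)
Lemma path_integral_differential (U : C -> Prop) (phi : C -> C) (h : C -> R) (z0 : C) (r : R) :
  0 < r ->
  (forall gamma, C1_path gamma -> path_in U gamma ->
     h (gamma 1) = h (gamma 0) + Re (line_int phi gamma)) ->
  (forall w, cbox z0 r w -> U w /\ exists l, cderiv phi w l) ->
  differentiable_pt_lim (fun x y => h (x, y)) (Re z0) (Im z0) (Re (phi z0)) (- Im (phi z0)).
Proof.
  intros Hr Hh Hphi [eps Heps].
  assert (Hp0 : (Re z0, Im z0) = z0) by (destruct z0; reflexivity).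
  assert (He2 : 0 < eps / 2) by lra.
  destruct (proj2 (Hphi z0 (cbox_center z0 r Hr))) as [l Hl].
  destruct (cderiv_cont phi z0 l Hl _ He2) as (d & Hd & B).
  assert (Hm : 0 < Rmin r (d / 2)) by (apply Rmin_pos; lra).
  exists (mkposreal _ Hm). simpl. intros u v Hu Hv.
  assert (M1 := Rmin_l r (d / 2)). assert (M2 := Rmin_r r (d / 2)).
  set (w := (u, v) : C).
  assert (Hw : cbox z0 (Rmin r (d / 2)) w) by (split; auto).
  assert (Hseg : forall s, 0 <= s <= 1 -> cbox z0 (Rmin r (d / 2)) (seg z0 w s))
    by (intros; apply seg_in_cbox; auto).
  assert (HI := Hh (seg z0 w) (seg_C1_path z0 w)
     (fun t Ht => proj1 (Hphi _ (cbox_mono _ _ _ _ M1 (Hseg t Ht))))).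
  rewrite seg_0, seg_1 in HI. rewrite Hp0. fold w. rewrite HI.
  assert (Hcont : forall s, 0 <= s <= 1 ->
    continuous (fun s => Re (phi (seg z0 w s) * path_deriv (seg z0 w) s)%C) s /\
    continuous (fun s => Im (phi (seg z0 w s) * path_deriv (seg z0 w) s)%C) s).
  { intros s Hs.
    destruct (proj2 (Hphi _ (cbox_mono _ _ _ _ M1 (Hseg s Hs)))) as [m Hm'].
    destruct (comp_seg_derive phi (fun _ => m) z0 w s Hm') as [D1 D2].
    assert (K1 : continuous (fun s => Re (phi (seg z0 w s))) s)
      by (apply (ex_derive_continuous (V := R_NormedModule)); eexists; apply is_derive_Reals; exact D1).
    assert (K2 : continuous (fun s => Im (phi (seg z0 w s))) s)
      by (apply (ex_derive_continuous (V := R_NormedModule)); eexists; apply is_derive_Reals; exact D2).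
    split.
    - apply continuous_extR with (fun s => Re (phi (seg z0 w s)) * Re (w - z0)%C
         + - (Im (phi (seg z0 w s)) * Im (w - z0)%C)).
      + intros t. rewrite (proj2 (proj2 (seg_path_deriv z0 w t))). reflexivity.
      + apply continuous_plusR; [|apply continuous_oppR]; apply continuous_multR; auto;
          apply continuous_const.
    - apply continuous_extR with (fun s => Re (phi (seg z0 w s)) * Im (w - z0)%C
         + Im (phi (seg z0 w s)) * Re (w - z0)%C).
      + intros t. rewrite (proj2 (proj2 (seg_path_deriv z0 w t))). reflexivity.
      + apply continuous_plusR; apply continuous_multR; auto; apply continuous_const. }
  unfold line_int. rewrite Re_RInt_C by (apply ex_RInt_cont; [lra|apply Hcont]).
  assert (NC := RInt_near_const
    (fun s => Re (phi (seg z0 w s) * path_deriv (seg z0 w) s)%C) 0 1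
    (Re (phi z0 * (w - z0))%C) (eps / 2 * Cmod (w - z0))).
  rewrite Rmin_left, Rmax_right, Rminus_0_r, Rabs_R1, !Rmult_1_r in NC by lra.
  match type of NC with ?A -> _ => assert (HA : A) end.
  { intros s Hs. split; [exact (proj1 (Hcont s Hs))|].
    rewrite (proj2 (proj2 (seg_path_deriv z0 w s))).
    change (Re (phi (seg z0 w s) * (w - z0))%C - Re (phi z0 * (w - z0))%C)
      with (Re (phi (seg z0 w s) * (w - z0) - phi z0 * (w - z0))%C).
    apply Rle_trans with (1 := Re_le_Cmod _).
    replace (phi (seg z0 w s) * (w - z0) - phi z0 * (w - z0))%C
      with ((phi (seg z0 w s) - phi z0) * (w - z0))%C by ring.
    rewrite Cmod_mult. apply Rmult_le_compat_r; [apply Cmod_ge_0|].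
    apply Rlt_le, B. apply Rlt_le_trans with (1 := Cmod_of_cbox _ _ _ (Hseg s Hs)). lra. }
  specialize (NC HA).
  assert (HM := Cmod_le_max (w - z0)).
  change (Re (w - z0)) with (u - Re z0) in HM. change (Im (w - z0)) with (v - Im z0) in HM.
  match goal with |- Rabs ?a <= _ => match type of NC with Rabs ?b <= _ =>
    replace a with b by (unfold w, Re, Im; simpl; ring) end end.
  nra.
Qed.

(** [|X_x|^2] for the Weierstrass data of [g = e^(ell + i theta)]: it is
    [cosh(ell)^2]. *)
Definition conformal_factor (l : R) : R := ((exp l + exp (- l)) / 2) ^ 2.

Lemma weierstrass_metric (c : C) : c <> 0%C ->
  let w1 := (/ 2 * (/ c - c))%C in let w2 := (Ci / 2 * (/ c + c))%C in
  Re w1 * Re w1 + Re w2 * Re w2 + 1 * 1 = conformal_factor (ln (Cmod c)) /\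
  Re w1 * - Im w1 + Re w2 * - Im w2 + 1 * 0 = 0 /\
  - Im w1 * - Im w1 + - Im w2 * - Im w2 + 0 * 0 = conformal_factor (ln (Cmod c)).
Proof.
  intros H w1 w2. assert (P := proj1 (Cmod_gt_0 c) H).
  assert (Hm := Cmod_sqr c).
  set (m := Re c ^ 2 + Im c ^ 2) in *.
  assert (Hm0 : m <> 0) by (rewrite <- Hm; nra).
  assert (E : conformal_factor (ln (Cmod c)) = (/ m + 2 + m) / 4).
  { unfold conformal_factor. rewrite exp_Ropp, exp_ln by auto. rewrite <- Hm. field. lra. }
  assert (Hi : / m * m = 1) by (apply Rinv_l; auto).
  assert (E1 : w1 = ((Re c * / m - Re c) / 2, (- Im c * / m - Im c) / 2)).
  { unfold w1. apply injective_projections; unfold m, Re, Im in *; simpl in *; field; lra. }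
  assert (E2 : w2 = (- ((- Im c * / m + Im c) / 2), (Re c * / m + Re c) / 2)).
  { unfold w2. apply injective_projections; unfold m, Re, Im in *; simpl in *; field; lra. }
  rewrite E, E1, E2. cbn [fst snd Re Im].
  assert (K1 : (/ m - 2) * (/ m * m - 1) = 0) by (rewrite Hi; ring).
  assert (K2 : (/ m + 2) * (/ m * m - 1) = 0) by (rewrite Hi; ring).
  assert (Em : Re c ^ 2 + Im c ^ 2 = m) by reflexivity.
  unfold Re, Im in *. clearbody m.
  set (i := / m) in *. clearbody i. clear - K1 K2 Em. subst m.
  set (a := fst c) in *. set (b := snd c) in *. clearbody a b.
  split; [|split]; apply Rminus_diag_uniq.
  - transitivity (/ 4 * ((i - 2) * (i * (a ^ 2 + b ^ 2) - 1))); [field | rewrite K1; ring].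
  - field.
  - transitivity (/ 4 * ((i + 2) * (i * (a ^ 2 + b ^ 2) - 1))); [field | rewrite K2; ring].
Qed.

Lemma weierstrass_cderiv (g : C -> sphere) (z : C) : meromorphic_cyl g -> regular g z ->
  (exists l, cderiv (weierstrass1 g) z l) /\ (exists l, cderiv (weierstrass2 g) z l).
Proof.
  intros Hm Hr. destruct (regular_local g z Hm Hr) as (r & Hr0 & H).
  destruct (H z (cbox_center z r Hr0)) as [_ [l Hl]].
  destruct (regular_nonzero g z Hr) as [_ Hn].
  assert (Hi := cderiv_inv _ _ _ Hn Hl). cbv beta in Hi.
  split; eexists.
  - apply (cderiv_scal (/ 2)%C (fun w => / toC (g w) - toC (g w))%C).
    apply (cderiv_plus (fun w => / toC (g w))%C (fun w => - toC (g w))%C); [exact Hi|].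
    replace (fun w => - toC (g w))%C with (fun w => (-1) * toC (g w))%C
      by (apply functional_extensionality; intros; ring).
    apply cderiv_scal; exact Hl.
  - apply (cderiv_scal (Ci / 2)%C (fun w => / toC (g w) + toC (g w))%C).
    apply (cderiv_plus (fun w => / toC (g w))%C (fun w => toC (g w))%C); [exact Hi|exact Hl].
Qed.

Lemma pair_eta (z : C) : (Re z, Im z) = z.
Proof. destruct z; reflexivity. Qed.

Lemma induced_metric (g : C -> sphere) (X : C -> R3) (x y : R) :
  meromorphic_cyl g -> weierstrass_param g X -> regular g (x, y) ->
  EE X (x, y) = conformal_factor (ell g x y) /\ FF X (x, y) = 0 /\
  GG X (x, y) = conformal_factor (ell g x y).
Proof.
  intros Hm [_ HX] Hr. destruct (regular_local g (x, y) Hm Hr) as (r & Hr0 & H).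
  assert (D1 := path_integral_differential (regular g) (weierstrass1 g) (fun w => Defs.c1 (X w)) (x, y) r Hr0
    (fun gam Hg Hp => proj1 (HX gam Hg Hp))
    (fun w Hw => conj (proj1 (H w Hw)) (proj1 (weierstrass_cderiv g w Hm (proj1 (H w Hw)))))).
  assert (D2 := path_integral_differential (regular g) (weierstrass2 g) (fun w => c2 (X w)) (x, y) r Hr0
    (fun gam Hg Hp => proj1 (proj2 (HX gam Hg Hp)))
    (fun w Hw => conj (proj1 (H w Hw)) (proj2 (weierstrass_cderiv g w Hm (proj1 (H w Hw)))))).
  assert (D3 := path_integral_differential (regular g) weierstrass3 (fun w => c3 (X w)) (x, y) r Hr0
    (fun gam Hg Hp => proj2 (proj2 (HX gam Hg Hp)))
    (fun w Hw => conj (proj1 (H w Hw)) (ex_intro _ _ (cderiv_const 1 w)))).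
  change (Re (x, y)) with x in D1, D2, D3. change (Im (x, y)) with y in D1, D2, D3.
  assert (P : forall (f : C -> R) a b, differentiable_pt_lim (fun x y => f (x, y)) x y a b ->
    pdx f (x, y) = a /\ pdy f (x, y) = b).
  { intros f a b D. split; apply is_derive_unique.
    - exact (differentiable_partial_x _ _ _ _ _ D).
    - exact (differentiable_partial_y _ _ _ _ _ D). }
  apply (P (fun w => Defs.c1 (X w))) in D1. apply (P (fun w => c2 (X w))) in D2.
  apply (P (fun w => c3 (X w))) in D3. destruct D1 as [A1 B1], D2 as [A2 B2], D3 as [A3 B3].
  destruct (regular_nonzero g _ Hr) as [_ Hn].
  destruct (weierstrass_metric (toC (g (x, y))) Hn) as (W1 & W2 & W3).
  change (EE X (x, y)) with
    (pdx (fun w => Defs.c1 (X w)) (x, y) * pdx (fun w => Defs.c1 (X w)) (x, y) +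
     pdx (fun w => c2 (X w)) (x, y) * pdx (fun w => c2 (X w)) (x, y) +
     pdx (fun w => c3 (X w)) (x, y) * pdx (fun w => c3 (X w)) (x, y)).
  change (FF X (x, y)) with
    (pdx (fun w => Defs.c1 (X w)) (x, y) * pdy (fun w => Defs.c1 (X w)) (x, y) +
     pdx (fun w => c2 (X w)) (x, y) * pdy (fun w => c2 (X w)) (x, y) +
     pdx (fun w => c3 (X w)) (x, y) * pdy (fun w => c3 (X w)) (x, y)).
  change (GG X (x, y)) with
    (pdy (fun w => Defs.c1 (X w)) (x, y) * pdy (fun w => Defs.c1 (X w)) (x, y) +
     pdy (fun w => c2 (X w)) (x, y) * pdy (fun w => c2 (X w)) (x, y) +
     pdy (fun w => c3 (X w)) (x, y) * pdy (fun w => c3 (X w)) (x, y)).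
  rewrite A1, A2, A3, B1, B2, B3. unfold ell.
  change (Re (weierstrass3 (x, y))) with 1.
  replace (- Im (weierstrass3 (x, y))) with 0 by (unfold weierstrass3; simpl; ring).
  unfold weierstrass1, weierstrass2.
  split; [exact W1|split; [exact W2|exact W3]].
Qed.

(** [-2 K E], the potential of the Jacobi operator in the coordinate [z]:
    [2 |grad ell|^2 / cosh(ell)^2], which is [8 |g'|^2 / (1 + |g|^2)^2]. *)
Definition potential (g : C -> sphere) (x y : R) : R :=
  2 * (ell_x g x y ^ 2 + ell_y g x y ^ 2) / conformal_factor (ell g x y).

Lemma conformal_factor_pos (l : R) : 0 < conformal_factor l.
Proof.
  unfold conformal_factor. apply pow_lt. generalize (exp_pos l) (exp_pos (- l)); lra.
Qed.

Lemma Derive_near (f h : R -> R) (x d : R) : 0 < d ->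
  (forall t, Rabs (t - x) < d -> f t = h t) -> Derive f x = Derive h x.
Proof.
  intros Hd H. apply Derive_ext_loc. exists (mkposreal d Hd). intros t Ht. apply H. exact Ht.
Qed.

(** For the metric [E (dx^2 + dy^2)] the curvature is [- Delta (log E) / (2 E)],
    where here [log E = 2 log cosh(ell)] and [ell] is harmonic. *)
Lemma gauss_curvature_formula (g : C -> sphere) (X : C -> R3) (x y : R) :
  meromorphic_cyl g -> weierstrass_param g X -> regular g (x, y) ->
  2 * gauss_curvature X (x, y) * conformal_factor (ell g x y) = - potential g x y.
Proof.
  intros Hm HX Hr. destruct (regular_local g (x, y) Hm Hr) as (r & Hr0 & H).
  assert (Hc := cbox_center (x, y) r Hr0).
  assert (Hmet : forall u v, cbox (x, y) r (u, v) ->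
    EE X (u, v) = conformal_factor (ell g u v) /\ FF X (u, v) = 0 /\
    GG X (u, v) = conformal_factor (ell g u v)).
  { intros u v Huv. apply induced_metric; auto. apply H; auto. }
  assert (Hh : forall u v, cbox (x, y) r (u, v) -> _)
    by (intros u v Huv; exact (proj1 (ell_harmonic g u v Hm (proj1 (H _ Huv))))).
  set (e1 := fun l => (exp l + exp (- l)) * (exp l - exp (- l)) / 2).
  set (e2 := fun l => ((exp l + exp (- l)) ^ 2 + (exp l - exp (- l)) ^ 2) / 2).
  assert (De : forall f t f', is_derive f t f' ->
     is_derive (fun s => conformal_factor (f s)) t (e1 (f t) * f')).
  { intros f t f' Hf. unfold conformal_factor, e1. auto_derive.
    - repeat split; eexists; exact Hf.
    - replace (Derive (fun x0 => f x0) t) with f' by (symmetry; apply is_derive_unique; exact Hf).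
      field. }
  assert (De1 : forall f t f', is_derive f t f' ->
     is_derive (fun s => e1 (f s)) t (e2 (f t) * f')).
  { intros f t f' Hf. unfold e1, e2. auto_derive.
    - repeat split; eexists; exact Hf.
    - replace (Derive (fun x0 => f x0) t) with f' by (symmetry; apply is_derive_unique; exact Hf).
      field. }
  assert (Lx : forall u v, cbox (x, y) r (u, v) -> exists d, 0 < d /\
    forall t, Rabs (t - u) < d -> cbox (x, y) r (t, v)) by (intros; apply cbox_line_x; auto).
  assert (Ly : forall u v, cbox (x, y) r (u, v) -> exists d, 0 < d /\
    forall t, Rabs (t - v) < d -> cbox (x, y) r (u, t)) by (intros; apply cbox_line_y; auto).
  (* first derivatives of a function that is the conformal factor near (x, y) *)
  assert (D1 : forall f : C -> R, (forall u v, cbox (x, y) r (u, v) -> f (u, v) = conformal_factor (ell g u v)) ->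
    forall u v, cbox (x, y) r (u, v) ->
    pdx f (u, v) = e1 (ell g u v) * ell_x g u v /\ pdy f (u, v) = e1 (ell g u v) * ell_y g u v).
  { intros f Hf u v Huv. destruct (Hh u v Huv) as (A1 & A2 & _). split.
    - destruct (Lx u v Huv) as (d & Hd & B). unfold pdx; simpl.
      rewrite (Derive_near _ (fun t => conformal_factor (ell g t v)) u d Hd
        (fun t Ht => Hf t v (B t Ht))).
      apply is_derive_unique. exact (De (fun t => ell g t v) u _ A1).
    - destruct (Ly u v Huv) as (d & Hd & B). unfold pdy; simpl.
      rewrite (Derive_near _ (fun t => conformal_factor (ell g u t)) v d Hd
        (fun t Ht => Hf u t (B t Ht))).
      apply is_derive_unique. exact (De (fun t => ell g u t) v _ A2). }
  assert (D2 : forall f : C -> R, (forall u v, cbox (x, y) r (u, v) -> f (u, v) = conformal_factor (ell g u v)) ->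
    pdx (pdx f) (x, y) = e2 (ell g x y) * ell_x g x y ^ 2 + e1 (ell g x y) * ell_xx g x y /\
    pdy (pdy f) (x, y) = e2 (ell g x y) * ell_y g x y ^ 2 - e1 (ell g x y) * ell_xx g x y).
  { intros f Hf. destruct (Hh x y Hc) as (A1 & A2 & A3 & A4). split.
    - destruct (Lx x y Hc) as (d & Hd & B). unfold pdx at 1; simpl.
      rewrite (Derive_near _ (fun t => e1 (ell g t y) * ell_x g t y) x d Hd
        (fun t Ht => proj1 (D1 f Hf t y (B t Ht)))).
      apply is_derive_unique. evar_last.
      + apply (is_derive_mult (fun t => e1 (ell g t y)) (fun t => ell_x g t y)).
        * exact (De1 (fun t => ell g t y) x _ A1).
        * exact A3.
        * exact Rmult_comm.
      + unfold plus, mult; simpl. ring.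
    - destruct (Ly x y Hc) as (d & Hd & B). unfold pdy at 1; simpl.
      rewrite (Derive_near _ (fun t => e1 (ell g x t) * ell_y g x t) y d Hd
        (fun t Ht => proj2 (D1 f Hf x t (B t Ht)))).
      apply is_derive_unique. evar_last.
      + apply (is_derive_mult (fun t => e1 (ell g x t)) (fun t => ell_y g x t)).
        * exact (De1 (fun t => ell g x t) y _ A2).
        * exact A4.
        * exact Rmult_comm.
      + unfold plus, mult; simpl. ring. }
  assert (F1 : forall u v, cbox (x, y) r (u, v) -> pdx (FF X) (u, v) = 0 /\ pdy (FF X) (u, v) = 0).
  { intros u v Huv. split.
    - destruct (Lx u v Huv) as (d & Hd & B). unfold pdx; simpl.
      rewrite (Derive_near _ (fun t => 0) u d Hd (fun t Ht => proj1 (proj2 (Hmet t v (B t Ht))))).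
      apply Derive_const.
    - destruct (Ly u v Huv) as (d & Hd & B). unfold pdy; simpl.
      rewrite (Derive_near _ (fun t => 0) v d Hd (fun t Ht => proj1 (proj2 (Hmet u t (B t Ht))))).
      apply Derive_const. }
  assert (F2 : pdy (pdx (FF X)) (x, y) = 0).
  { destruct (Ly x y Hc) as (d & Hd & B). unfold pdy; simpl.
    rewrite (Derive_near _ (fun t => 0) y d Hd (fun t Ht => proj1 (F1 x t (B t Ht)))).
    apply Derive_const. }
  assert (HE : forall u v, cbox (x, y) r (u, v) -> EE X (u, v) = conformal_factor (ell g u v))
    by (intros u v Huv; apply (Hmet u v Huv)).
  assert (HG : forall u v, cbox (x, y) r (u, v) -> GG X (u, v) = conformal_factor (ell g u v))
    by (intros u v Huv; apply (Hmet u v Huv)).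
  destruct (D1 _ HE x y Hc) as [E1 E2]. destruct (D1 _ HG x y Hc) as [G1 G2].
  destruct (D2 _ HE) as [_ E3]. destruct (D2 _ HG) as [G3 _].
  destruct (F1 x y Hc) as [F3 F4].
  assert (F0 : FF X (x, y) = 0) by (apply (Hmet x y Hc)).
  unfold gauss_curvature.
  rewrite E1, E2, G1, G2, E3, G3, F2, F3, F4, F0, (HE x y Hc), (HG x y Hc).
  unfold det3, potential.
  assert (P := conformal_factor_pos (ell g x y)).
  assert (R1 : e1 (ell g x y) ^ 2 = 4 * conformal_factor (ell g x y) * (conformal_factor (ell g x y) - 1)).
  { unfold e1, conformal_factor. rewrite exp_Ropp. field. apply Rgt_not_eq, exp_pos. }
  assert (R2 : e2 (ell g x y) = 2 * (2 * conformal_factor (ell g x y) - 1)).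
  { unfold e2, conformal_factor. rewrite exp_Ropp. field. apply Rgt_not_eq, exp_pos. }
  rewrite R2.
  set (E := conformal_factor (ell g x y)) in *.
  set (d1 := e1 (ell g x y)) in *. set (a := ell_x g x y). set (b := ell_y g x y).
  transitivity ((- 2 * (2 * (2 * E - 1)) * (a ^ 2 + b ^ 2) * E ^ 2 + 2 * d1 ^ 2 * (a ^ 2 + b ^ 2) * E)
     / (2 * E ^ 3)); [field; lra|].
  rewrite R1. field. lra.
Qed.

(** [laplacian] depends only on the metric near the point, where it is
    [E (dx^2 + dy^2)]. *)
Lemma laplacian_formula (g : C -> sphere) (X : C -> R3) (v : C -> R) (x y : R) :
  meromorphic_cyl g -> weierstrass_param g X -> regular g (x, y) ->
  laplacian X v (x, y) * conformal_factor (ell g x y) = pdx (pdx v) (x, y) + pdy (pdy v) (x, y).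
Proof.
  intros Hm HX Hr. destruct (regular_local g (x, y) Hm Hr) as (r & Hr0 & H).
  assert (Hc := cbox_center (x, y) r Hr0).
  assert (Ha : forall u w, cbox (x, y) r (u, w) ->
    area_density X (u, w) = conformal_factor (ell g u w) /\
    (GG X (u, w) * pdx v (u, w) - FF X (u, w) * pdy v (u, w)) / area_density X (u, w) = pdx v (u, w) /\
    (EE X (u, w) * pdy v (u, w) - FF X (u, w) * pdx v (u, w)) / area_density X (u, w) = pdy v (u, w)).
  { intros u w Huw. destruct (induced_metric g X u w Hm HX (proj1 (H _ Huw))) as (M1 & M2 & M3).
    assert (P := conformal_factor_pos (ell g u w)).
    assert (A : area_density X (u, w) = conformal_factor (ell g u w)).
    { unfold area_density. rewrite M1, M2, M3.
      replace (conformal_factor (ell g u w) * conformal_factor (ell g u w) - 0 ^ 2)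
        with (conformal_factor (ell g u w) * conformal_factor (ell g u w)) by ring.
      apply sqrt_square; lra. }
    rewrite A, M1, M2, M3. split; [reflexivity|split; field; lra]. }
  unfold laplacian. rewrite (proj1 (Ha x y Hc)).
  assert (P := conformal_factor_pos (ell g x y)).
  match goal with |- / _ * (?A + ?B) * _ = _ =>
    replace A with (pdx (pdx v) (x, y)); [replace B with (pdy (pdy v) (x, y)); [field; lra|]|] end.
  - destruct (cbox_line_y _ _ _ _ Hc) as (d & Hd & B). unfold pdy at 1 2; simpl.
    apply (Derive_near _ _ y d Hd). intros t Ht. symmetry. apply (Ha x t (B t Ht)).
  - destruct (cbox_line_x _ _ _ _ Hc) as (d & Hd & B). unfold pdx at 1 2; simpl.
    apply (Derive_near _ _ x d Hd). intros t Ht. symmetry. apply (Ha t y (B t Ht)).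
Qed.

Lemma jacobi_equation_iff (g : C -> sphere) (X : C -> R3) (v : C -> R) (x y : R) :
  meromorphic_cyl g -> weierstrass_param g X -> regular g (x, y) ->
  (laplacian X v (x, y) - 2 * gauss_curvature X (x, y) * v (x, y) = 0 <->
   pdx (pdx v) (x, y) + pdy (pdy v) (x, y) + potential g x y * v (x, y) = 0).
Proof.
  intros Hm HX Hr.
  assert (L := laplacian_formula g X v x y Hm HX Hr).
  assert (K := gauss_curvature_formula g X x y Hm HX Hr).
  assert (P := conformal_factor_pos (ell g x y)).
  rewrite <- L. replace (potential g x y) with
    (- (2 * gauss_curvature X (x, y) * conformal_factor (ell g x y))) by (rewrite K; ring).
  set (E := conformal_factor (ell g x y)) in *.
  split; intros J.
  - replace (laplacian X v (x, y) * E + - (2 * gauss_curvature X (x, y) * E) * v (x, y)) with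
      ((laplacian X v (x, y) - 2 * gauss_curvature X (x, y) * v (x, y)) * E) by ring.
    rewrite J; ring.
  - apply Rmult_eq_reg_r with E; [|lra]. rewrite Rmult_0_l, <- J. ring.
Qed.

(** * Boundedness of the potential *)

(** Compactness of the rectangle, for the covering by the squares of half-side
    [delta] around its points. *)
Lemma rectangle_cover (delta : R -> R -> R) (a b c d : R) :
  (forall x y, 0 < delta x y) ->
  exists l : list (R * R), forall x y, a <= x <= b -> c <= y <= d ->
    exists p, In p l /\ Rabs (x - fst p) < delta (fst p) (snd p) /\
                        Rabs (y - snd p) < delta (fst p) (snd p).
Proof.
  intros Hd.
  set (del := fun p : Compactness.Tn 2 R => mkposreal (delta (fst p) (fst (snd p))) (Hd _ _)).
  destruct (NNPP _ (compactness_list 2 (a, (c, tt)) (b, (d, tt)) del)) as [l Hl].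
  exists (map (fun p : Compactness.Tn 2 R => (fst p, fst (snd p))) l).
  intros x y Hx Hy.
  destruct (Hl (x, (y, tt))) as (t & Ht & _ & Hc).
  { simpl. tauto. }
  exists (fst t, fst (snd t)). split.
  - apply in_map_iff. exists t; auto.
  - destruct t as [t1 [t2 []]]. simpl in *. tauto.
Qed.

Lemma regular_inv (g : C -> sphere) (z : C) : regular g z ->
  sph_inv (g z) = Fin (/ toC (g z)).
Proof.
  intros H. destruct (regular_nonzero g z H) as [E N]. rewrite E. simpl.
  destruct (Ceq_dec (toC (g z)) 0); [congruence | reflexivity].
Qed.

Lemma ell_periodic (g : C -> sphere) (x y : R) : (forall z, g (z + Ci)%C = g z) ->
  ell g x (y + 1) = ell g x y.
Proof.
  intros H. unfold ell. rewrite <- (H (x, y)). f_equal. f_equal. f_equal. f_equal.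
  apply injective_projections; simpl; ring.
Qed.

Lemma Derive_shift (f : R -> R) (y : R) : (forall t, f (t + 1) = f t) ->
  Derive f (y + 1) = Derive f y.
Proof.
  intros H. unfold Derive. f_equal. apply Lim_ext. intros h.
  replace (y + 1 + h) with ((y + h) + 1) by ring. rewrite !H. reflexivity.
Qed.

Lemma ell_derivatives_periodic (g : C -> sphere) (x y : R) : (forall z, g (z + Ci)%C = g z) ->
  ell_x g x (y + 1) = ell_x g x y /\ ell_y g x (y + 1) = ell_y g x y /\
  ell_xx g x (y + 1) = ell_xx g x y.
Proof.
  intros H.
  assert (Hx : forall x y, ell_x g x (y + 1) = ell_x g x y).
  { intros u v. apply Derive_ext. intros t; apply ell_periodic; auto. }
  split; [apply Hx|split].
  - apply Derive_shift. intros t; apply ell_periodic; auto.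
  - apply Derive_ext. intros t; apply Hx.
Qed.

Lemma potential_periodic (g : C -> sphere) (x y : R) : (forall z, g (z + Ci)%C = g z) ->
  potential g x (y + 1) = potential g x y.
Proof.
  intros H. destruct (ell_derivatives_periodic g x y H) as (H1 & H2 & _).
  unfold potential. rewrite H1, H2, ell_periodic; auto.
Qed.

Lemma periodic_Z (f : R -> R) : (forall t, f (t + 1) = f t) -> forall (n : Z) t, f (t + IZR n) = f t.
Proof.
  intros H.
  assert (Hn : forall (n : nat) t, f (t + INR n) = f t).
  { induction n; intros t; [simpl; f_equal; ring|].
    rewrite S_INR. replace (t + (INR n + 1)) with ((t + INR n) + 1) by ring. rewrite H; auto. }
  intros n t. destruct (Z_le_gt_dec 0 n) as [L|L].
  - rewrite <- (Z2Nat.id n L), <- INR_IZR_INZ. apply Hn.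
  - rewrite <- (Hn (Z.to_nat (- n)) (t + IZR n)). f_equal.
    rewrite INR_IZR_INZ, Z2Nat.id, opp_IZR by lia. ring.
Qed.

Lemma periodic_Z_prop (P : R -> Prop) : (forall t, P (t + 1) <-> P t) ->
  forall (n : Z) t, P (t + IZR n) <-> P t.
Proof.
  intros H n t.
  set (f := fun t => if excluded_middle_informative (P t) then 1 else 0).
  assert (E : f (t + IZR n) = f t).
  { apply periodic_Z. intros s. specialize (H s). unfold f.
    destruct (excluded_middle_informative (P (s + 1)));
    destruct (excluded_middle_informative (P s)); tauto. }
  unfold f in E.
  destruct (excluded_middle_informative (P (t + IZR n)));
  destruct (excluded_middle_informative (P t)); try tauto; lra.
Qed.

Lemma unit_representative (y : R) : exists n : Z, 0 <= y + IZR n < 1.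
Proof.
  destruct (archimed y) as [A1 A2]. exists (1 - up y)%Z. rewrite minus_IZR. lra.
Qed.

Lemma cosh_lower (c : C) : c <> 0%C ->
  / 4 * Cmod c ^ 2 <= conformal_factor (ln (Cmod c)) /\
  / 4 * / Cmod c ^ 2 <= conformal_factor (ln (Cmod c)).
Proof.
  intros H. assert (P := proj1 (Cmod_gt_0 c) H).
  unfold conformal_factor. rewrite exp_Ropp, exp_ln by auto.
  assert (Q : 0 < / Cmod c) by (apply Rinv_0_lt_compat; auto).
  rewrite <- pow_inv. split; nra.
Qed.

Lemma ell_gradient (g : C -> sphere) (x y : R) (l : C) : meromorphic_cyl g -> regular g (x, y) ->
  cderiv (fun w => toC (g w)) (x, y) l ->
  ell_x g x y ^ 2 + ell_y g x y ^ 2 = (Cmod l / Cmod (toC (g (x, y)))) ^ 2.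
Proof.
  intros Hm Hr Hl. destruct (regular_nonzero g _ Hr) as [_ N].
  assert (P := proj1 (Cmod_gt_0 _) N).
  set (p := (l / toC (g (x, y)))%C).
  assert (E : l = (p * toC (g (x, y)))%C) by (unfold p; field; auto).
  rewrite E in Hl. destruct (ell_derive g x y p N Hl) as [D1 D2].
  unfold ell_x, ell_y.
  replace (Derive (fun t => ell g t y) x) with (Re p) by (symmetry; apply is_derive_unique; exact D1).
  replace (Derive (fun t => ell g x t) y) with (- Im p) by (symmetry; apply is_derive_unique; exact D2).
  rewrite E, Cmod_mult.
  replace (Cmod p * Cmod (toC (g (x, y))) / Cmod (toC (g (x, y)))) with (Cmod p) by (field; lra).
  rewrite Cmod_sqr. ring.
Qed.

(** [cosh(log |g|) >= |g| / 2] and [>= 1 / (2 |g|)]; the second bound compensates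
    the [|g|] in the denominator of [|grad ell| = |g'| / |g|], and the first one
    that for [1 / g]. *)
Lemma potential_le_deriv (g : C -> sphere) (x y : R) (l : C) : meromorphic_cyl g -> regular g (x, y) ->
  cderiv (fun w => toC (g w)) (x, y) l -> potential g x y <= 8 * Cmod l ^ 2.
Proof.
  intros Hm Hr Hl. destruct (regular_nonzero g _ Hr) as [_ N].
  unfold potential. rewrite (ell_gradient g x y l Hm Hr Hl).
  destruct (cosh_lower _ N) as [_ B]. fold (ell g x y) in B.
  assert (P := proj1 (Cmod_gt_0 _) N).
  assert (Q := conformal_factor_pos (ell g x y)).
  apply Rmult_le_reg_r with (conformal_factor (ell g x y)); auto.
  unfold Rdiv at 1. rewrite Rmult_assoc, Rinv_l, Rmult_1_r by lra.
  apply Rle_trans with (8 * Cmod l ^ 2 * (/ 4 * / Cmod (toC (g (x, y))) ^ 2)).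
  - right. field. lra.
  - apply Rmult_le_compat_l; auto. assert (0 <= Cmod l ^ 2) by apply pow2_ge_0. lra.
Qed.

Lemma potential_le_deriv_inv (g : C -> sphere) (x y : R) (l : C) : meromorphic_cyl g -> regular g (x, y) ->
  cderiv (fun w => toC (sph_inv (g w))) (x, y) l -> potential g x y <= 8 * Cmod l ^ 2.
Proof.
  intros Hm Hr Hl. destruct (regular_nonzero g _ Hr) as [_ N].
  destruct (regular_local g (x, y) Hm Hr) as (r & Hr0 & H).
  destruct (H _ (cbox_center _ _ Hr0)) as [_ [m Hm']].
  assert (Hi : cderiv (fun w => toC (sph_inv (g w))) (x, y) (- m / (toC (g (x, y)) * toC (g (x, y))))%C).
  { apply (cderiv_ext_loc (fun w => / toC (g w))%C _ _ _ r Hr0).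
    - intros w Hw. rewrite (regular_inv g w); [reflexivity|]. apply H, cbox_of_Cmod; exact Hw.
    - exact (cderiv_inv _ _ _ N Hm'). }
  rewrite (cderiv_unique _ _ _ _ Hl Hi).
  unfold potential. rewrite (ell_gradient g x y m Hm Hr Hm').
  destruct (cosh_lower _ N) as [B _]. fold (ell g x y) in B.
  assert (P := proj1 (Cmod_gt_0 _) N).
  assert (Q := conformal_factor_pos (ell g x y)).
  apply Rmult_le_reg_r with (conformal_factor (ell g x y)); auto.
  unfold Rdiv at 1. rewrite Rmult_assoc, Rinv_l, Rmult_1_r by lra.
  rewrite Cmod_div by (apply Cmult_neq_0; auto). rewrite Cmod_opp, Cmod_mult.
  apply Rle_trans with (8 * (Cmod m / (Cmod (toC (g (x, y))) * Cmod (toC (g (x, y))))) ^ 2 *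
     (/ 4 * Cmod (toC (g (x, y))) ^ 2)).
  - right. field. lra.
  - apply Rmult_le_compat_l; auto. apply Rmult_le_pos; [lra | apply pow2_ge_0].
Qed.

Lemma finite_cderiv (g : C -> sphere) (z : C) : meromorphic_cyl g -> g z <> Infty ->
  exists l, cderiv (fun w => toC (g w)) z l.
Proof.
  intros Hm Hz. destruct (proj1 (proj2 Hm) z) as [[H1 H2]|[H1 H2]].
  - apply holomorphic_at_cbox in H2. destruct H2 as (r & Hr & H2). apply H2, cbox_center; exact Hr.
  - apply locally_cbox in H1. destruct H1 as (r & Hr & H1). specialize (H1 z (cbox_center z r Hr)).
    assert (Hreg : regular g z).
    { intros [E|E]; [|contradiction]. apply H1. rewrite E. simpl.
      destruct (Ceq_dec 0 0); congruence. }
    destruct (regular_local g z Hm Hreg) as (r' & Hr' & H). apply H, cbox_center; exact Hr'.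
Qed.

Lemma finite_inv_cderiv (g : C -> sphere) (z : C) : meromorphic_cyl g -> sph_inv (g z) <> Infty ->
  exists l, cderiv (fun w => toC (sph_inv (g w))) z l.
Proof.
  intros Hm Hz. destruct (proj1 (proj2 Hm) z) as [[H1 H2]|[H1 H2]].
  - apply locally_cbox in H1. destruct H1 as (r & Hr & H1). specialize (H1 z (cbox_center z r Hr)).
    assert (Hreg : regular g z).
    { intros [E|E]; [|contradiction]. apply Hz. rewrite E. simpl.
      destruct (Ceq_dec 0 0); congruence. }
    destruct (regular_local g z Hm Hreg) as (r' & Hr' & H).
    destruct (H z (cbox_center z r' Hr')) as [_ [l Hl]].
    destruct (regular_nonzero g z Hreg) as [_ N].
    exists (- l / (toC (g z) * toC (g z)))%C.
    apply (cderiv_ext_loc (fun w => / toC (g w))%C _ _ _ r' Hr').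
    + intros w Hw. rewrite (regular_inv g w); [reflexivity|]. apply H, cbox_of_Cmod; exact Hw.
    + exact (cderiv_inv _ _ _ N Hl).
  - apply holomorphic_at_cbox in H2. destruct H2 as (r & Hr & H2). apply H2, cbox_center; exact Hr.
Qed.

Definition tame_box (g : C -> sphere) (z : C) (r M : R) : Prop :=
  (forall w, cbox z r w -> g w <> Infty /\ Cmod (toC (g w)) <= M) \/
  (forall w, cbox z r w -> sph_inv (g w) <> Infty /\ Cmod (toC (sph_inv (g w))) <= M).

(** Cauchy's estimate for [g] or for [1 / g], whose logarithms have opposite
    real parts and hence the same potential. *)
Lemma potential_tame (g : C -> sphere) (x y r M : R) : meromorphic_cyl g -> regular g (x, y) ->
  0 < r -> tame_box g (x, y) r M -> potential g x y <= 8 * (16 * M / r) ^ 2.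
Proof.
  intros Hm Hreg Hr [H|H].
  - destruct (finite_cderiv g (x, y) Hm (proj1 (H _ (cbox_center _ _ Hr)))) as [l Hl].
    assert (B := cauchy_estimate (fun w => toC (g w)) (x, y) l r M Hr
       (fun w Hw => finite_cderiv g w Hm (proj1 (H w Hw))) (fun w Hw => proj2 (H w Hw)) Hl).
    apply Rle_trans with (1 := potential_le_deriv g x y l Hm Hreg Hl).
    apply Rmult_le_compat_l; [lra|]. apply pow_incr; split; [apply Cmod_ge_0 | exact B].
  - destruct (finite_inv_cderiv g (x, y) Hm (proj1 (H _ (cbox_center _ _ Hr)))) as [l Hl].
    assert (B := cauchy_estimate (fun w => toC (sph_inv (g w))) (x, y) l r M Hr
       (fun w Hw => finite_inv_cderiv g w Hm (proj1 (H w Hw))) (fun w Hw => proj2 (H w Hw)) Hl).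
    apply Rle_trans with (1 := potential_le_deriv_inv g x y l Hm Hreg Hl).
    apply Rmult_le_compat_l; [lra|]. apply pow_incr; split; [apply Cmod_ge_0 | exact B].
Qed.

Lemma finite_bounded_near (f : C -> sphere) (z : C) : finite_holomorphic_at f z ->
  exists r M, 0 < r /\ 0 <= M /\ forall w, cbox z r w -> f w <> Infty /\ Cmod (toC (f w)) <= M.
Proof.
  intros [H1 H2]. apply locally_cbox in H1. destruct H1 as (r1 & Hr1 & H1).
  apply holomorphic_at_cbox in H2. destruct H2 as (r2 & Hr2 & H2).
  destruct (H2 z (cbox_center z r2 Hr2)) as [l Hl].
  destruct (cderiv_cont _ z l Hl 1 Rlt_0_1) as (d & Hd & B).
  exists (Rmin r1 (d / 2)), (Cmod (toC (f z)) + 1).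
  assert (Hz := Cmod_ge_0 (toC (f z))).
  split; [apply Rmin_pos; lra|]. split; [lra|]. intros w Hw. split.
  - apply H1. apply cbox_mono with (2 := Hw). apply Rmin_l.
  - assert (Hw' : Cmod (w - z) < d).
    { apply Cmod_of_cbox in Hw. generalize (Rmin_r r1 (d / 2)); lra. }
    specialize (B w Hw').
    replace (toC (f w)) with ((toC (f w) - toC (f z)) + toC (f z))%C by ring.
    apply Rle_trans with (1 := Cmod_triangle _ _). lra.
Qed.

Lemma tame_near (g : C -> sphere) (z : C) : meromorphic_cyl g ->
  exists r M, 0 < r /\ 0 <= M /\ tame_box g z r M.
Proof.
  intros Hm. destruct (proj1 (proj2 Hm) z) as [H|H].
  - destruct (finite_bounded_near g z H) as (r & M & Hr & HM & B).
    exists r, M. split; [exact Hr|split; [exact HM|left; exact B]].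
  - destruct (finite_bounded_near (fun w => sph_inv (g w)) z H) as (r & M & Hr & HM & B).
    exists r, M. split; [exact Hr|split; [exact HM|right; exact B]].
Qed.

Lemma cbox_half (z w x : C) (r : R) : cbox z (r / 2) w -> cbox w (r / 2) x -> cbox z r x.
Proof.
  intros [H1 H2] [H3 H4]. split.
  - replace (Re x - Re z) with ((Re x - Re w) + (Re w - Re z)) by ring.
    apply Rle_lt_trans with (1 := Rabs_triang _ _). lra.
  - replace (Im x - Im z) with ((Im x - Im w) + (Im w - Im z)) by ring.
    apply Rle_lt_trans with (1 := Rabs_triang _ _). lra.
Qed.

Lemma list_upper_bound (A : Type) (f : A -> R) (l : list A) :
  exists K, 0 <= K /\ forall p, In p l -> f p <= K.
Proof.
  induction l as [|p l [K [HK IH]]]; [exists 0; split; [lra|intros ? []]|].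
  exists (Rmax K (f p)). split; [apply Rle_trans with (1 := HK), Rmax_l|].
  intros q [->|Hq]; [apply Rmax_r | apply Rle_trans with (1 := IH q Hq), Rmax_l].
Qed.

Lemma potential_bounded_strip (g : C -> sphere) (T : R) : meromorphic_cyl g ->
  exists K, 0 <= K /\ forall x y, Rabs x <= T -> regular g (x, y) -> potential g x y <= K.
Proof.
  intros Hm.
  assert (Hl : forall p : R * R, exists rK : R * R, 0 < fst rK /\
     forall x y, cbox p (fst rK) (x, y) -> regular g (x, y) -> potential g x y <= snd rK).
  { intros p. destruct (tame_near g p Hm) as (r & M & Hr & HM & Ht).
    assert (Hr2 : 0 < r / 2) by lra.
    exists (r / 2, 8 * (16 * M / (r / 2)) ^ 2). simpl. split; [exact Hr2|].
    intros x y Hxy Hreg. apply potential_tame; auto.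
    destruct Ht as [Ht|Ht]; [left|right]; intros w Hw; apply Ht; apply cbox_half with (x, y); auto. }
  destruct (choice _ Hl) as [F HF].
  destruct (rectangle_cover (fun x y => fst (F (x, y))) (- T) T 0 1) as [l Hcov].
  { intros x y. apply HF. }
  destruct (list_upper_bound _ (fun p => snd (F p)) l) as (K & HK & BK).
  exists K. split; [exact HK|]. intros x y Hx Hreg.
  destruct (unit_representative y) as [n Hn].
  assert (Hper : forall z, g (z + Ci)%C = g z) by apply Hm.
  rewrite <- (periodic_Z (potential g x) (fun t => potential_periodic g x t Hper) n y).
  assert (Hreg' : regular g (x, y + IZR n)).
  { assert (E : forall t, (fun t => regular g (x, t)) (t + 1) <-> regular g (x, t)).
    { intros t. unfold regular, zero_or_pole. rewrite <- (Hper (x, t)).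
      replace (Cplus (x, t) Ci) with ((x, t + 1) : C); [tauto|].
      apply injective_projections; simpl; ring. }
    apply (periodic_Z_prop (fun t => regular g (x, t)) E n y). exact Hreg. }
  destruct (Hcov x (y + IZR n)) as (p & Hp & H1 & H2); [apply Rabs_le_between; exact Hx|lra|].
  apply Rle_trans with (2 := BK p Hp). apply HF; [|exact Hreg'].
  rewrite <- surjective_pairing in H1, H2. split; [exact H1 | exact H2].
Qed.

Lemma sqrt_1_plus (c : C) : 1 <= sqrt (1 + Cmod c ^ 2) /\ Cmod c <= sqrt (1 + Cmod c ^ 2) /\
  sqrt (1 + Cmod c ^ 2) <= 1 + Cmod c.
Proof.
  assert (H := Cmod_ge_0 c). split; [|split].
  - rewrite <- sqrt_1 at 1. apply sqrt_le_1_alt. nra.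
  - rewrite <- (sqrt_pow2 (Cmod c)) at 1 by auto. apply sqrt_le_1_alt. lra.
  - rewrite <- (sqrt_pow2 (1 + Cmod c)) by lra. apply sqrt_le_1_alt. nra.
Qed.

Lemma chordal_inv (s t : sphere) : chordal (sph_inv s) (sph_inv t) = chordal s t.
Proof.
  assert (Hs : forall c : C, c <> 0%C -> sqrt (1 + Cmod (/ c) ^ 2) = sqrt (1 + Cmod c ^ 2) / Cmod c).
  { intros c Hc. assert (P := proj1 (Cmod_gt_0 c) Hc). rewrite Cmod_inv by auto.
    rewrite <- (sqrt_pow2 (Cmod c)) at 3 by lra. rewrite <- sqrt_div_alt by nra.
    f_equal. field. lra. }
  assert (H0 : sqrt (1 + Cmod 0 ^ 2) = 1).
  { rewrite Cmod_0. replace (1 + 0 ^ 2) with 1 by ring. apply sqrt_1. }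
  destruct s as [a|], t as [b|]; simpl sph_inv;
    repeat match goal with |- context [Ceq_dec ?u ?v] => destruct (Ceq_dec u v) as [->|?] end;
    try congruence; cbn [chordal];
    try rewrite !Hs by assumption; try rewrite !H0.
  all: repeat match goal with |- context [sqrt (1 + Cmod ?a ^ 2)] =>
      lazymatch goal with _ : 1 <= sqrt (1 + Cmod a ^ 2) /\ _ |- _ => fail | _ =>
        assert (Hq := sqrt_1_plus a) end end.
  all: repeat match goal with N : ?c <> RtoC 0 |- _ =>
      generalize (proj1 (Cmod_gt_0 c) N); revert N end; intros.
  - replace (0 - 0)%C with (RtoC 0) by ring. rewrite Cmod_0. field.
  - replace (0 - b)%C with (- b)%C by ring. rewrite Cmod_opp. field; repeat split; lra.
  - replace (a - 0)%C with a by ring. field; repeat split; lra.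
  - replace (/ a - / b)%C with ((b - a) / (a * b))%C by (field; auto).
    rewrite Cmod_div by (apply Cmult_neq_0; auto).
    rewrite Cmod_mult, (Cmod_sub_sym b a). generalize (sqrt_1_plus b); intros. field. repeat split; lra.
  - reflexivity.
  - replace (/ a - 0)%C with (/ a)%C by ring. rewrite Cmod_inv by auto. field; repeat split; lra.
  - reflexivity.
  - replace (0 - / b)%C with (- / b)%C by ring. rewrite Cmod_opp, Cmod_inv by auto. field; repeat split; lra.
  - replace (0 - 0)%C with (RtoC 0) by ring. rewrite Cmod_0. field.
Qed.

(** Uniform spherical convergence to a bounded function gives bounds in [C]. *)
Lemma chordal_finite (s t : sphere) (M : R) : 0 <= M -> t <> Infty -> Cmod (toC t) <= M ->
  chordal s t < / (2 * (1 + M)) -> s <> Infty /\ Cmod (toC s) <= 2 * M + 2.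
Proof.
  intros HM Ht Hb Hc. destruct t as [h|]; [|congruence]. simpl in Hb.
  destruct (sqrt_1_plus h) as (Q1 & Q2 & Q3).
  assert (Hinv : / (2 * (1 + M)) * (2 * (1 + M)) = 1) by (apply Rinv_l; lra).
  assert (Hip : 0 < / (2 * (1 + M))) by (apply Rinv_0_lt_compat; lra).
  destruct s as [f|]; simpl in Hc.
  - split; [congruence|]. simpl. apply Rnot_lt_le; intros Hf.
    destruct (sqrt_1_plus f) as (S1 & S2 & S3).
    assert (D : Cmod f - M <= Cmod (f - h)).
    { assert (T := Cmod_triangle (f - h) h). replace (f - h + h)%C with f in T by ring. lra. }
    apply (Rmult_lt_compat_r (sqrt (1 + Cmod f ^ 2) * sqrt (1 + Cmod h ^ 2))) in Hc; [|nra].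
    unfold Rdiv in Hc. rewrite Rmult_assoc, Rinv_l, Rmult_1_r in Hc by nra.
    assert (B : / (2 * (1 + M)) * (sqrt (1 + Cmod f ^ 2) * sqrt (1 + Cmod h ^ 2)) <=
      / (2 * (1 + M)) * ((1 + Cmod f) * (1 + M))).
    { apply Rmult_le_compat_l; [lra|]. apply Rmult_le_compat; lra. }
    replace (/ (2 * (1 + M)) * ((1 + Cmod f) * (1 + M))) with ((1 + Cmod f) / 2) in B
      by (field; lra).
    lra.
  - exfalso. apply (Rmult_lt_compat_r (sqrt (1 + Cmod h ^ 2))) in Hc; [|lra].
    unfold Rdiv in Hc. rewrite Rmult_assoc, Rinv_l, Rmult_1_r in Hc by lra.
    assert (B : / (2 * (1 + M)) * sqrt (1 + Cmod h ^ 2) <= / (2 * (1 + M)) * (2 * (1 + M))).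
    { apply Rmult_le_compat_l; lra. }
    lra.
Qed.

(** Quasiperiodicity makes the potential bounded: along a sequence where it
    blew up, the translates of [g] (or of [1 / g]) would converge uniformly
    near [0] to a bounded function, and Cauchy's estimate would apply. *)
Lemma potential_bounded (g : C -> sphere) : quasiperiodic g ->
  exists Q, 0 <= Q /\ forall x y, regular g (x, y) -> potential g x y <= Q.
Proof.
  intros (Hm & _ & Hq).
  apply NNPP; intros Hno.
  assert (Hz : forall n : nat, exists z : C, regular g z /\ INR n < Rabs (Re z) /\
     INR n < potential g (Re z) (Im z)).
  { intros n. destruct (potential_bounded_strip g (INR n) Hm) as (K & HK & BK).
    apply NNPP; intros H. apply Hno. exists (K + INR n).
    assert (Hn := pos_INR n). split; [lra|]. intros x y Hreg.
    apply Rnot_lt_le; intros Hlt. apply H. exists (x, y). split; [exact Hreg|].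
    change (Re (x, y)) with x. change (Im (x, y)) with y. split; [|lra].
    apply Rnot_le_lt; intros Hle. specialize (BK x y Hle Hreg). lra. }
  destruct (choice _ Hz) as [z Hz'].
  destruct (Hq z) as (s & h & Hs & Hh & _ & Hc).
  { unfold cyl_divergent. apply (is_lim_seq_le_p_loc INR); [|apply is_lim_seq_INR].
    exists O. intros n _. apply Rlt_le, Hz'. }
  (* the limit of the translates is tame near 0, hence so are the late translates *)
  destruct (tame_near h 0 Hh) as (r & M & Hr & HM & Ht).
  destruct (Hc r (/ (2 * (1 + M)))) as [N HN]; [apply Rinv_0_lt_compat; lra|].
  assert (Htame : forall k, (N <= k)%nat -> tame_box g (z (s k)) r (2 * M + 2)).
  { intros k Hk. specialize (HN k Hk).
    assert (Hsh : forall w, cbox (z (s k)) r w -> cbox 0 r (w - z (s k))%C /\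
       Rabs (Re (w - z (s k))) <= r /\ (w - z (s k) + z (s k))%C = w).
    { intros w [W1 W2].
      assert (Hb : cbox 0 r (w - z (s k))%C).
      { split; simpl; rewrite Rminus_0_r; [exact W1 | exact W2]. }
      split; [exact Hb|split; [|ring]]. apply Rlt_le. exact W1. }
    destruct Ht as [Ht|Ht]; [left|right]; intros w Hw;
      destruct (Hsh w Hw) as (W1 & W2 & W3); specialize (HN _ W2); rewrite W3 in HN;
      destruct (Ht _ W1) as [T1 T2]; apply (chordal_finite _ _ M HM T1 T2).
    - exact HN.
    - rewrite chordal_inv. exact HN. }
  assert (Hmono : forall k, (k <= s k)%nat).
  { induction k; [lia|]. generalize (Hs k). lia. }
  destruct (INR_unbounded (8 * (16 * (2 * M + 2) / r) ^ 2)) as [m Hm'].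
  set (k := max N m).
  assert (Hb := potential_tame g (Re (z (s k))) (Im (z (s k))) r (2 * M + 2) Hm).
  rewrite pair_eta in Hb.
  specialize (Hb (proj1 (Hz' (s k))) Hr (Htame k (Nat.le_max_l N m))).
  assert (Hlt := proj2 (proj2 (Hz' (s k)))).
  assert (Hge : INR m <= INR (s k)).
  { apply le_INR. apply Nat.le_trans with k; [apply Nat.le_max_r | apply Hmono]. }
  lra.
Qed.

(** * Growth of [log |g|] at the zeros and poles *)

Lemma Rabs_ln_le_inv (r : R) : 0 < r <= 1 -> Rabs (ln r) <= / r.
Proof.
  intros [H1 H2]. assert (Hi : 0 < / r) by (apply Rinv_0_lt_compat; auto).
  assert (ln r <= 0) by (rewrite <- ln_1; destruct H2 as [H2| ->]; [apply Rlt_le, ln_increasing|]; lra).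
  rewrite Rabs_left1 by auto. rewrite <- ln_Rinv by auto.
  assert (E := exp_ineq1_le (ln (/ r))). rewrite exp_ln in E by auto. lra.
Qed.

(** Here [log |f| = 2 log r + O(1)] and [f' / f = 2 / (z - z0) + O(1)], with
    [r = |z - z0|]. Where [|log |f|| <= L] one has [exp(- L) <= |f| = O(r^2)], so that
    [r^2] may be replaced by [r^2 + exp(- L)] in the bound for the gradient; this is
    what makes the gradient square integrable there, with an integral of order [L]. *)
Lemma double_zero_growth (f h : C -> C) (z0 : C) (r : R) : 0 < r -> h z0 <> 0%C ->
  (forall w, cbox z0 r w -> f w = ((w - z0) ^ 2 * h w)%C /\ exists l, cderiv h w l) ->
  exists r' K, 0 < r' /\ 0 <= K /\
    (forall z, cbox z0 r' z -> z <> z0 -> f z <> 0%C /\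
       Rabs (ln (Cmod (f z))) * Cmod (z - z0) <= K /\
       exists l, cderiv f z l /\ forall L, Rabs (ln (Cmod (f z))) <= L ->
         (Cmod l / Cmod (f z)) ^ 2 * (Cmod (z - z0) ^ 2 + exp (- L)) <= K) /\
    (forall L, exists d, 0 < d /\ forall z, cbox z0 d z -> z <> z0 -> L < Rabs (ln (Cmod (f z)))).
Proof.
  intros Hr Hh0 Hf.
  destruct (holomorphic_derivative h z0 r Hr (fun w Hw => proj2 (Hf w Hw))) as [h1 Hh1].
  assert (Hz0 : Cmod (z0 - z0) < r / 2).
  { replace (z0 - z0)%C with (RtoC 0) by ring. rewrite Cmod_0. lra. }
  destruct (Hh1 z0 Hz0) as [Hd0 [l0 Hl0]].
  assert (P : 0 < Cmod (h z0)) by (apply Cmod_gt_0; auto).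
  set (m := Cmod (h z0) / 2). assert (Hm : 0 < m) by (unfold m; lra).
  destruct (cderiv_cont h z0 _ Hd0 m Hm) as (d1 & Hd1 & B1).
  destruct (cderiv_cont h1 z0 _ Hl0 1 Rlt_0_1) as (d2 & Hd2 & B2).
  set (D := Cmod (h1 z0) + 1).
  assert (HD : 0 < D) by (unfold D; generalize (Cmod_ge_0 (h1 z0)); lra).
  set (r0 := Rmin (Rmin (r / 4) (1 / 2)) (Rmin (d1 / 2) (d2 / 2))).
  assert (Hr0 : 0 < r0) by (unfold r0; repeat apply Rmin_pos; lra).
  assert (Hle : r0 <= r / 4 /\ r0 <= 1 / 2 /\ r0 <= d1 / 2 /\ r0 <= d2 / 2).
  { unfold r0. assert (A1 := Rmin_l (Rmin (r / 4) (1 / 2)) (Rmin (d1 / 2) (d2 / 2))).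
    assert (A2 := Rmin_r (Rmin (r / 4) (1 / 2)) (Rmin (d1 / 2) (d2 / 2))).
    assert (A3 := Rmin_l (r / 4) (1 / 2)). assert (A4 := Rmin_r (r / 4) (1 / 2)).
    assert (A5 := Rmin_l (d1 / 2) (d2 / 2)). assert (A6 := Rmin_r (d1 / 2) (d2 / 2)). lra. }
  set (M := 3 * m).
  assert (Hbnd : forall z, cbox z0 r0 z -> z <> z0 ->
     0 < Cmod (z - z0) < 1 /\ m <= Cmod (h z) <= M /\ Cmod (h1 z) <= D /\
     cderiv h z (h1 z) /\ f z = ((z - z0) ^ 2 * h z)%C /\ (z - z0)%C <> 0%C).
  { intros z Hz Hne. assert (Hc := Cmod_of_cbox _ _ _ Hz).
    assert (Hnz : (z - z0)%C <> 0%C).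
    { intros E. apply Hne. replace z with ((z - z0) + z0)%C by ring. rewrite E. ring. }
    assert (Hp := proj1 (Cmod_gt_0 _) Hnz).
    specialize (B1 z ltac:(lra)). specialize (B2 z ltac:(lra)).
    split; [lra|]. split; [|split; [|split; [|split; [|exact Hnz]]]].
    - assert (T1 := Cmod_triangle (h z - h z0) (h z0)).
      replace (h z - h z0 + h z0)%C with (h z) in T1 by ring.
      assert (T2 := Cmod_triangle (h z0 - h z) (h z)).
      replace (h z0 - h z + h z)%C with (h z0) in T2 by ring.
      rewrite Cmod_sub_sym in T2. unfold M, m in *. lra.
    - assert (T1 := Cmod_triangle (h1 z - h1 z0) (h1 z0)).
      replace (h1 z - h1 z0 + h1 z0)%C with (h1 z) in T1 by ring. unfold D. lra.
    - apply Hh1. lra.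
    - apply Hf. apply cbox_mono with (2 := Hz). lra. }
  assert (Hmod : forall z, cbox z0 r0 z -> z <> z0 ->
     Cmod (f z) = Cmod (z - z0) ^ 2 * Cmod (h z)).
  { intros z Hz Hne. destruct (Hbnd z Hz Hne) as (_ & _ & _ & _ & E & _).
    rewrite E, Cmod_mult, Cmod_pow. reflexivity. }
  set (K1 := 2 + Rabs (ln m) + Rabs (ln M)).
  assert (HK1 : 0 <= K1) by (unfold K1; generalize (Rabs_pos (ln m)) (Rabs_pos (ln M)); lra).
  set (K2 := (2 + D / m) ^ 2 * (1 + M)).
  assert (HK2 : 0 <= K2).
  { unfold K2. apply Rmult_le_pos; [apply pow2_ge_0 | unfold M; lra]. }
  assert (HMp : 0 < M) by (unfold M; lra).
  exists r0, (K1 + K2). split; [exact Hr0|]. split; [lra|]. split.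
  - intros z Hz Hne. destruct (Hbnd z Hz Hne) as (Hrho & Hhz & Hh1z & Hdz & Ez & Hnz).
    set (rho := Cmod (z - z0)) in *.
    assert (Hmz := Hmod z Hz Hne). fold rho in Hmz.
    assert (Hfz : 0 < Cmod (f z)).
    { rewrite Hmz. apply Rmult_lt_0_compat; [apply pow_lt|]; lra. }
    assert (Hln : ln (Cmod (f z)) = 2 * ln rho + ln (Cmod (h z))).
    { rewrite Hmz, ln_mult by (try apply pow_lt; lra). f_equal.
      replace (rho ^ 2) with (rho * rho) by ring. rewrite ln_mult by lra. ring. }
    split; [apply Cmod_gt_0; exact Hfz|]. split.
    + assert (B3 : Rabs (ln (Cmod (h z))) <= Rabs (ln m) + Rabs (ln M)).
      { assert (L1 : ln m <= ln (Cmod (h z))).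
        { destruct (proj1 Hhz) as [H|H]; [apply Rlt_le, ln_increasing; lra | rewrite H; lra]. }
        assert (L2 : ln (Cmod (h z)) <= ln M).
        { destruct (proj2 Hhz) as [H|H]; [apply Rlt_le, ln_increasing; lra | rewrite H; lra]. }
        assert (A1 := Rabs_maj2 (ln m)). assert (A2 := Rle_abs (ln M)).
        assert (A3 := Rabs_pos (ln m)). assert (A4 := Rabs_pos (ln M)).
        apply Rabs_le. lra. }
      assert (B4 := Rabs_ln_le_inv rho ltac:(lra)).
      assert (B5 : Rabs (ln (Cmod (f z))) <= 2 * / rho + (Rabs (ln m) + Rabs (ln M))).
      { rewrite Hln. apply Rle_trans with (1 := Rabs_triang _ _).
        rewrite Rabs_mult, (Rabs_pos_eq 2) by lra. lra. }
      apply Rle_trans with ((2 * / rho + (Rabs (ln m) + Rabs (ln M))) * rho).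
      * apply Rmult_le_compat_r; lra.
      * rewrite Rmult_plus_distr_r, Rmult_assoc, Rinv_l by lra.
        assert (A3 := Rabs_pos (ln m)). assert (A4 := Rabs_pos (ln M)). unfold K1. nra.
    + exists (2 * (z - z0) * h z + (z - z0) ^ 2 * h1 z)%C.
      split.
      * destruct (cbox_nested _ _ _ Hz) as (r' & Hr' & Hnest).
        apply (cderiv_ext_loc (fun w => (w - z0) * (w - z0) * h w)%C _ _ _ r' Hr').
        { intros w Hw. rewrite (proj1 (Hf w (cbox_mono z0 w r0 r ltac:(lra)
            (Hnest w (cbox_of_Cmod _ _ _ Hw))))). ring. }
        assert (Hi : cderiv (fun w => w - z0)%C z 1%C)
          by (apply (cderiv_sub_const (fun w => w)), cderiv_id).
        assert (H2 := cderiv_mult _ _ _ _ _ (cderiv_mult _ _ _ _ _ Hi Hi) Hdz). cbv beta in H2.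
        replace (2 * (z - z0) * h z + (z - z0) ^ 2 * h1 z)%C with
          ((1 * (z - z0) + (z - z0) * 1) * h z + (z - z0) * (z - z0) * h1 z)%C by ring.
        exact H2.
      * intros L HL.
        assert (Hexp : exp (- L) <= M * rho ^ 2).
        { assert (HL' : - L <= ln (Cmod (f z))) by (apply Rabs_le_between in HL; lra).
          assert (X : exp (- L) <= Cmod (f z)).
          { rewrite <- (exp_ln (Cmod (f z))) by exact Hfz.
            destruct HL' as [H|H]; [apply Rlt_le, exp_increasing; exact H | rewrite H; lra]. }
          rewrite Hmz in X. assert (0 <= rho ^ 2) by apply pow2_ge_0. nra. }
        assert (Hquot : Cmod (2 * (z - z0) * h z + (z - z0) ^ 2 * h1 z) / Cmod (f z) * rho <= 2 + D / m).
        { rewrite Hmz.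
          assert (Hnum : Cmod (2 * (z - z0) * h z + (z - z0) ^ 2 * h1 z) <=
             2 * rho * Cmod (h z) + rho ^ 2 * D).
          { apply Rle_trans with (1 := Cmod_triangle _ _).
            rewrite !Cmod_mult, Cmod_pow, Cmod_R, Rabs_pos_eq by lra. fold rho.
            apply Rplus_le_compat_l. apply Rmult_le_compat_l; [apply pow2_ge_0 | exact Hh1z]. }
          apply Rle_trans with ((2 * rho * Cmod (h z) + rho ^ 2 * D) / (rho ^ 2 * Cmod (h z)) * rho).
          - apply Rmult_le_compat_r; [lra|]. apply Rmult_le_compat_r; [|exact Hnum].
            apply Rlt_le, Rinv_0_lt_compat. rewrite <- Hmz; exact Hfz.
          - replace ((2 * rho * Cmod (h z) + rho ^ 2 * D) / (rho ^ 2 * Cmod (h z)) * rho)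
              with (2 + D * rho * / Cmod (h z)) by (field; lra).
            apply Rplus_le_compat_l. unfold Rdiv. apply Rmult_le_compat.
            + nra.
            + apply Rlt_le, Rinv_0_lt_compat; lra.
            + nra.
            + apply Rinv_le_contravar; lra. }
        set (q := Cmod (2 * (z - z0) * h z + (z - z0) ^ 2 * h1 z) / Cmod (f z)) in *.
        assert (Hq : 0 <= q) by (apply Rdiv_le_0_compat; [apply Cmod_ge_0 | exact Hfz]).
        apply Rle_trans with ((q * rho) ^ 2 * (1 + M)).
        { replace ((q * rho) ^ 2 * (1 + M)) with (q ^ 2 * (rho ^ 2 + M * rho ^ 2)) by ring.
          apply Rmult_le_compat_l; [apply pow2_ge_0 | lra]. }
        apply Rle_trans with K2; [|lra]. unfold K2.
        apply Rmult_le_compat_r; [lra|]. apply pow_incr. split; [|exact Hquot].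
        apply Rmult_le_pos; lra.
  - intros L.
    set (e := exp (- (Rabs L + 1)) / M).
    assert (He : 0 < e) by (apply Rdiv_lt_0_compat; [apply exp_pos | exact HMp]).
    exists (Rmin r0 (Rmin (/ 2) (e / 2))). split; [repeat apply Rmin_pos; lra|].
    intros z Hz Hne.
    assert (A1 := Rmin_l r0 (Rmin (/ 2) (e / 2))). assert (A2 := Rmin_r r0 (Rmin (/ 2) (e / 2))).
    assert (A3 := Rmin_l (/ 2) (e / 2)). assert (A4 := Rmin_r (/ 2) (e / 2)).
    assert (Hz' : cbox z0 r0 z) by (apply cbox_mono with (2 := Hz); exact A1).
    destruct (Hbnd z Hz' Hne) as (Hrho & Hhz & _).
    assert (Hc := Cmod_of_cbox _ _ _ Hz).
    set (rho := Cmod (z - z0)) in *.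
    assert (Hmz := Hmod z Hz' Hne). fold rho in Hmz.
    assert (Hfz : 0 < Cmod (f z)).
    { rewrite Hmz. apply Rmult_lt_0_compat; [apply pow_lt|]; lra. }
    assert (Hlt : Cmod (f z) < exp (- (Rabs L + 1))).
    { apply Rle_lt_trans with (rho * M).
      - rewrite Hmz. apply Rmult_le_compat; try lra; nra.
      - replace (exp (- (Rabs L + 1))) with (e * M) by (unfold e; field; lra).
        apply Rmult_lt_compat_r; lra. }
    assert (Hl : ln (Cmod (f z)) < - (Rabs L + 1)).
    { rewrite <- (ln_exp (- (Rabs L + 1))). apply ln_increasing; auto. }
    assert (HL := Rle_abs L). assert (HL2 := Rabs_pos L).
    rewrite Rabs_left by lra. lra.
Qed.

Lemma cderiv_shift (f : C -> C) (z c l : C) :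
  cderiv f (z - c)%C l -> cderiv (fun w => f (w - c))%C z l.
Proof.
  rewrite !cderiv_eps. intros H eps He. destruct (H eps He) as (d & Hd & B).
  exists d. split; [exact Hd|]. intros w Hw.
  replace (w - z)%C with (w - c - (z - c))%C in * by ring. apply B. exact Hw.
Qed.

Lemma zero_of_order_cyl (n : nat) (g : C -> sphere) (p z : C) : (forall z, g (z + Ci)%C = g z) ->
  cyl_eq z p -> zero_of_order n g p -> zero_of_order n g z.
Proof.
  intros Hper [k Hk] (h & H1 & H2 & H3).
  set (c := (IZR k * Ci)%C).
  assert (Hz : (z - c)%C = p) by (rewrite Hk; unfold c; ring).
  assert (Hgc : forall w, g (w - c)%C = g w).
  { intros w. destruct w as [x y].
    assert (E : forall t, (fun t => g (x, t)) (t + 1) = (fun t => g (x, t)) t).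
    { intros t. rewrite <- (Hper (x, t)). f_equal. apply injective_projections; simpl; ring. }
    assert (Hn : forall s, g (x, s + IZR (- k)) = g (x, s) ).
    { intros s. set (P := fun t => g (x, t) = g (x, s)).
      apply (periodic_Z_prop P); [|reflexivity].
      intros t. unfold P. specialize (E t). cbv beta in E. rewrite E. tauto. }
    rewrite <- (Hn y). f_equal. rewrite opp_IZR.
    apply injective_projections; unfold c; simpl; ring. }
  assert (Hbox : forall r w, cbox z r w -> cbox p r (w - c)%C).
  { intros r w [W1 W2]. rewrite <- Hz. split.
    - replace (Re (w - c) - Re (z - c)) with (Re w - Re z) by (unfold Re; simpl; ring). exact W1.
    - replace (Im (w - c) - Im (z - c)) with (Im w - Im z) by (unfold Im; simpl; ring). exact W2. }
  exists (fun w => h (w - c)%C). split; [|split].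
  - apply holomorphic_at_cbox in H1. destruct H1 as (r & Hr & H1).
    apply holomorphic_at_cbox. exists r. split; [exact Hr|]. intros w Hw.
    destruct (H1 _ (Hbox r w Hw)) as [l Hl]. exists l. apply cderiv_shift. exact Hl.
  - rewrite Hz. exact H2.
  - apply locally_cbox in H3. destruct H3 as (r & Hr & H3).
    apply locally_cbox. exists r. split; [exact Hr|]. intros w Hw.
    rewrite <- (Hgc w). rewrite (H3 _ (Hbox r w Hw)), <- Hz. f_equal. f_equal. f_equal. ring.
Qed.

(** At most logarithmic growth of [ell] near [z0], and at most simple poles of its
    gradient, in the form that the cutoff of singularities by the size of [ell]
    will use. *)
Definition tempered_at (g : C -> sphere) (z0 : C) (r K : R) : Prop :=
  forall x y, cbox z0 r (x, y) -> regular g (x, y) ->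
    ell g x y ^ 2 * ((x - Re z0) ^ 2 + (y - Im z0) ^ 2) <= K /\
    forall L, 0 <= L -> Rabs (ell g x y) <= L ->
      (ell_x g x y ^ 2 + ell_y g x y ^ 2) * ((x - Re z0) ^ 2 + (y - Im z0) ^ 2 + exp (- L)) <= K.

Lemma Cmod_sub_sqr (x y : R) (z0 : C) :
  Cmod ((x, y) - z0) ^ 2 = (x - Re z0) ^ 2 + (y - Im z0) ^ 2.
Proof. rewrite Cmod_sqr. reflexivity. Qed.

Lemma tempered_regular (g : C -> sphere) (z0 : C) : meromorphic_cyl g -> regular g z0 ->
  exists r K, 0 < r /\ 0 <= K /\ (forall z, cbox z0 r z -> regular g z) /\ tempered_at g z0 r K.
Proof.
  intros Hm Hreg. destruct (regular_local g z0 Hm Hreg) as (r & Hr & H).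
  assert (Hreg' : regular g (Re z0, Im z0)) by (rewrite pair_eta; exact Hreg).
  destruct (ell_harmonic g (Re z0) (Im z0) Hm Hreg') as [_ (C0 & C1 & C2 & _)].
  assert (Hb : forall f, continuity_2d_pt f (Re z0) (Im z0) -> exists d, 0 < d /\
    forall x y, cbox z0 d (x, y) -> Rabs (f x y) <= Rabs (f (Re z0) (Im z0)) + 1).
  { intros f Hf. destruct (Hf (mkposreal 1 Rlt_0_1)) as [d Hd]. exists d.
    split; [apply cond_pos|]. intros x y [X1 X2]. specialize (Hd x y X1 X2). simpl in Hd.
    replace (f x y) with ((f x y - f (Re z0) (Im z0)) + f (Re z0) (Im z0)) by ring.
    apply Rle_trans with (1 := Rabs_triang _ _). lra. }
  destruct (Hb _ C0) as (d0 & Hd0 & B0). destruct (Hb _ C1) as (d1 & Hd1 & B1).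
  destruct (Hb _ C2) as (d2 & Hd2 & B2).
  set (k0 := Rabs (ell g (Re z0) (Im z0)) + 1) in *.
  set (k1 := Rabs (ell_x g (Re z0) (Im z0)) + 1) in *.
  set (k2 := Rabs (ell_y g (Re z0) (Im z0)) + 1) in *.
  set (r' := Rmin (Rmin r 1) (Rmin d0 (Rmin d1 d2))).
  assert (Hr' : 0 < r') by (unfold r'; repeat apply Rmin_pos; lra).
  assert (Hle : r' <= r /\ r' <= 1 /\ r' <= d0 /\ r' <= d1 /\ r' <= d2).
  { unfold r'. assert (A1 := Rmin_l (Rmin r 1) (Rmin d0 (Rmin d1 d2))).
    assert (A2 := Rmin_r (Rmin r 1) (Rmin d0 (Rmin d1 d2))).
    assert (A3 := Rmin_l r 1). assert (A4 := Rmin_r r 1).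
    assert (A5 := Rmin_l d0 (Rmin d1 d2)). assert (A6 := Rmin_r d0 (Rmin d1 d2)).
    assert (A7 := Rmin_l d1 d2). assert (A8 := Rmin_r d1 d2). lra. }
  exists r', (2 * k0 ^ 2 + 3 * (k1 ^ 2 + k2 ^ 2)).
  assert (S0 := pow2_ge_0 k0). assert (S1 := pow2_ge_0 k1). assert (S2 := pow2_ge_0 k2).
  split; [exact Hr'|]. split; [lra|]. split.
  - intros z Hz. apply H. apply cbox_mono with (2 := Hz); lra.
  - intros x y Hxy _.
    assert (Hsq : (x - Re z0) ^ 2 + (y - Im z0) ^ 2 <= 2).
    { destruct Hxy as [X1 X2]. change (Re (x, y)) with x in X1. change (Im (x, y)) with y in X2.
      apply Rabs_lt_between in X1. apply Rabs_lt_between in X2. nra. }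
    assert (Hsq0 : 0 <= (x - Re z0) ^ 2 + (y - Im z0) ^ 2)
      by (generalize (pow2_ge_0 (x - Re z0)) (pow2_ge_0 (y - Im z0)); lra).
    assert (Hk : forall a k, Rabs a <= k -> a ^ 2 <= k ^ 2).
    { intros a k Hak. rewrite <- (pow2_abs a). apply pow_incr. split; [apply Rabs_pos | exact Hak]. }
    specialize (B0 x y (cbox_mono z0 (x, y) r' d0 ltac:(lra) Hxy)).
    specialize (B1 x y (cbox_mono z0 (x, y) r' d1 ltac:(lra) Hxy)).
    specialize (B2 x y (cbox_mono z0 (x, y) r' d2 ltac:(lra) Hxy)).
    apply Hk in B0, B1, B2. assert (Q0 := pow2_ge_0 (ell g x y)).
    split; [nra|]. intros L HL _.
    assert (He : exp (- L) <= 1).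
    { rewrite <- exp_0. destruct HL as [HL|HL]; [apply Rlt_le, exp_increasing; lra|].
      rewrite <- HL, Ropp_0. lra. }
    assert (He' := exp_pos (- L)). nra.
Qed.

(** [double_zero_growth] for whichever of [g] and [1 / g] vanishes at [z0]. *)
Lemma tempered_singular (g : C -> sphere) (z0 : C) : meromorphic_cyl g -> double_divisor g ->
  ~ regular g z0 ->
  exists r K, 0 < r /\ 0 <= K /\ (forall z, cbox z0 r z -> z <> z0 -> regular g z) /\
    tempered_at g z0 r K /\
    forall L, exists d, 0 < d /\ forall x y, cbox z0 d (x, y) -> regular g (x, y) -> L < Rabs (ell g x y).
Proof.
  intros Hm (p & q & _ & _ & Hp & Hq & Zp & Pq) Hreg.
  assert (Hper : forall z, g (z + Ci)%C = g z) by apply Hm.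
  assert (Hord : zero_of_order 2 g z0 \/ zero_of_order 2 (fun w => sph_inv (g w)) z0).
  { apply NNPP in Hreg. destruct Hreg as [E|E].
    - left. apply Hp in E. destruct E as [j Hj]. apply zero_of_order_cyl with (p j); auto.
    - right. apply Hq in E. destruct E as [j Hj].
      apply zero_of_order_cyl with (q j); auto.
      + intros z. rewrite Hper. reflexivity.
      + apply Pq. }
  (* f is whichever of g and 1 / g vanishes at z0 *)
  assert (Hf : exists (f h : C -> C) (r : R), 0 < r /\ h z0 <> 0%C /\
    (forall w, cbox z0 r w -> f w = ((w - z0) ^ 2 * h w)%C /\ exists l, cderiv h w l) /\
    (forall w, cbox z0 r w -> f w <> 0%C -> regular g w) /\
    (forall x y, cbox z0 r (x, y) -> regular g (x, y) ->
       Rabs (ell g x y) = Rabs (ln (Cmod (f (x, y)))) /\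
       forall l, cderiv f (x, y) l ->
         ell_x g x y ^ 2 + ell_y g x y ^ 2 = (Cmod l / Cmod (f (x, y))) ^ 2)).
  { destruct Hord as [(h & H1 & H2 & H3)|(h & H1 & H2 & H3)];
      apply holomorphic_at_cbox in H1; destruct H1 as (r1 & Hr1 & H1);
      apply locally_cbox in H3; destruct H3 as (r3 & Hr3 & H3);
      assert (L1 := Rmin_l r1 r3); assert (L2 := Rmin_r r1 r3).
    - exists (fun w => toC (g w)), h, (Rmin r1 r3). split; [apply Rmin_pos; lra|].
      split; [exact H2|]. split; [|split].
      + intros w Hw. split; [|apply H1, cbox_mono with (2 := Hw); lra].
        rewrite (H3 w (cbox_mono _ _ _ _ L2 Hw)). reflexivity.
      + intros w Hw Hne. assert (E := H3 w (cbox_mono _ _ _ _ L2 Hw)).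
        apply nonzero_regular with (1 := E). rewrite E in Hne. exact Hne.
      + intros x y _ Hr. split; [reflexivity|]. intros l Hl.
        exact (ell_gradient g x y l Hm Hr Hl).
    - exists (fun w => toC (sph_inv (g w))), h, (Rmin r1 r3). split; [apply Rmin_pos; lra|].
      split; [exact H2|]. split; [|split].
      + intros w Hw. split; [|apply H1, cbox_mono with (2 := Hw); lra].
        rewrite (H3 w (cbox_mono _ _ _ _ L2 Hw)). reflexivity.
      + intros w Hw Hne. intros [E|E]; rewrite E in Hne; simpl in Hne.
        * destruct (Ceq_dec 0 0); simpl in Hne; congruence.
        * congruence.
      + intros x y _ Hr. destruct (regular_nonzero g _ Hr) as [_ N].
        assert (P := proj1 (Cmod_gt_0 _) N). split.
        * rewrite (regular_inv g _ Hr). simpl. rewrite Cmod_inv, ln_Rinv, Rabs_Ropp by auto.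
          reflexivity.
        * intros l Hl. destruct (regular_local g (x, y) Hm Hr) as (r & Hr0 & H).
          destruct (H _ (cbox_center _ _ Hr0)) as [_ [m Hm']].
          assert (Hi : cderiv (fun w => toC (sph_inv (g w))) (x, y)
            (- m / (toC (g (x, y)) * toC (g (x, y))))%C).
          { apply (cderiv_ext_loc (fun w => / toC (g w))%C _ _ _ r Hr0).
            - intros w Hw. rewrite (regular_inv g w); [reflexivity|]. apply H, cbox_of_Cmod; exact Hw.
            - exact (cderiv_inv _ _ _ N Hm'). }
          rewrite (cderiv_unique _ _ _ _ Hl Hi), (regular_inv g _ Hr), (ell_gradient g x y m Hm Hr Hm').
          simpl toC. rewrite Cmod_inv, Cmod_div, Cmod_opp, Cmod_mult by (auto; apply Cmult_neq_0; auto).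
          field. lra. }
  destruct Hf as (f & h & r & Hr & Hh & Hfh & Hfr & Hell).
  destruct (double_zero_growth f h z0 r Hr Hh Hfh) as (r' & K & Hr' & HK & G1 & G2).
  assert (L1 := Rmin_l r r'). assert (L2 := Rmin_r r r').
  assert (Hne : forall x y, regular g (x, y) -> (x, y) <> z0).
  { intros x y R1 E. apply Hreg. rewrite <- E. exact R1. }
  exists (Rmin r r'), (K ^ 2 + K). split; [apply Rmin_pos; lra|].
  split; [generalize (pow2_ge_0 K); lra|]. split; [|split].
  - intros z Hz Hz0. apply Hfr; [apply cbox_mono with (2 := Hz); lra|].
    apply (G1 z); [apply cbox_mono with (2 := Hz); lra | exact Hz0].
  - intros x y Hxy Hrxy.
    destruct (G1 (x, y) (cbox_mono _ _ _ _ L2 Hxy) (Hne x y Hrxy)) as (_ & Ga & l & Hl & Gb).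
    destruct (Hell x y (cbox_mono _ _ _ _ L1 Hxy) Hrxy) as [E1 E2].
    assert (Hc0 := Cmod_ge_0 ((x, y) - z0)).
    rewrite <- Cmod_sub_sqr. split.
    + rewrite <- (pow2_abs (ell g x y)), E1, <- Rpow_mult_distr.
      apply Rle_trans with (K ^ 2); [|lra]. apply pow_incr. split; [|exact Ga].
      apply Rmult_le_pos; [apply Rabs_pos | exact Hc0].
    + intros L HL HLe. rewrite (E2 l Hl). rewrite E1 in HLe.
      generalize (Gb L HLe) (pow2_ge_0 K). lra.
  - intros L. destruct (G2 L) as (d & Hd & Gd).
    exists (Rmin r d). split; [apply Rmin_pos; lra|]. intros x y Hxy Hrxy.
    rewrite (proj1 (Hell x y (cbox_mono _ _ _ _ (Rmin_l r d) Hxy) Hrxy)).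
    apply Gd; [apply cbox_mono with (2 := Hxy), Rmin_r | apply Hne; exact Hrxy].
Qed.

(** * Real Fourier series on the circle of length one *)

(** The frequency of the [j]-th mode; the modes are [1], then
    [sqrt 2 cos(2 pi k y)], [sqrt 2 sin(2 pi k y)] for [j = 2 k - 1, 2 k]. *)
Definition freq (j : nat) : R := 2 * PI * INR (Nat.div2 (S j)).

Definition mode (j : nat) (y : R) : R :=
  match j with
  | O => 1
  | S i => if Nat.even i then sqrt 2 * cos (freq j * y) else sqrt 2 * sin (freq j * y)
  end.

Definition mode' (j : nat) (y : R) : R :=
  match j with
  | O => 0
  | S i => if Nat.even i then - (freq j) * (sqrt 2 * sin (freq j * y))
           else freq j * (sqrt 2 * cos (freq j * y))
  end.

Lemma mode_derive (j : nat) (y : R) :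
  is_derive (mode j) y (mode' j y) /\ is_derive (mode' j) y (- (freq j ^ 2) * mode j y).
Proof.
  destruct j as [|i].
  - simpl. split.
    + apply (is_derive_const (V := R_NormedModule)).
    + replace (- (freq 0 * (freq 0 * 1)) * 1) with 0 by (unfold freq; simpl; ring).
      apply (is_derive_const (V := R_NormedModule)).
  - unfold mode, mode'. set (w := freq (S i)). destruct (Nat.even i); split; auto_derive; auto; ring.
Qed.

Lemma continuous_of_derive (f : R -> R) (x l : R) : is_derive f x l -> continuous f x.
Proof.
  intros H. apply (ex_derive_continuous (V := R_NormedModule)). exists l; exact H.
Qed.

Lemma mode_continuous (j : nat) (y : R) : continuous (mode j) y.
Proof. exact (continuous_of_derive _ _ _ (proj1 (mode_derive j y))). Qed.

Lemma mode'_continuous (j : nat) (y : R) : continuous (mode' j) y.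
Proof. exact (continuous_of_derive _ _ _ (proj2 (mode_derive j y))). Qed.

Lemma sqrt2_sqr : sqrt 2 * sqrt 2 = 2.
Proof. apply sqrt_sqrt; lra. Qed.

Lemma sqrt2_bound : 0 <= sqrt 2 <= 2.
Proof. generalize sqrt2_sqr (sqrt_pos 2). nra. Qed.

Lemma mode_bound (j : nat) (y : R) : Rabs (mode j y) <= 2 /\ Rabs (mode' j y) <= 2 * freq j.
Proof.
  assert (F : 0 <= freq j).
  { unfold freq. generalize PI_RGT_0 (pos_INR (Nat.div2 (S j))). intros. nra. }
  assert (S2 := sqrt2_bound).
  assert (Ht : forall t, Rabs (sqrt 2 * cos t) <= 2 /\ Rabs (sqrt 2 * sin t) <= 2).
  { intros t. rewrite !Rabs_mult, (Rabs_pos_eq (sqrt 2)) by lra.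
    assert (H1 : Rabs (cos t) <= 1) by (apply Rabs_le; generalize (COS_bound t); lra).
    assert (H2 : Rabs (sin t) <= 1) by (apply Rabs_le; generalize (SIN_bound t); lra).
    generalize (Rabs_pos (cos t)) (Rabs_pos (sin t)). intros. split; nra. }
  destruct j as [|i].
  - simpl. rewrite Rabs_R1, Rabs_R0. split; lra.
  - unfold mode, mode'. destruct (Ht (freq (S i) * y)) as [H1 H2].
    destruct (Nat.even i); split; auto; rewrite Rabs_mult, ?Rabs_Ropp, (Rabs_pos_eq (freq (S i))) by auto;
      nra.
Qed.

Lemma mode_periodic (j : nat) (y : R) : mode j (y + 1) = mode j y /\ mode' j (y + 1) = mode' j y.
Proof.
  assert (E : freq j * (y + 1) = freq j * y + 2 * INR (Nat.div2 (S j)) * PI)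
    by (unfold freq; ring).
  destruct j as [|i]; [split; reflexivity|].
  unfold mode, mode'. rewrite E, cos_period, sin_period. split; reflexivity.
Qed.

(** Equations whose left member is a [RInt] live in a module structure on [R],
    which hides them from [ring] and [field]. *)
Ltac eqR := match goal with |- @eq _ ?a ?b => change (@eq R a b) end.

Lemma int_cos (n : Z) : n <> 0%Z -> RInt (fun y => cos (2 * PI * IZR n * y)) 0 1 = 0.
Proof.
  intros Hn.
  assert (Hs : sin (2 * PI * IZR n) = 0).
  { apply sin_eq_0_1. exists (2 * n)%Z. rewrite mult_IZR. ring. }
  rewrite (RInt_ftc (fun y => sin (2 * PI * IZR n * y) / (2 * PI * IZR n))).
  - rewrite Rmult_1_r, Rmult_0_r, sin_0, Hs. eqR. field. split; [|generalize PI_RGT_0; lra].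
    apply not_0_IZR; auto.
  - intros t. auto_derive; auto. field. split; [|generalize PI_RGT_0; lra].
    apply not_0_IZR; auto.
  - intros t. apply continuous_of_derive with (- (2 * PI * IZR n) * sin (2 * PI * IZR n * t)).
    auto_derive; auto; ring.
Qed.

Lemma int_sin (n : Z) : RInt (fun y => sin (2 * PI * IZR n * y)) 0 1 = 0.
Proof.
  destruct (Z.eq_dec n 0) as [->|Hn].
  { rewrite (RInt_ext _ (fun _ => 0)).
    - rewrite RInt_constR. eqR. ring.
    - intros y _. replace (2 * PI * IZR 0 * y) with 0 by (simpl; ring). apply sin_0. }
  assert (Hr : IZR n <> 0) by (apply not_0_IZR; auto).
  assert (Hc : cos (2 * PI * IZR n) = 1).
  { assert (Hs : sin (PI * IZR n) = 0) by (apply sin_eq_0_1; exists n; ring).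
    replace (2 * PI * IZR n) with (2 * (PI * IZR n)) by ring. rewrite cos_2a_sin, Hs. ring. }
  rewrite (RInt_ftc (fun y => - cos (2 * PI * IZR n * y) / (2 * PI * IZR n))).
  - rewrite Rmult_1_r, Rmult_0_r, cos_0, Hc. eqR. field. split; auto. generalize PI_RGT_0; lra.
  - intros t. auto_derive; auto. field. split; auto. generalize PI_RGT_0; lra.
  - intros t. apply continuous_of_derive with (2 * PI * IZR n * cos (2 * PI * IZR n * t)).
    auto_derive; auto; ring.
Qed.

Lemma int_trig_comb (a b : R) (n m : Z) :
  RInt (fun y => a * cos (2 * PI * IZR n * y) + b * cos (2 * PI * IZR m * y)) 0 1 =
  a * RInt (fun y => cos (2 * PI * IZR n * y)) 0 1 + b * RInt (fun y => cos (2 * PI * IZR m * y)) 0 1 /\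
  RInt (fun y => a * sin (2 * PI * IZR n * y) + b * sin (2 * PI * IZR m * y)) 0 1 = 0.
Proof.
  assert (Hc : forall k n, ex_RInt (fun y => k * cos (2 * PI * IZR n * y)) 0 1).
  { intros k p. apply ex_RInt_cont_all; intros t; apply (ex_derive_continuous (V := R_NormedModule));
    auto_derive; auto. }
  assert (Hs : forall k n, ex_RInt (fun y => k * sin (2 * PI * IZR n * y)) 0 1).
  { intros k p. apply ex_RInt_cont_all; intros t; apply (ex_derive_continuous (V := R_NormedModule));
    auto_derive; auto. }
  assert (Hc' : forall n, ex_RInt (fun y => cos (2 * PI * IZR n * y)) 0 1).
  { intros p. apply ex_RInt_cont_all; intros t; apply (ex_derive_continuous (V := R_NormedModule));
    auto_derive; auto. }
  assert (Hs' : forall n, ex_RInt (fun y => sin (2 * PI * IZR n * y)) 0 1).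
  { intros p. apply ex_RInt_cont_all; intros t; apply (ex_derive_continuous (V := R_NormedModule));
    auto_derive; auto. }
  split.
  - rewrite RInt_plusR by auto. rewrite !RInt_scalR by auto. reflexivity.
  - rewrite RInt_plusR by auto. rewrite !RInt_scalR by auto. rewrite !int_sin. eqR; ring.
Qed.

(** The mean of [cos(2 pi n y)] over the circle. *)
Definition delta_zero (n : Z) : R := if Z.eq_dec n 0 then 1 else 0.

Lemma int_cos_delta (n : Z) : RInt (fun y => cos (2 * PI * IZR n * y)) 0 1 = delta_zero n.
Proof.
  unfold delta_zero. destruct (Z.eq_dec n 0) as [->|N]; [|apply int_cos; auto].
  rewrite (RInt_ext _ (fun _ => 1)); [rewrite RInt_constR; eqR; ring|].
  intros y _. replace (2 * PI * IZR 0 * y) with 0 by (simpl; ring). apply cos_0.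
Qed.

Lemma cos_cos_prod (a b : R) : cos a * cos b = / 2 * cos (a - b) + / 2 * cos (a + b).
Proof. rewrite cos_minus, cos_plus. field. Qed.
Lemma sin_sin_prod (a b : R) : sin a * sin b = / 2 * cos (a - b) + - / 2 * cos (a + b).
Proof. rewrite cos_minus, cos_plus. field. Qed.
Lemma sin_cos_prod (a b : R) : sin a * cos b = / 2 * sin (a - b) + / 2 * sin (a + b).
Proof. rewrite sin_minus, sin_plus. field. Qed.

Lemma int_products (k l : Z) :
  RInt (fun y => cos (2 * PI * IZR k * y) * cos (2 * PI * IZR l * y)) 0 1 = / 2 * delta_zero (k - l) + / 2 * delta_zero (k + l) /\
  RInt (fun y => sin (2 * PI * IZR k * y) * sin (2 * PI * IZR l * y)) 0 1 = / 2 * delta_zero (k - l) - / 2 * delta_zero (k + l) /\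
  RInt (fun y => sin (2 * PI * IZR k * y) * cos (2 * PI * IZR l * y)) 0 1 = 0 /\
  RInt (fun y => cos (2 * PI * IZR k * y) * sin (2 * PI * IZR l * y)) 0 1 = 0.
Proof.
  assert (Em : forall k l y, 2 * PI * IZR k * y - 2 * PI * IZR l * y = 2 * PI * IZR (k - l) * y)
    by (intros; rewrite minus_IZR; ring).
  assert (Ep : forall k l y, 2 * PI * IZR k * y + 2 * PI * IZR l * y = 2 * PI * IZR (k + l) * y)
    by (intros; rewrite plus_IZR; ring).
  split; [|split; [|split]].
  - rewrite (RInt_ext _ (fun y => / 2 * cos (2 * PI * IZR (k - l) * y) + / 2 * cos (2 * PI * IZR (k + l) * y))).
    + rewrite (proj1 (int_trig_comb _ _ _ _)), !int_cos_delta. reflexivity.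
    + intros y _. rewrite cos_cos_prod, Em, Ep. reflexivity.
  - rewrite (RInt_ext _ (fun y => / 2 * cos (2 * PI * IZR (k - l) * y) + - / 2 * cos (2 * PI * IZR (k + l) * y))).
    + rewrite (proj1 (int_trig_comb _ _ _ _)), !int_cos_delta. eqR; ring.
    + intros y _. rewrite sin_sin_prod, Em, Ep. reflexivity.
  - rewrite (RInt_ext _ (fun y => / 2 * sin (2 * PI * IZR (k - l) * y) + / 2 * sin (2 * PI * IZR (k + l) * y))).
    + apply int_trig_comb.
    + intros y _. rewrite sin_cos_prod, Em, Ep. reflexivity.
  - rewrite (RInt_ext _ (fun y => / 2 * sin (2 * PI * IZR (l - k) * y) + / 2 * sin (2 * PI * IZR (l + k) * y))).
    + apply int_trig_comb.
    + intros y _. rewrite Rmult_comm, sin_cos_prod, Em, Ep. reflexivity.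
Qed.

Definition kronecker (i j : nat) : R := if Nat.eq_dec i j then 1 else 0.

Lemma mode_trig (j : nat) : exists (c : R) (k : Z),
  (j = O /\ c = 1 /\ k = 0%Z /\ forall y, mode j y = c * cos (2 * PI * IZR k * y)) \/
  (c = sqrt 2 /\ (0 < k)%Z /\ j = (2 * Z.to_nat k - 1)%nat /\
     forall y, mode j y = c * cos (2 * PI * IZR k * y)) \/
  (c = sqrt 2 /\ (0 < k)%Z /\ j = (2 * Z.to_nat k)%nat /\
     forall y, mode j y = c * sin (2 * PI * IZR k * y)).
Proof.
  destruct j as [|i].
  - exists 1, 0%Z. left. repeat split. intros y. simpl. replace (2 * PI * 0 * y) with 0 by ring.
    rewrite cos_0. ring.
  - set (k := Nat.div2 (S (S i))).
    assert (Hk : (0 < k)%nat) by exact (Nat.lt_0_succ _).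
    exists (sqrt 2), (Z.of_nat k). right.
    assert (Hf : forall y, freq (S i) * y = 2 * PI * IZR (Z.of_nat k) * y).
    { intros y. unfold freq. fold k. rewrite INR_IZR_INZ. reflexivity. }
    assert (Hd := Nat.div2_odd (S (S i))). fold k in Hd.
    rewrite Nat2Z.id.
    unfold mode. destruct (Nat.even i) eqn:E.
    + left. split; [reflexivity|split; [lia|split; [|intros y; rewrite Hf; reflexivity]]].
      assert (Ho : Nat.odd (S (S i)) = false).
      { unfold Nat.odd. simpl. rewrite E. reflexivity. }
      rewrite Ho in Hd. simpl Nat.b2n in Hd. lia.
    + right. split; [reflexivity|split; [lia|split; [|intros y; rewrite Hf; reflexivity]]].
      assert (Ho : Nat.odd (S (S i)) = true).
      { unfold Nat.odd. simpl. rewrite E. reflexivity. }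
      rewrite Ho in Hd. simpl Nat.b2n in Hd. lia.
Qed.

Lemma mode_orthonormal (i j : nat) : RInt (fun y => mode i y * mode j y) 0 1 = kronecker i j.
Proof.
  destruct (mode_trig i) as (c & k & Hi). destruct (mode_trig j) as (d & l & Hj).
  assert (S2 := sqrt2_sqr).
  assert (Hcc : forall f g : R -> R, (forall y, mode i y = c * f y) -> (forall y, mode j y = d * g y) ->
     (forall y, continuous f y) -> (forall y, continuous g y) ->
     RInt (fun y => mode i y * mode j y) 0 1 = c * d * RInt (fun y => f y * g y) 0 1).
  { intros f g Hf Hg Cf Cg. rewrite <- RInt_scalR.
    - apply RInt_ext. intros y _. rewrite Hf, Hg. eqR; ring.
    - apply ex_RInt_cont_all. intros t. apply continuous_multR; auto. }
  assert (Ccos : forall m y, continuous (fun y => cos (2 * PI * IZR m * y)) y).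
  { intros m t. apply (ex_derive_continuous (V := R_NormedModule)). auto_derive; auto. }
  assert (Csin : forall m y, continuous (fun y => sin (2 * PI * IZR m * y)) y).
  { intros m t. apply (ex_derive_continuous (V := R_NormedModule)). auto_derive; auto. }
  destruct (int_products k l) as (P1 & P2 & P3 & P4).
  unfold kronecker.
  destruct Hi as [(Ii & Ic & Ik & If)|[(Ic & Ik & Ii & If)|(Ic & Ik & Ii & If)]];
  destruct Hj as [(Ji & Jc & Jk & Jf)|[(Jc & Jk & Ji & Jf)|(Jc & Jk & Ji & Jf)]];
    rewrite (Hcc _ _ If Jf) by auto; rewrite ?P1, ?P2, ?P3, ?P4; unfold delta_zero;
    destruct (Nat.eq_dec i j) as [E|E];
    try destruct (Z.eq_dec (k - l) 0) as [E1|E1]; try destruct (Z.eq_dec (k + l) 0) as [E2|E2];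
    try lia; rewrite Ic, Jc; eqR; nra.
Qed.

Definition coef (f : R -> R) (j : nat) : R := RInt (fun y => f y * mode j y) 0 1.

Lemma continuous_sum (F : nat -> R -> R) (M : nat) (t : R) :
  (forall j, continuous (F j) t) -> continuous (fun t => sum_f_R0 (fun j => F j t) M) t.
Proof.
  intros H. induction M; simpl; [apply H|]. apply continuous_plusR; auto.
Qed.

Lemma RInt_sum (F : nat -> R -> R) (M : nat) (a b : R) :
  (forall j t, continuous (F j) t) ->
  RInt (fun t => sum_f_R0 (fun j => F j t) M) a b = sum_f_R0 (fun j => RInt (F j) a b) M.
Proof.
  intros H. induction M; simpl.
  - apply RInt_ext; auto.
  - rewrite RInt_plusR, IHM; auto; apply ex_RInt_cont_all; intros t; [apply continuous_sum; auto | auto].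
Qed.

Lemma sum_kronecker (a : nat -> R) (i M : nat) : (i <= M)%nat ->
  sum_f_R0 (fun j => a j * kronecker j i) M = a i.
Proof.
  assert (H0 : forall M, (M < i)%nat -> sum_f_R0 (fun j => a j * kronecker j i) M = 0).
  { induction M0; intros H; simpl; [|rewrite IHM0 by lia]; unfold kronecker;
      destruct (Nat.eq_dec _ i); try lia; ring. }
  induction M; intros H; simpl.
  - unfold kronecker. destruct (Nat.eq_dec 0 i); [subst; ring | lia].
  - destruct (Nat.eq_dec (S M) i) as [E|E].
    + rewrite H0 by lia. unfold kronecker. destruct (Nat.eq_dec (S M) i); [subst; ring|lia].
    + rewrite IHM by lia. unfold kronecker. destruct (Nat.eq_dec (S M) i); [lia|ring].
Qed.

(** By orthonormality; so the Fourier coefficients are the best choice of [a]. *)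
Lemma distance_to_modes (f : R -> R) (a : nat -> R) (M : nat) : (forall t, continuous f t) ->
  RInt (fun y => (f y - sum_f_R0 (fun j => a j * mode j y) M) ^ 2) 0 1 =
  RInt (fun y => f y ^ 2) 0 1 - sum_f_R0 (fun j => coef f j ^ 2) M
  + sum_f_R0 (fun j => (a j - coef f j) ^ 2) M.
Proof.
  intros Hf. set (P := fun y => sum_f_R0 (fun j => a j * mode j y) M).
  assert (HP : forall t, continuous P t).
  { intros t. apply continuous_sum. intros j. apply continuous_multR; [apply continuous_const|].
    apply mode_continuous. }
  assert (Hint : forall g, (forall t, continuous g t) ->
     RInt (fun y => g y * P y) 0 1 = sum_f_R0 (fun j => a j * coef g j) M).
  { intros g Hg. rewrite (RInt_ext _ (fun y => sum_f_R0 (fun j => a j * (g y * mode j y)) M)).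
    - rewrite RInt_sum.
      + apply sum_eq. intros j _. apply RInt_scalR. apply ex_RInt_cont_all. intros t.
        apply continuous_multR; auto using mode_continuous.
      + intros j t. apply continuous_multR; [apply continuous_const|].
        apply continuous_multR; auto using mode_continuous.
    - intros y _. unfold P. rewrite scal_sum. apply sum_eq. intros; ring. }
  assert (HPP : forall j, (j <= M)%nat -> coef P j = a j).
  { intros j Hj. unfold coef.
    rewrite (RInt_ext _ (fun y => mode j y * P y)) by (intros; apply Rmult_comm).
    rewrite Hint by apply mode_continuous. rewrite <- (sum_kronecker a j M Hj).
    apply sum_eq. intros i _. f_equal. unfold coef. rewrite <- mode_orthonormal.
    apply RInt_ext. intros; apply Rmult_comm. }
  assert (E1 := Hint f Hf). assert (E2 := Hint P HP).
  rewrite (sum_eq _ (fun j => a j ^ 2)) in E2.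
  2:{ intros j Hj. rewrite HPP by auto. ring. }
  assert (Cff : ex_RInt (fun y => f y ^ 2) 0 1).
  { apply ex_RInt_cont_all. intros t. apply continuous_extR with (fun y => f y * f y); [intros; ring|].
    apply continuous_multR; auto. }
  assert (CfP : ex_RInt (fun y => f y * P y) 0 1).
  { apply ex_RInt_cont_all. intros t. apply continuous_multR; auto. }
  assert (CPP : ex_RInt (fun y => P y * P y) 0 1).
  { apply ex_RInt_cont_all. intros t. apply continuous_multR; auto. }
  transitivity (RInt (fun y => f y ^ 2) 0 1 - 2 * RInt (fun y => f y * P y) 0 1
     + RInt (fun y => P y * P y) 0 1).
  - rewrite <- (RInt_scalR _ 2) by auto.
    rewrite <- RInt_minusR by (auto using ex_RInt_scalR).
    rewrite <- RInt_plusR; auto.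
    + apply RInt_ext. intros y _. fold (P y). eqR; ring.
    + apply (ex_RInt_minus (V := R_NormedModule)); auto using ex_RInt_scalR.
  - rewrite E1, E2.
    assert (E3 : sum_f_R0 (fun j => (a j - coef f j) ^ 2) M =
      sum_f_R0 (fun j => a j ^ 2) M - 2 * sum_f_R0 (fun j => a j * coef f j) M
      + sum_f_R0 (fun j => coef f j ^ 2) M).
    { clear. induction M; cbn [sum_f_R0]; [ring|]. rewrite IHM. ring. }
    rewrite E3. eqR; ring.
Qed.

Lemma bessel (f : R -> R) (M : nat) : (forall t, continuous f t) ->
  sum_f_R0 (fun j => coef f j ^ 2) M <= RInt (fun y => f y ^ 2) 0 1.
Proof.
  intros Hf. assert (D := distance_to_modes f (coef f) M Hf).
  assert (E : sum_f_R0 (fun j => (coef f j - coef f j) ^ 2) M = 0).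
  { clear. induction M; cbn [sum_f_R0]; [|rewrite IHM]; ring. }
  rewrite E in D.
  assert (P : 0 <= RInt (fun y => (f y - sum_f_R0 (fun j => coef f j * mode j y) M) ^ 2) 0 1).
  { apply RInt_ge_0; [lra| |intros; apply pow2_ge_0].
    apply ex_RInt_cont_all. intros t.
    set (h := fun y => f y - sum_f_R0 (fun j => coef f j * mode j y) M).
    assert (Hh : continuous h t).
    { apply (continuous_minus (V := R_NormedModule)); auto. apply continuous_sum.
      intros j; apply continuous_multR; [apply continuous_const | apply mode_continuous]. }
    apply continuous_extR with (fun y => h y * h y); [intros; unfold h; ring|].
    apply continuous_multR; auto. }
  lra.
Qed.

Definition trig_poly (f : R -> R) : Prop :=
  exists (M : nat) (a : nat -> R), forall x, f x = sum_f_R0 (fun j => a j * mode j x) M.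

Lemma trig_poly_plus (f g : R -> R) : trig_poly f -> trig_poly g -> trig_poly (fun x => f x + g x).
Proof.
  assert (Hpad : forall (a : nat -> R) M k x,
    sum_f_R0 (fun j => (if le_dec j M then a j else 0) * mode j x) (M + k) =
    sum_f_R0 (fun j => a j * mode j x) M).
  { intros a M k x. induction k.
    - rewrite Nat.add_0_r. apply sum_eq. intros j Hj. destruct (le_dec j M); [reflexivity|lia].
    - rewrite Nat.add_succ_r. simpl. rewrite IHk. destruct (le_dec (S (M + k)) M); [lia|ring]. }
  intros (M & a & Ha) (N & b & Hb).
  exists (M + N)%nat, (fun j => (if le_dec j M then a j else 0) + (if le_dec j N then b j else 0)).
  intros x. rewrite Ha, Hb, <- (Hpad a M N x), <- (Hpad b N M x), (Nat.add_comm N M), <- sum_plus.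
  apply sum_eq. intros; ring.
Qed.

Lemma trig_poly_scal (k : R) (f : R -> R) : trig_poly f -> trig_poly (fun x => k * f x).
Proof.
  intros (M & a & Ha). exists M, (fun j => k * a j). intros x. rewrite Ha, scal_sum.
  apply sum_eq. intros; ring.
Qed.

Lemma trig_poly_ext (f g : R -> R) : (forall x, f x = g x) -> trig_poly f -> trig_poly g.
Proof. intros H (M & a & Ha). exists M, a. intros x. rewrite <- H; auto. Qed.

Lemma trig_poly_mode (i : nat) : trig_poly (mode i).
Proof.
  exists i, (fun j => kronecker j i). intros x.
  rewrite (sum_eq _ (fun j => mode j x * kronecker j i)) by (intros; ring).
  rewrite sum_kronecker; auto.
Qed.

Lemma trig_poly_cos_sin (k : nat) :
  trig_poly (fun x => cos (2 * PI * INR k * x)) /\ trig_poly (fun x => sin (2 * PI * INR k * x)).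
Proof.
  destruct k as [|k].
  - split.
    + apply (trig_poly_ext (mode 0)); [|apply trig_poly_mode].
      intros x. simpl. replace (2 * PI * 0 * x) with 0 by ring. rewrite cos_0; auto.
    + apply (trig_poly_ext (fun x => 0 * mode 0 x)); [|apply trig_poly_scal, trig_poly_mode].
      intros x. simpl. replace (2 * PI * 0 * x) with 0 by ring. rewrite sin_0; ring.
  - assert (S2 : sqrt 2 <> 0) by (generalize sqrt2_sqr; nra).
    assert (H1 : mode (S (2 * k)) = fun x => sqrt 2 * cos (2 * PI * INR (S k) * x)).
    { apply functional_extensionality; intros x. unfold mode, freq.
      rewrite Nat.even_even. do 2 f_equal. f_equal. f_equal. f_equal.
      replace (S (S (2 * k))) with (2 * S k)%nat by lia. apply Nat.div2_double. }
    assert (H2 : mode (S (S (2 * k))) = fun x => sqrt 2 * sin (2 * PI * INR (S k) * x)).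
    { apply functional_extensionality; intros x. unfold mode, freq.
      rewrite Nat.even_succ. replace (Nat.odd (2 * k)) with false by (symmetry; apply Nat.odd_even).
      do 2 f_equal. f_equal. f_equal. f_equal.
      replace (S (S (S (2 * k)))) with (S (2 * S k))%nat by lia. apply Nat.div2_succ_double. }
    split.
    + apply (trig_poly_ext (fun x => / sqrt 2 * mode (S (2 * k)) x));
        [|apply trig_poly_scal, trig_poly_mode]. intros x. rewrite H1. field; auto.
    + apply (trig_poly_ext (fun x => / sqrt 2 * mode (S (S (2 * k))) x));
        [|apply trig_poly_scal, trig_poly_mode]. intros x. rewrite H2. field; auto.
Qed.

Lemma trig_poly_sum (F : nat -> R -> R) (M : nat) : (forall j, trig_poly (F j)) ->
  trig_poly (fun x => sum_f_R0 (fun j => F j x) M).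
Proof.
  intros H. induction M; [apply H|].
  apply (trig_poly_ext (fun x => sum_f_R0 (fun j => F j x) M + F (S M) x)); [reflexivity|].
  apply trig_poly_plus; auto.
Qed.

(** The product formulas: frequencies are shifted by one. *)
Lemma trig_poly_mult_base (f : R -> R) : trig_poly f ->
  trig_poly (fun x => cos (2 * PI * x) * f x) /\ trig_poly (fun x => sin (2 * PI * x) * f x).
Proof.
  assert (H1 : forall k : nat,
    trig_poly (fun x => cos (2 * PI * x) * cos (2 * PI * INR k * x)) /\
    trig_poly (fun x => cos (2 * PI * x) * sin (2 * PI * INR k * x)) /\
    trig_poly (fun x => sin (2 * PI * x) * cos (2 * PI * INR k * x)) /\
    trig_poly (fun x => sin (2 * PI * x) * sin (2 * PI * INR k * x))).
  { intros [|k].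
    - assert (E : forall x, 2 * PI * INR 0 * x = 0) by (intros; simpl; ring).
      assert (E1 : forall x, 2 * PI * INR 1 * x = 2 * PI * x) by (intros; simpl; ring).
      destruct (trig_poly_cos_sin 1) as [T1 T2]. destruct (trig_poly_cos_sin 0) as [T3 T4].
      split; [|split; [|split]].
      + apply (trig_poly_ext _ _) with (2 := T1). intros x. rewrite E, E1, cos_0; ring.
      + apply (trig_poly_ext _ _) with (2 := T4). intros x. rewrite E, sin_0; ring.
      + apply (trig_poly_ext _ _) with (2 := T2). intros x. rewrite E, E1, cos_0; ring.
      + apply (trig_poly_ext _ _) with (2 := T4). intros x. rewrite E, sin_0; ring.
    - destruct (trig_poly_cos_sin k) as [T1 T2]. destruct (trig_poly_cos_sin (S (S k))) as [T3 T4].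
      assert (Em : forall x, 2 * PI * INR (S k) * x - 2 * PI * x = 2 * PI * INR k * x)
        by (intros; rewrite S_INR; ring).
      assert (Ep : forall x, 2 * PI * INR (S k) * x + 2 * PI * x = 2 * PI * INR (S (S k)) * x)
        by (intros; rewrite (S_INR (S k)); ring).
      split; [|split; [|split]].
      + apply (trig_poly_ext _ _) with (2 := trig_poly_plus _ _ (trig_poly_scal (/ 2) _ T1) (trig_poly_scal (/ 2) _ T3)).
        intros x. rewrite <- Em, <- Ep, (Rmult_comm (cos _)), cos_cos_prod. reflexivity.
      + apply (trig_poly_ext _ _) with (2 := trig_poly_plus _ _ (trig_poly_scal (/ 2) _ T2) (trig_poly_scal (/ 2) _ T4)).
        intros x. rewrite <- Em, <- Ep, (Rmult_comm (cos _)), sin_cos_prod. reflexivity.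
      + apply (trig_poly_ext _ _) with (2 := trig_poly_plus _ _ (trig_poly_scal (- / 2) _ T2) (trig_poly_scal (/ 2) _ T4)).
        intros x. rewrite <- Em, <- Ep, sin_minus, sin_plus. field.
      + apply (trig_poly_ext _ _) with (2 := trig_poly_plus _ _ (trig_poly_scal (/ 2) _ T1) (trig_poly_scal (- / 2) _ T3)).
        intros x. rewrite <- Em, <- Ep, (Rmult_comm (sin _)), sin_sin_prod. reflexivity. }
  assert (H2 : forall j, trig_poly (fun x => cos (2 * PI * x) * mode j x) /\
     trig_poly (fun x => sin (2 * PI * x) * mode j x)).
  { intros j. destruct j as [|i].
    - destruct (H1 O) as (A1 & _ & A3 & _).
      assert (E : forall x, 2 * PI * INR 0 * x = 0) by (intros; simpl; ring).
      split; [apply (trig_poly_ext _ _) with (2 := A1) | apply (trig_poly_ext _ _) with (2 := A3)];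
        intros x; rewrite E, cos_0; reflexivity.
    - destruct (H1 (Nat.div2 (S (S i)))) as (A1 & A2 & A3 & A4).
      unfold mode, freq. destruct (Nat.even i).
      + split; [apply (trig_poly_ext _ _) with (2 := trig_poly_scal (sqrt 2) _ A1)
               | apply (trig_poly_ext _ _) with (2 := trig_poly_scal (sqrt 2) _ A3)]; intros x; ring.
      + split; [apply (trig_poly_ext _ _) with (2 := trig_poly_scal (sqrt 2) _ A2)
               | apply (trig_poly_ext _ _) with (2 := trig_poly_scal (sqrt 2) _ A4)]; intros x; ring. }
  intros (M & a & Ha). split.
  - apply (trig_poly_ext (fun x => sum_f_R0 (fun j => a j * (cos (2 * PI * x) * mode j x)) M)).
    + intros x. rewrite Ha, scal_sum. apply sum_eq; intros; ring.
    + apply (trig_poly_sum (fun j x => a j * (cos (2 * PI * x) * mode j x))). intros j. apply trig_poly_scal, H2.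
  - apply (trig_poly_ext (fun x => sum_f_R0 (fun j => a j * (sin (2 * PI * x) * mode j x)) M)).
    + intros x. rewrite Ha, scal_sum. apply sum_eq; intros; ring.
    + apply (trig_poly_sum (fun j x => a j * (sin (2 * PI * x) * mode j x))). intros j. apply trig_poly_scal, H2.
Qed.

(** The (unnormalized) convolution kernel of de la Vallee-Poussin. *)
Definition vp_kernel (n : nat) (x y : R) : R := cos (PI * (x - y)) ^ (2 * n).

Lemma vp_kernel_continuous (n : nat) (x y : R) : continuous (vp_kernel n x) y.
Proof.
  apply (ex_derive_continuous (V := R_NormedModule)). unfold vp_kernel. auto_derive; auto.
Qed.

(** [cos(pi (x - y))^2 = (1 + cos(2 pi (x - y))) / 2], so that each power of it is a
    combination of products of a mode in [x] and a mode in [y]. *)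
Lemma vp_convolution_trig_poly (n : nat) (f : R -> R) : (forall t, continuous f t) ->
  trig_poly (fun x => RInt (fun y => f y * vp_kernel n x y) 0 1).
Proof.
  revert f. induction n as [|n IH]; intros f Hf.
  - apply (trig_poly_ext (fun x => RInt f 0 1 * mode 0 x)).
    + intros x. simpl. rewrite Rmult_1_r. apply RInt_ext. intros y _. unfold vp_kernel. simpl. eqR; ring.
    + apply trig_poly_scal, trig_poly_mode.
  - assert (Cc : forall t, continuous (fun y => cos (2 * PI * y)) t)
      by (intros t; apply (ex_derive_continuous (V := R_NormedModule)); auto_derive; auto).
    assert (Cs : forall t, continuous (fun y => sin (2 * PI * y)) t)
      by (intros t; apply (ex_derive_continuous (V := R_NormedModule)); auto_derive; auto).
    set (fc := fun y => f y * cos (2 * PI * y)). set (fs := fun y => f y * sin (2 * PI * y)).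
    assert (Hfc : forall t, continuous fc t) by (intros; apply continuous_multR; auto).
    assert (Hfs : forall t, continuous fs t) by (intros; apply continuous_multR; auto).
    assert (T1 := trig_poly_scal (/ 2) _ (IH f Hf)).
    assert (T2 := trig_poly_scal (/ 2) _ (proj1 (trig_poly_mult_base _ (IH fc Hfc)))).
    assert (T3 := trig_poly_scal (/ 2) _ (proj2 (trig_poly_mult_base _ (IH fs Hfs)))).
    apply (trig_poly_ext _ _) with (2 := trig_poly_plus _ _ T1 (trig_poly_plus _ _ T2 T3)).
    intros x.
    assert (Hk : forall h, (forall t, continuous h t) -> ex_RInt (fun y => h y * vp_kernel n x y) 0 1).
    { intros h Hh. apply ex_RInt_cont_all. intros t. apply continuous_multR; auto using vp_kernel_continuous. }
    rewrite <- !Rmult_assoc. rewrite <- !RInt_scalR by auto.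
    rewrite <- !RInt_plusR; auto using ex_RInt_scalR.
    2:{ apply (ex_RInt_plus (V := R_NormedModule)); auto using ex_RInt_scalR. }
    apply RInt_ext. intros y _. unfold fc, fs, vp_kernel.
    replace (2 * S n)%nat with (2 * n + 2)%nat by lia. rewrite pow_add.
    assert (E : cos (PI * (x - y)) ^ 2 = / 2 * (1 + (cos (2 * PI * x) * cos (2 * PI * y) + sin (2 * PI * x) * sin (2 * PI * y)))).
    { rewrite <- cos_minus. replace (2 * PI * x - 2 * PI * y) with (2 * (PI * (x - y))) by ring.
      rewrite cos_2a_cos. field. }
    rewrite E. eqR; ring.
Qed.

Lemma sin_cos_shift_PI (t : R) : sin (t - PI) = - sin t /\ cos (t - PI) = - cos t.
Proof. rewrite sin_minus, cos_minus, sin_PI, cos_PI. split; ring. Qed.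

(** The kernel concentrates: by parts, the mean of [sin^2] against
    [cos^(2 n)] is [1 / (2 n + 2)], whatever the total mass. *)
Lemma vp_kernel_mass (n : nat) : exists I, 0 < I /\ forall x,
  RInt (vp_kernel n x) 0 1 = I /\
  RInt (fun y => sin (PI * (x - y)) ^ 2 * vp_kernel n x y) 0 1 = I / (2 * INR n + 2).
Proof.
  assert (Hrec : forall n x, RInt (vp_kernel (S n) x) 0 1 * (2 * INR n + 2) =
     RInt (vp_kernel n x) 0 1 * (2 * INR n + 1)).
  { clear n. intros n x. assert (HPI := PI_RGT_0).
    assert (E : RInt (fun y => PI * (2 * INR n + 1) * vp_kernel n x y - PI * (2 * INR n + 2) * vp_kernel (S n) x y) 0 1 = 0).
    { rewrite (RInt_ftc (fun y => sin (PI * (x - y)) * cos (PI * (x - y)) ^ (2 * n + 1))).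
      - replace (PI * (x - 1)) with (PI * (x - 0) - PI) by ring.
        destruct (sin_cos_shift_PI (PI * (x - 0))) as [E1 E2]. rewrite E1, E2.
        replace (- cos (PI * (x - 0))) with ((-1) * cos (PI * (x - 0))) by ring.
        rewrite Rpow_mult_distr.
        replace ((-1) ^ (2 * n + 1)) with (-1).
        2:{ rewrite Nat.add_1_r. symmetry. apply pow_1_odd. }
        eqR; ring.
      - intros y. unfold vp_kernel. auto_derive; auto.
        replace (2 * S n)%nat with (2 * n + 2)%nat by lia.
        replace (n + (n + 0) + 1)%nat with (2 * n + 1)%nat by lia.
        replace (Init.Nat.pred (n + (n + 0) + 1)) with (2 * n)%nat by lia.
        rewrite !plus_INR, mult_INR. simpl (INR 2). simpl (INR 1).
        rewrite (pow_add _ (2 * n) 1), (pow_add _ (2 * n) 2).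
        replace (Init.Nat.pred (2 * n + 1)) with (2 * n)%nat by lia.
        set (c := cos _). set (s := sin _).
        assert (SC : s * s = 1 - c * c).
        { generalize (sin2_cos2 (PI * (x + - y))). unfold Rsqr, s, c. lra. }
        transitivity (PI * c ^ (2 * n) * ((2 * INR n + 1) * (s * s) - c * c)); [ring|].
        rewrite SC. ring.
      - intros y. apply (continuous_minus (V := R_NormedModule)); apply continuous_multR;
          auto using vp_kernel_continuous; apply continuous_const. }
    rewrite RInt_minusR in E by (apply ex_RInt_scalR, ex_RInt_cont_all; apply vp_kernel_continuous).
    rewrite !RInt_scalR in E by (apply ex_RInt_cont_all; apply vp_kernel_continuous).
    apply Rmult_eq_reg_l with PI; [|lra]. lra. }
  assert (Hmass : exists I, 0 < I /\ forall x, RInt (vp_kernel n x) 0 1 = I).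
  { induction n as [|n [I [HI IH]]].
    - exists 1. split; [lra|]. intros x. rewrite (RInt_ext _ (fun _ => 1)).
      + rewrite RInt_constR. eqR; ring.
      + intros y _. unfold vp_kernel. reflexivity.
    - assert (Hn := pos_INR n). exists (I * (2 * INR n + 1) / (2 * INR n + 2)).
      split; [apply Rdiv_lt_0_compat; nra|]. intros x.
      assert (R1 := Hrec n x). rewrite IH in R1.
      apply Rmult_eq_reg_r with (2 * INR n + 2); [rewrite R1; field|]; lra. }
  destruct Hmass as (I & HI & HIx). exists I. split; [exact HI|]. intros x. split; [apply HIx|].
  assert (Hn := pos_INR n).
  rewrite (RInt_ext _ (fun y => vp_kernel n x y - vp_kernel (S n) x y)).
  - rewrite RInt_minusR by (apply ex_RInt_cont_all; apply vp_kernel_continuous).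
    assert (R1 := Hrec n x). rewrite HIx in *.
    assert (R2 : RInt (vp_kernel (S n) x) 0 1 = I * (2 * INR n + 1) / (2 * INR n + 2)).
    { apply Rmult_eq_reg_r with (2 * INR n + 2); [rewrite R1; field|]; lra. }
    rewrite R2. eqR. field. lra.
  - intros y _. unfold vp_kernel. replace (2 * S n)%nat with (2 * n + 2)%nat by lia.
    rewrite pow_add. generalize (sin2_cos2 (PI * (x - y))). unfold Rsqr. intros E.
    replace (sin (PI * (x - y)) ^ 2) with (1 - cos (PI * (x - y)) ^ 2) by (eqR; nra). eqR; ring.
Qed.

Lemma vp_kernel_pos (n : nat) (x y : R) : 0 <= vp_kernel n x y.
Proof. unfold vp_kernel. rewrite pow_mult. apply pow_le, pow2_ge_0. Qed.

(** The error of the normalized convolution is at most [A] times the mean of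
    [|sin(pi (x - y))| <= eta / 2 + sin^2 / (2 eta)], which is why the Lipschitz
    condition is stated with the chord. *)
Lemma trig_poly_approximation (f : R -> R) (A eps : R) :
  (forall t, continuous f t) ->
  (forall x y, 0 <= x <= 1 -> 0 <= y <= 1 -> Rabs (f x - f y) <= A * Rabs (sin (PI * (x - y)))) ->
  0 <= A -> 0 < eps ->
  exists p, trig_poly p /\ forall x, 0 <= x <= 1 -> Rabs (f x - p x) <= eps.
Proof.
  intros Hf HA A0 He.
  set (eta := eps / (A + 1)).
  assert (Heta : 0 < eta) by (apply Rdiv_lt_0_compat; lra).
  assert (HAeta : A * eta <= eps).
  { replace eps with ((A + 1) * eta) by (unfold eta; field; lra). nra. }
  destruct (INR_unbounded (/ (eta * eta))) as [n Hn].
  assert (Hn2 : / (2 * INR n + 2) <= eta * eta).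
  { rewrite <- (Rinv_inv (eta * eta)). apply Rinv_le_contravar; [|generalize (pos_INR n); lra].
    apply Rinv_0_lt_compat. nra. }
  destruct (vp_kernel_mass n) as (I & HI & HIx).
  exists (fun x => / I * RInt (fun y => f y * vp_kernel n x y) 0 1). split.
  - apply trig_poly_scal, vp_convolution_trig_poly; auto.
  - intros x Hx. destruct (HIx x) as [E1 E2].
    assert (Cf : ex_RInt (fun y => f y * vp_kernel n x y) 0 1).
    { apply ex_RInt_cont_all. intros t. apply continuous_multR; auto using vp_kernel_continuous. }
    assert (Ck : ex_RInt (fun y => f x * vp_kernel n x y) 0 1).
    { apply ex_RInt_scalR, ex_RInt_cont_all. apply vp_kernel_continuous. }
    assert (D : Rabs (RInt (fun y => f x * vp_kernel n x y - f y * vp_kernel n x y) 0 1) <=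
       RInt (fun y => A * (eta / 2) * vp_kernel n x y + A * / (2 * eta) * (sin (PI * (x - y)) ^ 2 * vp_kernel n x y)) 0 1).
    { apply Rle_trans with (RInt (fun y => Rabs (f x * vp_kernel n x y - f y * vp_kernel n x y)) 0 1).
      - apply abs_RInt_le; [lra|]. apply (ex_RInt_minus (V := R_NormedModule)); auto.
      - apply RInt_le; [lra| | |].
        + apply ex_RInt_cont_all. intros t.
          apply (continuous_comp (fun y => f x * vp_kernel n x y - f y * vp_kernel n x y) Rabs);
            [|apply continuous_Rabs].
          apply (continuous_minus (V := R_NormedModule)); apply continuous_multR;
            auto using vp_kernel_continuous; apply continuous_const.
        + apply ex_RInt_cont_all. intros t.
          apply continuous_plusR; (apply continuous_multR; [apply continuous_const|]);
            [apply vp_kernel_continuous|].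
          apply continuous_multR; [|apply vp_kernel_continuous].
          apply (ex_derive_continuous (V := R_NormedModule)). auto_derive; auto.
        + intros y Hy. replace (f x * vp_kernel n x y - f y * vp_kernel n x y)
            with ((f x - f y) * vp_kernel n x y) by ring.
          assert (K0 := vp_kernel_pos n x y).
          rewrite Rabs_mult, (Rabs_pos_eq (vp_kernel n x y)) by auto.
          set (s := sin (PI * (x - y))).
          assert (Hs : Rabs s <= eta / 2 + / (2 * eta) * s ^ 2).
          { rewrite <- (pow2_abs s). set (r := Rabs s).
            assert (0 <= (r - eta) ^ 2) by apply pow2_ge_0.
            apply Rmult_le_reg_l with (2 * eta); [lra|].
            replace (2 * eta * (eta / 2 + / (2 * eta) * r ^ 2)) with (eta ^ 2 + r ^ 2) by (field; lra).
            nra. }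
          assert (H1 := HA x y Hx ltac:(lra)). fold s in H1.
          apply Rle_trans with (A * (eta / 2 + / (2 * eta) * s ^ 2) * vp_kernel n x y).
          * apply Rmult_le_compat_r; auto. apply Rle_trans with (1 := H1).
            apply Rmult_le_compat_l; auto.
          * right. ring. }
    rewrite RInt_minusR in D by auto. rewrite RInt_scalR in D by (apply ex_RInt_cont_all; apply vp_kernel_continuous).
    rewrite RInt_plusR in D.
    2:{ apply ex_RInt_scalR, ex_RInt_cont_all. apply vp_kernel_continuous. }
    2:{ apply ex_RInt_scalR, ex_RInt_cont_all. intros t.
        apply continuous_multR; [|apply vp_kernel_continuous].
        apply (ex_derive_continuous (V := R_NormedModule)). auto_derive; auto. }
    rewrite !RInt_scalR in D.
    2:{ apply ex_RInt_cont_all. intros t.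
        apply continuous_multR; [|apply vp_kernel_continuous].
        apply (ex_derive_continuous (V := R_NormedModule)). auto_derive; auto. }
    2:{ apply ex_RInt_cont_all. apply vp_kernel_continuous. }
    rewrite E1, E2 in D.
    set (J := RInt (fun y => f y * vp_kernel n x y) 0 1) in *.
    replace (f x - / I * J) with (/ I * (f x * I - J)) by (field; lra).
    assert (HIi : 0 < / I) by (apply Rinv_0_lt_compat; auto).
    rewrite Rabs_mult, (Rabs_pos_eq (/ I)) by lra.
    apply Rle_trans with (/ I * (A * (eta / 2) * I + A * / (2 * eta) * (I / (2 * INR n + 2)))).
    + apply Rmult_le_compat_l; [lra | exact D].
    + replace (/ I * (A * (eta / 2) * I + A * / (2 * eta) * (I / (2 * INR n + 2))))
        with (A * (eta / 2 + / (2 * eta) * / (2 * INR n + 2)))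
        by (field; generalize (pos_INR n); repeat split; lra).
      apply Rle_trans with (A * eta); [|exact HAeta]. apply Rmult_le_compat_l; auto.
      assert (0 < / (2 * eta)) by (apply Rinv_0_lt_compat; lra).
      apply Rle_trans with (eta / 2 + / (2 * eta) * (eta * eta)).
      * apply Rplus_le_compat_l, Rmult_le_compat_l; lra.
      * right. field. lra.
Qed.

(** The nontrivial half of Parseval's identity: the partial Fourier sum is the
    best approximation in [L^2]. *)
Lemma parseval (f : R -> R) (A eps : R) :
  (forall t, continuous f t) ->
  (forall x y, 0 <= x <= 1 -> 0 <= y <= 1 -> Rabs (f x - f y) <= A * Rabs (sin (PI * (x - y)))) ->
  0 <= A -> 0 < eps ->
  exists M, RInt (fun y => f y ^ 2) 0 1 <= sum_f_R0 (fun j => coef f j ^ 2) M + eps.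
Proof.
  intros Hf HA A0 He. set (e := Rmin 1 eps).
  assert (He1 : 0 < e) by (apply Rmin_pos; lra).
  assert (He2 : e * e <= eps).
  { assert (M1 := Rmin_l 1 eps). assert (M2 := Rmin_r 1 eps). fold e in M1, M2. nra. }
  destruct (trig_poly_approximation f A e Hf HA A0 He1) as (p & (M & a & Ha) & Hp).
  exists M. assert (D := distance_to_modes f a M Hf).
  assert (P : 0 <= sum_f_R0 (fun j => (a j - coef f j) ^ 2) M)
    by (apply cond_pos_sum; intros; apply pow2_ge_0).
  set (h := fun y => f y - sum_f_R0 (fun j => a j * mode j y) M).
  assert (Hh : forall t, continuous h t).
  { intros t. apply (continuous_minus (V := R_NormedModule)); auto. apply continuous_sum.
    intros j; apply continuous_multR; [apply continuous_const | apply mode_continuous]. }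
  assert (B : RInt (fun y => h y ^ 2) 0 1 <= (1 - 0) * (e * e)).
  { apply Rle_trans with (1 := Rle_abs _). apply abs_RInt_le_const; [lra| |].
    - apply ex_RInt_cont_all. intros t. apply continuous_extR with (fun y => h y * h y); [intros; ring|].
      apply continuous_multR; auto.
    - intros t Ht. rewrite Rabs_pos_eq by apply pow2_ge_0.
      rewrite <- (pow2_abs (h t)). replace (Rabs (h t) ^ 2) with (Rabs (h t) * Rabs (h t)) by ring.
      unfold h. rewrite <- Ha. apply Rmult_le_compat; auto using Rabs_pos. }
  unfold h in B. rewrite D in B. lra.
Qed.

(** * Cutting off the singularities *)

Definition pos_part (u : R) : R := Rmax u 0.
(** The cube makes [bump] of class [C^2]; its derivatives are [bump1] and [bump2]. *)
Definition bump (s : R) : R := pos_part (1 - s ^ 2) ^ 3.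
Definition bump1 (s : R) : R := - 6 * s * pos_part (1 - s ^ 2) ^ 2.
Definition bump2 (s : R) : R := - 6 * pos_part (1 - s ^ 2) ^ 2 + 24 * s ^ 2 * pos_part (1 - s ^ 2).

Lemma pos_part_continuous (u : R) : continuous pos_part u.
Proof.
  apply continuous_eps. intros eps He. exists eps. split; [exact He|]. intros y Hy.
  apply Rle_lt_trans with (2 := Hy). unfold pos_part, Rmax.
  destruct (Rle_dec y 0), (Rle_dec u 0); unfold Rabs; repeat destruct Rcase_abs; lra.
Qed.

Lemma pos_part_pow_derive (n : nat) (u : R) :
  is_derive (fun u => pos_part u ^ S (S n)) u (INR (S (S n)) * pos_part u ^ S n).
Proof.
  destruct (Rtotal_order u 0) as [Hu|[Hu|Hu]].
  - apply (is_derive_ext_near (fun _ => 0)) with (- u); [lra| |].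
    + intros t Ht. apply Rabs_lt_between in Ht. unfold pos_part. rewrite Rmax_right by lra.
      simpl; ring.
    + unfold pos_part. rewrite Rmax_right by lra. rewrite pow_i, Rmult_0_r by lia.
      apply (is_derive_const (V := R_NormedModule)).
  - subst u. unfold pos_part at 2. rewrite Rmax_left, pow_i, Rmult_0_r by (lia || lra).
    apply is_derive_Reals. intros eps He.
    assert (Hm : 0 < Rmin 1 eps) by (apply Rmin_pos; lra).
    exists (mkposreal _ Hm). intros h Hh0 Hh. simpl in Hh.
    assert (M1 := Rmin_l 1 eps). assert (M2 := Rmin_r 1 eps).
    rewrite Rplus_0_l. unfold pos_part at 2. rewrite (Rmax_left 0 0), (pow_i (S (S n))) by (lia || lra).
    rewrite !Rminus_0_r. unfold Rdiv. rewrite Rabs_mult, Rabs_inv, <- RPow_abs.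
    assert (Hp : Rabs (pos_part h) <= Rabs h).
    { unfold pos_part, Rmax. destruct (Rle_dec h 0); [rewrite Rabs_R0; apply Rabs_pos | lra]. }
    assert (Hh' := Rabs_pos_lt h Hh0).
    apply Rle_lt_trans with (Rabs h ^ S (S n) * / Rabs h).
    + apply Rmult_le_compat_r; [apply Rlt_le, Rinv_0_lt_compat; auto|].
      apply pow_incr. split; [apply Rabs_pos | exact Hp].
    + replace (Rabs h ^ S (S n) * / Rabs h) with (Rabs h * Rabs h ^ n) by (simpl; field; lra).
      assert (Rabs h ^ n <= 1) by (rewrite <- (pow1 n); apply pow_incr; lra).
      assert (0 <= Rabs h ^ n) by (apply pow_le; lra). nra.
  - apply (is_derive_ext_near (fun u => u ^ S (S n))) with u; [lra| |].
    + intros t Ht. apply Rabs_lt_between in Ht. unfold pos_part. rewrite Rmax_left by lra.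
      reflexivity.
    + unfold pos_part. rewrite Rmax_left by lra.
      replace (INR (S (S n)) * u ^ S n) with (INR (S (S n)) * 1 * u ^ pred (S (S n)))
        by (rewrite Nat.pred_succ; ring).
      apply (is_derive_pow (fun u => u) (S (S n)) u 1). apply (is_derive_id (K := R_AbsRing)).
Qed.

Lemma bump_derive (s : R) : is_derive bump s (bump1 s) /\ is_derive bump1 s (bump2 s).
Proof.
  assert (H0 : is_derive (fun s => 1 - s ^ 2) s (- (2 * s))) by (auto_derive; auto; ring).
  split.
  - evar_last.
    + apply (is_derive_comp (fun u => pos_part u ^ 3) (fun s => 1 - s ^ 2)).
      * apply (pos_part_pow_derive 1).
      * exact H0.
    + unfold bump1, scal; simpl; unfold mult; simpl. eqR. ring.
  - evar_last.
    + apply (is_derive_mult (fun s => - 6 * s) (fun s => pos_part (1 - s ^ 2) ^ 2)).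
      * apply (is_derive_scal (fun s => s) s (- 6) 1). apply (is_derive_id (K := R_AbsRing)).
      * apply (is_derive_comp (fun u => pos_part u ^ 2) (fun s => 1 - s ^ 2)).
        -- apply (pos_part_pow_derive 0).
        -- exact H0.
      * exact Rmult_comm.
    + unfold bump2, plus, scal, mult; simpl; unfold mult; simpl. eqR. ring.
Qed.

Lemma bump_continuous (s : R) : continuous bump s /\ continuous bump1 s /\ continuous bump2 s.
Proof.
  destruct (bump_derive s) as [D1 D2].
  split; [exact (continuous_of_derive _ _ _ D1)|split; [exact (continuous_of_derive _ _ _ D2)|]].
  assert (Hp : continuous (fun s => pos_part (1 - s ^ 2)) s).
  { apply (continuous_comp (fun s => 1 - s ^ 2) pos_part); [|apply pos_part_continuous].
    apply (ex_derive_continuous (V := R_NormedModule)). auto_derive; auto. }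
  apply continuous_extR with (fun s => - 6 * (pos_part (1 - s ^ 2) * pos_part (1 - s ^ 2))
     + 24 * s ^ 2 * pos_part (1 - s ^ 2)).
  - intros t. unfold bump2. ring.
  - apply continuous_plusR.
    + apply continuous_multR; [apply continuous_const|]. apply continuous_multR; exact Hp.
    + apply continuous_multR; [|exact Hp].
      apply (ex_derive_continuous (V := R_NormedModule)). auto_derive; auto.
Qed.

Lemma bump_bounds (s : R) : 0 <= bump s <= 1 /\ 1 - bump s <= 3 * s ^ 2 /\
  Rabs (bump1 s) <= 6 /\ Rabs (bump2 s) <= 30.
Proof.
  assert (S0 := pow2_ge_0 s).
  unfold bump, bump1, bump2. set (p := pos_part (1 - s ^ 2)).
  assert (Hp : 0 <= p <= 1 /\ (p = 1 - s ^ 2 \/ (p = 0 /\ 1 <= s ^ 2))).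
  { unfold p, pos_part, Rmax. destruct (Rle_dec (1 - s ^ 2) 0); lra. }
  destruct Hp as [Hp Hc].
  assert (P2 : 0 <= p ^ 2 <= 1) by (split; nra).
  assert (P3 : 0 <= p ^ 3 <= 1) by (split; simpl in *; nra).
  split; [exact P3|]. split; [|split].
  - destruct Hc as [-> | [-> H]]; [|nra].
    set (t := s ^ 2) in *. assert (0 <= t) by exact S0.
    replace (1 - (1 - t) ^ 3) with (3 * t - t ^ 2 * (3 - t)) by ring.
    destruct (Rle_dec t 3); [assert (0 <= t ^ 2 * (3 - t)) by (apply Rmult_le_pos; nra); lra|].
    exfalso. lra.
  - rewrite !Rabs_mult. replace (Rabs (-6)) with 6 by (rewrite Rabs_left; lra).
    rewrite (Rabs_pos_eq (p ^ 2)) by lra.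
    destruct Hc as [Hc | [-> H]]; [|replace (0 ^ 2) with 0 by ring; rewrite Rmult_0_r; lra].
    assert (Hs : Rabs s <= 1) by (apply Rabs_le; nra). generalize (Rabs_pos s). nra.
  - destruct Hc as [Hc | [-> H]].
    2:{ replace (-6 * 0 ^ 2 + 24 * s ^ 2 * 0) with 0 by ring. rewrite Rabs_R0. lra. }
    apply Rabs_le. split; nra.
Qed.

Lemma bump_vanish (s : R) : 1 <= Rabs s -> bump s = 0 /\ bump1 s = 0 /\ bump2 s = 0.
Proof.
  intros H. assert (E : pos_part (1 - s ^ 2) = 0).
  { unfold pos_part. apply Rmax_right. rewrite <- (pow2_abs s). nra. }
  unfold bump, bump1, bump2. rewrite E. split; [|split]; ring.
Qed.

(** A singular harmonic function [l] on a periodic open set [U] of the plane,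
    with [a, b] its gradient and [c, - c] its pure second derivatives, together
    with a bounded potential [q]. The bounds near each point say that [l] grows
    like [log r] at the points outside [U], which are isolated. This is all that
    the analysis below retains of the surface. *)
Record harmonic_cylinder (U : R -> R -> Prop) (l a b c q : R -> R -> R) (Q : R) : Prop := {
  hc_open : forall x y, U x y -> exists d, 0 < d /\
    forall u v, Rabs (u - x) < d -> Rabs (v - y) < d -> U u v;
  hc_periodic : forall x y, U x (y + 1) <-> U x y;
  hc_l_periodic : forall x y, l x (y + 1) = l x y /\ b x (y + 1) = b x y;
  hc_derive : forall x y, U x y ->
    is_derive (fun t => l t y) x (a x y) /\ is_derive (fun t => l x t) y (b x y) /\
    is_derive (fun t => a t y) x (c x y) /\ is_derive (fun t => b x t) y (- c x y);
  hc_cont : forall x y, U x y -> continuity_2d_pt l x y /\ continuity_2d_pt a x y /\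
    continuity_2d_pt b x y /\ continuity_2d_pt c x y /\ continuity_2d_pt q x y;
  hc_q_bound : 0 <= Q /\ forall x y, U x y -> Rabs (q x y) <= Q;
  hc_tempered : forall x0 y0, exists r K, 0 < r /\ 0 <= K /\
    forall x y, Rabs (x - x0) < r -> Rabs (y - y0) < r ->
      (U x y \/ (x = x0 /\ y = y0)) /\
      (U x y -> l x y ^ 2 * ((x - x0) ^ 2 + (y - y0) ^ 2) <= K /\
         forall L, 0 <= L -> Rabs (l x y) <= L ->
           (a x y ^ 2 + b x y ^ 2) * ((x - x0) ^ 2 + (y - y0) ^ 2 + exp (- L)) <= K);
  hc_blowup : forall x0 y0, ~ U x0 y0 -> forall L, exists d, 0 < d /\
    forall x y, Rabs (x - x0) < d -> Rabs (y - y0) < d -> U x y -> L < Rabs (l x y) }.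

Record bounded_solution (U : R -> R -> Prop) (q v vx vy vxx vyy : R -> R -> R) (B : R) : Prop := {
  bs_periodic : forall x y, U x y -> v x (y + 1) = v x y /\ vy x (y + 1) = vy x y;
  bs_derive : forall x y, U x y ->
    is_derive (fun t => v t y) x (vx x y) /\ is_derive (fun t => v x t) y (vy x y) /\
    is_derive (fun t => vx t y) x (vxx x y) /\ is_derive (fun t => vy x t) y (vyy x y);
  bs_cont : forall x y, U x y -> continuity_2d_pt v x y /\ continuity_2d_pt vx x y /\
    continuity_2d_pt vy x y /\ continuity_2d_pt vxx x y /\ continuity_2d_pt vyy x y;
  bs_equation : forall x y, U x y -> vxx x y + vyy x y + q x y * v x y = 0;
  bs_bound : 0 <= B /\ forall x y, U x y -> Rabs (v x y) <= B }.

Definition cut (U : R -> R -> Prop) (F : R -> R -> R) (x y : R) : R :=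
  if excluded_middle_informative (U x y) then F x y else 0.

Lemma cut_in (U : R -> R -> Prop) (F : R -> R -> R) (x y : R) : U x y -> cut U F x y = F x y.
Proof. intros H. unfold cut. destruct (excluded_middle_informative (U x y)); tauto. Qed.

Lemma cut_out (U : R -> R -> Prop) (F : R -> R -> R) (x y : R) : ~ U x y -> cut U F x y = 0.
Proof. intros H. unfold cut. destruct (excluded_middle_informative (U x y)); tauto. Qed.

Section Cutoff.
Variables (U : R -> R -> Prop) (l a b c q : R -> R -> R) (Q : R).
Hypothesis HC : harmonic_cylinder U l a b c q Q.

(** As [|l|] is large near the singularities, such an [F] vanishes around them. *)
Definition cut_zone (L : R) (F : R -> R -> R) : Prop :=
  forall x y, U x y -> L <= Rabs (l x y) -> F x y = 0.

(** By the blow-up of [l], the cutoff region contains a neighbourhood of each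
    singularity; extension by zero across it is therefore smooth. *)
Lemma cut_zero_near (L : R) (F : R -> R -> R) (x y : R) : cut_zone L F -> ~ U x y ->
  exists d, 0 < d /\ forall u v, Rabs (u - x) < d -> Rabs (v - y) < d -> cut U F u v = 0.
Proof.
  intros HF Hn. destruct (hc_blowup _ _ _ _ _ _ _ HC x y Hn L) as (d & Hd & B).
  exists d. split; [exact Hd|]. intros u v Hu Hv.
  destruct (excluded_middle_informative (U u v)) as [H|H]; [|apply cut_out; exact H].
  rewrite cut_in by exact H. apply HF; [exact H|]. apply Rlt_le, B; auto.
Qed.

Lemma cut_continuous (L : R) (F : R -> R -> R) : cut_zone L F ->
  (forall x y, U x y -> continuity_2d_pt F x y) -> forall x y, continuity_2d_pt (cut U F) x y.
Proof.
  intros HF Hc x y. destruct (excluded_middle_informative (U x y)) as [H|H].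
  - apply continuity_2d_pt_ext_loc with F; [|apply Hc; exact H].
    destruct (hc_open _ _ _ _ _ _ _ HC x y H) as (d & Hd & B). exists (mkposreal d Hd).
    intros u v Hu Hv. symmetry. apply cut_in, B; auto.
  - apply continuity_2d_pt_ext_loc with (fun _ _ => 0); [|apply continuity_2d_pt_const].
    destruct (cut_zero_near L F x y HF H) as (d & Hd & B). exists (mkposreal d Hd).
    intros u v Hu Hv. symmetry. apply B; auto.
Qed.

Lemma cut_derive_x (L : R) (F G : R -> R -> R) : cut_zone L F ->
  (forall x y, U x y -> is_derive (fun t => F t y) x (G x y)) ->
  forall x y, is_derive (fun t => cut U F t y) x (cut U G x y).
Proof.
  intros HF HD x y. destruct (excluded_middle_informative (U x y)) as [H|H].
  - rewrite cut_in by exact H. destruct (hc_open _ _ _ _ _ _ _ HC x y H) as (d & Hd & B).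
    apply (is_derive_ext_near (fun t => F t y)) with d; [exact Hd| |apply HD; exact H].
    intros t Ht. symmetry. apply cut_in, B; auto. rewrite Rminus_diag, Rabs_R0; auto.
  - rewrite (cut_out U G) by exact H. destruct (cut_zero_near L F x y HF H) as (d & Hd & B).
    apply (is_derive_ext_near (fun t => 0)) with d; [exact Hd| |apply (is_derive_const (V := R_NormedModule))].
    intros t Ht. symmetry. apply B; auto. rewrite Rminus_diag, Rabs_R0; auto.
Qed.

Lemma cut_derive_y (L : R) (F G : R -> R -> R) : cut_zone L F ->
  (forall x y, U x y -> is_derive (fun t => F x t) y (G x y)) ->
  forall x y, is_derive (fun t => cut U F x t) y (cut U G x y).
Proof.
  intros HF HD x y. destruct (excluded_middle_informative (U x y)) as [H|H].
  - rewrite cut_in by exact H. destruct (hc_open _ _ _ _ _ _ _ HC x y H) as (d & Hd & B).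
    apply (is_derive_ext_near (fun t => F x t)) with d; [exact Hd| |apply HD; exact H].
    intros t Ht. symmetry. apply cut_in, B; auto. rewrite Rminus_diag, Rabs_R0; auto.
  - rewrite (cut_out U G) by exact H. destruct (cut_zero_near L F x y HF H) as (d & Hd & B).
    apply (is_derive_ext_near (fun t => 0)) with d; [exact Hd| |apply (is_derive_const (V := R_NormedModule))].
    intros t Ht. symmetry. apply B; auto. rewrite Rminus_diag, Rabs_R0; auto.
Qed.

End Cutoff.

(** * Integrals over the circle depending on a parameter *)

Lemma circle_int_cont (G : R -> R -> R) : (forall x y, continuity_2d_pt G x y) ->
  forall x, continuous (fun x => RInt (fun y => G x y) 0 1) x.
Proof.
  intros HG x. apply continuous_eps. intros eps He.
  assert (He2 : 0 < eps / 2) by lra.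
  destruct (uniform_continuity_2d_1d' G 0 1 x (fun y _ => HG x y) (mkposreal _ He2)) as [[d Hd] B].
  simpl in B.
  exists d. split; [exact Hd|]. intros x' Hx'. apply Rabs_lt_between in Hx'.
  assert (Hs : forall x, ex_RInt (fun y => G x y) 0 1).
  { intros u. apply ex_RInt_cont_all. intros t. apply continuous_section_y, HG. }
  rewrite <- RInt_minusR by auto.
  apply Rle_lt_trans with ((1 - 0) * (eps / 2)); [|lra].
  apply abs_RInt_le_const; [lra| |].
  - apply (ex_RInt_minus (V := R_NormedModule)); auto.
  - intros t Ht. apply Rlt_le. apply (B t x t x'); try lra. rewrite Rminus_diag, Rabs_R0; auto.
Qed.

(** Differentiation under the integral sign. *)
Lemma circle_int_derive (G Gx : R -> R -> R) :
  (forall x y, continuity_2d_pt G x y) -> (forall x y, continuity_2d_pt Gx x y) ->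
  (forall x y, is_derive (fun t => G t y) x (Gx x y)) ->
  forall x, is_derive (fun x => RInt (fun y => G x y) 0 1) x (RInt (fun y => Gx x y) 0 1).
Proof.
  intros HG HGx HD x.
  assert (E : forall u v, Derive (fun t => G t v) u = Gx u v)
    by (intros; apply is_derive_unique, HD).
  rewrite <- (RInt_ext (fun t => Derive (fun u => G u t) x)) by (intros; apply E).
  apply is_derive_RInt_param.
  - exists (mkposreal 1 Rlt_0_1). intros u _ t _. eexists. apply HD.
  - intros t _. apply continuity_2d_pt_ext with Gx; [intros; symmetry; apply E|apply HGx].
  - exists (mkposreal 1 Rlt_0_1). intros u _. apply ex_RInt_cont_all.
    intros t. apply continuous_section_y, HG.
Qed.

Lemma circle_by_parts (f g df dg : R -> R) :
  (forall t, is_derive f t (df t)) -> (forall t, is_derive g t (dg t)) ->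
  (forall t, continuous df t) -> (forall t, continuous dg t) ->
  f 1 * g 1 = f 0 * g 0 ->
  RInt (fun t => df t * g t) 0 1 = - RInt (fun t => f t * dg t) 0 1.
Proof.
  intros Hf Hg Cf Cg E.
  assert (Kf : forall t, continuous f t) by (intros; exact (continuous_of_derive _ _ _ (Hf t))).
  assert (Kg : forall t, continuous g t) by (intros; exact (continuous_of_derive _ _ _ (Hg t))).
  assert (E2 : RInt (fun t => df t * g t + f t * dg t) 0 1 = 0).
  { rewrite (RInt_ftc (fun t => f t * g t)).
    - rewrite E. eqR. ring.
    - intros t. apply (is_derive_mult f g); [apply Hf | apply Hg | exact Rmult_comm].
    - intros t. apply continuous_plusR; apply continuous_multR; auto. }
  rewrite RInt_plusR in E2 by (apply ex_RInt_cont_all; intros; apply continuous_multR; auto).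
  lra.
Qed.

Lemma is_derive_multR (f g : R -> R) (t df dg : R) : is_derive f t df -> is_derive g t dg ->
  is_derive (fun s => f s * g s) t (df * g t + f t * dg).
Proof. intros Hf Hg. apply (is_derive_mult f g); [exact Hf|exact Hg|exact Rmult_comm]. Qed.

Lemma is_derive_plusR (f g : R -> R) (t df dg : R) : is_derive f t df -> is_derive g t dg ->
  is_derive (fun s => f s + g s) t (df + dg).
Proof. exact (is_derive_plus (V := R_NormedModule) f g t df dg). Qed.

Lemma is_derive_minusR (f g : R -> R) (t df dg : R) : is_derive f t df -> is_derive g t dg ->
  is_derive (fun s => f s - g s) t (df - dg).
Proof. exact (is_derive_minus (V := R_NormedModule) f g t df dg). Qed.

Lemma is_derive_scalR (f : R -> R) (k t df : R) : is_derive f t df ->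
  is_derive (fun s => k * f s) t (k * df).
Proof. exact (fun H => is_derive_scal f t k df H). Qed.

Lemma is_derive_eq (f : R -> R) (t l l' : R) : is_derive f t l -> l = l' -> is_derive f t l'.
Proof. intros H <-; exact H. Qed.

Lemma bump_comp_derive (eps : R) (g : R -> R) (t g' : R) : is_derive g t g' ->
  is_derive (fun s => bump (eps * g s)) t (eps * g' * bump1 (eps * g t)) /\
  is_derive (fun s => bump1 (eps * g s)) t (eps * g' * bump2 (eps * g t)).
Proof.
  intros Hg. destruct (bump_derive (eps * g t)) as [D1 D2].
  split.
  - exact (is_derive_comp bump (fun s => eps * g s) t _ _ D1 (is_derive_scalR g eps t g' Hg)).
  - exact (is_derive_comp bump1 (fun s => eps * g s) t _ _ D2 (is_derive_scalR g eps t g' Hg)).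
Qed.

(** With [chi = bump (eps g)]: [(chi w)' = chi w' + chi' w], and
    [(chi w' - chi' w)' = chi w'' - chi'' w]. *)
Lemma cutoff_derivatives (eps : R) (g ga w w1 : R -> R) (t gc w2 : R) :
  is_derive g t (ga t) -> is_derive ga t gc -> is_derive w t (w1 t) -> is_derive w1 t w2 ->
  is_derive (fun s => bump (eps * g s) * w s) t
    ((bump (eps * g t) * w1 t - bump1 (eps * g t) * (eps * ga t * w t))
     + 2 * (bump1 (eps * g t) * (eps * ga t * w t))) /\
  is_derive (fun s => bump (eps * g s) * w1 s - bump1 (eps * g s) * (eps * ga s * w s)) t
    (bump (eps * g t) * w2 - bump1 (eps * g t) * (eps * gc * w t)
     - bump2 (eps * g t) * (eps ^ 2 * ga t ^ 2 * w t)).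
Proof.
  intros Hg Hga Hw Hw1. destruct (bump_comp_derive eps g t (ga t) Hg) as [D1 D2]. split.
  - apply (is_derive_eq _ _ _ _ (is_derive_multR _ _ _ _ _ D1 Hw)). ring.
  - apply (is_derive_eq _ _ _ _ (is_derive_minusR _ _ _ _ _ (is_derive_multR _ _ _ _ _ D1 Hw1)
      (is_derive_multR _ _ _ _ _ D2 (is_derive_multR _ _ _ _ _ (is_derive_scalR _ eps _ _ Hga) Hw)))).
    ring.
Qed.

Lemma continuity_2d_sqr (f : R -> R -> R) (x y : R) :
  continuity_2d_pt f x y -> continuity_2d_pt (fun x y => f x y ^ 2) x y.
Proof.
  intros Hf. apply continuity_2d_pt_ext with (fun x y => f x y * f x y); [intros; ring|].
  apply continuity_2d_pt_mult; exact Hf.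
Qed.

Section ModeEquation.
Variables (U : R -> R -> Prop) (l a b c q : R -> R -> R) (Q : R).
Hypothesis HC : harmonic_cylinder U l a b c q Q.
Variables (v vx vy vxx vyy : R -> R -> R) (B : R).
Hypothesis HS : bounded_solution U q v vx vy vxx vyy B.
Variable (eps : R).
Hypothesis Heps : 0 < eps.

Let ps (x y : R) : R := bump (eps * l x y).
Let ps1 (x y : R) : R := bump1 (eps * l x y).
Let ps2 (x y : R) : R := bump2 (eps * l x y).

Definition cut_v := cut U (fun x y => bump (eps * l x y) * v x y).
Definition cut_qv := cut U (fun x y => bump (eps * l x y) * (q x y * v x y)).
(** [chi v_x - chi_x v], instead of the derivative of [chi v]: its own derivative
    contains no first derivative of [v], for which no bound is known. *)
Definition cut_vx := cut U (fun x y => bump (eps * l x y) * vx x y - bump1 (eps * l x y) * (eps * a x y * v x y)).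
Definition cut_vy := cut U (fun x y => bump (eps * l x y) * vy x y - bump1 (eps * l x y) * (eps * b x y * v x y)).
(** the error terms [chi_x v], [chi_y v] and [v Delta chi] *)
Definition err_x := cut U (fun x y => bump1 (eps * l x y) * (eps * a x y * v x y)).
Definition err_y := cut U (fun x y => bump1 (eps * l x y) * (eps * b x y * v x y)).
Definition err_lap := cut U (fun x y => bump2 (eps * l x y) * (eps ^ 2 * (a x y ^ 2 + b x y ^ 2) * v x y)).
Let cut_vxx := cut U (fun x y => ps x y * vxx x y - ps1 x y * (eps * c x y * v x y)
   - ps2 x y * (eps ^ 2 * a x y ^ 2 * v x y)).
Let cut_vyy := cut U (fun x y => ps x y * vyy x y - ps1 x y * (eps * - c x y * v x y)
   - ps2 x y * (eps ^ 2 * b x y ^ 2 * v x y)).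

Lemma scaled_large (t : R) : / eps <= Rabs t -> 1 <= Rabs (eps * t).
Proof.
  intros H. rewrite Rabs_mult, (Rabs_pos_eq eps) by lra.
  replace 1 with (eps * / eps) by (field; lra). apply Rmult_le_compat_l; lra.
Qed.

Ltac zone := let HU := fresh in let HL := fresh in intros ? ? HU HL; apply scaled_large in HL; apply bump_vanish in HL;
  let HL0 := fresh in let HL1 := fresh in let HL2 := fresh in
  destruct HL as (HL0 & HL1 & HL2); unfold ps, ps1, ps2; rewrite ?HL0, ?HL1, ?HL2; ring.

Lemma bump_cont_2d (x y : R) : U x y ->
  continuity_2d_pt ps x y /\ continuity_2d_pt ps1 x y /\ continuity_2d_pt ps2 x y.
Proof.
  intros HU. destruct (hc_cont _ _ _ _ _ _ _ HC x y HU) as (Cl & _).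
  destruct (bump_continuous (eps * l x y)) as (C0 & C1 & C2).
  assert (Ce : continuity_2d_pt (fun x y => eps * l x y) x y)
    by (apply continuity_2d_pt_mult; [apply continuity_2d_pt_const|exact Cl]).
  split; [|split]; apply continuity_1d_2d_pt_comp; try exact Ce; apply continuity_pt_filterlim.
  - exact C0.
  - exact C1.
  - exact C2.
Qed.

Ltac c2d HU :=
  let C0 := fresh in let C1 := fresh in let C2 := fresh in
  destruct (bump_cont_2d _ _ HU) as (C0 & C1 & C2);
  let Cl := fresh in let Ca := fresh in let Cb := fresh in let Cc := fresh in let Cq := fresh in
  destruct (hc_cont _ _ _ _ _ _ _ HC _ _ HU) as (Cl & Ca & Cb & Cc & Cq);
  let Cv := fresh in let Cvx := fresh in let Cvy := fresh in let Cvxx := fresh in let Cvyy := fresh in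
  destruct (bs_cont _ _ _ _ _ _ _ _ HS _ _ HU) as (Cv & Cvx & Cvy & Cvxx & Cvyy);
  repeat first [ assumption | apply continuity_2d_pt_const | apply continuity_2d_sqr
    | apply continuity_2d_pt_minus | apply continuity_2d_pt_plus
    | apply continuity_2d_pt_mult | apply continuity_2d_pt_opp ].

Lemma cut_functions_continuous (x y : R) :
  (continuity_2d_pt cut_v x y /\ continuity_2d_pt cut_qv x y /\
   continuity_2d_pt cut_vx x y /\ continuity_2d_pt cut_vy x y) /\
  (continuity_2d_pt err_x x y /\ continuity_2d_pt err_y x y /\ continuity_2d_pt err_lap x y) /\
  (continuity_2d_pt cut_vxx x y /\ continuity_2d_pt cut_vyy x y).
Proof.
  repeat split; (apply (cut_continuous _ _ _ _ _ _ _ HC (/ eps)); [zone | intros x0 y0 HU; c2d HU]).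
Qed.

Lemma cut_derivatives (x y : R) :
  is_derive (fun t => cut_v t y) x (cut_vx x y + 2 * err_x x y) /\
  is_derive (fun t => cut_v x t) y (cut_vy x y + 2 * err_y x y) /\
  is_derive (fun t => cut_vx t y) x (cut_vxx x y) /\
  is_derive (fun t => cut_vy x t) y (cut_vyy x y).
Proof.
  split; [|split; [|split]].
  - apply is_derive_eq with (cut U (fun x y => (ps x y * vx x y - ps1 x y * (eps * a x y * v x y))
      + 2 * (ps1 x y * (eps * a x y * v x y))) x y).
    + apply (cut_derive_x _ _ _ _ _ _ _ HC (/ eps)); [zone|]. intros u w HU.
      destruct (hc_derive _ _ _ _ _ _ _ HC _ _ HU) as (D1 & D2 & D3 & D4).
      destruct (bs_derive _ _ _ _ _ _ _ _ HS _ _ HU) as (E1 & E2 & E3 & E4).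
      exact (proj1 (cutoff_derivatives eps (fun t => l t w) (fun t => a t w) (fun t => v t w)
        (fun t => vx t w) u _ _ D1 D3 E1 E3)).
    + unfold cut_vx, err_x, cut. destruct (excluded_middle_informative (U x y)); [reflexivity|ring].
  - apply is_derive_eq with (cut U (fun x y => (ps x y * vy x y - ps1 x y * (eps * b x y * v x y))
      + 2 * (ps1 x y * (eps * b x y * v x y))) x y).
    + apply (cut_derive_y _ _ _ _ _ _ _ HC (/ eps)); [zone|]. intros u w HU.
      destruct (hc_derive _ _ _ _ _ _ _ HC _ _ HU) as (D1 & D2 & D3 & D4).
      destruct (bs_derive _ _ _ _ _ _ _ _ HS _ _ HU) as (E1 & E2 & E3 & E4).
      exact (proj1 (cutoff_derivatives eps (fun t => l u t) (fun t => b u t) (fun t => v u t)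
        (fun t => vy u t) w _ _ D2 D4 E2 E4)).
    + unfold cut_vy, err_y, cut. destruct (excluded_middle_informative (U x y)); [reflexivity|ring].
  - apply (cut_derive_x _ _ _ _ _ _ _ HC (/ eps)); [zone|]. intros u w HU.
    destruct (hc_derive _ _ _ _ _ _ _ HC _ _ HU) as (D1 & D2 & D3 & D4).
    destruct (bs_derive _ _ _ _ _ _ _ _ HS _ _ HU) as (E1 & E2 & E3 & E4).
    exact (proj2 (cutoff_derivatives eps (fun t => l t w) (fun t => a t w) (fun t => v t w)
        (fun t => vx t w) u _ _ D1 D3 E1 E3)).
  - apply (cut_derive_y _ _ _ _ _ _ _ HC (/ eps)); [zone|]. intros u w HU.
    destruct (hc_derive _ _ _ _ _ _ _ HC _ _ HU) as (D1 & D2 & D3 & D4).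
    destruct (bs_derive _ _ _ _ _ _ _ _ HS _ _ HU) as (E1 & E2 & E3 & E4).
    exact (proj2 (cutoff_derivatives eps (fun t => l u t) (fun t => b u t) (fun t => v u t)
        (fun t => vy u t) w _ _ D2 D4 E2 E4)).
Qed.

Lemma cut_laplacian (x y : R) : cut_vxx x y = - cut_vyy x y - cut_qv x y - err_lap x y.
Proof.
  unfold cut_vxx, cut_vyy, cut_qv, err_lap, cut.
  destruct (excluded_middle_informative (U x y)) as [HU|HU]; [|ring].
  assert (E := bs_equation _ _ _ _ _ _ _ _ HS _ _ HU).
  fold (ps x y). fold (ps2 x y). replace (vxx x y) with (- vyy x y - q x y * v x y) by lra. ring.
Qed.

Lemma cut_periodic (x y : R) : cut_v x (y + 1) = cut_v x y /\ cut_vy x (y + 1) = cut_vy x y.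
Proof.
  unfold cut_v, cut_vy, cut. assert (P := hc_periodic _ _ _ _ _ _ _ HC x y).
  destruct (hc_l_periodic _ _ _ _ _ _ _ HC x y) as [P1 P2].
  destruct (excluded_middle_informative (U x (y + 1))) as [H1|H1];
  destruct (excluded_middle_informative (U x y)) as [H2|H2]; try tauto.
  destruct (bs_periodic _ _ _ _ _ _ _ _ HS _ _ H2) as [P3 P4].
  rewrite P1, P2, P3, P4. split; reflexivity.
Qed.

Variable j : nat.

(** The [j]-th coefficients of [chi v], [chi v_x - chi_x v], [chi q v], and
    the errors in the differential system that they satisfy. *)
Definition cut_coef (x : R) : R := RInt (fun y => cut_v x y * mode j y) 0 1.
Definition cut_coef_x (x : R) : R := RInt (fun y => cut_vx x y * mode j y) 0 1.
Definition cut_source (x : R) : R := RInt (fun y => cut_qv x y * mode j y) 0 1.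
Definition cut_err1 (x : R) : R := 2 * RInt (fun y => err_x x y * mode j y) 0 1.
Definition cut_err2 (x : R) : R :=
  2 * RInt (fun y => err_y x y * mode' j y) 0 1 + RInt (fun y => err_lap x y * mode j y) 0 1.

Lemma mult_y_continuous (F : R -> R -> R) (g : R -> R) :
  (forall x y, continuity_2d_pt F x y) -> (forall y, continuous g y) ->
  forall x y, continuity_2d_pt (fun x y => F x y * g y) x y.
Proof.
  intros HF Hg x y. apply continuity_2d_pt_mult; [apply HF|].
  apply (continuity_1d_2d_pt_comp g (fun _ y => y)); [|apply continuity_2d_pt_id2].
  apply continuity_pt_filterlim, Hg.
Qed.

Lemma mult_y_ex_RInt (F : R -> R -> R) (g : R -> R) :
  (forall x y, continuity_2d_pt F x y) -> (forall y, continuous g y) ->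
  forall x, ex_RInt (fun y => F x y * g y) 0 1.
Proof.
  intros HF Hg x. apply ex_RInt_cont_all. intros y.
  apply (continuous_section_y (fun x y => F x y * g y)). apply mult_y_continuous; auto.
Qed.

Lemma cut_coef_continuous (x : R) : continuous cut_coef x /\ continuous cut_source x /\
  continuous cut_err1 x /\ continuous cut_err2 x.
Proof.
  assert (CC := cut_functions_continuous).
  split; [|split; [|split]].
  - apply (circle_int_cont (fun x y => cut_v x y * mode j y)).
    apply mult_y_continuous; [apply CC | apply mode_continuous].
  - apply (circle_int_cont (fun x y => cut_qv x y * mode j y)).
    apply mult_y_continuous; [apply CC | apply mode_continuous].
  - apply continuous_multR; [apply continuous_const|].
    apply (circle_int_cont (fun x y => err_x x y * mode j y)).
    apply mult_y_continuous; [apply CC | apply mode_continuous].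
  - apply continuous_plusR.
    + apply continuous_multR; [apply continuous_const|].
      apply (circle_int_cont (fun x y => err_y x y * mode' j y)).
      apply mult_y_continuous; [apply CC | apply mode'_continuous].
    + apply (circle_int_cont (fun x y => err_lap x y * mode j y)).
      apply mult_y_continuous; [apply CC | apply mode_continuous].
Qed.

Lemma cut_coef_derive (x : R) : is_derive cut_coef x (cut_coef_x x + cut_err1 x).
Proof.
  assert (CC := cut_functions_continuous).
  assert (Cm := mode_continuous j).
  apply is_derive_eq with (RInt (fun y => (cut_vx x y + 2 * err_x x y) * mode j y) 0 1).
  - apply (circle_int_derive (fun x y => cut_v x y * mode j y)
      (fun x y => (cut_vx x y + 2 * err_x x y) * mode j y)).
    + apply mult_y_continuous; [apply CC | exact Cm].
    + apply (mult_y_continuous (fun x y => cut_vx x y + 2 * err_x x y)); [|exact Cm].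
      intros u w. apply continuity_2d_pt_plus; [apply CC|].
      apply continuity_2d_pt_mult; [apply continuity_2d_pt_const | apply CC].
    + intros u w. apply is_derive_eq with (mode j w * (cut_vx u w + 2 * err_x u w)); [|ring].
      apply (is_derive_ext (fun t => mode j w * cut_v t w)); [intros; apply Rmult_comm|].
      apply is_derive_scalR. apply cut_derivatives.
  - unfold cut_coef_x, cut_err1. rewrite <- RInt_scalR, <- RInt_plusR.
    + apply RInt_ext. intros y _. eqR. ring.
    + apply mult_y_ex_RInt; [apply CC | exact Cm].
    + apply ex_RInt_scalR. apply mult_y_ex_RInt; [apply CC | exact Cm].
    + apply mult_y_ex_RInt; [apply CC | exact Cm].
Qed.

Lemma cut_coef_x_derive (x : R) :
  is_derive cut_coef_x x (freq j ^ 2 * cut_coef x - cut_source x - cut_err2 x).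
Proof.
  assert (CC := cut_functions_continuous).
  assert (Cm := mode_continuous j). assert (Cm' := mode'_continuous j).
  apply is_derive_eq with (RInt (fun y => cut_vxx x y * mode j y) 0 1).
  { apply (circle_int_derive (fun x y => cut_vx x y * mode j y) (fun x y => cut_vxx x y * mode j y)).
    - apply mult_y_continuous; [apply CC | exact Cm].
    - apply mult_y_continuous; [apply CC | exact Cm].
    - intros u w. apply is_derive_eq with (mode j w * cut_vxx u w); [|ring].
      apply (is_derive_ext (fun t => mode j w * cut_vx t w)); [intros; apply Rmult_comm|].
      apply is_derive_scalR. apply cut_derivatives. }
  (* the pure y-derivatives are integrated by parts around the circle *)
  assert (X1 : ex_RInt (fun y => cut_vyy x y * mode j y) 0 1)
    by (apply mult_y_ex_RInt; [apply CC | exact Cm]).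
  assert (X2 : ex_RInt (fun y => cut_qv x y * mode j y) 0 1)
    by (apply mult_y_ex_RInt; [apply CC | exact Cm]).
  assert (X3 : ex_RInt (fun y => err_lap x y * mode j y) 0 1)
    by (apply mult_y_ex_RInt; [apply CC | exact Cm]).
  assert (X4 : ex_RInt (fun y => cut_vy x y * mode' j y) 0 1)
    by (apply mult_y_ex_RInt; [apply CC | exact Cm']).
  assert (X5 : ex_RInt (fun y => err_y x y * mode' j y) 0 1)
    by (apply mult_y_ex_RInt; [apply CC | exact Cm']).
  assert (X6 : ex_RInt (fun y => cut_v x y * mode j y) 0 1)
    by (apply mult_y_ex_RInt; [apply CC | exact Cm]).
  assert (E1 : RInt (fun y => cut_vyy x y * mode j y) 0 1 = - RInt (fun y => cut_vy x y * mode' j y) 0 1).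
  { apply (circle_by_parts (fun y => cut_vy x y) (mode j) (fun y => cut_vyy x y) (mode' j)).
    - intros t. apply cut_derivatives.
    - intros t. apply mode_derive.
    - intros t. apply continuous_section_y. apply CC.
    - exact Cm'.
    - rewrite <- (Rplus_0_l 1). rewrite (proj2 (cut_periodic x 0)), (proj1 (mode_periodic j 0)). reflexivity. }
  assert (E2 : RInt (fun y => (cut_vy x y + 2 * err_y x y) * mode' j y) 0 1 =
    - RInt (fun y => cut_v x y * (- (freq j ^ 2) * mode j y)) 0 1).
  { apply (circle_by_parts (fun y => cut_v x y) (mode' j) (fun y => cut_vy x y + 2 * err_y x y)
      (fun y => - (freq j ^ 2) * mode j y)).
    - intros t. apply cut_derivatives.
    - intros t. apply mode_derive.
    - intros t. apply continuous_plusR; [|apply continuous_multR; [apply continuous_const|]];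
        apply continuous_section_y; apply CC.
    - intros t. apply continuous_multR; [apply continuous_const | apply Cm].
    - rewrite <- (Rplus_0_l 1). rewrite (proj1 (cut_periodic x 0)), (proj2 (mode_periodic j 0)). reflexivity. }
  assert (E3 : RInt (fun y => cut_v x y * (- (freq j ^ 2) * mode j y)) 0 1 = - (freq j ^ 2) * cut_coef x).
  { unfold cut_coef. rewrite <- RInt_scalR by exact X6. apply RInt_ext. intros y _. eqR. ring. }
  assert (E4 : RInt (fun y => (cut_vy x y + 2 * err_y x y) * mode' j y) 0 1 =
    RInt (fun y => cut_vy x y * mode' j y) 0 1 + 2 * RInt (fun y => err_y x y * mode' j y) 0 1).
  { rewrite <- RInt_scalR, <- RInt_plusR; auto using ex_RInt_scalR.
    apply RInt_ext. intros y _. eqR. ring. }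
  assert (E5 : RInt (fun y => cut_vxx x y * mode j y) 0 1 =
    - RInt (fun y => cut_vyy x y * mode j y) 0 1 - cut_source x - RInt (fun y => err_lap x y * mode j y) 0 1).
  { unfold cut_source.
    transitivity ((-1) * RInt (fun y => cut_vyy x y * mode j y) 0 1
      + ((-1) * RInt (fun y => cut_qv x y * mode j y) 0 1 + (-1) * RInt (fun y => err_lap x y * mode j y) 0 1)).
    - rewrite <- !RInt_scalR, <- !RInt_plusR; auto using ex_RInt_scalR.
      + apply RInt_ext. intros y _. rewrite cut_laplacian. eqR. ring.
      + apply (ex_RInt_plus (V := R_NormedModule)); auto using ex_RInt_scalR.
    - eqR. ring. }
  rewrite E5, E1. unfold cut_err2. rewrite E3, E4 in E2. lra.
Qed.

End ModeEquation.

(** * Dominating functions for the error terms *)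

Notation pole := (R * R * R)%type.

(** The sum of [K / (r^2 + rho)] over weighted centres, [r] being the distance to
    the centre: with [rho] positive it stays continuous at the centres. *)
Fixpoint dom (ps : list pole) (rho x y : R) : R :=
  match ps with
  | nil => 0
  | (x0, y0, K) :: ps => K / ((x - x0) ^ 2 + (y - y0) ^ 2 + rho) + dom ps rho x y
  end.

(** Bounds the integrals of [dom] over circles, by [int dt / (s^2 + t^2) = pi / s]. *)
Fixpoint dom_fiber (ps : list pole) (rho x : R) : R :=
  match ps with
  | nil => 0
  | (x0, _, K) :: ps => K * (PI / sqrt ((x - x0) ^ 2 + rho)) + dom_fiber ps rho x
  end.

Definition nonneg_weights (ps : list pole) : Prop := forall p, In p ps -> 0 <= snd p.

Lemma sum_sqr_pos (u w rho : R) : 0 < rho -> 0 < u ^ 2 + w ^ 2 + rho.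
Proof. intros H. generalize (pow2_ge_0 u) (pow2_ge_0 w). lra. Qed.

Lemma dom_continuous (ps : list pole) (rho x y : R) : 0 < rho -> continuous (fun y => dom ps rho x y) y.
Proof.
  intros Hr. induction ps as [|[[x0 y0] K] ps IH]; cbn [dom]; [apply continuous_const|].
  apply continuous_plusR; [|exact IH]. apply continuous_multR; [apply continuous_const|].
  apply continuous_invR; [|apply Rgt_not_eq, sum_sqr_pos; exact Hr].
  apply (ex_derive_continuous (V := R_NormedModule)). auto_derive; auto.
Qed.

Lemma dom_fiber_continuous (ps : list pole) (rho x : R) : 0 < rho -> continuous (dom_fiber ps rho) x.
Proof.
  intros Hr. induction ps as [|[[x0 y0] K] ps IH]; cbn [dom_fiber]; [apply continuous_const|].
  apply continuous_plusR; [|exact IH]. apply (ex_derive_continuous (V := R_NormedModule)).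
  assert (P : 0 < (x - x0) ^ 2 + rho) by (generalize (pow2_ge_0 (x - x0)); lra).
  auto_derive. simpl in P. split; [replace (x + - x0) with (x - x0) by ring; lra|].
  split; auto. apply Rgt_not_eq, sqrt_lt_R0. replace (x + - x0) with (x - x0) by ring. lra.
Qed.

Lemma dom_nonneg (ps : list pole) (rho x y : R) : nonneg_weights ps -> 0 < rho -> 0 <= dom ps rho x y.
Proof.
  intros Hw Hr. induction ps as [|[[x0 y0] K] ps IH]; cbn [dom]; [lra|].
  apply Rplus_le_le_0_compat.
  - apply Rdiv_le_0_compat; [exact (Hw _ (or_introl eq_refl)) | apply sum_sqr_pos; exact Hr].
  - apply IH. intros p Hp. apply Hw. right; exact Hp.
Qed.

Lemma dom_fiber_nonneg (ps : list pole) (rho x : R) : nonneg_weights ps -> 0 < rho -> 0 <= dom_fiber ps rho x.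
Proof.
  intros Hw Hr. induction ps as [|[[x0 y0] K] ps IH]; cbn [dom_fiber]; [lra|].
  apply Rplus_le_le_0_compat.
  - apply Rmult_le_pos; [exact (Hw _ (or_introl eq_refl))|]. apply Rlt_le, Rdiv_lt_0_compat; [apply PI_RGT_0|].
    apply sqrt_lt_R0. generalize (pow2_ge_0 (x - x0)); lra.
  - apply IH. intros p Hp. apply Hw. right; exact Hp.
Qed.

Lemma dom_ge_term (ps : list pole) (rho x y : R) (p : pole) : nonneg_weights ps -> 0 < rho -> In p ps ->
  snd p / ((x - fst (fst p)) ^ 2 + (y - snd (fst p)) ^ 2 + rho) <= dom ps rho x y.
Proof.
  intros Hw Hr Hp. induction ps as [|[[x0 y0] K] ps IH]; [destruct Hp|]. cbn [dom].
  assert (Hw' : nonneg_weights ps) by (intros p' Hp'; apply Hw; right; exact Hp').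
  assert (D := dom_nonneg ps rho x y Hw' Hr).
  destruct Hp as [<-|Hp].
  - cbn [fst snd]. lra.
  - specialize (IH Hw' Hp).
    assert (0 <= K / ((x - x0) ^ 2 + (y - y0) ^ 2 + rho)); [|lra].
    apply Rdiv_le_0_compat; [exact (Hw _ (or_introl eq_refl)) | apply sum_sqr_pos; exact Hr].
Qed.

Lemma int_lorentzian (s y0 : R) : 0 < s ->
  RInt (fun y => / (s ^ 2 + (y - y0) ^ 2)) 0 1 <= PI / s.
Proof.
  intros Hs.
  assert (P : forall t, 0 < s ^ 2 + (t - y0) ^ 2) by (intros t; generalize (pow2_ge_0 (t - y0)); nra).
  rewrite (RInt_ftc (fun y => / s * atan ((y - y0) / s))).
  - assert (A1 := atan_bound ((1 - y0) / s)). assert (A2 := atan_bound ((0 - y0) / s)).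
    assert (Hi : 0 < / s) by (apply Rinv_0_lt_compat; exact Hs).
    unfold Rdiv at 3. rewrite <- Rmult_minus_distr_l, (Rmult_comm PI). apply Rmult_le_compat_l; lra.
  - intros t. apply is_derive_eq with (/ s * (/ s * / (1 + ((t - y0) / s) ^ 2))).
    + apply is_derive_scalR.
      apply (is_derive_comp atan (fun y => (y - y0) / s)).
      * apply is_derive_Reals, derivable_pt_lim_atan.
      * auto_derive; auto. field. lra.
    + assert (Pt := P t). field. repeat split; first [lra | intros Hx; nra].
  - intros t. apply continuous_invR; [|apply Rgt_not_eq, P].
    apply (ex_derive_continuous (V := R_NormedModule)). auto_derive; auto.
Qed.

Lemma dom_int_fiber (ps : list pole) (rho x : R) : nonneg_weights ps -> 0 < rho ->
  RInt (fun y => dom ps rho x y) 0 1 <= dom_fiber ps rho x.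
Proof.
  intros Hw Hr. induction ps as [|[[x0 y0] K] ps IH]; cbn [dom_fiber].
  - cbn [dom]. rewrite RInt_constR. lra.
  - cbn [dom]. set (s := sqrt ((x - x0) ^ 2 + rho)).
    assert (P0 : 0 < (x - x0) ^ 2 + rho) by (generalize (pow2_ge_0 (x - x0)); lra).
    assert (Hs : 0 < s) by (apply sqrt_lt_R0; exact P0).
    assert (Es : s ^ 2 = (x - x0) ^ 2 + rho) by (apply pow2_sqrt; lra).
    assert (Cs : ex_RInt (fun y => / (s ^ 2 + (y - y0) ^ 2)) 0 1).
    { apply ex_RInt_cont_all. intros t. apply continuous_invR.
      - apply (ex_derive_continuous (V := R_NormedModule)). auto_derive; auto.
      - generalize (pow2_ge_0 (t - y0)); nra. }
    rewrite (RInt_ext _ (fun y => K * / (s ^ 2 + (y - y0) ^ 2) + dom ps rho x y)).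
    + rewrite RInt_plusR, RInt_scalR; auto using ex_RInt_scalR.
      * apply Rplus_le_compat.
        -- apply Rmult_le_compat_l; [exact (Hw _ (or_introl eq_refl)) | apply int_lorentzian; exact Hs].
        -- apply IH. intros p Hp. apply Hw. right; exact Hp.
      * apply ex_RInt_cont_all. intros t. apply dom_continuous; exact Hr.
    + intros y _. rewrite Es. unfold Rdiv. f_equal. f_equal. f_equal. ring.
Qed.

(** [ln (u + sqrt (u^2 + rho))] is the primitive of [1 / sqrt (u^2 + rho)]. *)
Lemma int_inv_sqrt (x0 T s : R) : 0 <= T -> 0 <= s ->
  RInt (fun x => / sqrt ((x - x0) ^ 2 + exp (- s))) (- T) T <= 2 * ln (2 * (T + Rabs x0) + 1) + s.
Proof.
  intros HT Hs. set (rho := exp (- s)).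
  assert (Hr : 0 < rho) by apply exp_pos.
  assert (Hr1 : rho <= 1).
  { unfold rho. rewrite <- exp_0. destruct Hs as [Hs| <-]; [apply Rlt_le, exp_increasing; lra|].
    rewrite Ropp_0. lra. }
  assert (P : forall u, 0 < u ^ 2 + rho) by (intros u; generalize (pow2_ge_0 u); lra).
  assert (Hq : forall u, Rabs u < sqrt (u ^ 2 + rho) /\ sqrt (u ^ 2 + rho) <= Rabs u + 1).
  { intros u. assert (H0 := Rabs_pos u). split.
    - rewrite <- (sqrt_pow2 (Rabs u)) at 1 by auto. apply sqrt_lt_1_alt.
      rewrite pow2_abs. split; [apply pow2_ge_0 | lra].
    - rewrite <- (sqrt_pow2 (Rabs u + 1)) by lra. apply sqrt_le_1_alt.
      rewrite <- (pow2_abs u). nra. }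
  assert (Hpos : forall u, 0 < u + sqrt (u ^ 2 + rho)).
  { intros u. destruct (Hq u) as [H _]. generalize (Rabs_maj2 u). lra. }
  rewrite (RInt_ftc (fun x => ln ((x - x0) + sqrt ((x - x0) ^ 2 + rho)))).
  - set (M := T + Rabs x0). assert (HM : 0 <= M) by (unfold M; generalize (Rabs_pos x0); lra).
    assert (U1 : ln (T - x0 + sqrt ((T - x0) ^ 2 + rho)) <= ln (2 * M + 1)).
    { assert (Hu : Rabs (T - x0) <= M).
      { unfold M. apply Rle_trans with (1 := Rabs_triang _ _). rewrite Rabs_Ropp, (Rabs_pos_eq T); lra. }
      destruct (Hq (T - x0)) as [_ H].
      assert (Hle : T - x0 + sqrt ((T - x0) ^ 2 + rho) <= 2 * M + 1) by (generalize (Rle_abs (T - x0)); lra).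
      destruct Hle as [Hlt|E]; [apply Rlt_le, ln_increasing; auto | rewrite E; lra]. }
    assert (U2 : - (ln (2 * M + 1) + s) <= ln (- T - x0 + sqrt ((- T - x0) ^ 2 + rho))).
    { assert (Hu : Rabs (- T - x0) <= M).
      { unfold M. apply Rle_trans with (1 := Rabs_triang _ _). rewrite !Rabs_Ropp, (Rabs_pos_eq T); lra. }
      destruct (Hq (- T - x0)) as [_ H]. set (u := - T - x0) in *.
      assert (Pu := Hpos u). assert (Pu' : 0 < - u + sqrt (u ^ 2 + rho)).
      { replace (u ^ 2) with ((- u) ^ 2) by ring. apply Hpos. }
      assert (E : u + sqrt (u ^ 2 + rho) = rho / (- u + sqrt (u ^ 2 + rho))).
      { apply Rmult_eq_reg_r with (- u + sqrt (u ^ 2 + rho)); [|lra].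
        unfold Rdiv. rewrite Rmult_assoc, Rinv_l, Rmult_1_r by lra.
        assert (S2 := pow2_sqrt (u ^ 2 + rho) (Rlt_le _ _ (P u))). nra. }
      rewrite E. unfold Rdiv. rewrite ln_mult, ln_Rinv by (auto; apply Rinv_0_lt_compat; auto).
      unfold rho at 1. rewrite ln_exp.
      assert (Hle : - u + sqrt (u ^ 2 + rho) <= 2 * M + 1) by (generalize (Rabs_maj2 u); lra).
      assert (ln (- u + sqrt (u ^ 2 + rho)) <= ln (2 * M + 1)); [|lra].
      destruct Hle as [Hlt|E']; [apply Rlt_le, ln_increasing; auto | rewrite E'; lra]. }
    lra.
  - intros t. assert (Pt := P (t - x0)). assert (Q := Hpos (t - x0)).
    assert (Sp : 0 < sqrt ((t - x0) ^ 2 + rho)) by (apply sqrt_lt_R0; exact Pt).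
    apply is_derive_eq with ((1 + (t - x0) / sqrt ((t - x0) ^ 2 + rho)) / ((t - x0) + sqrt ((t - x0) ^ 2 + rho))).
    + auto_derive.
      * replace (t + - x0) with (t - x0) by ring. split; [exact Pt|]. split; [exact Q|exact I].
      * replace (t + - x0) with (t - x0) by ring. replace ((t - x0) * ((t - x0) * 1)) with ((t - x0) ^ 2) by ring. field. split; lra.
    + field. split; lra.
  - intros t. apply continuous_invR.
    + apply (ex_derive_continuous (V := R_NormedModule)). auto_derive.
      exact (P (t - x0)).
    + apply Rgt_not_eq, sqrt_lt_R0, P.
Qed.

(** The integral over the strip is only logarithmic in [rho = exp(- s)]. *)
Lemma dom_fiber_int (ps : list pole) (T : R) : nonneg_weights ps -> 0 <= T ->
  exists K, 0 <= K /\ forall s, 0 <= s -> RInt (dom_fiber ps (exp (- s))) (- T) T <= K * (1 + s).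
Proof.
  intros Hw HT. induction ps as [|[[x0 y0] k] ps IH].
  - exists 0. split; [lra|]. intros s Hs. cbn [dom_fiber]. rewrite RInt_constR. lra.
  - destruct IH as (K & HK & IH); [intros p Hp; apply Hw; right; exact Hp|].
    assert (Hk : 0 <= k) by exact (Hw _ (or_introl eq_refl)).
    assert (HPI := PI_RGT_0).
    set (A := 2 * ln (2 * (T + Rabs x0) + 1) + 1).
    assert (HA : 1 <= A).
    { assert (H1 : 1 <= 2 * (T + Rabs x0) + 1) by (generalize (Rabs_pos x0); lra).
      assert (H2 : ln 1 <= ln (2 * (T + Rabs x0) + 1)).
      { destruct H1 as [H1| <-]; [apply Rlt_le, ln_increasing; lra | lra]. }
      rewrite ln_1 in H2. unfold A. lra. }
    assert (HkA : 0 <= k * PI * A) by (apply Rmult_le_pos; [apply Rmult_le_pos|]; lra).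
    exists (K + k * PI * A). split; [lra|].
    intros s Hs. assert (Hr : 0 < exp (- s)) by apply exp_pos.
    assert (C1 : ex_RInt (fun x => / sqrt ((x - x0) ^ 2 + exp (- s))) (- T) T).
    { apply ex_RInt_cont_all. intros t.
      assert (P : 0 < (t - x0) ^ 2 + exp (- s)) by (generalize (pow2_ge_0 (t - x0)); lra).
      apply continuous_invR; [|apply Rgt_not_eq, sqrt_lt_R0; exact P].
      apply (ex_derive_continuous (V := R_NormedModule)). auto_derive.
      exact P. }
    rewrite (RInt_ext _ (fun x => (k * PI) * / sqrt ((x - x0) ^ 2 + exp (- s)) + dom_fiber ps (exp (- s)) x)).
    + rewrite RInt_plusR, RInt_scalR; auto using ex_RInt_scalR.
      * assert (I1 := int_inv_sqrt x0 T s HT Hs). specialize (IH s Hs).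
        assert (k * PI * RInt (fun x => / sqrt ((x - x0) ^ 2 + exp (- s))) (- T) T <= k * PI * (A * (1 + s))).
        { apply Rmult_le_compat_l; [apply Rmult_le_pos; lra|]. unfold A in *. nra. }
        lra.
      * apply ex_RInt_cont_all. intros t. apply dom_fiber_continuous; exact Hr.
    + intros x _. cbn [dom_fiber]. unfold Rdiv. eqR. ring.
Qed.

(** With [rho = e^2], for the circle integrals of [1 - bump (e l)]. *)
Lemma dom_fiber_le (ps : list pole) : nonneg_weights ps ->
  exists K, 0 <= K /\ forall e x, 0 < e -> e ^ 2 * dom_fiber ps (e ^ 2) x <= K * e.
Proof.
  intros Hw. induction ps as [|[[x0 y0] k] ps IH].
  - exists 0. split; [lra|]. intros e' x He. cbn [dom_fiber]. lra.
  - destruct IH as (K & HK & IH); [intros p Hp; apply Hw; right; exact Hp|].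
    assert (Hk : 0 <= k) by exact (Hw _ (or_introl eq_refl)). assert (HPI := PI_RGT_0).
    assert (HkP : 0 <= k * PI) by (apply Rmult_le_pos; lra).
    exists (K + k * PI). split; [lra|]. intros e' x He. cbn [dom_fiber]. specialize (IH e' x He).
    assert (Hs : e' <= sqrt ((x - x0) ^ 2 + e' ^ 2)).
    { rewrite <- (sqrt_pow2 e') at 1 by lra. apply sqrt_le_1_alt. generalize (pow2_ge_0 (x - x0)); lra. }
    assert (Hi : / sqrt ((x - x0) ^ 2 + e' ^ 2) <= / e') by (apply Rinv_le_contravar; auto).
    assert (e' ^ 2 * (k * (PI / sqrt ((x - x0) ^ 2 + e' ^ 2))) <= k * PI * e').
    { replace (e' ^ 2 * (k * (PI / sqrt ((x - x0) ^ 2 + e' ^ 2)))) with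
        ((k * PI) * (e' ^ 2 * / sqrt ((x - x0) ^ 2 + e' ^ 2))) by (unfold Rdiv; ring).
      apply Rmult_le_compat_l; [exact HkP|].
      apply Rle_trans with (e' ^ 2 * / e'); [apply Rmult_le_compat_l; [apply pow2_ge_0|exact Hi]|].
      right. field. lra. }
    lra.
Qed.

(** Finitely many centres such that the local bounds of [hc_tempered] hold
    everywhere in the strip [|x| <= T], each point referring to one of them. *)
Definition covers (U : R -> R -> Prop) (l a b : R -> R -> R) (T : R) (ps : list pole) : Prop :=
  nonneg_weights ps /\
  forall x y, Rabs x <= T -> 0 <= y <= 1 -> exists p, In p ps /\
    (U x y \/ (x = fst (fst p) /\ y = snd (fst p))) /\
    (U x y -> l x y ^ 2 * ((x - fst (fst p)) ^ 2 + (y - snd (fst p)) ^ 2) <= snd p /\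
       forall L, 0 <= L -> Rabs (l x y) <= L ->
         (a x y ^ 2 + b x y ^ 2) * ((x - fst (fst p)) ^ 2 + (y - snd (fst p)) ^ 2 + exp (- L)) <= snd p).

Lemma strip_cover (U : R -> R -> Prop) (l a b c q : R -> R -> R) (Q T : R) :
  harmonic_cylinder U l a b c q Q -> exists ps, covers U l a b T ps.
Proof.
  intros HC.
  assert (HT : forall z : R * R, exists rK : R * R, 0 < fst rK /\ 0 <= snd rK /\
    forall x y, Rabs (x - fst z) < fst rK -> Rabs (y - snd z) < fst rK ->
      (U x y \/ (x = fst z /\ y = snd z)) /\
      (U x y -> l x y ^ 2 * ((x - fst z) ^ 2 + (y - snd z) ^ 2) <= snd rK /\
         forall L, 0 <= L -> Rabs (l x y) <= L ->
           (a x y ^ 2 + b x y ^ 2) * ((x - fst z) ^ 2 + (y - snd z) ^ 2 + exp (- L)) <= snd rK)).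
  { intros [x0 y0]. destruct (hc_tempered _ _ _ _ _ _ _ HC x0 y0) as (r & K & H).
    exists (r, K). exact H. }
  destruct (choice _ HT) as [f Hf].
  destruct (rectangle_cover (fun x y => fst (f (x, y))) (- T) T 0 1) as [lst Hl].
  { intros x y. apply Hf. }
  exists (map (fun z => (z, snd (f z))) lst). split.
  - intros p Hp. apply in_map_iff in Hp. destruct Hp as (z & <- & _). apply Hf.
  - intros x y Hx Hy. destruct (Hl x y) as (z & Hz & H1 & H2); [apply Rabs_le_between; exact Hx|exact Hy|].
    exists (z, snd (f z)). split; [apply in_map_iff; exists z; auto|].
    rewrite <- surjective_pairing in H1, H2. apply Hf; auto.
Qed.

(** The weights that dominate [1 - bump (eps l)]. *)
Definition reweigh (ps : list pole) : list pole := map (fun p => (fst p, 3 * snd p + 1)) ps.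

Lemma reweigh_nonneg (ps : list pole) : nonneg_weights ps -> nonneg_weights (reweigh ps).
Proof.
  intros Hw p Hp. apply in_map_iff in Hp. destruct Hp as (p' & <- & Hp'). simpl.
  generalize (Hw p' Hp'). lra.
Qed.

Lemma RInt_abs_bound (f g : R -> R) : (forall t, continuous f t) -> ex_RInt g 0 1 ->
  (forall t, 0 <= t <= 1 -> Rabs (f t) <= g t) -> Rabs (RInt f 0 1) <= RInt g 0 1.
Proof.
  intros Hf Hg H. apply Rle_trans with (RInt (fun t => Rabs (f t)) 0 1).
  - apply abs_RInt_le; [lra|]. apply ex_RInt_cont_all; auto.
  - apply RInt_le; [lra| |exact Hg|intros; apply H; lra].
    apply ex_RInt_cont_all. intros t. apply (continuous_comp f Rabs); [apply Hf|apply continuous_Rabs].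
Qed.

Section ErrorBounds.
Variables (U : R -> R -> Prop) (l a b c q : R -> R -> R) (Q : R).
Hypothesis HC : harmonic_cylinder U l a b c q Q.
Variables (T : R) (ps : list pole).
Hypothesis Hps : covers U l a b T ps.

Lemma gradient_dominated (x y L : R) : Rabs x <= T -> 0 <= y <= 1 -> U x y -> 0 <= L ->
  Rabs (l x y) <= L -> a x y ^ 2 + b x y ^ 2 <= dom ps (exp (- L)) x y.
Proof.
  intros Hx Hy HU HL Hl. destruct Hps as [Hw Hc]. destruct (Hc x y Hx Hy) as (p & Hp & _ & H).
  destruct (H HU) as [_ H2]. specialize (H2 L HL Hl).
  assert (He := exp_pos (- L)).
  apply Rle_trans with (2 := dom_ge_term ps (exp (- L)) x y p Hw He Hp).
  assert (P := sum_sqr_pos (x - fst (fst p)) (y - snd (fst p)) _ He).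
  apply Rmult_le_reg_r with ((x - fst (fst p)) ^ 2 + (y - snd (fst p)) ^ 2 + exp (- L)); [exact P|].
  unfold Rdiv. rewrite Rmult_assoc, Rinv_l, Rmult_1_r by lra. exact H2.
Qed.

(** [1 - bump s] is at most [1] and at most [3 s^2], and [l^2 <= K / r^2]: this gives
    both [1] and [3 e^2 K / r^2] as bounds, hence [e^2 (3 K + 1) / (r^2 + e^2)]. *)
Lemma one_sub_cutoff_dominated (x y e : R) : Rabs x <= T -> 0 <= y <= 1 -> 0 < e ->
  0 <= 1 - cut U (fun x y => bump (e * l x y)) x y <= e ^ 2 * dom (reweigh ps) (e ^ 2) x y.
Proof.
  intros Hx Hy He. destruct Hps as [Hw Hc]. destruct (Hc x y Hx Hy) as (p & Hp & H1 & H2).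
  assert (He2 : 0 < e ^ 2) by nra.
  assert (Hp' : In (fst p, 3 * snd p + 1) (reweigh ps)) by (apply in_map_iff; exists p; auto).
  assert (D := dom_ge_term _ (e ^ 2) x y _ (reweigh_nonneg ps Hw) He2 Hp'). cbn [fst snd] in D.
  assert (P := sum_sqr_pos (x - fst (fst p)) (y - snd (fst p)) _ He2).
  assert (Hk := Hw p Hp).
  set (r2 := (x - fst (fst p)) ^ 2 + (y - snd (fst p)) ^ 2) in *.
  assert (Hr2 : 0 <= r2) by (unfold r2; generalize (pow2_ge_0 (x - fst (fst p))) (pow2_ge_0 (y - snd (fst p))); lra).
  enough (0 <= 1 - cut U (fun x y => bump (e * l x y)) x y /\
    (1 - cut U (fun x y => bump (e * l x y)) x y) * (r2 + e ^ 2) <= e ^ 2 * (3 * snd p + 1)) as [E1 E2].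
  { split; [exact E1|]. apply Rle_trans with (e ^ 2 * ((3 * snd p + 1) / (r2 + e ^ 2))).
    - apply Rmult_le_reg_r with (r2 + e ^ 2); [exact P|].
      replace (e ^ 2 * ((3 * snd p + 1) / (r2 + e ^ 2)) * (r2 + e ^ 2)) with (e ^ 2 * (3 * snd p + 1))
        by (field; lra). exact E2.
    - apply Rmult_le_compat_l; [lra|exact D]. }
  destruct (excluded_middle_informative (U x y)) as [HU|HU].
  - rewrite cut_in by exact HU. destruct (bump_bounds (e * l x y)) as (B1 & B2 & _).
    destruct (H2 HU) as [H3 _]. split; [lra|].
    assert (M1 : (1 - bump (e * l x y)) * r2 <= e ^ 2 * (3 * snd p)).
    { apply Rle_trans with (3 * (e * l x y) ^ 2 * r2); [apply Rmult_le_compat_r; lra|].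
      replace (3 * (e * l x y) ^ 2 * r2) with (e ^ 2 * (3 * (l x y ^ 2 * r2))) by ring.
      apply Rmult_le_compat_l; lra. }
    assert (M2 : (1 - bump (e * l x y)) * e ^ 2 <= 1 * e ^ 2) by (apply Rmult_le_compat_r; lra).
    lra.
  - rewrite cut_out by exact HU. split; [lra|].
    destruct H1 as [H1|[E1 E2]]; [contradiction|].
    assert (E : r2 = 0) by (unfold r2; rewrite E1, E2; ring). rewrite E. nra.
Qed.

(** Uniformly in [x], the singular circles included: the difference of two
    cutoffs is dominated by [dom], whose circle integrals are small. *)
Lemma cut_coef_close (w : R -> R -> R) (Bw : R) (j : nat) :
  (forall x y, U x y -> continuity_2d_pt w x y) -> 0 <= Bw -> (forall x y, U x y -> Rabs (w x y) <= Bw) ->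
  exists K, 0 <= K /\ forall x e, Rabs x <= T -> 0 < e ->
    (forall e', 0 < e' ->
       Rabs (RInt (fun y => cut U (fun x y => bump (e * l x y) * w x y) x y * mode j y) 0 1 -
             RInt (fun y => cut U (fun x y => bump (e' * l x y) * w x y) x y * mode j y) 0 1)
       <= K * (e + e')) /\
    ((forall y, U x y) ->
       Rabs (RInt (fun y => cut U (fun x y => bump (e * l x y) * w x y) x y * mode j y) 0 1 -
             RInt (fun y => w x y * mode j y) 0 1) <= K * e).
Proof.
  intros Hwc HB Hwb. destruct Hps as [Hw Hc].
  destruct (dom_fiber_le (reweigh ps) (reweigh_nonneg ps Hw)) as (K & HK & BK).
  exists (2 * Bw * K). split; [repeat apply Rmult_le_pos; lra|]. intros x e Hx He.
  set (W := fun e => cut U (fun x y => bump (e * l x y) * w x y)).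
  set (chi := fun e => cut U (fun x y => bump (e * l x y))).
  assert (HWc : forall e, 0 < e -> forall x y, continuity_2d_pt (W e) x y).
  { intros e' He'. apply (cut_continuous _ _ _ _ _ _ _ HC (/ e')).
    - intros u t HU HL. apply (scaled_large e' He') in HL. rewrite (proj1 (bump_vanish _ HL)). ring.
    - intros u t HU. apply continuity_2d_pt_mult; [|apply Hwc; exact HU].
      destruct (hc_cont _ _ _ _ _ _ _ HC u t HU) as (Cl & _).
      apply continuity_1d_2d_pt_comp.
      + apply continuity_pt_filterlim. exact (proj1 (bump_continuous _)).
      + apply continuity_2d_pt_mult; [apply continuity_2d_pt_const|exact Cl]. }
  assert (HWe : forall e, 0 < e -> forall y, continuous (fun y => W e x y * mode j y) y).
  { intros e' He' y. apply continuous_multR; [apply continuous_section_y, HWc; exact He' | apply mode_continuous]. }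
  (* the integrand of either difference is at most Bw |chi - chi'| |mode j| *)
  assert (HWchi : forall e y, W e x y = chi e x y * cut U w x y).
  { intros e' y. unfold W, chi, cut. destruct (excluded_middle_informative (U x y)); ring. }
  assert (Hcw : forall y, Rabs (cut U w x y) <= Bw).
  { intros y. destruct (excluded_middle_informative (U x y)) as [H|H].
    - rewrite cut_in by exact H. apply Hwb; exact H.
    - rewrite cut_out by exact H. rewrite Rabs_R0; exact HB. }
  assert (Hbd : forall k y, Rabs k <= e ^ 2 * 0 + Rabs k -> Rabs (k * cut U w x y * mode j y) <= 2 * Bw * Rabs k).
  { intros k y _. rewrite !Rabs_mult. assert (M := proj1 (mode_bound j y)).
    replace (2 * Bw * Rabs k) with (Rabs k * Bw * 2) by ring.
    apply Rmult_le_compat; auto using Rabs_pos.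
    - apply Rmult_le_pos; apply Rabs_pos.
    - apply Rmult_le_compat_l; [apply Rabs_pos|apply Hcw]. }
  assert (Hdc : forall e, 0 < e -> ex_RInt (fun y => e ^ 2 * dom (reweigh ps) (e ^ 2) x y) 0 1).
  { intros e' He'. apply ex_RInt_scalR, ex_RInt_cont_all. intros t. apply dom_continuous. nra. }
  assert (Hdi : forall e, 0 < e -> RInt (fun y => e ^ 2 * dom (reweigh ps) (e ^ 2) x y) 0 1 <= K * e).
  { intros e' He'. assert (He2 : 0 < e' ^ 2) by nra. rewrite RInt_scalR.
    - apply Rle_trans with (2 := BK e' x He'). apply Rmult_le_compat_l; [lra|].
      apply dom_int_fiber; [apply reweigh_nonneg; exact Hw | exact He2].
    - apply ex_RInt_cont_all. intros t. apply dom_continuous; exact He2. }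
  split.
  - intros e' He'. fold (W e). fold (W e').
    rewrite <- RInt_minusR by (apply ex_RInt_cont_all, HWe; assumption).
    apply Rle_trans with (RInt (fun y => 2 * Bw * (e ^ 2 * dom (reweigh ps) (e ^ 2) x y + e' ^ 2 * dom (reweigh ps) (e' ^ 2) x y)) 0 1).
    + apply RInt_abs_bound.
      * intros t. apply (continuous_minus (V := R_NormedModule)); apply HWe; assumption.
      * apply ex_RInt_scalR. apply (ex_RInt_plus (V := R_NormedModule)); apply Hdc; assumption.
      * intros y Hy. rewrite !HWchi.
        replace (chi e x y * cut U w x y * mode j y - chi e' x y * cut U w x y * mode j y)
          with ((chi e x y - chi e' x y) * cut U w x y * mode j y) by ring.
        apply Rle_trans with (2 * Bw * Rabs (chi e x y - chi e' x y)).
        { apply Hbd. lra. }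
        apply Rmult_le_compat_l; [lra|].
        assert (D1 := one_sub_cutoff_dominated x y e Hx Hy He).
        assert (D2 := one_sub_cutoff_dominated x y e' Hx Hy He').
        fold (chi e) in D1. fold (chi e') in D2. apply Rabs_le. lra.
    + assert (X1 := Hdc e He). assert (X2 := Hdc e' He').
      rewrite RInt_scalR; [|apply (ex_RInt_plus (V := R_NormedModule)); [exact X1|exact X2]].
      rewrite RInt_plusR; [|exact X1|exact X2].
      assert (I1 := Hdi e He). assert (I2 := Hdi e' He').
      replace (2 * Bw * K * (e + e')) with (2 * Bw * (K * e + K * e')) by ring.
      apply Rmult_le_compat_l; lra.
  - intros Hreg. fold (W e).
    assert (Hwy : forall y, continuous (fun y => w x y * mode j y) y).
    { intros y. apply continuous_multR; [apply continuous_section_y, Hwc, Hreg | apply mode_continuous]. }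
    rewrite <- RInt_minusR by (apply ex_RInt_cont_all; auto).
    apply Rle_trans with (RInt (fun y => 2 * Bw * (e ^ 2 * dom (reweigh ps) (e ^ 2) x y)) 0 1).
    + apply RInt_abs_bound.
      * intros t. apply (continuous_minus (V := R_NormedModule)); auto.
      * apply ex_RInt_scalR, Hdc; exact He.
      * intros y Hy. rewrite HWchi.
        replace (chi e x y * cut U w x y * mode j y - w x y * mode j y)
          with ((chi e x y - 1) * cut U w x y * mode j y) by (rewrite (cut_in U w x y (Hreg y)); ring).
        apply Rle_trans with (2 * Bw * Rabs (chi e x y - 1)).
        { apply Hbd. lra. }
        apply Rmult_le_compat_l; [lra|].
        assert (D1 := one_sub_cutoff_dominated x y e Hx Hy He). fold (chi e) in D1. apply Rabs_le. lra.
    + rewrite RInt_scalR by (apply Hdc; exact He). rewrite (Rmult_assoc (2 * Bw)).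
      apply Rmult_le_compat_l; [lra|apply Hdi; exact He].
Qed.

Variables (v vx vy vxx vyy : R -> R -> R) (B : R).
Hypothesis HS : bounded_solution U q v vx vy vxx vyy B.

(** The errors tend to zero in [L^1], at speed [1 / m] for [eps = 1 / m^2]:
    [eps |grad l|] is at most [m^-3 |grad l|^2 + m^-1] by the inequality between
    means, and [|grad l|^2 <= sum K / (r^2 + exp(- m^2))] where [|l| <= m^2], whose
    integral is [O(1 + m^2)]. *)
Lemma error_pointwise (m x y : R) : 1 <= m -> Rabs x <= T -> 0 <= y <= 1 ->
  let e := / (m * m) in let D := / m ^ 3 * dom ps (exp (- (m * m))) x y + / m in
  Rabs (err_x U l a v e x y) <= 6 * B * D /\ Rabs (err_y U l b v e x y) <= 6 * B * D /\
  Rabs (err_lap U l a b v e x y) <= 30 * B * D.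
Proof.
  intros Hm Hx Hy e D.
  assert (Hmm : 0 < m * m) by nra. assert (Him : 0 < / m) by (apply Rinv_0_lt_compat; lra).
  assert (He : 0 < e) by (apply Rinv_0_lt_compat; exact Hmm).
  assert (Hw := proj1 Hps).
  assert (Hdom := dom_nonneg ps (exp (- (m * m))) x y Hw (exp_pos _)).
  assert (Hi3 : 0 < / m ^ 3) by (apply Rinv_0_lt_compat, pow_lt; lra).
  assert (HD : 0 <= D).
  { unfold D. assert (0 <= / m ^ 3 * dom ps (exp (- (m * m))) x y) by (apply Rmult_le_pos; lra). lra. }
  destruct (bs_bound _ _ _ _ _ _ _ _ HS) as [HB Hvb].
  assert (H6 : 0 <= 6 * B * D) by (apply Rmult_le_pos; lra).
  assert (H30 : 0 <= 30 * B * D) by (apply Rmult_le_pos; lra).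
  unfold err_x, err_y, err_lap, cut.
  destruct (excluded_middle_informative (U x y)) as [HU|HU]; [|rewrite Rabs_R0; auto].
  destruct (Rle_dec (m * m) (Rabs (l x y))) as [Hl|Hl].
  - assert (Hbig : 1 <= Rabs (e * l x y)).
    { apply scaled_large; [exact He|]. unfold e. rewrite Rinv_inv. exact Hl. }
    destruct (bump_vanish _ Hbig) as (_ & E1 & E2). rewrite E1, E2, !Rmult_0_l, Rabs_R0. auto.
  - assert (G := gradient_dominated x y (m * m) Hx Hy HU ltac:(lra) ltac:(lra)).
    destruct (bump_bounds (e * l x y)) as (_ & _ & B1 & B2).
    set (d := dom ps (exp (- (m * m))) x y) in *.
    assert (AM : forall t, t ^ 2 <= d -> e * Rabs t <= D).
    { intros t Ht. assert (Ht' : Rabs t ^ 2 <= d) by (rewrite pow2_abs; exact Ht).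
      set (r := Rabs t) in *. unfold D, e.
      assert (Sq := pow2_ge_0 (/ m * r - 1)).
      apply Rmult_le_reg_l with m; [lra|].
      replace (m * (/ (m * m) * r)) with (/ m * r) by (field; lra).
      replace (m * (/ m ^ 3 * d + / m)) with ((/ m) ^ 2 * d + 1) by (field; lra).
      assert (0 <= d) by exact Hdom. nra. }
    assert (Hgen : forall k s, Rabs k <= 6 -> s ^ 2 <= d -> Rabs (k * (e * s * v x y)) <= 6 * B * D).
    { intros k s Hk Hs. rewrite !Rabs_mult, (Rabs_pos_eq e) by lra.
      replace (6 * B * D) with (6 * (D * B)) by ring.
      apply Rmult_le_compat; auto using Rabs_pos.
      - apply Rmult_le_pos; [apply Rmult_le_pos; [lra|apply Rabs_pos]|apply Rabs_pos].
      - apply Rmult_le_compat; auto using Rabs_pos. apply Rmult_le_pos; [lra|apply Rabs_pos]. }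
    split; [|split].
    + apply Hgen; [exact B1|]. generalize (pow2_ge_0 (b x y)); lra.
    + apply Hgen; [exact B1|]. generalize (pow2_ge_0 (a x y)); lra.
    + rewrite !Rabs_mult. replace (30 * B * D) with (30 * (D * B)) by ring.
      apply Rmult_le_compat; auto using Rabs_pos.
      { apply Rmult_le_pos; [apply Rmult_le_pos; apply Rabs_pos|apply Rabs_pos]. }
      apply Rmult_le_compat; auto using Rabs_pos; [apply Rmult_le_pos; apply Rabs_pos|].
      assert (S0 : 0 <= a x y ^ 2 + b x y ^ 2) by (generalize (pow2_ge_0 (a x y)) (pow2_ge_0 (b x y)); lra).
      rewrite (Rabs_pos_eq (e ^ 2)), (Rabs_pos_eq _ S0) by apply pow2_ge_0.
      assert (He3 : e ^ 2 <= / m ^ 3).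
      { unfold e. rewrite pow_inv. apply Rinv_le_contravar; [apply pow_lt; lra|].
        replace ((m * m) ^ 2) with (m ^ 3 * m) by ring. assert (0 < m ^ 3) by (apply pow_lt; lra). nra. }
      apply Rle_trans with (/ m ^ 3 * d); [|unfold D; lra].
      apply Rmult_le_compat; auto. apply pow2_ge_0.
Qed.

Lemma errors_small (j : nat) : 0 <= T -> exists K, 0 <= K /\ forall m, 1 <= m ->
  RInt (fun x => Rabs (cut_err1 U l a v (/ (m * m)) j x)) (- T) T <= K * / m /\
  RInt (fun x => Rabs (cut_err2 U l a b v (/ (m * m)) j x)) (- T) T <= K * / m.
Proof.
  intros HT. destruct (dom_fiber_int ps T (proj1 Hps) HT) as (K & HK & BK).
  destruct (bs_bound _ _ _ _ _ _ _ _ HS) as [HB _].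
  assert (HF : 0 <= freq j).
  { unfold freq. generalize PI_RGT_0 (pos_INR (Nat.div2 (S j))). intros. nra. }
  set (A := 24 * B + 24 * (B * freq j) + 60 * B).
  assert (HBF : 0 <= B * freq j) by (apply Rmult_le_pos; lra).
  assert (HA : 0 <= A) by (unfold A; lra).
  exists (A * (2 * K + 2 * T)). split; [apply Rmult_le_pos; lra|]. intros m Hm.
  assert (Hmm : 0 < m * m) by nra. assert (Him : 0 < / m) by (apply Rinv_0_lt_compat; lra).
  set (e := / (m * m)). assert (He : 0 < e) by (apply Rinv_0_lt_compat; exact Hmm).
  assert (Hi3 : 0 < / m ^ 3) by (apply Rinv_0_lt_compat, pow_lt; lra).
  set (rho := exp (- (m * m))). assert (Hr : 0 < rho) by apply exp_pos.
  assert (Cd : forall x, ex_RInt (fun y => dom ps rho x y) 0 1).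
  { intros x. apply ex_RInt_cont_all. intros t. apply dom_continuous; exact Hr. }
  assert (CC := cut_functions_continuous _ _ _ _ _ _ _ HC _ _ _ _ _ _ HS e He).
  set (DD := fun x => / m ^ 3 * dom_fiber ps rho x + / m).
  assert (Hint : forall (F : R -> R -> R) (g : R -> R) k G x, Rabs x <= T ->
    (forall x y, continuity_2d_pt F x y) -> (forall y, continuous g y) -> 0 <= k -> 0 <= G ->
    (forall y, Rabs (g y) <= G) ->
    (forall y, 0 <= y <= 1 -> Rabs (F x y) <= k * (/ m ^ 3 * dom ps rho x y + / m)) ->
    Rabs (RInt (fun y => F x y * g y) 0 1) <= k * G * DD x).
  { intros F g k G x Hx HF' Hg Hk HG HgG HFb.
    assert (C1 : ex_RInt (fun y => / m ^ 3 * dom ps rho x y + / m) 0 1).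
    { apply (ex_RInt_plus (V := R_NormedModule)); [apply ex_RInt_scalR, Cd | apply ex_RInt_const]. }
    apply Rle_trans with (RInt (fun y => k * G * (/ m ^ 3 * dom ps rho x y + / m)) 0 1).
    - apply RInt_abs_bound.
      + intros t. apply continuous_multR; [apply continuous_section_y, HF' | apply Hg].
      + apply ex_RInt_scalR, C1.
      + intros y Hy. rewrite Rabs_mult.
        replace (k * G * (/ m ^ 3 * dom ps rho x y + / m)) with (k * (/ m ^ 3 * dom ps rho x y + / m) * G) by ring.
        apply Rmult_le_compat; auto using Rabs_pos.
    - rewrite RInt_scalR by exact C1. apply Rmult_le_compat_l; [apply Rmult_le_pos; auto|].
      rewrite RInt_plusR, RInt_scalR, RInt_constR by (auto using ex_RInt_scalR; apply ex_RInt_const).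
      unfold DD. assert (I := dom_int_fiber ps rho x (proj1 Hps) Hr).
      assert (/ m ^ 3 * RInt (fun y => dom ps rho x y) 0 1 <= / m ^ 3 * dom_fiber ps rho x)
        by (apply Rmult_le_compat_l; lra).
      change (RInt (dom ps rho x) 0 1) with (RInt (fun y => dom ps rho x y) 0 1). lra. }
  assert (HDD : forall x, 0 <= DD x).
  { intros x. unfold DD. assert (0 <= / m ^ 3 * dom_fiber ps rho x); [|lra].
    apply Rmult_le_pos; [lra|]. apply dom_fiber_nonneg; [apply Hps|exact Hr]. }
  assert (Hpt := fun x y Hx Hy => error_pointwise m x y Hm Hx Hy). cbv zeta in Hpt.
  fold e in Hpt. fold rho in Hpt.
  assert (P1 : forall x, Rabs x <= T -> Rabs (cut_err1 U l a v e j x) <= A * DD x).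
  { intros x Hx. unfold cut_err1. rewrite Rabs_mult, (Rabs_pos_eq 2) by lra.
    assert (I1 := Hint (err_x U l a v e) (mode j) (6 * B) 2 x Hx
      (fun x y => proj1 (proj1 (proj2 (CC x y)))) (mode_continuous j) ltac:(lra) ltac:(lra)
      (fun y => proj1 (mode_bound j y)) (fun y Hy => proj1 (Hpt x y Hx Hy))).
    assert (0 <= (24 * (B * freq j) + 60 * B) * DD x) by (apply Rmult_le_pos; [lra|apply HDD]).
    unfold A. lra. }
  assert (P2 : forall x, Rabs x <= T -> Rabs (cut_err2 U l a b v e j x) <= A * DD x).
  { intros x Hx. unfold cut_err2. apply Rle_trans with (1 := Rabs_triang _ _).
    rewrite Rabs_mult, (Rabs_pos_eq 2) by lra.
    assert (I1 := Hint (err_y U l b v e) (mode' j) (6 * B) (2 * freq j) x Hx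
      (fun x y => proj1 (proj2 (proj1 (proj2 (CC x y))))) (mode'_continuous j) ltac:(lra) ltac:(lra)
      (fun y => proj2 (mode_bound j y)) (fun y Hy => proj1 (proj2 (Hpt x y Hx Hy)))).
    assert (I2 := Hint (err_lap U l a b v e) (mode j) (30 * B) 2 x Hx
      (fun x y => proj2 (proj2 (proj1 (proj2 (CC x y))))) (mode_continuous j) ltac:(lra) ltac:(lra)
      (fun y => proj1 (mode_bound j y)) (fun y Hy => proj2 (proj2 (Hpt x y Hx Hy)))).
    assert (0 <= (24 * B) * DD x) by (apply Rmult_le_pos; [lra|apply HDD]).
    unfold A. lra. }
  assert (CDD : ex_RInt DD (- T) T).
  { apply (ex_RInt_plus (V := R_NormedModule)); [|apply ex_RInt_const].
    apply ex_RInt_scalR, ex_RInt_cont_all. intros t. apply dom_fiber_continuous; exact Hr. }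
  assert (IDD : RInt DD (- T) T <= (2 * K + 2 * T) * / m).
  { unfold DD. rewrite RInt_plusR, RInt_scalR, RInt_constR.
    - specialize (BK (m * m) ltac:(lra)). fold rho in BK.
      assert (/ m ^ 3 * RInt (dom_fiber ps rho) (- T) T <= / m ^ 3 * (K * (1 + m * m)))
        by (apply Rmult_le_compat_l; lra).
      assert (/ m ^ 3 * (K * (1 + m * m)) <= 2 * K * / m).
      { apply Rmult_le_reg_l with (m ^ 3); [apply pow_lt; lra|].
        replace (m ^ 3 * (/ m ^ 3 * (K * (1 + m * m)))) with (K * (1 + m * m)) by (field; lra).
        replace (m ^ 3 * (2 * K * / m)) with (2 * K * (m * m)) by (field; lra).
        assert (1 <= m * m) by nra. nra. }
      lra.
    - apply ex_RInt_cont_all. intros t. apply dom_fiber_continuous; exact Hr.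
    - apply ex_RInt_scalR, ex_RInt_cont_all. intros t. apply dom_fiber_continuous; exact Hr.
    - apply ex_RInt_const. }
  assert (Hfin : forall E : R -> R, (forall x, continuous E x) -> (forall x, Rabs x <= T -> Rabs (E x) <= A * DD x) ->
    RInt (fun x => Rabs (E x)) (- T) T <= A * (2 * K + 2 * T) * / m).
  { intros E HE HEb. apply Rle_trans with (RInt (fun x => A * DD x) (- T) T).
    - apply RInt_le; [lra| |apply ex_RInt_scalR; exact CDD|].
      + apply ex_RInt_cont_all. intros t. apply (continuous_comp E Rabs); [apply HE|apply continuous_Rabs].
      + intros t Ht. apply HEb, Rabs_le; lra.
    - rewrite RInt_scalR by exact CDD. rewrite Rmult_assoc. apply Rmult_le_compat_l; auto. }
  assert (Cc := cut_coef_continuous _ _ _ _ _ _ _ HC _ _ _ _ _ _ HS e He j).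
  split; apply Hfin; auto; intros t; apply Cc.
Qed.

End ErrorBounds.

(** * Passage to the limit *)

Definition scale (n : nat) : R := INR (S n).
Definition cutoff (n : nat) : R := / (scale n * scale n).

Lemma scale_ge_1 (n : nat) : 1 <= scale n.
Proof. unfold scale. rewrite S_INR. generalize (pos_INR n); lra. Qed.

Lemma cutoff_pos (n : nat) : 0 < cutoff n <= / scale n.
Proof.
  assert (H := scale_ge_1 n). unfold cutoff. split; [apply Rinv_0_lt_compat; nra|].
  apply Rinv_le_contravar; nra.
Qed.

Lemma inv_scale_small (K eps : R) : 0 < eps -> exists N, forall n, (N <= n)%nat -> K * / scale n < eps.
Proof.
  intros He. destruct (INR_unbounded (Rabs K / eps)) as [N HN]. exists N. intros n Hn.
  assert (Hs := scale_ge_1 n). assert (HNn : INR N <= INR n) by (apply le_INR; exact Hn).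
  assert (Hlt : Rabs K / eps < scale n) by (unfold scale; rewrite S_INR; lra).
  assert (HK := Rle_abs K).
  apply Rmult_lt_reg_r with (scale n); [lra|]. rewrite Rmult_assoc, Rinv_l, Rmult_1_r by lra.
  apply Rle_lt_trans with (1 := HK).
  apply (Rmult_lt_compat_l eps) in Hlt; [|exact He].
  replace (eps * (Rabs K / eps)) with (Rabs K) in Hlt by (field; lra). exact Hlt.
Qed.

Lemma le_of_inv_scale (a K : R) : (forall n, a <= K * / scale n) -> a <= 0.
Proof.
  intros H. apply Rnot_lt_le; intros Ha. destruct (inv_scale_small K a Ha) as [N HN].
  specialize (HN N (Nat.le_refl N)). specialize (H N). lra.
Qed.

Lemma uniform_limit (Y : nat -> R -> R) :
  (forall T, exists K, 0 <= K /\ forall n k x, Rabs x <= T -> Rabs (Y n x - Y k x) <= K * (cutoff n + cutoff k)) ->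
  exists V, forall T, exists K, 0 <= K /\ forall n x, Rabs x <= T -> Rabs (Y n x - V x) <= K * / scale n.
Proof.
  intros H. exists (fun x => real (Lim_seq (fun n => Y n x))). intros T.
  destruct (H T) as (K & HK & B). exists K. split; [exact HK|]. intros n x Hx.
  assert (HB : forall n k, Rabs (Y n x - Y k x) <= K * / scale n + K * / scale k).
  { intros i k. apply Rle_trans with (1 := B i k x Hx).
    assert (H1 := cutoff_pos i). assert (H2 := cutoff_pos k).
    rewrite <- Rmult_plus_distr_l. apply Rmult_le_compat_l; lra. }
  assert (Hex : ex_finite_lim_seq (fun n => Y n x)).
  { apply ex_lim_seq_cauchy_corr. intros [eps He].
    destruct (inv_scale_small K (eps / 2) ltac:(lra)) as [N HN]. exists N. intros i k Hi Hk. simpl.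
    specialize (HB i k). assert (H1 := HN i Hi). assert (H2 := HN k Hk). lra. }
  destruct Hex as [V HV]. rewrite (is_lim_seq_unique _ _ HV). simpl.
  apply Rnot_lt_le; intros Hlt.
  set (d := (Rabs (Y n x - V) - K * / scale n) / 2).
  assert (Hd : 0 < d) by (unfold d; lra).
  apply is_lim_seq_spec in HV. destruct (HV (mkposreal d Hd)) as [N1 HN1]. simpl in HN1.
  destruct (inv_scale_small K d Hd) as [N2 HN2].
  set (k := max N1 N2).
  specialize (HN1 k (Nat.le_max_l _ _)). specialize (HN2 k (Nat.le_max_r _ _)). specialize (HB n k).
  assert (T1 : Rabs (Y n x - V) <= Rabs (Y n x - Y k x) + Rabs (Y k x - V)).
  { replace (Y n x - V) with ((Y n x - Y k x) + (Y k x - V)) by ring. apply Rabs_triang. }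
  unfold d in *. lra.
Qed.

Lemma uniform_limit_continuous (Y : nat -> R -> R) (V : R -> R) :
  (forall n x, continuous (Y n) x) ->
  (forall T, exists K, 0 <= K /\ forall n x, Rabs x <= T -> Rabs (Y n x - V x) <= K * / scale n) ->
  forall x, continuous V x.
Proof.
  intros HY HV x. apply continuous_eps. intros eps He.
  destruct (HV (Rabs x + 1)) as (K & HK & B).
  destruct (inv_scale_small K (eps / 4) ltac:(lra)) as [N HN]. specialize (HN N (Nat.le_refl N)).
  assert (HYc := HY N x). apply filterlim_locally with (eps := mkposreal (eps / 4) ltac:(lra)) in HYc.
  destruct HYc as [[d Hd] Hc].
  exists (Rmin d 1). split; [apply Rmin_pos; lra|]. intros y Hy.
  assert (M1 := Rmin_l d 1). assert (M2 := Rmin_r d 1).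
  assert (Hy1 : Rabs (Y N y - Y N x) < eps / 4).
  { apply (Hc y). apply Rlt_le_trans with (1 := Hy). exact M1. }
  assert (B1 := B N x ltac:(lra)).
  assert (Hyx : Rabs y <= Rabs x + 1).
  { replace y with (x + (y - x)) by ring. apply Rle_trans with (1 := Rabs_triang _ _). lra. }
  assert (B2 := B N y Hyx).
  apply Rabs_le_between in B1. apply Rabs_le_between in B2. apply Rabs_lt_between in Hy1.
  apply Rabs_lt_between. lra.
Qed.

Lemma is_derive_RInt_upper (g : R -> R) (x : R) : (forall t, continuous g t) ->
  is_derive (fun x => RInt g 0 x) x (g x).
Proof.
  intros Hg. apply (is_derive_RInt (V := R_NormedModule) g (fun x => RInt g 0 x) 0 x).
  - exists (mkposreal 1 Rlt_0_1). intros y _. apply (RInt_correct g), ex_RInt_cont_all, Hg.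
  - apply Hg.
Qed.

Lemma RInt_upper_bound (g : R -> R) (x T : R) : (forall t, continuous g t) -> Rabs x <= T ->
  Rabs (RInt g 0 x) <= RInt (fun t => Rabs (g t)) (- T) T.
Proof.
  intros Hg Hx. apply Rabs_le_between in Hx.
  assert (Ca : forall t, continuous (fun t => Rabs (g t)) t).
  { intros t. apply (continuous_comp g Rabs); [apply Hg|apply continuous_Rabs]. }
  assert (Cx : forall u w, ex_RInt (fun t => Rabs (g t)) u w) by (intros; apply ex_RInt_cont_all; auto).
  assert (P : forall u w, u <= w -> 0 <= RInt (fun t => Rabs (g t)) u w).
  { intros u w Huw. apply RInt_ge_0; auto. intros; apply Rabs_pos. }
  assert (Hle : forall u w, u <= w -> Rabs (RInt g u w) <= RInt (fun t => Rabs (g t)) u w).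
  { intros u w Huw. apply abs_RInt_le; [exact Huw|]. apply ex_RInt_cont_all; auto. }
  destruct (Rle_dec 0 x) as [H0|H0].
  - rewrite (RInt_ChaslesR _ (- T) 0 T), (RInt_ChaslesR _ 0 x T) by auto.
    generalize (Hle 0 x H0) (P (- T) 0 ltac:(lra)) (P x T ltac:(lra)). lra.
  - rewrite (RInt_swapR g x 0), Rabs_Ropp by (apply ex_RInt_cont_all; auto).
    rewrite (RInt_ChaslesR _ (- T) x T), (RInt_ChaslesR _ x 0 T) by auto.
    generalize (Hle x 0 ltac:(lra)) (P (- T) x ltac:(lra)) (P 0 T ltac:(lra)). lra.
Qed.

Lemma RInt_upper_const (g : R -> R) (x T M : R) : (forall t, continuous g t) -> Rabs x <= T ->
  (forall t, Rabs t <= T -> Rabs (g t) <= M) -> Rabs (RInt g 0 x) <= T * M.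
Proof.
  intros Hg Hx HM.
  assert (M0 : 0 <= M) by (apply Rle_trans with (2 := HM x Hx), Rabs_pos).
  apply Rle_trans with (Rabs (x - 0) * M).
  - apply (norm_RInt_le_const_abs (V := R_NormedModule) g 0 x).
    + intros t Ht. apply HM. apply Rabs_le. apply Rabs_le_between in Hx.
      revert Ht. unfold Rmin, Rmax. destruct (Rle_dec 0 x); lra.
    + apply (RInt_correct g), ex_RInt_cont_all, Hg.
  - rewrite Rminus_0_r. apply Rmult_le_compat_r; auto.
Qed.

(** Integrating the system twice, [Y] is up to small errors [Y 0 + Z 0 x] plus the
    double integral of [k Y - F]. The initial slopes [Z n 0] need not be known to
    converge: [V] minus its double integral is a limit of affine functions,
    hence affine. *)
Lemma perturbed_ode_limit (k : R) (Y Z F E1 E2 : nat -> R -> R) (V f : R -> R) :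
  (forall n x, is_derive (Y n) x (Z n x + E1 n x)) ->
  (forall n x, is_derive (Z n) x (k * Y n x - F n x - E2 n x)) ->
  (forall n x, continuous (Y n) x /\ continuous (F n) x /\ continuous (E1 n) x /\ continuous (E2 n) x) ->
  (forall T, exists K, 0 <= K /\ forall n x, Rabs x <= T -> Rabs (Y n x - V x) <= K * / scale n) ->
  (forall T, exists K, 0 <= K /\ forall n x, Rabs x <= T -> Rabs (F n x - f x) <= K * / scale n) ->
  (forall T, 0 <= T -> exists K, 0 <= K /\ forall n, RInt (fun x => Rabs (E1 n x)) (- T) T <= K * / scale n /\
     RInt (fun x => Rabs (E2 n x)) (- T) T <= K * / scale n) ->
  (forall x, continuous f x) /\
  exists V1, (forall x, is_derive V x (V1 x)) /\ (forall x, is_derive V1 x (k * V x - f x)).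
Proof.
  intros HY HZ HC HV Hf HE.
  assert (CY := fun n x => proj1 (HC n x)).
  assert (CF := fun n x => proj1 (proj2 (HC n x))).
  assert (CV := uniform_limit_continuous Y V CY HV).
  assert (Cf := uniform_limit_continuous F f CF Hf).
  split; [exact Cf|].
  set (h := fun s => k * V s - f s).
  assert (Ch : forall x, continuous h x).
  { intros x. apply (continuous_minus (V := R_NormedModule)); [|apply Cf].
    apply continuous_multR; [apply continuous_const|apply CV]. }
  set (G := fun x => RInt h 0 x).
  assert (DG : forall x, is_derive G x (h x)) by (intros; apply is_derive_RInt_upper; exact Ch).
  assert (CG : forall x, continuous G x) by (intros x; exact (continuous_of_derive _ _ _ (DG x))).
  set (H := fun x => RInt G 0 x).
  assert (DH : forall x, is_derive H x (G x)) by (intros; apply is_derive_RInt_upper; exact CG).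
  set (N := fun x => V x - V 0 - H x).
  (* N is a limit of linear functions *)
  assert (Hlin : forall T, 0 <= T -> exists K, 0 <= K /\ forall n x, Rabs x <= T ->
     Rabs (N x - Z n 0 * x) <= K * / scale n).
  { intros T HT. destruct (HV T) as (KV & HKV & BV). destruct (Hf T) as (Kf & HKf & Bf).
    destruct (HE T HT) as (KE & HKE & BE).
    set (Kg := Rabs k * KV + Kf). assert (HKg : 0 <= Kg).
    { unfold Kg. assert (0 <= Rabs k * KV) by (apply Rmult_le_pos; [apply Rabs_pos|exact HKV]). lra. }
    exists (2 * KV + KE + T * KE + T * (T * Kg)).
    assert (T2 : 0 <= T * (T * Kg)) by (repeat apply Rmult_le_pos; auto).
    assert (T3 : 0 <= T * KE) by (apply Rmult_le_pos; auto).
    split; [lra|]. intros n x Hx.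
    set (hn := fun s => k * Y n s - F n s).
    assert (Chn : forall x, continuous hn x).
    { intros t. apply (continuous_minus (V := R_NormedModule)); [|exact (CF n t)].
      apply continuous_multR; [apply continuous_const|exact (CY n t)]. }
    set (Gn := fun x => RInt hn 0 x).
    assert (DGn : forall x, is_derive Gn x (hn x)) by (intros; apply is_derive_RInt_upper; exact Chn).
    assert (CGn : forall x, continuous Gn x) by (intros t; exact (continuous_of_derive _ _ _ (DGn t))).
    assert (CE1 := fun x => proj1 (proj2 (proj2 (HC n x)))).
    assert (CE2 := fun x => proj2 (proj2 (proj2 (HC n x)))).
    assert (Zn : forall x, Z n x = Z n 0 + Gn x - RInt (E2 n) 0 x).
    { intros t. assert (E : RInt (fun s => hn s - E2 n s) 0 t = Z n t - Z n 0).
      { apply RInt_ftc; [intros s; apply HZ|].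
        intros s. apply (continuous_minus (V := R_NormedModule)); auto. }
      rewrite RInt_minusR in E by (apply ex_RInt_cont_all; auto). unfold Gn. lra. }
    set (r := fun x => RInt (E2 n) 0 x).
    assert (Cr : forall x, continuous r x).
    { intros t. exact (continuous_of_derive _ _ _ (is_derive_RInt_upper (E2 n) t CE2)). }
    assert (Yn : Y n x = Y n 0 + Z n 0 * x + RInt Gn 0 x + RInt (E1 n) 0 x - RInt r 0 x).
    { assert (E : RInt (fun s => Z n 0 + (Gn s + (E1 n s - r s))) 0 x = Y n x - Y n 0).
      { apply RInt_ftc.
        - intros s. apply is_derive_eq with (1 := HY n s). rewrite Zn. fold (r s). ring.
        - intros s. apply continuous_plusR; [apply continuous_const|].
          apply continuous_plusR; [apply CGn|]. apply (continuous_minus (V := R_NormedModule)); auto. }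
      assert (X1 : ex_RInt (fun s => E1 n s - r s) 0 x).
      { apply (ex_RInt_minus (V := R_NormedModule)); apply ex_RInt_cont_all; auto. }
      assert (X2 : ex_RInt (fun s => Gn s + (E1 n s - r s)) 0 x).
      { apply (ex_RInt_plus (V := R_NormedModule)); [apply ex_RInt_cont_all; auto|exact X1]. }
      rewrite RInt_plusR in E; [|apply ex_RInt_const|exact X2].
      rewrite RInt_plusR in E; [|apply ex_RInt_cont_all; auto|exact X1].
      rewrite RInt_minusR in E by (apply ex_RInt_cont_all; auto).
      rewrite RInt_constR in E. change (RInt (fun s => Gn s) 0 x) with (RInt Gn 0 x) in E.
      change (RInt (fun s => E1 n s) 0 x) with (RInt (E1 n) 0 x) in E.
      change (RInt (fun s => r s) 0 x) with (RInt r 0 x) in E. lra. }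
    assert (B1 : Rabs (RInt (E1 n) 0 x) <= KE * / scale n).
    { apply Rle_trans with (1 := RInt_upper_bound (E1 n) x T CE1 Hx). exact (proj1 (BE n)). }
    assert (B2 : Rabs (RInt r 0 x) <= T * (KE * / scale n)).
    { apply RInt_upper_const; auto. intros t Ht.
      apply Rle_trans with (1 := RInt_upper_bound (E2 n) t T CE2 Ht). exact (proj2 (BE n)). }
    assert (B3 : Rabs (RInt Gn 0 x - H x) <= T * (T * (Kg * / scale n))).
    { unfold H. rewrite <- RInt_minusR by (apply ex_RInt_cont_all; auto).
      apply RInt_upper_const; [|exact Hx|].
      - intros t. apply (continuous_minus (V := R_NormedModule)); auto.
      - intros t Ht. unfold Gn, G. rewrite <- RInt_minusR by (apply ex_RInt_cont_all; auto).
        apply RInt_upper_const; [|exact Ht|].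
        + intros s. apply (continuous_minus (V := R_NormedModule)); auto.
        + intros s Hs'. unfold hn, h.
          replace (k * Y n s - F n s - (k * V s - f s)) with (k * (Y n s - V s) + - (F n s - f s)) by ring.
          apply Rle_trans with (1 := Rabs_triang _ _). rewrite Rabs_mult, Rabs_Ropp.
          assert (b1 := BV n s Hs'). assert (b2 := Bf n s Hs'). unfold Kg.
          assert (Rabs k * Rabs (Y n s - V s) <= Rabs k * (KV * / scale n))
            by (apply Rmult_le_compat_l; [apply Rabs_pos|exact b1]). lra. }
    assert (B4 := BV n x Hx).
    assert (B5 := BV n 0 ltac:(rewrite Rabs_R0; exact HT)).
    unfold N.
    replace (V x - V 0 - H x - Z n 0 * x) with
      (- (Y n x - V x) + (Y n 0 - V 0) + (RInt Gn 0 x - H x) + RInt (E1 n) 0 x - RInt r 0 x)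
      by (rewrite Yn; ring).
    apply Rabs_le_between in B1. apply Rabs_le_between in B2. apply Rabs_le_between in B3.
    apply Rabs_le_between in B4. apply Rabs_le_between in B5.
    apply Rabs_le_between. lra. }
  assert (HN : forall x, N x = N 1 * x).
  { intros x. destruct (Hlin (Rabs x + 1)) as (K & HK & BK); [generalize (Rabs_pos x); lra|].
    assert (E : Rabs (N x - N 1 * x) <= 0).
    { apply le_of_inv_scale with (K * (1 + Rabs x)). intros n.
      assert (b1 := BK n x ltac:(lra)).
      assert (b2 := BK n 1 ltac:(rewrite Rabs_R1; generalize (Rabs_pos x); lra)).
      replace (N x - N 1 * x) with ((N x - Z n 0 * x) + - (x * (N 1 - Z n 0 * 1))) by ring.
      apply Rle_trans with (1 := Rabs_triang _ _). rewrite Rabs_Ropp, Rabs_mult.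
      assert (Rabs x * Rabs (N 1 - Z n 0 * 1) <= Rabs x * (K * / scale n))
        by (apply Rmult_le_compat_l; [apply Rabs_pos|exact b2]). lra. }
    assert (P := Rabs_pos (N x - N 1 * x)).
    assert (E0 : N x - N 1 * x = 0) by (apply Rabs_eq_0; lra). lra. }
  exists (fun x => N 1 + G x). split.
  - intros x. apply (is_derive_ext (fun x => V 0 + (N 1 * x + H x))).
    + intros t. assert (E := HN t). unfold N at 1 in E.
      change (V 0 + (N 1 * t + H t) = V t). lra.
    + apply is_derive_eq with (0 + (N 1 * 1 + G x)); [|ring].
      apply is_derive_plusR; [apply (is_derive_const (V := R_NormedModule))|].
      apply is_derive_plusR; [|apply DH].
      apply is_derive_scalR. apply (is_derive_id (K := R_AbsRing)).
  - intros x. apply is_derive_eq with (0 + h x); [|unfold h; ring].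
    apply is_derive_plusR; [apply (is_derive_const (V := R_NormedModule))|apply DG].
Qed.

(** The coefficient [V] of a bounded solution in the [j]-th mode is a function
    of class [C^2] on the whole line: no Dirac mass appears where a singularity
    is crossed, since a bounded solution has no logarithmic part there. *)
Lemma mode_equation (U : R -> R -> Prop) (l a b c q : R -> R -> R) (Q : R)
  (v vx vy vxx vyy : R -> R -> R) (B : R) (j : nat) :
  harmonic_cylinder U l a b c q Q -> bounded_solution U q v vx vy vxx vyy B ->
  exists V V1 f : R -> R,
    (forall x, is_derive V x (V1 x)) /\ (forall x, is_derive V1 x (freq j ^ 2 * V x - f x)) /\
    (forall x, continuous f x) /\
    (forall x, (forall y, U x y) ->
       V x = RInt (fun y => v x y * mode j y) 0 1 /\
       f x = RInt (fun y => q x y * v x y * mode j y) 0 1).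
Proof.
  intros HC HS.
  set (Y := fun n => cut_coef U l v (cutoff n) j).
  set (F := fun n => cut_source U l q v (cutoff n) j).
  destruct (bs_bound _ _ _ _ _ _ _ _ HS) as [HB Hvb].
  destruct (hc_q_bound _ _ _ _ _ _ _ HC) as [HQ Hqb].
  assert (Cv : forall x y, U x y -> continuity_2d_pt v x y) by (intros x y HU; apply (bs_cont _ _ _ _ _ _ _ _ HS x y HU)).
  assert (Cqv : forall x y, U x y -> continuity_2d_pt (fun x y => q x y * v x y) x y).
  { intros x y HU. apply continuity_2d_pt_mult; [|apply Cv; exact HU].
    apply (hc_cont _ _ _ _ _ _ _ HC x y HU). }
  assert (Bqv : forall x y, U x y -> Rabs (q x y * v x y) <= Q * B).
  { intros x y HU. rewrite Rabs_mult. apply Rmult_le_compat; auto using Rabs_pos. }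
  assert (HQB : 0 <= Q * B) by (apply Rmult_le_pos; auto).
  assert (LY : exists V, forall T, exists K, 0 <= K /\ forall n x, Rabs x <= T -> Rabs (Y n x - V x) <= K * / scale n).
  { apply uniform_limit. intros T. destruct (strip_cover _ _ _ _ _ _ _ T HC) as [ps Hps].
    destruct (cut_coef_close _ _ _ _ _ _ _ HC T ps Hps v B j Cv HB Hvb) as (K & HK & BK).
    exists K. split; [exact HK|]. intros n k x Hx.
    apply (BK x (cutoff n) Hx); apply cutoff_pos. }
  assert (LF : exists f, forall T, exists K, 0 <= K /\ forall n x, Rabs x <= T -> Rabs (F n x - f x) <= K * / scale n).
  { apply uniform_limit. intros T. destruct (strip_cover _ _ _ _ _ _ _ T HC) as [ps Hps].
    destruct (cut_coef_close _ _ _ _ _ _ _ HC T ps Hps (fun x y => q x y * v x y) (Q * B) j Cqv HQB Bqv) as (K & HK & BK).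
    exists K. split; [exact HK|]. intros n k x Hx.
    apply (BK x (cutoff n) Hx); apply cutoff_pos. }
  destruct LY as [V HV]. destruct LF as [f Hf].
  assert (Cc := fun n x => cut_coef_continuous _ _ _ _ _ _ _ HC _ _ _ _ _ _ HS (cutoff n) (proj1 (cutoff_pos n)) j x).
  destruct (perturbed_ode_limit (freq j ^ 2) Y
    (fun n => cut_coef_x U l a v vx (cutoff n) j) F
    (fun n => cut_err1 U l a v (cutoff n) j) (fun n => cut_err2 U l a b v (cutoff n) j) V f)
    as (Cf & V1 & D1 & D2).
  - intros n x. exact (cut_coef_derive _ _ _ _ _ _ _ HC _ _ _ _ _ _ HS (cutoff n) (proj1 (cutoff_pos n)) j x).
  - intros n x. exact (cut_coef_x_derive _ _ _ _ _ _ _ HC _ _ _ _ _ _ HS (cutoff n) (proj1 (cutoff_pos n)) j x).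
  - exact Cc.
  - exact HV.
  - exact Hf.
  - intros T HT. destruct (strip_cover _ _ _ _ _ _ _ T HC) as [ps Hps].
    destruct (errors_small _ _ _ _ _ _ _ HC T ps Hps _ _ _ _ _ _ HS j HT) as (K & HK & BK).
    exists K. split; [exact HK|]. intros n. exact (BK (scale n) (scale_ge_1 n)).
  - exists V, V1, f. split; [exact D1|]. split; [exact D2|]. split; [exact Cf|].
    intros x Hreg. destruct (strip_cover _ _ _ _ _ _ _ (Rabs x) HC) as [ps Hps].
    assert (Hlim : forall u w K1 K2 (W : nat -> R), 0 <= K2 ->
      (forall n, Rabs (W n - u) <= K1 * / scale n) ->
      (forall n, Rabs (W n - w) <= K2 * cutoff n) -> u = w).
    { intros u w K1 K2 W HK2 H1 H2. assert (E : Rabs (u - w) <= 0).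
      { apply le_of_inv_scale with (K1 + K2). intros n. specialize (H1 n). specialize (H2 n).
        assert (H3 := proj2 (cutoff_pos n)).
        assert (K2 * cutoff n <= K2 * / scale n) by (apply Rmult_le_compat_l; auto).
        replace (u - w) with (- (W n - u) + (W n - w)) by ring.
        apply Rle_trans with (1 := Rabs_triang _ _). rewrite Rabs_Ropp. lra. }
      assert (P := Rabs_pos (u - w)). assert (E0 : u - w = 0) by (apply Rabs_eq_0; lra). lra. }
    split.
    + destruct (HV (Rabs x)) as (K1 & HK1 & B1).
      destruct (cut_coef_close _ _ _ _ _ _ _ HC (Rabs x) ps Hps v B j Cv HB Hvb) as (K & HK & BK).
      apply (Hlim _ _ K1 K (fun n => Y n x) HK); intros n; [apply B1; lra|].
      apply (BK x (cutoff n)); [lra|apply cutoff_pos|exact Hreg].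
    + destruct (Hf (Rabs x)) as (K1 & HK1 & B1).
      destruct (cut_coef_close _ _ _ _ _ _ _ HC (Rabs x) ps Hps (fun x y => q x y * v x y) (Q * B) j Cqv HQB Bqv) as (K & HK & BK).
      apply (Hlim _ _ K1 K (fun n => F n x) HK); intros n; [apply B1; lra|].
      apply (BK x (cutoff n)); [lra|apply cutoff_pos|exact Hreg].
Qed.

Lemma avoid_list (xs : list R) (x0 : R) :
  exists d, 0 < d /\ forall x, 0 < Rabs (x - x0) < d -> ~ In x xs.
Proof.
  induction xs as [|x1 xs (d & Hd & IH)]; [exists 1; split; [lra|]; intros x _ []|].
  destruct (Req_dec x1 x0) as [->|Hne].
  - exists d. split; [exact Hd|]. intros x Hx [E|E]; [subst x; rewrite Rminus_diag, Rabs_R0 in Hx; lra|].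
    exact (IH x Hx E).
  - assert (P : 0 < Rabs (x1 - x0)) by (apply Rabs_pos_lt; lra).
    exists (Rmin d (Rabs (x1 - x0))). split; [apply Rmin_pos; lra|].
    assert (M1 := Rmin_l d (Rabs (x1 - x0))). assert (M2 := Rmin_r d (Rabs (x1 - x0))).
    intros x Hx [E|E]; [subst x; lra|]. apply (IH x); [lra|exact E].
Qed.

(** Only finitely many singularities lie over a bounded interval. *)
Lemma regular_circles (U : R -> R -> Prop) (l a b c q : R -> R -> R) (Q x0 : R) :
  harmonic_cylinder U l a b c q Q ->
  exists d, 0 < d /\ forall x, 0 < Rabs (x - x0) < d -> forall y, U x y.
Proof.
  intros HC. destruct (strip_cover _ _ _ _ _ _ _ (Rabs x0 + 1) HC) as [ps [_ Hps]].
  destruct (avoid_list (map (fun p => fst (fst p)) ps) x0) as (d & Hd & Hav).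
  exists (Rmin d 1). split; [apply Rmin_pos; lra|]. intros x Hx y.
  assert (M1 := Rmin_l d 1). assert (M2 := Rmin_r d 1).
  destruct (unit_representative y) as [n Hn].
  apply (periodic_Z_prop (fun t => U x t) (hc_periodic _ _ _ _ _ _ _ HC x) n y).
  destruct (Hps x (y + IZR n)) as (p & Hp & [H|[H _]] & _); [|lra|exact H|].
  - replace x with (x0 + (x - x0)) by ring. apply Rle_trans with (1 := Rabs_triang _ _). lra.
  - exfalso. apply (Hav x); [lra|]. apply in_map_iff. exists p. split; [symmetry; exact H|exact Hp].
Qed.

(** * Growth estimates for the high and the low modes *)

Definition ch (t : R) : R := (exp t + exp (- t)) / 2.
Definition sh (t : R) : R := (exp t - exp (- t)) / 2.

Lemma ch_bounds (t : R) : 1 <= ch t /\ Rabs t / 2 <= ch t /\ ch t <= exp (Rabs t) /\ exp (Rabs t) <= 2 * ch t.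
Proof.
  unfold ch. assert (P1 := exp_pos t). assert (P2 := exp_pos (- t)).
  assert (I1 := exp_ineq1_le t). assert (I2 := exp_ineq1_le (- t)).
  split; [nra|]. unfold Rabs. destruct (Rcase_abs t) as [H|H].
  - assert (L : exp t <= exp (- t)) by (apply Rlt_le, exp_increasing; lra).
    split; [lra|]. split; lra.
  - assert (L : exp (- t) <= exp t).
    { destruct H as [H| ->]; [apply Rlt_le, exp_increasing; lra|rewrite Ropp_0; lra]. }
    split; [lra|]. split; lra.
Qed.

Lemma ch_derive (mu x0 x : R) :
  is_derive (fun x => ch (mu * (x - x0))) x (mu * sh (mu * (x - x0))) /\
  is_derive (fun x => mu * sh (mu * (x - x0))) x (mu ^ 2 * ch (mu * (x - x0))).
Proof.
  unfold ch, sh. split; auto_derive; auto; replace (x + - x0) with (x - x0) by ring; field.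
Qed.

Lemma is_derive_sum (F dF : nat -> R -> R) (M : nat) (x : R) :
  (forall i, (i <= M)%nat -> is_derive (F i) x (dF i x)) ->
  is_derive (fun x => sum_f_R0 (fun i => F i x) M) x (sum_f_R0 (fun i => dF i x) M).
Proof.
  induction M as [|M IH]; intros H; cbn [sum_f_R0]; [apply H; lia|].
  apply is_derive_plusR; [apply IH; intros; apply H; lia|apply H; lia].
Qed.

(** The discriminant of [sum (k w_i - m u_i)^2 >= 0]. *)
Lemma cauchy_schwarz_sum (u w : nat -> R) (M : nat) : 0 < sum_f_R0 (fun i => u i ^ 2) M ->
  sum_f_R0 (fun i => u i * w i) M ^ 2 <=
  sum_f_R0 (fun i => u i ^ 2) M * sum_f_R0 (fun i => w i ^ 2) M.
Proof.
  set (A := sum_f_R0 (fun i => u i ^ 2) M). set (C := sum_f_R0 (fun i => u i * w i) M).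
  set (B := sum_f_R0 (fun i => w i ^ 2) M). intros HA.
  assert (E : forall k m, sum_f_R0 (fun i => (k * w i - m * u i) ^ 2) M = k ^ 2 * B - 2 * k * m * C + m ^ 2 * A).
  { intros k m. unfold A, B, C. clear. induction M; cbn [sum_f_R0]; [ring|]. rewrite IHM. ring. }
  assert (P : 0 <= sum_f_R0 (fun i => (A * w i - C * u i) ^ 2) M)
    by (apply cond_pos_sum; intros; apply pow2_ge_0).
  rewrite E in P. assert (P' : 0 <= A * (A * B - C ^ 2)) by lra.
  apply Rnot_lt_le; intros Hlt. assert (A * (A * B - C ^ 2) < 0); [|lra].
  assert (0 < A * (C ^ 2 - A * B)) by (apply Rmult_lt_0_compat; lra). lra.
Qed.

Lemma max_second_derivative (g g1 : R -> R) (x0 g2 : R) :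
  (forall x, is_derive g x (g1 x)) -> is_derive g1 x0 g2 -> (forall x, g x <= g x0) ->
  g1 x0 = 0 /\ g2 <= 0.
Proof.
  intros H1 H2 Hmax.
  assert (D : forall x, derivable_pt_lim g x (g1 x)) by (intros; apply is_derive_Reals, H1).
  assert (E : g1 x0 = 0).
  { change (g1 x0) with (derive_pt g x0 (exist _ (g1 x0) (D x0))).
    apply (deriv_maximum g (x0 - 1) (x0 + 1) x0); try lra. intros; apply Hmax. }
  split; [exact E|]. apply Rnot_lt_le; intros Hpos.
  apply is_derive_Reals in H2. destruct (H2 (g2 / 2) ltac:(lra)) as [[d Hd] B]. simpl in B.
  assert (Hinc : forall x, x0 < x < x0 + d -> 0 < g1 x).
  { intros x Hx. specialize (B (x - x0) ltac:(lra)). rewrite Rabs_pos_eq in B by lra.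
    specialize (B ltac:(lra)). replace (x0 + (x - x0)) with x in B by ring. rewrite E in B.
    apply Rabs_lt_between in B. assert (Q : g2 / 2 < (g1 x - 0) / (x - x0)) by lra.
    apply (Rmult_lt_compat_r (x - x0)) in Q; [|lra].
    replace ((g1 x - 0) / (x - x0) * (x - x0)) with (g1 x) in Q by (field; lra).
    assert (0 < g2 / 2 * (x - x0)) by (apply Rmult_lt_0_compat; lra). lra. }
  assert (MV : forall u w, u < w -> exists c, u <= c <= w /\ g w - g u = g1 c * (w - u)).
  { intros u w Huw. destruct (MVT_gen g u w g1) as (c & Hc & Ec).
    - intros; apply H1.
    - intros x _. apply derivable_continuous_pt. exists (g1 x). apply D.
    - rewrite Rmin_left, Rmax_right in Hc by lra. exists c. auto. }
  destruct (MV x0 (x0 + d / 4)) as (c & Hc & Ec); [lra|].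
  destruct (MV (x0 + d / 4) (x0 + d / 2)) as (c' & Hc' & Ec'); [lra|].
  assert (P2 := Hinc c' ltac:(lra)).
  assert (P3 : 0 <= g1 c).
  { destruct (Req_dec c x0) as [->|Hne]; [rewrite E; lra|]. apply Rlt_le, Hinc. lra. }
  assert (0 < g1 c' * (x0 + d / 2 - (x0 + d / 4))) by (apply Rmult_lt_0_compat; lra).
  assert (0 <= g1 c * (x0 + d / 4 - x0)) by (apply Rmult_le_pos; lra).
  generalize (Hmax (x0 + d / 2)). lra.
Qed.

(** Maximum principle: the ratio [sum V_i^2 / cosh^2] tends to zero at infinity, so
    it has a maximum, where the second derivative test gives
    [(La^2 - mu^2) |V| <= |f|]. Two uses of the Cauchy-Schwarz inequality replace
    the differentiation of [|V|]. *)
Lemma high_modes (M : nat) (V V1 f : nat -> R -> R) (lam : nat -> R) (La mu x0 S B : R) :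
  (forall i x, is_derive (V i) x (V1 i x)) ->
  (forall i x, is_derive (V1 i) x (lam i ^ 2 * V i x - f i x)) ->
  0 < mu < La -> 0 <= S -> (forall i, La <= lam i) ->
  (forall x, sum_f_R0 (fun i => V i x ^ 2) M <= B) ->
  (forall x, sum_f_R0 (fun i => f i x ^ 2) M <= (S * ch (mu * (x - x0))) ^ 2) ->
  forall x, sum_f_R0 (fun i => V i x ^ 2) M <= (S / (La ^ 2 - mu ^ 2) * ch (mu * (x - x0))) ^ 2.
Proof.
  intros HV HV1 Hmu HS Hlam HB Hf.
  set (w := fun x => ch (mu * (x - x0))). set (w1 := fun x => mu * sh (mu * (x - x0))).
  set (H := fun x => sum_f_R0 (fun i => V i x ^ 2) M).
  assert (Hw : forall x, 1 <= w x) by (intros x; apply ch_bounds).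
  assert (HH0 : forall x, 0 <= H x) by (intros; apply cond_pos_sum; intros; apply pow2_ge_0).
  set (G := La ^ 2 - mu ^ 2). assert (HG : 0 < G) by (unfold G; nra).
  intros x1. change (H x1 <= (S / G * w x1) ^ 2). apply Rnot_lt_le; intros Hbad.
  set (Rt := fun x => H x / w x ^ 2).
  assert (Hw2 : forall x, 0 < w x ^ 2) by (intros x; specialize (Hw x); apply pow_lt; lra).
  assert (HR1 : (S / G) ^ 2 < Rt x1).
  { unfold Rt. apply Rmult_lt_reg_r with (w x1 ^ 2); [apply Hw2|].
    unfold Rdiv at 2. rewrite Rmult_assoc, Rinv_l, Rmult_1_r by (apply Rgt_not_eq, Hw2).
    rewrite <- Rpow_mult_distr. exact Hbad. }
  assert (HR0 : 0 < Rt x1) by (apply Rle_lt_trans with (2 := HR1), pow2_ge_0).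
  assert (HB0 : 0 <= B) by (apply Rle_trans with (2 := HB x1), HH0).
  set (T := 2 * (B / Rt x1 + 1) / mu + Rabs (x1 - x0)).
  assert (HBR : 0 <= B / Rt x1) by (apply Rdiv_le_0_compat; auto).
  assert (HTp : 0 < 2 * (B / Rt x1 + 1) / mu) by (apply Rdiv_lt_0_compat; lra).
  assert (HT1 : Rabs (x1 - x0) <= T) by (unfold T; lra).
  assert (HT0 : 0 <= T) by (apply Rle_trans with (2 := HT1), Rabs_pos).
  assert (Dw : forall x, is_derive w x (w1 x)) by (intros; apply ch_derive).
  assert (DH : forall x, is_derive H x (sum_f_R0 (fun i => 2 * (V i x * V1 i x)) M)).
  { intros x. apply (is_derive_sum (fun i x => V i x ^ 2) (fun i x => 2 * (V i x * V1 i x))).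
    intros i _. apply (is_derive_ext (fun x => V i x * V i x)).
    - intros t. change (V i t * V i t = V i t ^ 2). ring.
    - apply is_derive_eq with (1 := is_derive_multR _ _ _ _ _ (HV i x) (HV i x)). ring. }
  assert (CR : forall x, continuous Rt x).
  { intros x. apply continuous_multR; [exact (continuous_of_derive _ _ _ (DH x))|].
    apply continuous_invR; [|apply Rgt_not_eq, Hw2].
    assert (Cw := continuous_of_derive _ _ _ (Dw x)).
    apply continuous_extR with (fun x => w x * w x); [intros; ring|]. apply continuous_multR; exact Cw. }
  (* T is so large that outside [x0 - T, x0 + T] the ratio is below its value at x1 *)
  destruct (continuity_ab_maj Rt (x0 - T) (x0 + T)) as (xs & Hmax & Hxs); [lra| |].
  { intros x _. apply continuity_pt_filterlim, CR. }
  assert (Hglob : forall x, Rt x <= Rt xs).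
  { intros x. apply Rabs_le_between in HT1.
    destruct (Rle_dec (Rabs (x - x0)) T) as [Hx|Hx].
    - apply Rabs_le_between in Hx. apply Hmax. lra.
    - apply Rle_trans with (Rt x1); [|apply Hmax; lra].
      apply Rmult_le_reg_r with (w x ^ 2); [apply Hw2|].
      unfold Rt at 1, Rdiv. rewrite Rmult_assoc, Rinv_l, Rmult_1_r by (apply Rgt_not_eq, Hw2).
      apply Rle_trans with (1 := HB x).
      assert (Hwx : B / Rt x1 + 1 <= w x).
      { apply Rle_trans with (Rabs (mu * (x - x0)) / 2); [|apply ch_bounds].
        rewrite Rabs_mult, (Rabs_pos_eq mu) by lra.
        assert (2 * (B / Rt x1 + 1) / mu < Rabs (x - x0)) by (unfold T in Hx; generalize (Rabs_pos (x1 - x0)); lra).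
        apply Rmult_le_reg_l with (2 / mu); [apply Rdiv_lt_0_compat; lra|].
        replace (2 / mu * (mu * Rabs (x - x0) / 2)) with (Rabs (x - x0)) by (field; lra).
        replace (2 / mu * (B / Rt x1 + 1)) with (2 * (B / Rt x1 + 1) / mu) by (field; lra). lra. }
      assert (Hw2x : B / Rt x1 <= w x ^ 2) by nra.
      apply (Rmult_le_compat_l (Rt x1)) in Hw2x; [|lra].
      replace (Rt x1 * (B / Rt x1)) with B in Hw2x by (field; lra). exact Hw2x. }
  set (Rs := Rt xs) in *.
  assert (HRs : (S / G) ^ 2 < Rs) by (apply Rlt_le_trans with (1 := HR1), Hglob).
  assert (HRs0 : 0 < Rs) by (apply Rle_lt_trans with (2 := HRs), pow2_ge_0).
  assert (HHs : H xs = Rs * w xs ^ 2).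
  { unfold Rs, Rt. field. apply Rgt_not_eq. specialize (Hw xs). lra. }
  set (g := fun x => H x - Rs * (w x * w x)).
  set (g1 := fun x => sum_f_R0 (fun i => 2 * (V i x * V1 i x)) M - Rs * (w1 x * w x + w x * w1 x)).
  set (g2 := sum_f_R0 (fun i => 2 * (V1 i xs * V1 i xs + V i xs * (lam i ^ 2 * V i xs - f i xs))) M
     - Rs * ((mu ^ 2 * w xs * w xs + w1 xs * w1 xs) + (w1 xs * w1 xs + w xs * (mu ^ 2 * w xs)))).
  assert (Dw1 : forall x, is_derive w1 x (mu ^ 2 * w x)) by (intros; apply ch_derive).
  destruct (max_second_derivative g g1 xs g2) as [E1 E2].
  { intros x. apply is_derive_minusR; [apply DH|]. apply is_derive_scalR.
    apply is_derive_multR; apply Dw. }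
  { apply is_derive_minusR.
    - apply (is_derive_sum (fun i x => 2 * (V i x * V1 i x))
        (fun i x => 2 * (V1 i x * V1 i x + V i x * (lam i ^ 2 * V i x - f i x)))).
      intros i _. apply is_derive_scalR. apply is_derive_multR; [apply HV|apply HV1].
    - apply is_derive_scalR. apply is_derive_plusR; apply is_derive_multR; auto. }
  { intros x. unfold g. replace (H xs - Rs * (w xs * w xs)) with 0 by (rewrite HHs; ring).
    assert (Hx := Hglob x). unfold Rt in Hx. apply (Rmult_le_compat_r (w x ^ 2)) in Hx; [|apply Rlt_le, Hw2].
    unfold Rdiv in Hx. rewrite Rmult_assoc, Rinv_l, Rmult_1_r in Hx by (apply Rgt_not_eq, Hw2).
    replace (w x * w x) with (w x ^ 2) by ring. lra. }
  set (sVV1 := sum_f_R0 (fun i => V i xs * V1 i xs) M).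
  set (sV1 := sum_f_R0 (fun i => V1 i xs ^ 2) M).
  set (sLV := sum_f_R0 (fun i => lam i ^ 2 * V i xs ^ 2) M).
  set (sVf := sum_f_R0 (fun i => V i xs * f i xs) M).
  assert (G1 : sVV1 = Rs * w xs * w1 xs).
  { unfold g1 in E1. replace (sum_f_R0 (fun i => 2 * (V i xs * V1 i xs)) M) with (2 * sVV1) in E1.
    - lra.
    - unfold sVV1. rewrite scal_sum. apply sum_eq. intros; ring. }
  assert (G2 : sV1 + sLV - sVf <= Rs * (w1 xs ^ 2 + mu ^ 2 * w xs ^ 2)).
  { unfold g2 in E2.
    replace (sum_f_R0 (fun i => 2 * (V1 i xs * V1 i xs + V i xs * (lam i ^ 2 * V i xs - f i xs))) M)
      with (2 * (sV1 + sLV - sVf)) in E2; [lra|].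
    unfold sV1, sLV, sVf. clear. induction M; cbn [sum_f_R0]; [ring|]. rewrite <- IHM. ring. }
  assert (HHpos : 0 < H xs) by (rewrite HHs; apply Rmult_lt_0_compat; auto).
  assert (CS1 := cauchy_schwarz_sum (fun i => V i xs) (fun i => V1 i xs) M HHpos). cbv beta in CS1.
  assert (CS2 := cauchy_schwarz_sum (fun i => V i xs) (fun i => f i xs) M HHpos). cbv beta in CS2.
  fold sVV1 sV1 (H xs) in CS1. fold sVf (H xs) in CS2.
  rewrite HHs in CS1, CS2.
  assert (HsLV : La ^ 2 * (Rs * w xs ^ 2) <= sLV).
  { rewrite <- HHs. unfold H, sLV. rewrite scal_sum. apply sum_Rle. intros i _.
    rewrite Rmult_comm. apply Rmult_le_compat_r; [apply pow2_ge_0|].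
    specialize (Hlam i). apply pow_incr. lra. }
  set (W := w xs) in *. set (W1 := w1 xs) in *.
  assert (HW : 1 <= W) by apply Hw.
  assert (K1 : Rs * W1 ^ 2 <= sV1).
  { apply Rmult_le_reg_l with (Rs * W ^ 2); [apply Rmult_lt_0_compat; [exact HRs0|apply pow_lt; lra]|].
    rewrite G1 in CS1. replace (Rs * W ^ 2 * (Rs * W1 ^ 2)) with ((Rs * W * W1) ^ 2) by ring. exact CS1. }
  assert (K2 : G * (Rs * W ^ 2) <= sVf) by (unfold G; lra).
  assert (K3 : sVf ^ 2 <= Rs * W ^ 2 * (S * W) ^ 2).
  { apply Rle_trans with (1 := CS2). apply Rmult_le_compat_l.
    - apply Rmult_le_pos; [lra|apply pow2_ge_0].
    - apply Hf. }
  assert (K4 : (G * (Rs * W ^ 2)) ^ 2 <= Rs * W ^ 2 * (S * W) ^ 2).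
  { apply Rle_trans with (2 := K3). apply pow_incr. split; [|exact K2].
    apply Rmult_le_pos; [lra|]. apply Rmult_le_pos; [lra|apply pow2_ge_0]. }
  assert (K5 : G ^ 2 * Rs <= S ^ 2).
  { apply Rmult_le_reg_l with (Rs * W ^ 4); [apply Rmult_lt_0_compat; [exact HRs0|apply pow_lt; lra]|].
    replace (Rs * W ^ 4 * (G ^ 2 * Rs)) with ((G * (Rs * W ^ 2)) ^ 2) by ring.
    replace (Rs * W ^ 4 * S ^ 2) with (Rs * W ^ 2 * (S * W) ^ 2) by ring. exact K4. }
  assert (K6 : G ^ 2 * (S / G) ^ 2 < S ^ 2).
  { apply Rlt_le_trans with (2 := K5). apply Rmult_lt_compat_l; [apply pow_lt; exact HG|exact HRs]. }
  replace (G ^ 2 * (S / G) ^ 2) with (S ^ 2) in K6 by (field; lra). lra.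
Qed.

(** The energy [sum V_i'^2 + m^2 V_i^2] satisfies
    [en' <= (m + mu) en + |f|^2 / (mu - m)], an inequality whose solutions with zero
    data grow at most like the source, that is like [exp(2 mu x)]. *)
Lemma low_modes_forward (M : nat) (V V1 f : nat -> R -> R) (lam : nat -> R) (m mu x0 S : R) :
  (forall i x, is_derive (V i) x (V1 i x)) ->
  (forall i x, is_derive (V1 i) x (lam i ^ 2 * V i x - f i x)) ->
  0 < m < mu -> (forall i, (i <= M)%nat -> 0 <= lam i <= m) ->
  (forall i, (i <= M)%nat -> V i x0 = 0 /\ V1 i x0 = 0) ->
  (forall x, sum_f_R0 (fun i => f i x ^ 2) M <= (S * ch (mu * (x - x0))) ^ 2) ->
  forall x, x0 <= x ->
    sum_f_R0 (fun i => V i x ^ 2) M <= (2 * S / (m * (mu - m)) * ch (mu * (x - x0))) ^ 2.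
Proof.
  intros HV HV1 Hm Hlam H0 Hf x Hx.
  set (k := mu - m). assert (Hk : 0 < k) by (unfold k; lra).
  set (en := fun x => sum_f_R0 (fun i => V1 i x ^ 2 + m ^ 2 * V i x ^ 2) M).
  set (en' := fun x => sum_f_R0 (fun i => 2 * (V1 i x * (lam i ^ 2 * V i x - f i x)) + m ^ 2 * (2 * (V i x * V1 i x))) M).
  assert (Den : forall x, is_derive en x (en' x)).
  { intros t. apply (is_derive_sum (fun i x => V1 i x ^ 2 + m ^ 2 * V i x ^ 2)
      (fun i x => 2 * (V1 i x * (lam i ^ 2 * V i x - f i x)) + m ^ 2 * (2 * (V i x * V1 i x)))).
    intros i _. apply (is_derive_ext (fun x => V1 i x * V1 i x + m ^ 2 * (V i x * V i x))).
    - intros s. change (V1 i s * V1 i s + m ^ 2 * (V i s * V i s) = V1 i s ^ 2 + m ^ 2 * V i s ^ 2). ring.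
    - apply is_derive_plusR.
      + apply is_derive_eq with (1 := is_derive_multR _ _ _ _ _ (HV1 i t) (HV1 i t)). ring.
      + apply is_derive_scalR. apply is_derive_eq with (1 := is_derive_multR _ _ _ _ _ (HV i t) (HV i t)). ring. }
  assert (Hen' : forall x, en' x <= (m + mu) * en x + / k * sum_f_R0 (fun i => f i x ^ 2) M).
  { intros t. unfold en', en. rewrite !scal_sum, <- sum_plus. apply sum_Rle. intros i Hi.
    destruct (Hlam i Hi) as [L1 L2].
    set (a := V i t). set (b := V1 i t). set (g := f i t).
    assert (Q1 : 2 * (lam i ^ 2 + m ^ 2) * (a * b) <= 2 * m * (m ^ 2 * a ^ 2 + b ^ 2)).
    { assert (Sq1 := pow2_ge_0 (m * a - b)). assert (Sq2 := pow2_ge_0 (m * a + b)).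
      assert (Hl2 : 0 <= lam i ^ 2 <= m ^ 2) by (split; [apply pow2_ge_0|apply pow_incr; lra]).
      apply Rmult_le_reg_l with m; [lra|].
      replace (m * (2 * (lam i ^ 2 + m ^ 2) * (a * b))) with ((lam i ^ 2 + m ^ 2) * (2 * (m * (a * b)))) by ring.
      replace (m * (2 * m * (m ^ 2 * a ^ 2 + b ^ 2))) with (2 * m ^ 2 * (m ^ 2 * a ^ 2 + b ^ 2)) by ring.
      apply Rle_trans with ((lam i ^ 2 + m ^ 2) * (m ^ 2 * a ^ 2 + b ^ 2)).
      - apply Rmult_le_compat_l; lra.
      - apply Rmult_le_compat_r; lra. }
    assert (Q2 : - 2 * (b * g) <= k * b ^ 2 + / k * g ^ 2).
    { assert (Sq := pow2_ge_0 (k * b + g)). apply Rmult_le_reg_l with k; [lra|].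
      replace (k * (k * b ^ 2 + / k * g ^ 2)) with (k ^ 2 * b ^ 2 + g ^ 2) by (field; lra). lra. }
    assert (Q3 : 0 <= k * (m ^ 2 * a ^ 2)).
    { apply Rmult_le_pos; [lra|]. apply Rmult_le_pos; apply pow2_ge_0. }
    unfold k in *. lra. }
  (* the integrating factor of the energy inequality, then its right side integrated:
     k is what remains of the rate 2 mu of the source *)
  set (y := fun x => en x * exp (- (m + mu) * (x - x0)) + - (S ^ 2 / k ^ 2) * exp (k * (x - x0))).
  assert (Dexp : forall r t, is_derive (fun t => exp (r * (t - x0))) t (r * exp (r * (t - x0)))).
  { intros r t. auto_derive; auto; unfold Rminus; ring. }
  assert (Dy : forall t, is_derive y t ((en' t * exp (- (m + mu) * (t - x0)) + en t * (- (m + mu) * exp (- (m + mu) * (t - x0))))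
       + - (S ^ 2 / k ^ 2) * (k * exp (k * (t - x0))))).
  { intros t. exact (is_derive_plusR _ _ _ _ _ (is_derive_multR _ _ _ _ _ (Den t) (Dexp (- (m + mu)) t))
      (is_derive_scalR _ (- (S ^ 2 / k ^ 2)) _ _ (Dexp k t))). }
  assert (Hy : y x <= y x0).
  { destruct (MVT_gen y x0 x (fun t => (en' t * exp (- (m + mu) * (t - x0)) + en t * (- (m + mu) * exp (- (m + mu) * (t - x0))))
       + - (S ^ 2 / k ^ 2) * (k * exp (k * (t - x0))))) as (c & Hc & Ec).
    - intros t _. apply Dy.
    - intros t _. apply continuity_pt_filterlim. exact (continuous_of_derive _ _ _ (Dy t)).
    - rewrite Rmin_left, Rmax_right in Hc by exact Hx.
      enough (en' c * exp (- (m + mu) * (c - x0)) + en c * (- (m + mu) * exp (- (m + mu) * (c - x0)))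
       + - (S ^ 2 / k ^ 2) * (k * exp (k * (c - x0))) <= 0) as Hneg.
      { assert (X : 0 <= x - x0) by lra.
        assert ((en' c * exp (- (m + mu) * (c - x0)) + en c * (- (m + mu) * exp (- (m + mu) * (c - x0)))
          + - (S ^ 2 / k ^ 2) * (k * exp (k * (c - x0)))) * (x - x0) <= 0) by nra. lra. }
      set (e1 := exp (- (m + mu) * (c - x0))). set (e2 := exp (k * (c - x0))).
      assert (P1 : 0 < e1) by apply exp_pos.
      assert (Hw : ch (mu * (c - x0)) ^ 2 * e1 <= e2).
      { assert (Hc2 : ch (mu * (c - x0)) <= exp (mu * (c - x0))).
        { replace (mu * (c - x0)) with (Rabs (mu * (c - x0))) at 2; [apply ch_bounds|].
          apply Rabs_pos_eq, Rmult_le_pos; lra. }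
        assert (Hc1 : 1 <= ch (mu * (c - x0))) by apply ch_bounds.
        replace e2 with (exp (mu * (c - x0)) ^ 2 * e1).
        - apply Rmult_le_compat_r; [lra|]. apply pow_incr. lra.
        - unfold e1, e2, k. replace (exp (mu * (c - x0)) ^ 2) with (exp (mu * (c - x0)) * exp (mu * (c - x0))) by ring.
          rewrite <- !exp_plus. f_equal. ring. }
      assert (X := Hen' c). assert (Y := Hf c).
      assert (Hik : 0 < / k) by (apply Rinv_0_lt_compat; exact Hk).
      assert (Z1 : en' c - (m + mu) * en c <= / k * (S ^ 2 * ch (mu * (c - x0)) ^ 2)).
      { assert (/ k * sum_f_R0 (fun i => f i c ^ 2) M <= / k * (S * ch (mu * (c - x0))) ^ 2)
          by (apply Rmult_le_compat_l; lra). rewrite Rpow_mult_distr in H. lra. }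
      apply (Rmult_le_compat_r e1) in Z1; [|lra].
      assert (Z2 : / k * S ^ 2 * (ch (mu * (c - x0)) ^ 2 * e1) <= / k * S ^ 2 * e2).
      { apply Rmult_le_compat_l; [apply Rmult_le_pos; [lra|apply pow2_ge_0]|exact Hw]. }
      replace (- (S ^ 2 / k ^ 2) * (k * e2)) with (- (/ k * S ^ 2 * e2)) by (field; lra). lra. }
  assert (Hy0 : y x0 <= 0).
  { unfold y. rewrite Rminus_diag, !Rmult_0_r, exp_0.
    assert (E0 : en x0 = 0).
    { unfold en. rewrite (sum_eq _ (fun _ => 0)).
      - clear. induction M; cbn [sum_f_R0]; lra.
      - intros i Hi. destruct (H0 i Hi) as [-> ->]. ring. }
    rewrite E0. assert (0 <= S ^ 2 / k ^ 2); [|lra].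
    apply Rdiv_le_0_compat; [apply pow2_ge_0|apply pow_lt; exact Hk]. }
  assert (Hen : en x <= (S ^ 2 / k ^ 2) * exp (mu * (x - x0)) ^ 2).
  { assert (Y : en x * exp (- (m + mu) * (x - x0)) <= S ^ 2 / k ^ 2 * exp (k * (x - x0))).
    { unfold y in Hy at 1. lra. }
    apply (Rmult_le_compat_r (exp ((m + mu) * (x - x0)))) in Y; [|apply Rlt_le, exp_pos].
    rewrite !Rmult_assoc, <- !exp_plus in Y.
    replace (- (m + mu) * (x - x0) + (m + mu) * (x - x0)) with 0 in Y by ring. rewrite exp_0, Rmult_1_r in Y.
    replace (k * (x - x0) + (m + mu) * (x - x0)) with (mu * (x - x0) + mu * (x - x0)) in Y by (unfold k; ring).
    rewrite exp_plus in Y. replace (exp (mu * (x - x0)) ^ 2) with (exp (mu * (x - x0)) * exp (mu * (x - x0))) by ring.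
    exact Y. }
  assert (Hew : exp (mu * (x - x0)) <= 2 * ch (mu * (x - x0))).
  { replace (mu * (x - x0)) with (Rabs (mu * (x - x0))) at 1; [apply ch_bounds|].
    apply Rabs_pos_eq, Rmult_le_pos; lra. }
  assert (Hsum : m ^ 2 * sum_f_R0 (fun i => V i x ^ 2) M <= en x).
  { unfold en. rewrite scal_sum. apply sum_Rle. intros i _. generalize (pow2_ge_0 (V1 i x)). lra. }
  apply Rmult_le_reg_l with (m ^ 2); [apply pow_lt; lra|].
  apply Rle_trans with (1 := Hsum). apply Rle_trans with (1 := Hen).
  apply Rle_trans with (S ^ 2 / k ^ 2 * (2 * ch (mu * (x - x0))) ^ 2).
  2:{ apply Req_le. unfold k. field. lra. }
  apply Rmult_le_compat_l.
  - apply Rdiv_le_0_compat; [apply pow2_ge_0|apply pow_lt; exact Hk].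
  - apply pow_incr. split; [apply Rlt_le, exp_pos|exact Hew].
Qed.

(** On the left of [x0], reflect. *)
Lemma low_modes (M : nat) (V V1 f : nat -> R -> R) (lam : nat -> R) (m mu x0 S : R) :
  (forall i x, is_derive (V i) x (V1 i x)) ->
  (forall i x, is_derive (V1 i) x (lam i ^ 2 * V i x - f i x)) ->
  0 < m < mu -> (forall i, (i <= M)%nat -> 0 <= lam i <= m) ->
  (forall i, (i <= M)%nat -> V i x0 = 0 /\ V1 i x0 = 0) ->
  (forall x, sum_f_R0 (fun i => f i x ^ 2) M <= (S * ch (mu * (x - x0))) ^ 2) ->
  forall x, sum_f_R0 (fun i => V i x ^ 2) M <= (2 * S / (m * (mu - m)) * ch (mu * (x - x0))) ^ 2.
Proof.
  intros HV HV1 Hm Hlam H0 Hf x.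
  destruct (Rle_dec x0 x) as [Hx|Hx].
  - apply (low_modes_forward M V V1 f lam m mu x0 S); auto.
  - assert (Hch : forall t, ch (mu * (2 * x0 - t - x0)) = ch (mu * (t - x0))).
    { intros t. unfold ch. replace (- (mu * (2 * x0 - t - x0))) with (mu * (t - x0)) by ring.
      replace (mu * (2 * x0 - t - x0)) with (- (mu * (t - x0))) by ring. rewrite Rplus_comm. reflexivity. }
    assert (Hrefl : forall (h : R -> R) (t d : R), is_derive h (2 * x0 - t) d -> is_derive (fun s => h (2 * x0 - s)) t (- d)).
    { intros h t d Hd. apply is_derive_eq with ((-1) * d); [|ring].
      apply (is_derive_comp h (fun s => 2 * x0 - s) t d (-1)); [exact Hd|]. auto_derive; auto; ring. }
    assert (L := low_modes_forward M (fun i t => V i (2 * x0 - t)) (fun i t => - V1 i (2 * x0 - t))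
      (fun i t => f i (2 * x0 - t)) lam m mu x0 S). cbv beta in L.
    specialize (L (fun i t => Hrefl (V i) t _ (HV i _))).
    assert (L2 : forall i t, is_derive (fun t => - V1 i (2 * x0 - t)) t (lam i ^ 2 * V i (2 * x0 - t) - f i (2 * x0 - t))).
    { intros i t. apply is_derive_eq with ((-1) * - (lam i ^ 2 * V i (2 * x0 - t) - f i (2 * x0 - t))); [|ring].
      apply (is_derive_ext (fun t => (-1) * V1 i (2 * x0 - t))).
      - intros s. change ((-1) * V1 i (2 * x0 - s) = - V1 i (2 * x0 - s)). ring.
      - apply is_derive_scalR, Hrefl, HV1. }
    specialize (L L2 Hm Hlam).
    replace (2 * x0 - x0) with x0 in L by ring.
    assert (L3 : forall i, (i <= M)%nat -> V i x0 = 0 /\ - V1 i x0 = 0).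
    { intros i Hi. destruct (H0 i Hi) as [E1 E2]. rewrite E1, E2. split; ring. }
    specialize (L L3).
    assert (L4 : forall t, sum_f_R0 (fun i => f i (2 * x0 - t) ^ 2) M <= (S * ch (mu * (t - x0))) ^ 2).
    { intros t. rewrite <- Hch. apply Hf. }
    specialize (L L4 (2 * x0 - x) ltac:(lra)).
    replace (2 * x0 - (2 * x0 - x)) with x in L by ring. rewrite Hch in L. exact L.
Qed.

(** * Unique continuation from finitely many Fourier data *)

(** The constant [1/3], rather than the optimal [2 / pi], is what the cubic Taylor
    bound and [PI <= 4] give. *)
Lemma sin_ge_third (t : R) : 0 <= t <= PI / 2 -> t / 3 <= sin t.
Proof.
  intros Ht. assert (P := PI_4).
  destruct (pre_sin_bound t 0) as [H _]; [lra|lra|].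
  apply Rle_trans with (2 := H).
  replace (sin_approx t (2 * 0 + 1)) with (t - t ^ 3 / 6).
  - assert (t ^ 2 <= 4) by nra. assert (0 <= t * (4 - t ^ 2)) by (apply Rmult_le_pos; lra). nra.
  - unfold sin_approx, sin_term. simpl. field.
Qed.

(** The chord [|sin(pi u)|] is comparable to the arc length [|u| <= 1/2], and the
    derivative is bounded by compactness. *)
Lemma periodic_lipschitz (f f1 : R -> R) :
  (forall y, f (y + 1) = f y) -> (forall y, is_derive f y (f1 y)) -> (forall y, continuous f1 y) ->
  exists A, 0 <= A /\ forall x y, 0 <= x <= 1 -> 0 <= y <= 1 ->
    Rabs (f x - f y) <= A * Rabs (sin (PI * (x - y))).
Proof.
  intros Hp Hd Hc.
  destruct (continuity_ab_maj (fun y => Rabs (f1 y)) 0 2) as (t0 & Ht0 & _); [lra| |].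
  { intros t _. apply continuity_pt_filterlim.
    exact (continuous_comp f1 Rabs t (Hc t) (continuous_Rabs _)). }
  set (A := Rabs (f1 t0)). assert (HA : 0 <= A) by apply Rabs_pos.
  exists A. split; [exact HA|].
  assert (L : forall u w, 0 <= u -> u <= w -> w <= 2 -> w - u <= / 2 ->
    Rabs (f w - f u) <= A * Rabs (sin (PI * (w - u)))).
  { intros u w H0 H1 H2 H3.
    destruct (MVT_gen f u w f1) as (s & Hs & Es).
    - intros; apply Hd.
    - intros t _. apply continuity_pt_filterlim. exact (continuous_of_derive _ _ _ (Hd t)).
    - rewrite Rmin_left, Rmax_right in Hs by exact H1.
      rewrite Es, Rabs_mult. apply Rmult_le_compat; try apply Rabs_pos.
      + apply Ht0. lra.
      + assert (P := PI_RGT_0). assert (P3 := PI2_3_2). rewrite Rabs_pos_eq by lra.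
        apply Rle_trans with (2 := Rle_abs _).
        apply Rle_trans with (PI * (w - u) / 3); [nra|]. apply sin_ge_third. nra. }
  assert (L2 : forall u w, 0 <= u -> u <= w -> w <= 1 ->
    Rabs (f w - f u) <= A * Rabs (sin (PI * (w - u)))).
  { intros u w H0 H1 H2. destruct (Rle_dec (w - u) (/ 2)) as [H3|H3]; [apply L; lra|].
    assert (E := L w (u + 1)). rewrite Hp, Rabs_minus_sym in E.
    replace (PI * (u + 1 - w)) with (PI - PI * (w - u)) in E by ring.
    rewrite sin_PI_x in E. apply E; lra. }
  intros x y Hx Hy. destruct (Rle_dec y x) as [H|H]; [apply L2; lra|].
  rewrite Rabs_minus_sym. replace (PI * (x - y)) with (- (PI * (y - x))) by ring.
  rewrite sin_neg, Rabs_Ropp. apply L2; lra.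
Qed.

Lemma RInt_sqr_zero (f : R -> R) : (forall t, continuous f t) -> RInt (fun t => f t ^ 2) 0 1 <= 0 ->
  forall t, 0 <= t <= 1 -> f t = 0.
Proof.
  intros Hf H0 t Ht. apply NNPP. intros Hne.
  assert (C2 : forall s, continuous (fun s => f s ^ 2) s).
  { intros s. apply continuous_extR with (fun s => f s * f s); [intros; ring|]. apply continuous_multR; auto. }
  assert (Hp : 0 < f t ^ 2) by (rewrite <- (pow2_abs); apply pow_lt, Rabs_pos_lt, Hne).
  destruct (proj1 (filterlim_locally _ _) (C2 t) (mkposreal (f t ^ 2 / 2) ltac:(simpl; lra))) as [[d Hd] Bd].
  simpl in Bd.
  assert (Low : forall s, Rabs (s - t) < d -> f t ^ 2 / 2 <= f s ^ 2).
  { intros s Hs. specialize (Bd s Hs). unfold ball in Bd. simpl in Bd.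
    unfold AbsRing_ball, abs, minus, plus, opp in Bd. simpl in Bd. apply Rabs_lt_between in Bd. simpl in *. lra. }
  set (s1 := Rmax 0 (t - d / 2)). set (s2 := Rmin 1 (t + d / 2)).
  assert (H1 : 0 <= s1 /\ t - d / 2 <= s1) by (split; [apply Rmax_l|apply Rmax_r]).
  assert (H2 : s2 <= 1 /\ s2 <= t + d / 2) by (split; [apply Rmin_l|apply Rmin_r]).
  assert (H3 : s1 < s2).
  { unfold s1, s2, Rmax, Rmin. destruct (Rle_dec 0 (t - d / 2)), (Rle_dec 1 (t + d / 2)); lra. }
  assert (Ex : forall u w, ex_RInt (fun s => f s ^ 2) u w) by (intros; apply ex_RInt_cont_all; auto).
  rewrite (RInt_ChaslesR _ 0 s1 1), (RInt_ChaslesR _ s1 s2 1) in H0 by apply Ex.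
  assert (I1 : 0 <= RInt (fun s => f s ^ 2) 0 s1) by (apply RInt_ge_0; [lra|apply Ex|intros; apply pow2_ge_0]).
  assert (I3 : 0 <= RInt (fun s => f s ^ 2) s2 1) by (apply RInt_ge_0; [lra|apply Ex|intros; apply pow2_ge_0]).
  assert (I2 : (s2 - s1) * (f t ^ 2 / 2) <= RInt (fun s => f s ^ 2) s1 s2).
  { rewrite <- RInt_constR. apply RInt_le; [lra|apply ex_RInt_cont_all; intros; apply continuous_const|apply Ex|].
    intros s Hs. apply Low. apply Rabs_def1; lra. }
  assert (0 < (s2 - s1) * (f t ^ 2 / 2)) by (apply Rmult_lt_0_compat; lra). lra.
Qed.

Lemma freq_low (N j : nat) : (j <= 2 * N)%nat -> 0 <= freq j <= 2 * PI * INR N.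
Proof.
  intros Hj. assert (P := PI_RGT_0). unfold freq.
  assert (H : (Nat.div2 (S j) <= N)%nat) by (rewrite Nat.div2_div; apply Nat.lt_succ_r, Nat.Div0.div_lt_upper_bound; lia).
  apply le_INR in H. assert (H0 := pos_INR (Nat.div2 (S j))). split.
  - apply Rmult_le_pos; lra.
  - apply Rmult_le_compat_l; lra.
Qed.

Lemma freq_high (N i : nat) : 2 * PI * (INR N + 1) <= freq (S (2 * N) + i).
Proof.
  assert (P := PI_RGT_0). unfold freq. rewrite <- S_INR. apply Rmult_le_compat_l; [lra|].
  apply le_INR. rewrite Nat.div2_div. apply Nat.div_le_lower_bound; lia.
Qed.

Section Uniqueness.

Variables (U : R -> R -> Prop) (l a b c q : R -> R -> R) (Q : R).
Hypothesis HC : harmonic_cylinder U l a b c q Q.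
Variables (v vx vy vxx vyy : R -> R -> R) (B : R).
Hypothesis HS : bounded_solution U q v vx vy vxx vyy B.

Definition regular_circle (x : R) : Prop := forall y, U x y.

(** The regular circles are dense. *)
Lemma le_of_regular (F G : R -> R) (x : R) : continuous F x -> continuous G x ->
  (forall t, regular_circle t -> F t <= G t) -> F x <= G x.
Proof.
  intros HF HG H. apply Rnot_lt_le. intros Hlt.
  set (e := (F x - G x) / 2). assert (He : 0 < e) by (unfold e; lra).
  destruct (proj1 (filterlim_locally _ _) HF (mkposreal e He)) as [[d1 Hd1] B1].
  destruct (proj1 (filterlim_locally _ _) HG (mkposreal e He)) as [[d2 Hd2] B2].
  destruct (regular_circles _ _ _ _ _ _ _ x HC) as (d3 & Hd3 & B3).
  simpl in B1, B2.
  set (d := Rmin d1 (Rmin d2 d3)).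
  assert (M1 := Rmin_l d1 (Rmin d2 d3)). assert (M2 := Rmin_r d1 (Rmin d2 d3)).
  assert (M3 := Rmin_l d2 d3). assert (M4 := Rmin_r d2 d3).
  assert (Hd : 0 < d) by (unfold d; repeat apply Rmin_pos; auto). fold d in M1, M2.
  assert (A : Rabs (x + d / 2 - x) = d / 2).
  { replace (x + d / 2 - x) with (d / 2) by ring. apply Rabs_pos_eq; lra. }
  specialize (B1 (x + d / 2)). specialize (B2 (x + d / 2)).
  unfold ball in B1, B2; simpl in B1, B2.
  unfold AbsRing_ball, abs, minus, plus, opp in B1, B2; simpl in B1, B2.
  change (x + d / 2 + - x) with (x + d / 2 - x) in B1, B2. rewrite A in B1, B2.
  specialize (B1 ltac:(lra)). specialize (B2 ltac:(lra)).
  apply Rabs_lt_between in B1, B2.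
  assert (K := H (x + d / 2) (B3 (x + d / 2) ltac:(rewrite A; lra))).
  unfold e in B1, B2. lra.
Qed.

Lemma v_fiber_continuous (x : R) : regular_circle x -> forall y, continuous (v x) y.
Proof.
  intros Hx y. apply (continuous_section_y v). apply (bs_cont _ _ _ _ _ _ _ _ HS x y (Hx y)).
Qed.

Lemma q_fiber_continuous (x : R) : regular_circle x -> forall y, continuous (q x) y.
Proof.
  intros Hx y. apply (continuous_section_y q). apply (hc_cont _ _ _ _ _ _ _ HC x y (Hx y)).
Qed.

Lemma sqr_continuous (f : R -> R) : (forall y, continuous f y) -> forall y, continuous (fun y => f y ^ 2) y.
Proof.
  intros Hf y. apply continuous_extR with (fun y => f y * f y); [intros; ring|]. apply continuous_multR; auto.
Qed.

Definition mass (x : R) : R := RInt (fun y => v x y ^ 2) 0 1.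

Lemma mass_le (x : R) : regular_circle x -> mass x <= B ^ 2.
Proof.
  intros Hx. destruct (bs_bound _ _ _ _ _ _ _ _ HS) as [HB Hb].
  replace (B ^ 2) with ((1 - 0) * B ^ 2) by ring. unfold mass. rewrite <- RInt_constR.
  apply RInt_le; [lra| | |].
  - apply ex_RInt_cont_all, sqr_continuous, v_fiber_continuous, Hx.
  - apply ex_RInt_cont_all. intros; apply continuous_const.
  - intros y _. rewrite <- pow2_abs. apply pow_incr. split; [apply Rabs_pos|apply Hb, Hx].
Qed.

Lemma source_mass_le (x : R) : regular_circle x ->
  RInt (fun y => (q x y * v x y) ^ 2) 0 1 <= Q ^ 2 * mass x.
Proof.
  intros Hx. destruct (hc_q_bound _ _ _ _ _ _ _ HC) as [HQ Hq].
  assert (Cv := sqr_continuous _ (v_fiber_continuous x Hx)).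
  unfold mass. rewrite <- RInt_scalR by (apply ex_RInt_cont_all; exact Cv).
  apply RInt_le; [lra| | |].
  - apply ex_RInt_cont_all. apply (sqr_continuous (fun y => q x y * v x y)). intros y.
    apply continuous_multR; [apply q_fiber_continuous, Hx|apply v_fiber_continuous, Hx].
  - apply ex_RInt_scalR, ex_RInt_cont_all; exact Cv.
  - intros y _. rewrite Rpow_mult_distr. apply Rmult_le_compat_r; [apply pow2_ge_0|].
    rewrite <- pow2_abs. apply pow_incr. split; [apply Rabs_pos|apply Hq, Hx].
Qed.

Variables V V1 f : nat -> R -> R.
Hypothesis HV : forall j x, is_derive (V j) x (V1 j x).
Hypothesis HV1 : forall j x, is_derive (V1 j) x (freq j ^ 2 * V j x - f j x).
Hypothesis Hf : forall j x, continuous (f j) x.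
Hypothesis HVc : forall j x, regular_circle x -> V j x = coef (v x) j.
Hypothesis Hfc : forall j x, regular_circle x -> f j x = coef (fun y => q x y * v x y) j.

Lemma V_continuous (j : nat) (x : R) : continuous (V j) x.
Proof. exact (continuous_of_derive _ _ _ (HV j x)). Qed.

Lemma coefs_bounded (M : nat) (x : R) : sum_f_R0 (fun j => V j x ^ 2) M <= B ^ 2.
Proof.
  apply (le_of_regular (fun x => sum_f_R0 (fun j => V j x ^ 2) M) (fun _ => B ^ 2)).
  - apply (continuous_sum (fun j x => V j x ^ 2)). intros j. apply sqr_continuous, V_continuous.
  - apply continuous_const.
  - intros t Ht. apply Rle_trans with (2 := mass_le t Ht).
    rewrite (sum_eq _ (fun j => coef (v t) j ^ 2)) by (intros; rewrite HVc by exact Ht; reflexivity).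
    apply bessel. apply v_fiber_continuous, Ht.
Qed.

Lemma sources_bounded (M : nat) (w : R -> R) (x : R) : (forall t, continuous w t) ->
  (forall t, regular_circle t -> mass t <= w t) ->
  sum_f_R0 (fun j => f j x ^ 2) M <= Q ^ 2 * w x.
Proof.
  intros Hw Hm.
  apply (le_of_regular (fun x => sum_f_R0 (fun j => f j x ^ 2) M) (fun x => Q ^ 2 * w x)).
  - apply (continuous_sum (fun j x => f j x ^ 2)). intros j. apply sqr_continuous, Hf.
  - apply continuous_multR; [apply continuous_const|apply Hw].
  - intros t Ht. apply Rle_trans with (Q ^ 2 * mass t).
    2:{ apply Rmult_le_compat_l; [apply pow2_ge_0|apply Hm, Ht]. }
    apply Rle_trans with (2 := source_mass_le t Ht).
    rewrite (sum_eq _ (fun j => coef (fun y => q t y * v t y) j ^ 2)) by (intros; rewrite Hfc by exact Ht; reflexivity).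
    apply (bessel (fun y => q t y * v t y)). intros y.
    apply continuous_multR; [apply q_fiber_continuous, Ht|apply v_fiber_continuous, Ht].
Qed.

(** Completeness of the modes, for the smooth restriction to a regular circle. *)
Lemma mass_le_of_coefs (x K : R) : regular_circle x ->
  (forall M, sum_f_R0 (fun j => V j x ^ 2) M <= K) -> mass x <= K.
Proof.
  intros Hx HK. apply le_epsilon. intros eps He.
  destruct (periodic_lipschitz (v x) (vy x)) as (A & HA & LA).
  - intros y. apply (bs_periodic _ _ _ _ _ _ _ _ HS x y (Hx y)).
  - intros y. apply (bs_derive _ _ _ _ _ _ _ _ HS x y (Hx y)).
  - intros y. apply (continuous_section_y vy). apply (bs_cont _ _ _ _ _ _ _ _ HS x y (Hx y)).
  - destruct (parseval (v x) A eps (v_fiber_continuous x Hx) LA HA He) as (M & HM).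
    apply Rle_trans with (1 := HM). apply Rplus_le_compat_r.
    rewrite <- (sum_eq (fun j => V j x ^ 2)); [apply HK|]. intros; rewrite HVc by exact Hx; reflexivity.
Qed.

Variables (N : nat) (x0 : R).
Hypothesis HN : Q <= INR N /\ 1 <= INR N.
Hypothesis Hzero : forall j, (j <= 2 * N)%nat -> V j x0 = 0 /\ V1 j x0 = 0.

Let m := 2 * PI * INR N.
Let mu := 2 * PI * (INR N + / 2).
Let La := 2 * PI * (INR N + 1).

(** The weight [cosh (mu (x - x0))] lies in the spectral gap between [m] and [La].
    There [m (mu - m) = 2 pi^2 N] and [La^2 - mu^2 = pi^2 (4 N + 3)] exceed [8 Q] and
    [4 Q], so that low and high modes contribute at most [(S / 4)^2] each. *)
Lemma contraction (S : R) : 0 <= S ->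
  (forall x, regular_circle x -> mass x <= (S * ch (mu * (x - x0))) ^ 2) ->
  forall x, regular_circle x -> mass x <= (S / 2 * ch (mu * (x - x0))) ^ 2.
Proof.
  intros HS0 Hm x Hx. assert (P := PI_RGT_0). assert (P3 := PI2_3_2).
  assert (HQ := proj1 (hc_q_bound _ _ _ _ _ _ _ HC)).
  assert (Cw : forall t, continuous (fun t => (S * ch (mu * (t - x0))) ^ 2) t).
  { apply sqr_continuous. intros t. apply continuous_multR; [apply continuous_const|].
    exact (continuous_of_derive _ _ _ (proj1 (ch_derive mu x0 t))). }
  assert (Hsrc : forall M t, sum_f_R0 (fun j => f j t ^ 2) M <= (Q * S * ch (mu * (t - x0))) ^ 2).
  { intros M t. apply Rle_trans with (1 := sources_bounded M _ t Cw Hm). apply Req_le. ring. }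
  assert (Hlow : sum_f_R0 (fun j => V j x ^ 2) (2 * N) <= (2 * (Q * S) / (m * (mu - m)) * ch (mu * (x - x0))) ^ 2).
  { apply (low_modes (2 * N) V V1 f freq m mu x0 (Q * S)); auto.
    - unfold m, mu. nra.
    - intros i Hi. apply freq_low, Hi. }
  assert (Hhigh : forall M, sum_f_R0 (fun i => V (Datatypes.S (2 * N) + i)%nat x ^ 2) M <=
     (Q * S / (La ^ 2 - mu ^ 2) * ch (mu * (x - x0))) ^ 2).
  { assert (Hcut : forall (g : nat -> R -> R) M t,
      sum_f_R0 (fun i => g (Datatypes.S (2 * N) + i)%nat t ^ 2) M <= sum_f_R0 (fun j => g j t ^ 2) (2 * N + Datatypes.S M)).
    { intros g M t. rewrite (tech2 (fun j => g j t ^ 2) (2 * N)) by lia.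
      replace (2 * N + Datatypes.S M - Datatypes.S (2 * N))%nat with M by lia.
      assert (0 <= sum_f_R0 (fun j => g j t ^ 2) (2 * N)); [|lra].
      apply cond_pos_sum. intros; apply pow2_ge_0. }
    intros M. apply (high_modes M (fun i => V (Datatypes.S (2 * N) + i)%nat)
      (fun i => V1 (Datatypes.S (2 * N) + i)%nat) (fun i => f (Datatypes.S (2 * N) + i)%nat)
      (fun i => freq (Datatypes.S (2 * N) + i)%nat) La mu x0 (Q * S) (B ^ 2)).
    - intros; apply HV.
    - intros; apply HV1.
    - unfold La, mu. nra.
    - apply Rmult_le_pos; auto.
    - intros i. apply freq_high.
    - intros t. apply Rle_trans with (1 := Hcut V M t). apply coefs_bounded.
    - intros t. apply Rle_trans with (1 := Hcut f M t). apply Hsrc. }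
  apply mass_le_of_coefs; [exact Hx|]. intros M.
  set (w := ch (mu * (x - x0))) in *. assert (Hw : 0 <= w ^ 2) by apply pow2_ge_0.
  apply Rle_trans with (sum_f_R0 (fun j => V j x ^ 2) (2 * N + Datatypes.S M)).
  { destruct (Nat.lt_ge_cases M (2 * N + Datatypes.S M)) as [H|H]; [|lia].
    rewrite (tech2 (fun j => V j x ^ 2) M _ H).
    assert (0 <= sum_f_R0 (fun i => V (Datatypes.S M + i)%nat x ^ 2) (2 * N + Datatypes.S M - Datatypes.S M)); [|lra].
    apply cond_pos_sum. intros; apply pow2_ge_0. }
  rewrite (tech2 (fun j => V j x ^ 2) (2 * N)) by lia.
  replace (2 * N + Datatypes.S M - Datatypes.S (2 * N))%nat with M by lia.
  specialize (Hhigh M).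
  apply Rle_trans with (1 := Rplus_le_compat _ _ _ _ Hlow Hhigh).
  assert (Small : forall k G, 0 <= k -> 4 * k * INR N <= G -> 0 < G ->
     (k * (Q * S) / G * w) ^ 2 <= (S / 4 * w) ^ 2).
  { intros k G Hk HG HG0. rewrite !(Rpow_mult_distr _ w). apply Rmult_le_compat_r; [exact Hw|].
    apply pow_incr. split.
    - apply Rmult_le_pos; [apply Rmult_le_pos; [exact Hk|apply Rmult_le_pos; auto]|apply Rlt_le, Rinv_0_lt_compat, HG0].
    - apply Rmult_le_reg_r with G; [exact HG0|].
      replace (k * (Q * S) / G * G) with (k * Q * S) by (field; lra).
      replace (S / 4 * G) with (G / 4 * S) by field. apply Rmult_le_compat_r; [exact HS0|].
      apply Rle_trans with (k * INR N); [|lra]. apply Rmult_le_compat_l; [exact Hk|apply HN]. }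
  assert (K1 := Small 2 (m * (mu - m))). assert (K2 := Small 1 (La ^ 2 - mu ^ 2)).
  replace (m * (mu - m)) with (2 * (PI * PI) * INR N) in * by (unfold m, mu; field).
  replace (La ^ 2 - mu ^ 2) with (PI * PI * (4 * INR N + 3)) in * by (unfold La, mu; field).
  assert (PP : 9 <= PI * PI) by nra.
  assert (K1' := K1 ltac:(lra) ltac:(nra) ltac:(nra)).
  assert (K2' := K2 ltac:(lra) ltac:(nra) ltac:(nra)).
  rewrite Rmult_1_l in K2'.
  assert (0 <= (S * w) ^ 2) by apply pow2_ge_0.
  replace ((S / 4 * w) ^ 2) with ((S * w) ^ 2 / 16) in * by field.
  replace ((S / 2 * w) ^ 2) with ((S * w) ^ 2 / 4) by field. lra.
Qed.

(** Iterating the contraction from the bound [B] of the solution. *)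
Lemma mass_zero (x : R) : regular_circle x -> mass x <= 0.
Proof.
  intros Hx. destruct (bs_bound _ _ _ _ _ _ _ _ HS) as [HB _].
  assert (It : forall k x, regular_circle x -> mass x <= (B / 2 ^ k * ch (mu * (x - x0))) ^ 2).
  { induction k as [|k IH]; intros t Ht.
    - apply Rle_trans with (1 := mass_le t Ht). rewrite Rpow_mult_distr. simpl (2 ^ 0). rewrite Rdiv_1_r.
      assert (C := proj1 (ch_bounds (mu * (t - x0)))).
      assert (1 <= ch (mu * (t - x0)) ^ 2) by (rewrite <- (pow1 2); apply pow_incr; lra).
      assert (0 <= B ^ 2) by apply pow2_ge_0. nra.
    - replace (B / 2 ^ Datatypes.S k) with (B / 2 ^ k / 2) by (simpl; field; apply pow_nonzero; lra).
      apply contraction; [|exact IH|exact Ht].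
      apply Rdiv_le_0_compat; [exact HB|apply pow_lt; lra]. }
  apply Rnot_lt_le. intros Hpos.
  set (w := ch (mu * (x - x0))). assert (Hw : 1 <= w) by apply ch_bounds.
  destruct (Pow_x_infinity 2 ltac:(rewrite Rabs_pos_eq; lra) (((B * w) ^ 2 + 1) / mass x + 1)) as (k & Hk).
  specialize (Hk k (le_n k)). rewrite Rabs_pos_eq in Hk by (apply pow_le; lra).
  assert (E := It k x Hx). fold w in E.
  assert (P2 : 1 <= 2 ^ k) by (apply pow_R1_Rle; lra).
  replace ((B / 2 ^ k * w) ^ 2) with ((B * w) ^ 2 / (2 ^ k * 2 ^ k)) in E by (field; lra).
  apply (Rmult_le_compat_r (2 ^ k * 2 ^ k)) in E; [|nra].
  replace ((B * w) ^ 2 / (2 ^ k * 2 ^ k) * (2 ^ k * 2 ^ k)) with ((B * w) ^ 2) in E by (field; lra).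
  assert (H : ((B * w) ^ 2 + 1) / mass x <= 2 ^ k) by lra.
  apply (Rmult_le_compat_r (mass x)) in H; [|lra].
  replace (((B * w) ^ 2 + 1) / mass x * mass x) with ((B * w) ^ 2 + 1) in H by (field; lra).
  assert (mass x * 2 ^ k <= mass x * (2 ^ k * 2 ^ k)) by (apply Rmult_le_compat_l; nra). lra.
Qed.

Lemma solution_zero (x y : R) : U x y -> v x y = 0.
Proof.
  intros HU.
  assert (Hreg : forall x y, regular_circle x -> v x y = 0).
  { intros t s Ht. destruct (unit_representative s) as [n Hn].
    rewrite <- (periodic_Z (v t)) with (n := n).
    - apply (RInt_sqr_zero (v t)); [apply v_fiber_continuous, Ht|exact (mass_zero t Ht)|lra].
    - intros r. apply (bs_periodic _ _ _ _ _ _ _ _ HS t r (Ht r)). }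
  assert (Hx : continuous (fun t => v t y) x).
  { destruct (bs_derive _ _ _ _ _ _ _ _ HS x y HU) as (D & _). exact (continuous_of_derive _ _ _ D). }
  apply Rle_antisym.
  - apply (le_of_regular (fun t => v t y) (fun _ => 0)); [exact Hx|apply continuous_const|].
    intros t Ht. rewrite Hreg by exact Ht. lra.
  - apply (le_of_regular (fun _ => 0) (fun t => v t y)); [apply continuous_const|exact Hx|].
    intros t Ht. rewrite Hreg by exact Ht. lra.
Qed.

End Uniqueness.

(** The data are the Fourier coefficients on one circle and their derivatives in
    [x]; a neighbourhood of regular circles makes the latter linear in [v]. *)
Lemma finitely_determined (U : R -> R -> Prop) (l a b c q : R -> R -> R) (Q : R) :
  harmonic_cylinder U l a b c q Q ->
  exists (x0 d : R) (n : nat), 0 < d /\ (forall x, Rabs (x - x0) < d -> forall y, U x y) /\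
    forall v vx vy vxx vyy B, bounded_solution U q v vx vy vxx vyy B ->
      (forall j, ex_derive (fun x => coef (v x) j) x0) /\
      ((forall j, (j <= n)%nat -> coef (v x0) j = 0 /\ Derive (fun x => coef (v x) j) x0 = 0) ->
       forall x y, U x y -> v x y = 0).
Proof.
  intros HC. destruct (regular_circles _ _ _ _ _ _ _ 0 HC) as (d0 & Hd0 & Hreg).
  (* all circles over (0, d0) are regular, and x0 is the middle of that interval *)
  set (x0 := d0 / 2). set (d := d0 / 2). assert (Hd : 0 < d) by (unfold d; lra).
  assert (Hcirc : forall x, Rabs (x - x0) < d -> forall y, U x y).
  { intros x Hx y. apply Hreg. rewrite Rminus_0_r. unfold x0, d in Hx. apply Rabs_lt_between in Hx.
    rewrite Rabs_pos_eq by lra. lra. }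
  destruct (nfloor_ex (Rabs Q)) as (k & Hk1 & Hk2); [apply Rabs_pos|].
  set (N := S k).
  assert (HN : Q <= INR N /\ 1 <= INR N).
  { unfold N. rewrite S_INR. assert (A := Rle_abs Q). assert (A' := Rabs_pos Q). assert (0 <= INR k) by apply pos_INR. lra. }
  exists x0, d, (2 * N)%nat. split; [exact Hd|]. split; [exact Hcirc|].
  intros v vx vy vxx vyy B HS.
  assert (Hch : forall j, {V : R -> R & {V1 : R -> R & {f : R -> R |
    (forall x, is_derive V x (V1 x)) /\ (forall x, is_derive V1 x (freq j ^ 2 * V x - f x)) /\
    (forall x, continuous f x) /\
    (forall x, (forall y, U x y) ->
       V x = RInt (fun y => v x y * mode j y) 0 1 /\
       f x = RInt (fun y => q x y * v x y * mode j y) 0 1)}}}).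
  { intros j. assert (E := mode_equation _ _ _ _ _ _ _ _ _ _ _ _ _ j HC HS).
    apply constructive_indefinite_description in E. destruct E as [V E]. exists V.
    apply constructive_indefinite_description in E. destruct E as [V1 E]. exists V1.
    apply constructive_indefinite_description in E. destruct E as [f E]. exists f. exact E. }
  set (V := fun j => projT1 (Hch j)). set (V1 := fun j => projT1 (projT2 (Hch j))).
  set (f := fun j => proj1_sig (projT2 (projT2 (Hch j)))).
  assert (HV := fun j => proj2_sig (projT2 (projT2 (Hch j)))). cbv beta in HV.
  fold V V1 f in HV.
  assert (Hder : forall j, is_derive (fun x => coef (v x) j) x0 (V1 j x0)).
  { intros j. destruct (HV j) as (D & _ & _ & E).
    apply (is_derive_ext_near (V j) _ x0 (V1 j x0) d Hd); [|apply D].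
    intros t Ht. apply (proj1 (E t (Hcirc t Ht))). }
  split.
  - intros j. exists (V1 j x0). apply Hder.
  - intros H0 x y HU.
    refine (solution_zero U l a b c q Q HC v vx vy vxx vyy B HS V V1 f _ _ _ _ _ N x0 HN _ x y HU).
    + intros j t. apply (HV j).
    + intros j t. destruct (HV j) as (_ & D & _). apply D.
    + intros j t. destruct (HV j) as (_ & _ & D & _). apply D.
    + intros j t Ht. destruct (HV j) as (_ & _ & _ & D). apply (proj1 (D t Ht)).
    + intros j t Ht. destruct (HV j) as (_ & _ & _ & D). apply (proj2 (D t Ht)).
    + intros j Hj. destruct (H0 j Hj) as [E1 E2]. destruct (HV j) as (_ & _ & _ & D). split.
      * exact (eq_trans (proj1 (D x0 (Hcirc x0 ltac:(rewrite Rminus_diag, Rabs_R0; exact Hd)))) E1).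
      * rewrite <- E2. symmetry. apply is_derive_unique, Hder.
Qed.

Definition closed_under_combination (S : (C -> R) -> Prop) : Prop :=
  forall u w k, S u -> S w -> S (fun z => u z + k * w z).

(** Induction on the number of functionals: either the last one vanishes on [S],
    or it is nonzero at some [w] and [S] is spanned by [w] and its kernel. *)
Lemma finite_dimensional_of_functionals (U : C -> Prop) (n : nat) :
  forall (S : (C -> R) -> Prop) (L : nat -> (C -> R) -> R),
  closed_under_combination S ->
  (forall i u w k, S u -> S w -> L i (fun z => u z + k * w z) = L i u + k * L i w) ->
  (forall u, S u -> (forall i, (i < n)%nat -> L i u = 0) -> forall z, U z -> u z = 0) ->
  finite_dimensional U S.
Proof.
  induction n as [|n IH]; intros S L HS HL Hsep.
  - exists 0%nat, (fun _ _ => 0). split; [intros; lia|]. intros u Hu. exists (fun _ => 0).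
    intros z Hz. simpl. apply (Hsep u Hu); [lia|exact Hz].
  - destruct (classic (exists w, S w /\ L n w <> 0)) as [(w & Hw & Hne)|Hall].
    + destruct (IH (fun u => S u /\ L n u = 0) L) as (r & e & He & Hspan).
      * intros u u' k [Hu E] [Hu' E']. split; [apply HS; assumption|].
        rewrite HL by assumption. rewrite E, E'. ring.
      * intros i u u' k [Hu _] [Hu' _]. apply HL; assumption.
      * intros u [Hu E] Hz. apply Hsep; [exact Hu|]. intros i Hi.
        destruct (Nat.eq_dec i n) as [->|Hin]; [exact E|apply Hz; lia].
      * exists (Datatypes.S r), (fun k => if Nat.eq_dec k r then w else e k). split.
        -- intros k Hk. destruct (Nat.eq_dec k r); [exact Hw|apply He; lia].
        -- intros u Hu. set (t := L n u / L n w).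
           destruct (Hspan (fun z => u z + - t * w z)) as [a Ha].
           { split; [apply HS; assumption|]. rewrite HL by assumption. unfold t. field. exact Hne. }
           exists (fun k => if Nat.eq_dec k r then t else a k). intros z Hz.
           specialize (Ha z Hz). rewrite seq_S, map_app, fold_right_app. simpl.
           destruct (Nat.eq_dec r r) as [_|]; [|congruence].
           assert (Efold : forall xs s, fold_right Rplus s xs = fold_right Rplus 0 xs + s).
           { induction xs as [|x xs IHx]; intros s; simpl; [ring|]. rewrite IHx. ring. }
           rewrite Efold. rewrite (map_ext_in _ (fun k => a k * e k z)).
           ++ rewrite <- Ha. ring.
           ++ intros k Hk. apply in_seq in Hk. destruct (Nat.eq_dec k r); [lia|reflexivity].
    + apply (IH S L HS HL). intros u Hu Hz. apply Hsep; [exact Hu|]. intros i Hi.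
      destruct (Nat.eq_dec i n) as [->|Hin]; [|apply Hz; lia].
      apply NNPP. intros Hne. apply Hall. exists u. auto.
Qed.

(** * Bounded Jacobi functions *)

Lemma regular_periodic (g : C -> sphere) (x y : R) : meromorphic_cyl g ->
  (regular g (x, y + 1) <-> regular g (x, y)).
Proof.
  intros (Hp & _). unfold regular, zero_or_pole.
  replace (x, y + 1) with ((x, y) + Ci)%C by (apply injective_projections; simpl; ring).
  rewrite Hp. tauto.
Qed.

Lemma potential_continuous (g : C -> sphere) (x y : R) : meromorphic_cyl g -> regular g (x, y) ->
  continuity_2d_pt (potential g) x y.
Proof.
  intros Hm Hr. destruct (ell_harmonic g x y Hm Hr) as (_ & C0 & C1 & C2 & _).
  assert (Hexp : forall k, continuity_2d_pt (fun x y => exp (k * ell g x y)) x y).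
  { intros k. apply (continuity_1d_2d_pt_comp exp (fun x y => k * ell g x y)).
    - apply derivable_continuous_pt, derivable_pt_exp.
    - apply continuity_2d_pt_mult; [apply continuity_2d_pt_const|exact C0]. }
  apply (continuity_2d_pt_ext (fun x y => 2 * (ell_x g x y * ell_x g x y + ell_y g x y * ell_y g x y) *
    / ((exp (1 * ell g x y) + exp (-1 * ell g x y)) * (exp (1 * ell g x y) + exp (-1 * ell g x y)) * / 4))).
  - intros u w. unfold potential, conformal_factor. rewrite Rmult_1_l.
    replace (-1 * ell g u w) with (- ell g u w) by ring.
    field. generalize (exp_pos (ell g u w)) (exp_pos (- ell g u w)). lra.
  - apply continuity_2d_pt_mult.
    + apply continuity_2d_pt_mult; [apply continuity_2d_pt_const|].
      apply continuity_2d_pt_plus; apply continuity_2d_pt_mult; assumption.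
    + apply continuity_2d_pt_inv.
      * apply continuity_2d_pt_mult; [|apply continuity_2d_pt_const].
        apply continuity_2d_pt_mult; apply continuity_2d_pt_plus; apply Hexp.
      * generalize (exp_pos (1 * ell g x y)) (exp_pos (-1 * ell g x y)). intros.
        apply Rgt_not_eq. apply Rmult_lt_0_compat; [apply Rmult_lt_0_compat|]; lra.
Qed.

Lemma harmonic_cylinder_of_gauss_map (g : C -> sphere) : in_W g ->
  exists Q, harmonic_cylinder (fun x y => regular g (x, y)) (ell g) (ell_x g) (ell_y g) (ell_xx g) (potential g) Q.
Proof.
  intros [Hq Hdiv]. assert (Hm := proj1 Hq). assert (Hper := proj1 Hm).
  destruct (potential_bounded g Hq) as (Q & HQ & Hb). exists Q. split.
  - intros x y HU. destruct (regular_local g (x, y) Hm HU) as (r & Hr & H).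
    exists r. split; [exact Hr|]. intros u w H1 H2. apply (H (u, w)). split; assumption.
  - intros x y. apply regular_periodic, Hm.
  - intros x y. split; [apply ell_periodic, Hper|apply (ell_derivatives_periodic g x y Hper)].
  - intros x y HU. apply (ell_harmonic g x y Hm HU).
  - intros x y HU. destruct (ell_harmonic g x y Hm HU) as (_ & C0 & C1 & C2 & C3).
    split; [exact C0|split; [exact C1|split; [exact C2|split; [exact C3|apply potential_continuous; assumption]]]].
  - split; [exact HQ|]. intros x y HU. rewrite Rabs_pos_eq; [apply Hb, HU|].
    apply Rdiv_le_0_compat; [|apply conformal_factor_pos].
    generalize (pow2_ge_0 (ell_x g x y)) (pow2_ge_0 (ell_y g x y)). lra.
  - intros x0 y0. destruct (classic (regular g (x0, y0))) as [HU|HU].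
    + destruct (tempered_regular g (x0, y0) Hm HU) as (r & K & Hr & HK & H1 & H2).
      exists r, K. split; [exact Hr|split; [exact HK|]]. intros x y X Y.
      assert (Hc : cbox (x0, y0) r (x, y)) by (split; assumption).
      split; [left; apply H1, Hc|exact (H2 x y Hc)].
    + destruct (tempered_singular g (x0, y0) Hm Hdiv HU) as (r & K & Hr & HK & H1 & H2 & _).
      exists r, K. split; [exact Hr|split; [exact HK|]]. intros x y X Y.
      assert (Hc : cbox (x0, y0) r (x, y)) by (split; assumption).
      split; [|exact (H2 x y Hc)].
      destruct (classic ((x, y) = (x0, y0))) as [E|E]; [right; inversion E; auto|left; apply H1; assumption].
  - intros x0 y0 HU L. destruct (tempered_singular g (x0, y0) Hm Hdiv HU) as (r & K & _ & _ & _ & _ & H).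
    destruct (H L) as (d & Hd & B). exists d. split; [exact Hd|].
    intros x y X Y. apply B. split; assumption.
Qed.

Lemma continuous_continuity_2d (f : C -> R) (x y : R) : continuous f (x, y) ->
  continuity_2d_pt (fun x y => f (x, y)) x y.
Proof.
  intros Hf eps.
  assert (L : locally ((x, y) : C) (fun w : C => Rabs (f w - f (x, y)) < eps)).
  { apply (Hf (fun t => Rabs (t - f (x, y)) < eps)). exists eps. intros t Ht. exact Ht. }
  destruct (proj1 (locally_cbox _ _) L) as (r & Hr & B). exists (mkposreal r Hr).
  intros u w Hu Hw. apply (B (u, w)). split; assumption.
Qed.

(** The partial derivatives of [v] are those of its definition as a function on
    the regular set; they are periodic since [v] is so near each regular point. *)
Lemma bounded_jacobi_solution (g : C -> sphere) (X : C -> R3) (v : C -> R) :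
  meromorphic_cyl g -> weierstrass_param g X -> bounded_jacobi (regular g) X v ->
  exists B, bounded_solution (fun x y => regular g (x, y)) (potential g) (fun x y => v (x, y))
    (fun x y => pdx v (x, y)) (fun x y => pdy v (x, y))
    (fun x y => pdx (pdx v) (x, y)) (fun x y => pdy (pdy v) (x, y)) B.
Proof.
  intros Hm HX [(Hp & (H1 & (H2 & H2x & _) & (H3 & _ & H3y)) & Hj) (B & HB)].
  assert (Hp' : forall x y, regular g (x, y) -> v (x, y + 1) = v (x, y)).
  { intros x y HU. rewrite <- (Hp (x, y) HU). f_equal. apply injective_projections; simpl; ring. }
  exists (Rmax B 0). split.
  - intros x y HU. split; [apply Hp', HU|].
    unfold pdy. cbn [Re Im fst snd].
    destruct (regular_local g (x, y) Hm HU) as (r & Hr & H).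
    transitivity (Derive (fun t => v (x, t + 1)) y).
    + unfold Derive. f_equal. apply Lim_ext. intros h.
      replace (y + 1 + h) with (y + h + 1) by ring. reflexivity.
    + apply (Derive_near _ _ y r Hr). intros t Ht. apply Hp'. apply (H (x, t)).
      split; simpl; [rewrite Rminus_diag, Rabs_R0; exact Hr|exact Ht].
  - intros x y HU.
    destruct (H1 _ HU) as (_ & D1 & D2). destruct (H2 _ HU) as (_ & D3 & _). destruct (H3 _ HU) as (_ & _ & D4).
    split; [exact (Derive_correct _ _ D1)|split; [exact (Derive_correct _ _ D2)|split]].
    + exact (Derive_correct _ _ D3).
    + exact (Derive_correct _ _ D4).
  - intros x y HU.
    split; [apply continuous_continuity_2d, (proj1 (H1 _ HU))|].
    split; [apply continuous_continuity_2d, (proj1 (H2 _ HU))|].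
    split; [apply continuous_continuity_2d, (proj1 (H3 _ HU))|].
    split; [apply continuous_continuity_2d, H2x, HU|apply continuous_continuity_2d, H3y, HU].
  - intros x y HU. apply (jacobi_equation_iff g X v x y Hm HX HU). apply Hj, HU.
  - split; [apply Rmax_r|]. intros x y HU. apply Rle_trans with B; [apply HB, HU|apply Rmax_l].
Qed.

Lemma pdx_near (u w : C -> R) (z : C) (r : R) : 0 < r -> (forall t, cbox z r t -> u t = w t) -> pdx u z = pdx w z.
Proof.
  intros Hr H. unfold pdx. apply (Derive_near _ _ _ r Hr). intros t Ht. apply H.
  split; simpl; [exact Ht|]. rewrite Rminus_diag, Rabs_R0. exact Hr.
Qed.

Lemma pdy_near (u w : C -> R) (z : C) (r : R) : 0 < r -> (forall t, cbox z r t -> u t = w t) -> pdy u z = pdy w z.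
Proof.
  intros Hr H. unfold pdy. apply (Derive_near _ _ _ r Hr). intros t Ht. apply H.
  split; simpl; [|exact Ht]. rewrite Rminus_diag, Rabs_R0. exact Hr.
Qed.

Definition box_open (U : C -> Prop) : Prop :=
  forall z, U z -> exists r, 0 < r /\ forall w, cbox z r w -> U w.

Lemma locally_eq (u w : C -> R) (z : C) (r : R) : 0 < r -> (forall t, cbox z r t -> u t = w t) ->
  (continuous u z -> continuous w z) /\
  (ex_derive (fun t => u (t, Im z)) (Re z) -> ex_derive (fun t => w (t, Im z)) (Re z)) /\
  (ex_derive (fun t => u (Re z, t)) (Im z) -> ex_derive (fun t => w (Re z, t)) (Im z)).
Proof.
  intros Hr H. split; [|split].
  - apply (continuous_ext_loc w u). apply locally_cbox. exists r. split; [exact Hr|]. intros t Ht. apply H, Ht.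
  - apply ex_derive_ext_loc. exists (mkposreal r Hr). intros t Ht. apply H. split; simpl; [exact Ht|].
    rewrite Rminus_diag, Rabs_R0. exact Hr.
  - apply ex_derive_ext_loc. exists (mkposreal r Hr). intros t Ht. apply H. split; simpl; [|exact Ht].
    rewrite Rminus_diag, Rabs_R0. exact Hr.
Qed.

(** [pdx u] and [pdx w] agree on the open set [U] where [u] and [w] do. *)
Lemma class_Ck_ext (U : C -> Prop) (k : nat) : box_open U -> forall u w : C -> R,
  (forall z, U z -> u z = w z) -> class_Ck k U u -> class_Ck k U w.
Proof.
  intros HU. induction k as [|k IH]; intros u w E H.
  - intros z Hz. destruct (HU z Hz) as (r & Hr & B).
    apply (locally_eq u w z r Hr); [intros t Ht; apply E, B, Ht|apply H, Hz].
  - destruct H as (H0 & Hx & Hy). split; [|split].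
    + intros z Hz. destruct (HU z Hz) as (r & Hr & B). destruct (H0 z Hz) as (A1 & A2 & A3).
      destruct (locally_eq u w z r Hr) as (L1 & L2 & L3); [intros t Ht; apply E, B, Ht|].
      split; [exact (L1 A1)|split; [exact (L2 A2)|exact (L3 A3)]].
    + apply (IH (pdx u)); [|exact Hx]. intros z Hz. destruct (HU z Hz) as (r & Hr & B).
      apply (pdx_near u w z r Hr). intros t Ht. apply E, B, Ht.
    + apply (IH (pdy u)); [|exact Hy]. intros z Hz. destruct (HU z Hz) as (r & Hr & B).
      apply (pdy_near u w z r Hr). intros t Ht. apply E, B, Ht.
Qed.

Lemma continuous_combination (u w : C -> R) (k : R) (z : C) : continuous u z -> continuous w z ->
  continuous (fun z => u z + k * w z) z.
Proof.
  intros Hu Hw. apply (continuous_plus (V := R_NormedModule) u (fun z => k * w z)); [exact Hu|].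
  apply (continuous_scal_r (V := R_NormedModule) k w). exact Hw.
Qed.

Lemma Derive_combination (f h : R -> R) (k t : R) : ex_derive f t -> ex_derive h t ->
  ex_derive (fun s => f s + k * h s) t /\ Derive (fun s => f s + k * h s) t = Derive f t + k * Derive h t.
Proof.
  intros [df Hf] [dh Hh].
  assert (D := is_derive_plusR _ _ _ _ _ Hf (is_derive_scalR _ k _ _ Hh)).
  split; [exists (df + k * dh); exact D|].
  rewrite (is_derive_unique _ _ _ Hf), (is_derive_unique _ _ _ Hh). exact (is_derive_unique _ _ _ D).
Qed.

Lemma class_Ck_combination (U : C -> Prop) (n : nat) : box_open U -> forall (u w : C -> R) (k : R),
  class_Ck n U u -> class_Ck n U w -> class_Ck n U (fun z => u z + k * w z).
Proof.
  intros HU. induction n as [|n IH]; intros u w k Hu Hw.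
  - intros z Hz. apply continuous_combination; [apply Hu, Hz|apply Hw, Hz].
  - destruct Hu as (Hu & Hux & Huy). destruct Hw as (Hw & Hwx & Hwy). split; [|split].
    + intros z Hz. destruct (Hu z Hz) as (A1 & A2 & A3). destruct (Hw z Hz) as (B1 & B2 & B3).
      split; [apply continuous_combination; assumption|].
      split; [exact (proj1 (Derive_combination _ _ k _ A2 B2))|exact (proj1 (Derive_combination _ _ k _ A3 B3))].
    + apply (class_Ck_ext U n HU (fun z => pdx u z + k * pdx w z)); [|apply IH; assumption].
      intros z Hz. destruct (Hu z Hz) as (A1 & A2 & A3). destruct (Hw z Hz) as (B1 & B2 & B3).
      symmetry. exact (proj2 (Derive_combination _ _ k _ A2 B2)).
    + apply (class_Ck_ext U n HU (fun z => pdy u z + k * pdy w z)); [|apply IH; assumption].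
      intros z Hz. destruct (Hu z Hz) as (A1 & A2 & A3). destruct (Hw z Hz) as (B1 & B2 & B3).
      symmetry. exact (proj2 (Derive_combination _ _ k _ A3 B3)).
Qed.

Lemma bounded_jacobi_combination (g : C -> sphere) (X : C -> R3) :
  meromorphic_cyl g -> weierstrass_param g X ->
  closed_under_combination (bounded_jacobi (regular g) X).
Proof.
  intros Hm HX u w k [(Pu & Cu & Ju) (Bu & HBu)] [(Pw & Cw & Jw) (Bw & HBw)].
  assert (HU : box_open (regular g)).
  { intros z Hz. destruct (regular_local g z Hm Hz) as (r & Hr & H). exists r. split; [exact Hr|].
    intros t Ht. apply H, Ht. }
  split; [split; [|split]|].
  - intros z Hz. rewrite Pu, Pw by exact Hz. reflexivity.
  - apply class_Ck_combination; assumption.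
  - intros z Hz. assert (Ez : z = (Re z, Im z)) by (symmetry; apply pair_eta).
    assert (Hz' : regular g (Re z, Im z)) by (rewrite <- Ez; exact Hz).
    assert (Eu := proj1 (jacobi_equation_iff g X u _ _ Hm HX Hz')).
    assert (Ew := proj1 (jacobi_equation_iff g X w _ _ Hm HX Hz')).
    assert (E := proj2 (jacobi_equation_iff g X (fun z => u z + k * w z) _ _ Hm HX Hz')).
    rewrite <- Ez in Eu, Ew, E. specialize (Eu (Ju z Hz)). specialize (Ew (Jw z Hz)).
    apply E. clear E.
    destruct Cu as (U0 & (U1 & _) & (U2 & _)). destruct Cw as (W0 & (W1 & _) & (W2 & _)).
    destruct (HU z Hz) as (r & Hr & B).
    rewrite (pdx_near _ (fun z => pdx u z + k * pdx w z) z r Hr), (pdy_near _ (fun z => pdy u z + k * pdy w z) z r Hr).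
    + destruct (U1 z Hz) as (_ & A1 & _). destruct (W1 z Hz) as (_ & A2 & _).
      destruct (U2 z Hz) as (_ & _ & A3). destruct (W2 z Hz) as (_ & _ & A4).
      assert (X1 : pdx (fun z => pdx u z + k * pdx w z) z = pdx (pdx u) z + k * pdx (pdx w) z)
        by exact (proj2 (Derive_combination _ _ k _ A1 A2)).
      assert (X2 : pdy (fun z => pdy u z + k * pdy w z) z = pdy (pdy u) z + k * pdy (pdy w) z)
        by exact (proj2 (Derive_combination _ _ k _ A3 A4)).
      rewrite X1, X2.
      set (p := potential g (Re z) (Im z)) in *. clearbody p.
      replace (pdx (pdx u) z + k * pdx (pdx w) z + (pdy (pdy u) z + k * pdy (pdy w) z) + p * (u z + k * w z))
        with ((pdx (pdx u) z + pdy (pdy u) z + p * u z) + k * (pdx (pdx w) z + pdy (pdy w) z + p * w z)) by ring.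
      rewrite Eu, Ew. ring.
    + intros t Ht. destruct (U0 t (B t Ht)) as (_ & _ & A3). destruct (W0 t (B t Ht)) as (_ & _ & B3).
      exact (proj2 (Derive_combination _ _ k _ A3 B3)).
    + intros t Ht. destruct (U0 t (B t Ht)) as (_ & A2 & _). destruct (W0 t (B t Ht)) as (_ & B2 & _).
      exact (proj2 (Derive_combination _ _ k _ A2 B2)).
  - exists (Bu + Rabs k * Bw). intros z Hz. apply Rle_trans with (1 := Rabs_triang _ _).
    rewrite Rabs_mult. apply Rplus_le_compat; [apply HBu, Hz|].
    apply Rmult_le_compat_l; [apply Rabs_pos|apply HBw, Hz].
Qed.

Theorem theorem7p3 :
  forall (g : C -> sphere) (X : C -> R3),
    qp_immersed_Riemann_type g X ->
    finite_dimensional (regular g) (bounded_jacobi (regular g) X).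
Proof.
  intros g X [[HW _] HX]. assert (Hm : meromorphic_cyl g) by exact (proj1 (proj1 HW)).
  destruct (harmonic_cylinder_of_gauss_map g HW) as (Q & HC).
  destruct (finitely_determined _ _ _ _ _ _ _ HC) as (x0 & d & n & Hd & Hcirc & Hdet).
  set (data := fun (u : C -> R) (j : nat) (x : R) => coef (fun y => u (x, y)) j).
  assert (Hlin : forall u w k j x, bounded_jacobi (regular g) X u -> bounded_jacobi (regular g) X w ->
    Rabs (x - x0) < d -> data (fun z => u z + k * w z) j x = data u j x + k * data w j x).
  { intros u w k j x Hu Hw Hx.
    assert (Cc : forall v, bounded_jacobi (regular g) X v -> ex_RInt (fun y => v (x, y) * mode j y) 0 1).
    { intros v Hv. destruct (bounded_jacobi_solution g X v Hm HX Hv) as (B & HS).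
      apply ex_RInt_cont_all. intros y. apply continuous_multR; [|apply mode_continuous].
      exact (v_fiber_continuous _ _ _ _ _ _ _ _ HS x (Hcirc x Hx) y). }
    unfold data, coef. rewrite <- RInt_scalR by (apply Cc, Hw).
    rewrite <- RInt_plusR; [|apply Cc, Hu|apply ex_RInt_scalR, Cc, Hw].
    apply RInt_ext. intros y _. eqR. ring. }
  (* the functionals 0, ..., n are the coefficients at x0, the next n + 1 their derivatives *)
  apply (finite_dimensional_of_functionals (regular g) (2 * S n) _
    (fun i u => if le_dec i n then data u i x0 else Derive (data u (i - S n)%nat) x0)).
  - apply bounded_jacobi_combination; assumption.
  - intros i u w k Hu Hw. destruct (le_dec i n) as [Hi|Hi].
    + apply Hlin; [exact Hu|exact Hw|]. rewrite Rminus_diag, Rabs_R0; exact Hd.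
    + rewrite (Derive_near _ (fun x => data u (i - S n)%nat x + k * data w (i - S n)%nat x) x0 d Hd).
      2:{ intros t Ht. apply Hlin; assumption. }
      destruct (bounded_jacobi_solution g X u Hm HX Hu) as (Bu & Su).
      destruct (bounded_jacobi_solution g X w Hm HX Hw) as (Bw & Sw).
      apply Derive_combination.
      * apply (proj1 (Hdet _ _ _ _ _ _ Su)).
      * apply (proj1 (Hdet _ _ _ _ _ _ Sw)).
  - intros u Hu H0 z Hz. destruct (bounded_jacobi_solution g X u Hm HX Hu) as (Bu & Su).
    rewrite <- (pair_eta z). rewrite <- (pair_eta z) in Hz.
    apply (proj2 (Hdet _ _ _ _ _ _ Su)); [|exact Hz].
    intros j Hj. split.
    + assert (E := H0 j ltac:(lia)). cbv beta in E. destruct (le_dec j n); [exact E|lia].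
    + assert (E := H0 (S n + j)%nat ltac:(lia)). cbv beta in E. destruct (le_dec (S n + j) n); [lia|].
      replace (S n + j - S n)%nat with j in E by lia. exact E.
Qed.
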